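(* Let $(M^{2m},\varphi,g)$ be a compact oriented para-Kähler–Norden manifold, let its tangent bundle $TM$ be endowed with the $\varphi$-Sasaki metric $g^{\varphi}$, let $\xi$ be a vector field on $M$, and consider the bienergy functional $E_2$ restricted to the space of vector fields on $M$. Let $\Phi:M\times(-\varepsilon,\varepsilon)\to TM$ ($\varepsilon>0$) be any smooth one-parameter variation of $\xi$ through vector fields, i.e. $\Phi(p,t)=\xi_t(p)\in T_pM$ for all $p\in M$ and $|t|<\varepsilon$, with $\xi_0=\xi$, and let $W$ be the vector field on $M$ given by $$W(p)=\lim_{t\to0}\frac1t\big(\xi_t(p)-\xi(p)\big)=\frac{d}{dt}\Phi_p(t)\Big|_{t=0},\qquad \Phi_p(t)=\xi_t(p),\quad p\in M.$$ Then $$\frac{d}{dt}E_2(\xi_t)\Big|_{t=0}=\int_M g\Big(\bar{\Delta}^2\xi-\mathrm{Tr}_g\big((\nabla_{\ast}R)(\ast,S(\xi))\xi+R(\ast,\nabla_{\ast}S(\xi))\xi+2R(\ast,S(\xi))\nabla_{\ast}\xi\big),\varphi W\Big)\,v_g.$$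
   Context: All manifolds, maps and tensor fields are smooth. A para-Kähler–Norden manifold $(M^{2m},\varphi,g)$ is a $2m$-dimensional manifold $M$ with a Riemannian metric $g$ and a $(1,1)$-tensor field $\varphi$ such that $\varphi^2=I$, $\varphi\neq\pm I$, the $+1$ and $-1$ eigenbundles of $\varphi$ have the same rank, $g(\varphi V,W)=g(V,\varphi W)$ for all vector fields $V,W$, and $\nabla\varphi=0$, where $\nabla$ is the Levi-Civita connection of $g$. $R(X,Y)Z=\nabla_X\nabla_YZ-\nabla_Y\nabla_XZ-\nabla_{[X,Y]}Z$ is the curvature tensor of $g$. $\mathrm{Tr}_g$ of an expression containing two asterisks means $\sum_i$ of the expression with both asterisks replaced by $e_i$, for a local $g$-orthonormal frame $\{e_i\}$. For a vector field $W$ on $M$, ${}^{H}W$ and ${}^{V}W$ are its horizontal (with respect to $\nabla$) and vertical lifts to $TM$. The $\varphi$-Sasaki metric $g^{\varphi}$ is the pseudo-Riemannian metric on $TM$ with $g^{\varphi}({}^{H}W,{}^{H}Z)=g(W,Z)$, $g^{\varphi}({}^{H}W,{}^{V}Z)=0$, $g^{\varphi}({}^{V}W,{}^{V}Z)=g(W,\varphi Z)$ (the right-hand sides being composed with the projection $TM\to M$). A vector field $\xi$ on $M$ is regarded as a map $\xi:(M,g)\to(TM,g^{\varphi})$. For a vector field $X$ on $M$, $\bar{\Delta}X=-\mathrm{Tr}_g(\nabla_{\ast}\nabla_{\ast}-\nabla_{\nabla_{\ast}\ast})X$ is the rough Laplacian, $\bar{\Delta}^2X=\bar{\Delta}\bar{\Delta}X$,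 and $S(\xi)=\mathrm{Tr}_gR(\varphi\xi,\nabla_{\ast}\xi)\ast$. The bienergy of $\xi$ is the bienergy of this map, $E_2(\xi)=\frac12\int_M|\tau(\xi)|^2v_g$, where $\tau(\xi)=\mathrm{Tr}_g\nabla d\xi$ is the tension field, $|\tau(\xi)|^2=g^{\varphi}(\tau(\xi),\tau(\xi))$, and $v_g$ is the Riemannian volume form of $g$. *)

(* Defs.v *)
From HB Require Import structures.
From mathcomp Require Import all_boot all_order all_algebra.
From mathcomp Require Import all_classical all_reals all_analysis.
From mathcomp Require Import ring.
Import Order.TTheory GRing.Theory Num.Theory.
Import numFieldNormedType.Exports.

Set Implicit Arguments.
Unset Strict Implicit.
Unset Printing Implicit Defensive.

Local Open Scope classical_set_scope.
Local Open Scope ring_scope.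

(* Conventions.  A tensor field on M is the family of its component functions
   in the charts of an atlas, subject to the transformation law under the
   changes of charts.  A tangent vector at x has for components a row vector
   u : 'rV_n; an endomorphism is a matrix acting on the right, and a bilinear
   form G is evaluated as u G v^T.  Of a component function, only the
   restriction to the image of the chart is meaningful. *)

Section Calculus.
Context {R : realType}.

(* C^oo on the open set O: all iterated directional derivatives of f exist and
   are (Frechet) differentiable at every point of O. *)
Definition smooth_on (U V : normedModType R) (O : set U) (f : U -> V) : Prop :=
  forall (s : seq U) (x : U), O x ->
    differentiable (foldr (fun v h => 'D_v h) f s) x.

(* Iterated Lebesgue integral; it is only used below for continuous functions
   with compact support. *)
Fixpoint integral_Rn (n : nat) : ('rV[R]_n -> R) -> R :=
  match n with
  | 0%N => fun f => f 0
  | n'.+1 => fun f => \int[lebesgue_measure]_(t in [set: R])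
                integral_Rn (fun x : 'rV[R]_n' => f (row_mx (t%:M : 'rV[R]_1) x))
  end.

Definition ip (n : nat) (G : 'M[R]_n) (u v : 'rV[R]_n) : R :=
  (u *m G *m v^T) 0 0.

End Calculus.

Section LeviCivita.
Context {R : realType} {n : nat}.
Implicit Types (G : 'rV[R]_n -> 'M[R]_n) (X Y Z W : 'rV[R]_n -> 'rV[R]_n).

Definition christoffel G (x : 'rV[R]_n) (k i j : 'I_n) : R :=
  2^-1 * \sum_l invmx (G x) k l *
    (('D_(delta_mx 0 i) G x) j l + ('D_(delta_mx 0 j) G x) i l
     - ('D_(delta_mx 0 l) G x) i j).

(* christ G x u v is the vector of components \sum_(i, j) Gamma^k_ij u^i v^j *)
Definition christ_mx G (x v : 'rV[R]_n) : 'M[R]_n :=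
  \matrix_(i, k) \sum_j christoffel G x k i j * v 0 j.
Definition christ G (x u v : 'rV[R]_n) : 'rV[R]_n := u *m christ_mx G x v.

(* Levi-Civita connection of G; see nabla_torsion_free and christ_metric *)
Definition nabla G X Y : 'rV[R]_n -> 'rV[R]_n :=
  fun x => 'D_(X x) Y x + christ G x (X x) (Y x).

Definition bracket X Y : 'rV[R]_n -> 'rV[R]_n :=
  fun x => 'D_(X x) Y x - 'D_(Y x) X x.

Lemma derive_sym G x v i j : differentiable G x ->
  (\forall y \near x, (G y)^T = G y) -> ('D_v G x) i j = ('D_v G x) j i.
Proof.
move=> dG sG; have dv : derivable G x v by exact: diff_derivable.
rewrite derive_mx // !mxE; apply: near_eq_derive.
apply: filterS sG => y sG.
by rewrite -[in LHS]sG mxE.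
Qed.

Lemma nabla_torsion_free G X Y x : differentiable G x ->
  (\forall y \near x, (G y)^T = G y) ->
  nabla G X Y x - nabla G Y X x = bracket X Y x.
Proof.
move=> dG sG.
have gC k i j : christoffel G x k i j = christoffel G x k j i.
  rewrite /christoffel; congr (_ * _); apply: eq_bigr => l _; congr (_ * _).
  by congr (_ - _); [exact: addrC | exact: derive_sym].
have cC u v : christ G x u v = christ G x v u.
  apply/rowP => k; rewrite !mxE.
  under eq_bigr do rewrite mxE mulr_sumr.
  under [RHS]eq_bigr do rewrite mxE mulr_sumr.
  rewrite exchange_big /=; apply: eq_bigr => j _; apply: eq_bigr => i _.
  by rewrite gC [LHS]mulrC -mulrA mulrCA.
by rewrite /nabla /bracket cC opprD addrACA subrr addr0.
Qed.

(* (D_u G)(v, w) = 0 for the covariant derivative D, expressed in components *)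
Lemma christ_metric G x u v w : differentiable G x ->
  (\forall y \near x, (G y)^T = G y) -> G x \in unitmx ->
  ip ('D_u G x) v w = ip (G x) (christ G x u v) w + ip (G x) v (christ G x u w).
Proof.
move=> dG sG uG.
have sx : (G x)^T = G x by exact: nbhs_singleton sG.
have [D DE] : exists D, forall i, 'D_(delta_mx 0 i) G x = D i.
  by exists (fun i => 'D_(delta_mx 0 i) G x).
have sD i a b : D i a b = D i b a by rewrite -DE; exact: derive_sym.
pose T i j m := D i j m + D j i m - D m i j.
have E v' i m : (christ_mx G x v' *m G x) i m = 2^-1 * \sum_j T i j m * v' 0 j.
  rewrite mxE.
  under eq_bigr => k _ do rewrite mxE mulr_suml.
  rewrite exchange_big mulr_sumr /=; apply: eq_bigr => j _.
  transitivity (\sum_k \sum_l 2^-1 * (T i j l * v' 0 j) *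
      (invmx (G x) k l * G x k m)).
    apply: eq_bigr => k _; rewrite /christoffel mulr_sumr !mulr_suml.
    apply: eq_bigr => l _; rewrite !DE -/(T i j l) -!mulrA; congr (_ * _).
    by rewrite mulrCA; congr (_ * _); rewrite mulrCA.
  rewrite exchange_big /=.
  under eq_bigr => l _.
    rewrite -mulr_sumr.
    have -> : \sum_k invmx (G x) k l * G x k m = (l == m)%:R.
      transitivity (((invmx (G x))^T *m G x) l m).
        by rewrite mxE; apply: eq_bigr => k _; rewrite mxE.
      by rewrite trmx_inv sx mulVmx // mxE.
    over.
  by rewrite (bigD1 m) //= eqxx mulr1 big1 ?addr0 // => l /negPf->; rewrite mulr0.
have Du : 'D_u G x = \sum_i u 0 i *: D i.
  rewrite deriveE // {1}(row_sum_delta u) raddf_sum; apply: eq_bigr => i _.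
  by rewrite -DE deriveE //; exact: linearZ_LR.
have ipE (B : 'M[R]_n) a b : ip B a b = \sum_j \sum_m a 0 j * B j m * b 0 m.
  rewrite /ip mxE exchange_big /=; apply: eq_bigr => m _.
  by rewrite !mxE mulr_suml.
have K v' w' : ip (G x) (christ G x u v') w' =
    \sum_i \sum_j \sum_m 2^-1 * (u 0 i * (v' 0 j * (w' 0 m * T i j m))).
  rewrite /christ {1}/ip -(mulmxA u) -/(ip _ u w') ipE.
  apply: eq_bigr => i _; rewrite exchange_big /=; apply: eq_bigr => m _.
  rewrite E !mulr_sumr mulr_suml; apply: eq_bigr => j _; ring.
have -> : ip (G x) v (christ G x u w) = ip (G x) (christ G x u w) v.
  rewrite /ip -[in RHS]sx; set c := christ _ _ _ _.
  have -> : c *m (G x)^T *m v^T = (v *m G x *m c^T)^T.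
    by rewrite trmx_mul trmxK trmx_mul mulmxA.
  by rewrite [RHS](mxE trmx_key).
rewrite !K Du -big_split ipE /=.
transitivity (\sum_i \sum_j \sum_m
    v 0 j * (u 0 i * D i j m) * w 0 m).
  rewrite [RHS]exchange_big /=; apply: eq_bigr => j _.
  rewrite [RHS]exchange_big /=; apply: eq_bigr => m _.
  rewrite summxE mulr_sumr mulr_suml.
  by apply: eq_bigr => i _; rewrite mxE.
apply: eq_bigr => i _; rewrite [X in _ = _ + X]exchange_big -big_split /=.
apply: eq_bigr => j _; rewrite -big_split /=; apply: eq_bigr => m _.
rewrite -mulrDr /T (sD i m j).
by field.
Qed.

Definition curv G X Y Z : 'rV[R]_n -> 'rV[R]_n :=
  fun x => nabla G X (nabla G Y Z) x - nabla G Y (nabla G X Z) x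
           - nabla G (bracket X Y) Z x.

(* (nabla_X R)(Y, Z) W *)
Definition nabla_curv G X Y Z W : 'rV[R]_n -> 'rV[R]_n :=
  fun x => nabla G X (curv G Y Z W) x - curv G (nabla G X Y) Z W x
           - curv G Y (nabla G X Z) W x - curv G Y Z (nabla G X W) x.

Definition act (phi : 'rV[R]_n -> 'M[R]_n) X : 'rV[R]_n -> 'rV[R]_n :=
  fun x => X x *m phi x.

Definition orthonormal_frame (O : set 'rV[R]_n) G
    (e : 'I_n -> 'rV[R]_n -> 'rV[R]_n) : Prop :=
  (forall a, smooth_on O (e a)) /\
  (forall a b x, O x -> ip (G x) (e a x) (e b x) = (a == b)%:R).

Definition rough_laplacian G (e : 'I_n -> 'rV[R]_n -> 'rV[R]_n) X :
    'rV[R]_n -> 'rV[R]_n :=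
  fun x => - \sum_a (nabla G (e a) (nabla G (e a) X) x
                     - nabla G (nabla G (e a) (e a)) X x).

Definition S_field G phi (e : 'I_n -> 'rV[R]_n -> 'rV[R]_n) X :
    'rV[R]_n -> 'rV[R]_n :=
  fun x => \sum_a curv G (act phi X) (nabla G (e a) X) (e a) x.

End LeviCivita.

Section HarmonicMaps.
Context {R : realType} {n : nat}.
Implicit Types (G : 'rV[R]_n -> 'M[R]_n) (X Y : 'rV[R]_n -> 'rV[R]_n).

(* Second fundamental form (nabla df)(X, Y) and tension field of a map f from
   the domain, with metric G, to R^N with the pseudo-Riemannian metric H: the
   first two terms are the pull-back connection applied to df(Y). *)
Definition second_form (N : nat) G (H : 'rV[R]_N -> 'M[R]_N)
    (f : 'rV[R]_n -> 'rV[R]_N) X Y : 'rV[R]_n -> 'rV[R]_N :=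
  let dfY := fun y => 'D_(Y y) f y in
  fun x => 'D_(X x) dfY x + christ H (f x) ('D_(X x) f x) (dfY x)
           - 'D_(nabla G X Y x) f x.

Definition tension (N : nat) G (H : 'rV[R]_N -> 'M[R]_N)
    (e : 'I_n -> 'rV[R]_n -> 'rV[R]_n) (f : 'rV[R]_n -> 'rV[R]_N) :
    'rV[R]_n -> 'rV[R]_N :=
  fun x => \sum_a second_form G H f (e a) (e a) x.

End HarmonicMaps.

Section TangentBundle.
Context {R : realType} {n : nat}.
Implicit Types (G phi : 'rV[R]_n -> 'M[R]_n).

(* A chart of M induces the chart of TM in which the tangent vector v at x has
   the coordinates row_mx x v.  Horizontal and vertical lifts at (x, v) of the
   tangent vector w at x: *)
Definition hlift G (x v w : 'rV[R]_n) : 'rV[R]_(n + n) :=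
  row_mx w (- christ G x w v).
Definition vlift (w : 'rV[R]_n) : 'rV[R]_(n + n) := row_mx 0 w.

(* The first summand is the pull-back of g by the projection TM -> M; the
   second one is g(K _, phi (K _)) for the connection map
   K (w, z) = z + christ w v.  See phi_sasakiP. *)
Definition phi_sasaki G phi : 'rV[R]_(n + n) -> 'M[R]_(n + n) := fun y =>
  let x := lsubmx y in let v := rsubmx y in
  let P := col_mx 1%:M 0 : 'M[R]_(n + n, n) in
  let K := col_mx (christ_mx G x v) 1%:M : 'M[R]_(n + n, n) in
  P *m G x *m P^T + K *m (G x *m (phi x)^T) *m K^T.

Definition section_map (X : 'rV[R]_n -> 'rV[R]_n) : 'rV[R]_n -> 'rV[R]_(n + n) :=
  fun x => row_mx x (X x).

Definition bienergy_density G phi (e : 'I_n -> 'rV[R]_n -> 'rV[R]_n)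
    (X : 'rV[R]_n -> 'rV[R]_n) : 'rV[R]_n -> R :=
  let H := phi_sasaki G phi in
  let tau := tension G H e (section_map X) in
  fun x => ip (H (section_map X x)) (tau x) (tau x).

Lemma phi_sasakiP G phi (x v w z : 'rV[R]_n) :
  let H := phi_sasaki G phi (row_mx x v) in
  [/\ ip H (hlift G x v w) (hlift G x v z) = ip (G x) w z,
      ip H (hlift G x v w) (vlift z) = 0 &
      ip H (vlift w) (vlift z) = ip (G x) w (z *m phi x)].
Proof.
rewrite /phi_sasaki /= row_mxKl row_mxKr.
set P := col_mx 1%:M 0; set K := col_mx _ 1%:M.
have E a b : ip (P *m G x *m P^T + K *m (G x *m (phi x)^T) *m K^T) a b
   = ip (G x) (a *m P) (b *m P) + ip (G x) (a *m K) (b *m K *m phi x).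
  rewrite /ip mulmxDr mulmxDl mxE; congr (_ + _);
  by rewrite !trmx_mul !mulmxA.
have hP u : hlift G x v u *m P = u by rewrite mul_row_col mulmx1 mulmx0 addr0.
have vP u : vlift u *m P = 0 by rewrite mul_row_col mul0mx mulmx0 addr0.
have hK u : hlift G x v u *m K = 0 by rewrite mul_row_col mulmx1 subrr.
have vK u : vlift u *m K = u by rewrite mul_row_col mul0mx mulmx1 add0r.
rewrite !E !hP !vP !hK !vK /ip !(mul0mx, trmx0, mulmx0) !mxE.
by split; rewrite ?(addr0, add0r).
Qed.

End TangentBundle.

Section Manifold.
Context {R : realType} {n : nat} {M : topologicalType} {I : Type}.

Record chart := Chart {
  dom : set M;
  coord : M -> 'rV[R]_n;
  param : 'rV[R]_n -> M }.

Definition img (c : chart) : set 'rV[R]_n := coord c @` dom c.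

Definition is_chart (c : chart) : Prop :=
  [/\ open (dom c), open (img c),
      (forall p, dom c p -> param c (coord c p) = p),
      {within dom c, continuous (coord c)} &
      {within img c, continuous (param c)}].

Definition transition (c d : chart) : 'rV[R]_n -> 'rV[R]_n :=
  fun x => coord d (param c x).
Definition overlap (c d : chart) : set 'rV[R]_n :=
  [set x | img c x /\ dom d (param c x)].

Definition oriented_atlas (A : I -> chart) : Prop :=
  [/\ (forall i, is_chart (A i)),
      (forall p, exists i, dom (A i) p),
      (forall i j, smooth_on (overlap (A i) (A j)) (transition (A i) (A j))) &
      (forall i j x, overlap (A i) (A j) x ->
         0 < \det ('J (transition (A i) (A j)) x))].

Variable A : I -> chart.

Definition vector_field (X : I -> 'rV[R]_n -> 'rV[R]_n) : Prop :=
  (forall i, smooth_on (img (A i)) (X i)) /\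
  (forall i j x, overlap (A i) (A j) x ->
     X j (transition (A i) (A j) x) = 'D_(X i x) (transition (A i) (A j)) x).

Definition endomorphism_field (phi : I -> 'rV[R]_n -> 'M[R]_n) : Prop :=
  (forall i, smooth_on (img (A i)) (phi i)) /\
  (forall i j x u, overlap (A i) (A j) x ->
     let theta := transition (A i) (A j) in
     'D_u theta x *m phi j (theta x) = 'D_(u *m phi i x) theta x).

Definition riemannian_metric (g : I -> 'rV[R]_n -> 'M[R]_n) : Prop :=
  [/\ (forall i, smooth_on (img (A i)) (g i)),
      (forall i x, img (A i) x -> (g i x)^T = g i x),
      (forall i x u, img (A i) x -> u != 0 -> 0 < ip (g i x) u u) &
      (forall i j x u v, overlap (A i) (A j) x ->
         let theta := transition (A i) (A j) in
         ip (g j (theta x)) ('D_u theta x) ('D_v theta x) = ip (g i x) u v)].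

Record para_kahler_norden (phi g : I -> 'rV[R]_n -> 'M[R]_n) : Prop := {
  pkn_metric : riemannian_metric g;
  pkn_endomorphism : endomorphism_field phi;
  pkn_involution : forall i x, img (A i) x -> phi i x *m phi i x = 1%:M;
  pkn_neq_id : ~ (forall i x, img (A i) x -> phi i x = 1%:M);
  pkn_neq_opp_id : ~ (forall i x, img (A i) x -> phi i x = - 1%:M);
  pkn_rank : forall i x, img (A i) x ->
    \rank (eigenspace (phi i x) 1) = \rank (eigenspace (phi i x) (- 1));
  pkn_sym : forall i x u v, img (A i) x ->
    ip (g i x) (u *m phi i x) v = ip (g i x) u (v *m phi i x);
  pkn_parallel : forall i X Y,
    smooth_on (img (A i)) X -> smooth_on (img (A i)) Y ->
    forall x, img (A i) x ->
      nabla (g i) X (act (phi i) Y) x = nabla (g i) X Y x *m phi i x }.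

Definition partition_of_unity (N : nat) (c : 'I_N -> I) (rho : 'I_N -> M -> R) :
    Prop :=
  [/\ (forall a i, smooth_on (img (A i)) (rho a \o param (A i))),
      (forall a p, 0 <= rho a p),
      (forall a, closure [set p | rho a p != 0] `<=` dom (A (c a))) &
      (forall p, \sum_a rho a p = 1)].

(* Integral over M, against the Riemannian volume form
   sqrt (det g) dx^1 /\ ... /\ dx^n, of the function with expression F i in the
   i-th chart, computed with a partition of unity. *)
Definition integral_vol (g : I -> 'rV[R]_n -> 'M[R]_n)
    (N : nat) (c : 'I_N -> I) (rho : 'I_N -> M -> R) (F : I -> 'rV[R]_n -> R) : R :=
  \sum_(a < N) integral_Rn
    ((fun x => rho a (param (A (c a)) x) * F (c a) x
               * Num.sqrt (\det (g (c a) x))) \_ (img (A (c a)))).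

Definition bienergy (phi g : I -> 'rV[R]_n -> 'M[R]_n)
    (e : I -> 'I_n -> 'rV[R]_n -> 'rV[R]_n)
    (N : nat) (c : 'I_N -> I) (rho : 'I_N -> M -> R)
    (X : I -> 'rV[R]_n -> 'rV[R]_n) : R :=
  2^-1 * integral_vol g c rho
           (fun i => bienergy_density (g i) (phi i) (e i) (X i)).

(* xi_ t, for `|t| < eps, is a smooth one-parameter family of vector fields *)
Definition smooth_variation (xi : I -> 'rV[R]_n -> 'rV[R]_n) (eps : R)
    (xi_ : R -> I -> 'rV[R]_n -> 'rV[R]_n) : Prop :=
  [/\ (forall t, `|t| < eps -> vector_field (xi_ t)),
      (forall i x, img (A i) x -> xi_ 0 i x = xi i x) &
      (forall i, smooth_on [set z : R^o * 'rV[R]_n | `|z.1| < eps /\ img (A i) z.2]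
                   (fun z : R^o * 'rV[R]_n => xi_ z.1 i z.2))].

End Manifold.
Arguments chart R n M : clear implicits.

(* Main.v *)
Require Import Defs.
From HB Require Import structures.
From mathcomp Require Import all_boot all_order all_algebra.
From mathcomp Require Import all_classical all_reals all_analysis.
From mathcomp Require Import perm.
From mathcomp Require Import ring lra.
Import Order.TTheory GRing.Theory Num.Theory.
Import numFieldNormedType.Exports.

Set Implicit Arguments.
Unset Strict Implicit.
Unset Printing Implicit Defensive.

Local Open Scope classical_set_scope.
Local Open Scope ring_scope.

(* Let L be the rough Laplacian.  Testing the tension field of the section xi
   against horizontal and vertical lifts, with Koszul's formula for g^phi,
   gives tau(xi) = H(S(xi)) - V(L xi); hence the density of the bienergy is
   g(S, S) + g(L xi, phi L xi).  By the pair symmetry of R and nabla phi = 0,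
   half of its derivative in t is the claimed integrand plus div V, where V is
   the vector field dual to
     u |-> g(R(u, S)xi, phi W) - g(nabla_u W, phi L xi) + g(W, nabla_u (phi L xi)).
   V does not depend on the chart, because the Levi-Civita connection is
   natural and traces do not depend on the frame, so its divergence integrates
   to 0: integrate rho_a div V by parts in each chart, insert sum_b rho_b = 1,
   and move rho_b V(rho_a) to the chart of rho_b.

   This needs the change of variables y = theta(x) for iterated integrals.  It
   is obtained by mollification.  The integral over y of
   int h(x) K((y - theta x) / e) dx is (int h) (e^n int K), since the
   derivative in s of the mass of int h(x) K((y - s theta x) / e) dx is the
   integral of a divergence; on the other hand, substituting
   x = theta^-1(y) + e w and letting e tend to 0 gives
   f(y) det J int K(w J) dw, and det J int K(w J) dw = int K because the
   quadratic form w J J^T w^T can be deformed to w w^T. *)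

(** The iterated integral has no invariance built into its definition, neither under linear maps nor
    under a reordering of the coordinates. The tools for it are linearity, translations and
    dilations, differentiation under the integral sign, and the vanishing of integrals of
    derivatives, each proved by induction on the dimension for continuous integrands of bounded
    support. This is why the substitution argument is phrased with derivatives in a parameter, and
    why a kernel that is once continuously differentiable is enough for it. The density of the
    bienergy contains second derivatives of the field, and the time derivative has to pass through
    them; a variation is therefore treated as one function on the product of the time axis and a
    chart, where mixed time and space derivatives commute. Christoffel symbols act as matrices from
    the right, so covariant differentiation obeys the Leibniz rule for matrix products and curvature
    becomes a matrix. The Christoffel symbols of [phi_sasaki] are never computed: they are tested
    against lifts, and nondegeneracy recovers the tension field. *)

(** * Directional derivatives and smooth functions *)

(* Locked, because unification otherwise unfolds the limit defining ['D_v f]. *)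
HB.lock Definition der {R : numFieldType} {U V : normedModType R} (v : U) (f : U -> V) :
  U -> V := 'D_v f.

Section DerivationRules.
Context {R : realType} {U : normedModType R}.
Implicit Types (V W : normedModType R) (x v : U).

(** The differential of [f] also serves for [g], because the remainders of the two first-order
    expansions coincide for small increments. *)
Lemma near_differentiable V (f g : U -> V) x :
  {near x, f =1 g} -> differentiable f x -> differentiable g x.
Proof.
move=> fg df; have fgx : f x = g x by exact: (nbhs_singleton fg).
apply/diff_locallyP.
have [dfc /eqaddoP dfo] := (diff_locallyP _ _).1 df.
suff H : g \o shift x = cst (g x) + 'd f x +o_ 0 id.
  by have -> := diff_unique dfc H.
apply/eqaddoP => e e0; have {}dfo := dfo e e0.
have fg0 : \forall h \near (0 : U), f (h + x) = g (h + x).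
  by move: fg; rewrite (near_shift 0 x) /=; apply: filterS => h /=; rewrite subr0.
near=> h; have -> : ((g \o shift x) - (cst (g x) + 'd f x)) h
    = ((f \o shift x) - (cst (f x) + 'd f x)) h.
  rewrite -fgx /=; rewrite !fctE /=; congr (_ - _); apply: esym; near: h; exact: fg0.
by near: h.
Unshelve. all: by end_near. Qed.

Lemma derive_eq_in V (O : set U) (f g : U -> V) x v : open O -> O x ->
  (forall y, O y -> f y = g y) -> der v f x = der v g x.
Proof.
rewrite der.unlock.
move=> oO Ox fg; apply: near_eq_derive.
by apply: filterS (open_nbhs_nbhs (conj oO Ox)).
Qed.

Lemma differentiable_eq_in V (O : set U) (f g : U -> V) x : open O -> O x ->
  (forall y, O y -> f y = g y) -> differentiable f x -> differentiable g x.
Proof.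
move=> oO Ox fg; apply: near_differentiable.
by apply: filterS (open_nbhs_nbhs (conj oO Ox)).
Qed.

Lemma derive_add V (f g : U -> V) x v : differentiable f x -> differentiable g x ->
  der v (fun y => f y + g y) x = der v f x + der v g x.
Proof.
rewrite der.unlock.
by move=> df dg; rewrite -deriveD//; exact: diff_derivable.
Qed.

Lemma derive_opp V (f : U -> V) x v : differentiable f x ->
  der v (fun y => - f y) x = - der v f x.
Proof.
rewrite der.unlock.
by move=> df; rewrite -deriveN//; exact: diff_derivable.
Qed.

Lemma derive_sub V (f g : U -> V) x v : differentiable f x -> differentiable g x ->
  der v (fun y => f y - g y) x = der v f x - der v g x.
Proof.
rewrite der.unlock.
by move=> df dg; rewrite -deriveB//; exact: diff_derivable.
Qed.

Lemma derive_scale_cst V (k : R) (f : U -> V) x v : differentiable f x ->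
  der v (fun y => k *: f y) x = k *: der v f x.
Proof.
rewrite der.unlock.
by move=> df; rewrite -deriveZ//; exact: diff_derivable.
Qed.

Lemma differentiable_add V (f g : U -> V) x : differentiable f x ->
  differentiable g x -> differentiable (fun y => f y + g y) x.
Proof. exact: differentiableD. Qed.

Lemma differentiable_sub V (f g : U -> V) x : differentiable f x ->
  differentiable g x -> differentiable (fun y => f y - g y) x.
Proof. exact: differentiableB. Qed.

Lemma differentiable_scale_cst V (k : R) (f : U -> V) x : differentiable f x ->
  differentiable (fun y => k *: f y) x.
Proof. exact: differentiableZ. Qed.

Lemma differentiable_bigsum V (J : Type) (r : seq J) (P : pred J) (f : J -> U -> V) x :
  (forall i, differentiable (f i) x) ->
  differentiable (fun y => \sum_(i <- r | P i) f i y) x.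
Proof.
move=> df; have -> : (fun y => \sum_(i <- r | P i) f i y) = \sum_(i <- r | P i) f i.
  by apply/funext => y; rewrite fct_sumE.
elim/big_rec : _ => [|i g _ dg]; first exact: differentiable_cst.
exact: differentiableD.
Qed.

Lemma derive_const V (w : V) x v : der v (fun=> w) x = 0.
Proof.
rewrite der.unlock; exact: derive_cst.
Qed.

Lemma is_derive_der V (f : U -> V) x v : differentiable f x ->
  is_derive x v f (der v f x).
Proof. by move=> df; rewrite der.unlock; apply: DeriveDef => //; exact: diff_derivable. Qed.

Lemma der_val V (f : U -> V) x v df : is_derive x v f df -> der v f x = df.
Proof. by move=> [_ <-]; rewrite der.unlock. Qed.

Lemma derive_bigsum V (J : Type) (r : seq J) (P : pred J) (f : J -> U -> V) x v :
  (forall i, differentiable (f i) x) ->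
  der v (fun y => \sum_(i <- r | P i) f i y) x = \sum_(i <- r | P i) der v (f i) x.
Proof.
move=> df; elim: r => [|i r IH].
  under eq_fun do rewrite big_nil.
  by rewrite big_nil derive_const.
under eq_fun do rewrite big_cons.
rewrite big_cons; case: ifP => // _.
by rewrite derive_add ?IH//; exact: differentiable_bigsum.
Qed.

Lemma differentiable_mul (f g : U -> R) x : differentiable f x ->
  differentiable g x -> differentiable (fun y => f y * g y) x.
Proof. exact: differentiableM. Qed.

Lemma derive_mul (f g : U -> R) x v : differentiable f x -> differentiable g x ->
  der v (fun y => f y * g y) x = der v f x * g x + f x * der v g x.
Proof.
rewrite der.unlock.
move=> df dg; rewrite (@deriveM _ _ f g x v); [|exact: diff_derivable..].
transitivity (f x * 'D_v g x + g x * 'D_v f x) => //.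
by rewrite addrC [X in X + _]mulrC.
Qed.

Lemma differentiable_const V (w : V) x : differentiable (fun=> w) x.
Proof. exact: differentiable_cst. Qed.

Lemma derive_scalel V (k : U -> R) (w : V) x v : differentiable k x ->
  der v (fun y => k y *: w) x = der v k x *: w.
Proof.
rewrite der.unlock.
move=> dk; rewrite deriveE; last exact: differentiableZl.
by rewrite diffZl// deriveE.
Qed.

Lemma differentiable_mxP m n (F : U -> 'M[R]_(m, n)) x :
  differentiable F x <-> forall i j, differentiable (fun y => F y i j) x.
Proof.
split=> [dF i j|dF].
  exact: (@differentiable_comp _ _ _ _ F (fun N : 'M[R]_(m, n) => N i j : R) x dF
    (differentiable_coord _ _ _)).
have -> : F = fun y => \sum_i \sum_j F y i j *: delta_mx i j.
  by apply/funext => y; exact: matrix_sum_delta.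
do 2!(apply: differentiable_bigsum => ?).
exact: differentiableZl.
Qed.

Lemma derive_entry m n (F : U -> 'M[R]_(m, n)) x v i j : differentiable F x ->
  (der v F x) i j = der v (fun y => F y i j) x.
Proof.
rewrite der.unlock.
by move=> dF; rewrite derive_mx ?mxE//; exact: diff_derivable.
Qed.

Lemma differentiable_mulmx m n p (F : U -> 'M[R]_(m, n)) (G : U -> 'M[R]_(n, p)) x :
  differentiable F x -> differentiable G x ->
  differentiable (fun y => F y *m G y) x.
Proof.
move=> /differentiable_mxP dF /differentiable_mxP dG; apply/differentiable_mxP => i j.
under eq_fun do rewrite mxE.
by apply: differentiable_bigsum => k; exact: differentiable_mul.
Qed.

Lemma derive_mulmx m n p (F : U -> 'M[R]_(m, n)) (G : U -> 'M[R]_(n, p)) x v :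
  differentiable F x -> differentiable G x ->
  der v (fun y => F y *m G y) x = der v F x *m G x + F x *m der v G x.
Proof.
move=> dF dG; apply/matrixP => i j.
rewrite derive_entry; last exact: differentiable_mulmx.
have [dF' dG'] := ((differentiable_mxP F x).1 dF, (differentiable_mxP G x).1 dG).
under eq_fun do rewrite mxE.
rewrite derive_bigsum; last by move=> k; exact: differentiable_mul.
rewrite !mxE -big_split /=; apply: eq_bigr => k _.
by rewrite derive_mul// -!derive_entry.
Qed.

Lemma differentiable_trmx m n (F : U -> 'M[R]_(m, n)) x :
  differentiable F x -> differentiable (fun y => (F y)^T) x.
Proof.
move=> /differentiable_mxP dF; apply/differentiable_mxP => i j.
by under eq_fun do rewrite mxE.
Qed.

Lemma derive_trmx m n (F : U -> 'M[R]_(m, n)) x v : differentiable F x ->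
  der v (fun y => (F y)^T) x = (der v F x)^T.
Proof.
move=> dF; apply/matrixP => i j.
rewrite derive_entry; last exact: differentiable_trmx.
under eq_fun do rewrite mxE.
by rewrite mxE derive_entry.
Qed.

Lemma differentiable_scale m n (k : U -> R) (F : U -> 'M[R]_(m, n)) x :
  differentiable k x -> differentiable F x -> differentiable (fun y => k y *: F y) x.
Proof.
move=> dk /differentiable_mxP dF; apply/differentiable_mxP => i j.
by under eq_fun do rewrite mxE; exact: differentiable_mul.
Qed.

Lemma derive_scale m n (k : U -> R) (F : U -> 'M[R]_(m, n)) x v :
  differentiable k x -> differentiable F x ->
  der v (fun y => k y *: F y) x = der v k x *: F x + k x *: der v F x.
Proof.
move=> dk dF; apply/matrixP => i j.
rewrite derive_entry; last exact: differentiable_scale.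
under eq_fun do rewrite mxE.
by rewrite derive_mul ?mxE -?derive_entry//; exact: (differentiable_mxP _ _).1.
Qed.

End DerivationRules.

Section ChainRule.
Context {R : realType}.

Lemma derive_row n (V : normedModType R) (g : 'rV[R]_n -> V) y (w : 'rV[R]_n) :
  differentiable g y -> der w g y = \sum_i w 0 i *: der (delta_mx 0 i) g y.
Proof.
rewrite der.unlock.
move=> dg; rewrite deriveE// {1}(row_sum_delta w) linear_sum.
by apply: eq_bigr => i _; rewrite linearZ /= deriveE.
Qed.

Lemma derive_comp (U V W : normedModType R) (f : U -> V) (g : V -> W) x v :
  differentiable f x -> differentiable g (f x) ->
  der v (fun y => g (f y)) x = der (der v f x) g (f x).
Proof.
rewrite der.unlock.
move=> df dg; rewrite deriveE; last exact: (differentiable_comp df dg).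
by rewrite diff_comp//= !deriveE.
Qed.

Lemma deriveDv (U V : normedModType R) (g : U -> V) y u v : differentiable g y ->
  der (u + v) g y = der u g y + der v g y.
Proof.
rewrite der.unlock.
by move=> dg; rewrite !deriveE// linearD.
Qed.

Lemma deriveZv (U V : normedModType R) (g : U -> V) y k v : differentiable g y ->
  der (k *: v) g y = k *: der v g y.
Proof.
rewrite der.unlock.
by move=> dg; rewrite !deriveE// linearZ.
Qed.

Lemma deriveNv (U V : normedModType R) (g : U -> V) y v : differentiable g y ->
  der (- v) g y = - der v g y.
Proof.
rewrite der.unlock.
by move=> dg; rewrite !deriveE// linearN.
Qed.

End ChainRule.

Section Smooth.
Context {R : realType} {U : normedModType R}.
Variable (O : set U).
Hypothesis oO : open O.

(** Derivatives up to order [k] are differentiable. The order is a number on which to induct with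
    the function generalised: the Leibniz and chain rules replace a function by sums of products of
    others, which an induction along a fixed list of directions does not follow. *)
Fixpoint Ck (k : nat) (V : normedModType R) (f : U -> V) : Prop :=
  match k with
  | 0%N => forall x, O x -> differentiable f x
  | k'.+1 => (forall x, O x -> differentiable f x) /\ forall v, Ck k' (der v f)
  end.

Lemma CkW k (V : normedModType R) (f : U -> V) : Ck k.+1 f -> Ck k f.
Proof.
elim: k f => [|k IH] f /=; first by case.
by move=> [df sf]; split=> // v; apply: IH; have [] := sf v.
Qed.

Lemma Ck_differentiable k (V : normedModType R) (f : U -> V) x :
  Ck k f -> O x -> differentiable f x.
Proof. by case: k => [|k] /=; [exact|case=> + _; exact]. Qed.

Lemma Ck_eq k (V : normedModType R) (f g : U -> V) :
  (forall y, O y -> f y = g y) -> Ck k f -> Ck k g.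
Proof.
elim: k f g => [|k IH] f g fg /= => [df x Ox|[df sf]].
  exact: (differentiable_eq_in oO Ox fg (df x Ox)).
split=> [x Ox|v]; first exact: (differentiable_eq_in oO Ox fg (df x Ox)).
by apply: IH (sf v) => y Oy; exact: (derive_eq_in v oO Oy fg).
Qed.

Lemma smooth_onP (V : normedModType R) (f : U -> V) :
  smooth_on O f <-> forall k, Ck k f.
Proof.
have derE v g : (fun h => derive h ^~ v) g = der v g :> (U -> V) by rewrite der.unlock.
split=> [sf k|Cf s].
  elim: k f sf => [|k IH] f sf /=; first exact: (sf [::]).
  split; first exact: (sf [::]).
  (* The innermost derivative belongs to the last entry of the list, hence [rcons]. *)
  by move=> v; apply: IH => s x Ox; have := sf (rcons s v) x Ox; rewrite foldr_rcons -derE.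
elim/last_ind: s f Cf => [|s v IH] f Cf; first exact: Cf 0%N.
by rewrite foldr_rcons; apply: IH => k; rewrite [X in Ck k X]derE; exact: (Cf k.+1).2 v.
Qed.

Lemma smooth_diff (V : normedModType R) (f : U -> V) x :
  smooth_on O f -> O x -> differentiable f x.
Proof. by move=> sf; exact: (sf [::]). Qed.

Lemma smooth_eq (V : normedModType R) (f g : U -> V) :
  (forall y, O y -> f y = g y) -> smooth_on O f -> smooth_on O g.
Proof. by move=> fg /smooth_onP Cf; apply/smooth_onP => k; exact: Ck_eq (Cf k). Qed.

Lemma smooth_derive (V : normedModType R) (f : U -> V) v :
  smooth_on O f -> smooth_on O (der v f).
Proof. by move=> /smooth_onP Cf; apply/smooth_onP => k; exact: (Cf k.+1).2 v. Qed.

Lemma Ck_cst k (V : normedModType R) (w : V) : Ck k (fun=> w).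
Proof.
elim: k w => [|k IH] w /=; first by move=> x _; exact: differentiable_cst.
split=> [x _|v]; first exact: differentiable_cst.
by apply: (Ck_eq _ (IH 0)) => y _; rewrite derive_const.
Qed.

Lemma smooth_cst (V : normedModType R) (w : V) : smooth_on O (fun=> w).
Proof. by apply/smooth_onP => k; exact: Ck_cst. Qed.

Lemma Ck_add k (V : normedModType R) (f g : U -> V) :
  Ck k f -> Ck k g -> Ck k (fun x => f x + g x).
Proof.
elim: k f g => [|k IH] f g /=.
  by move=> df dg x Ox; apply: differentiable_add; [exact: df|exact: dg].
move=> [df sf] [dg sg]; split=> [x Ox|v].
  by apply: differentiable_add; [exact: df|exact: dg].
apply: (Ck_eq _ (IH _ _ (sf v) (sg v))) => y Oy.
by rewrite derive_add; [|exact: df|exact: dg].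
Qed.

Lemma smooth_add (V : normedModType R) (f g : U -> V) :
  smooth_on O f -> smooth_on O g -> smooth_on O (fun x => f x + g x).
Proof. by move=> /smooth_onP Cf /smooth_onP Cg; apply/smooth_onP => k; exact: Ck_add. Qed.

Lemma Ck_scale_cst k (V : normedModType R) c (f : U -> V) :
  Ck k f -> Ck k (fun x => c *: f x).
Proof.
elim: k f => [|k IH] f /=.
  by move=> df x Ox; apply: differentiable_scale_cst; exact: df.
move=> [df sf]; split=> [x Ox|v].
  by apply: differentiable_scale_cst; exact: df.
apply: (Ck_eq _ (IH _ (sf v))) => y Oy.
by rewrite derive_scale_cst; [|exact: df].
Qed.

Lemma smooth_scale_cst (V : normedModType R) c (f : U -> V) :
  smooth_on O f -> smooth_on O (fun x => c *: f x).
Proof. by move=> /smooth_onP Cf; apply/smooth_onP => k; exact: Ck_scale_cst. Qed.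

Lemma smooth_opp (V : normedModType R) (f : U -> V) :
  smooth_on O f -> smooth_on O (fun x => - f x).
Proof.
move=> sf; apply: (smooth_eq _ (smooth_scale_cst (-1) sf)) => x _.
by rewrite scaleN1r.
Qed.

Lemma smooth_sub (V : normedModType R) (f g : U -> V) :
  smooth_on O f -> smooth_on O g -> smooth_on O (fun x => f x - g x).
Proof. by move=> sf sg; apply: smooth_add => //; exact: smooth_opp. Qed.

Lemma Ck_bigsum k (V : normedModType R) (J : Type) (r : seq J) (P : pred J)
  (f : J -> U -> V) : (forall j, Ck k (f j)) -> Ck k (fun x => \sum_(j <- r | P j) f j x).
Proof.
move=> sf; elim: r => [|j r IH].
  by apply: (Ck_eq _ (Ck_cst k 0)) => x _; rewrite big_nil.
case Pj : (P j); last by apply: (Ck_eq _ IH) => x _; rewrite big_cons Pj.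
by apply: (Ck_eq _ (Ck_add (sf j) IH)) => x _; rewrite big_cons Pj.
Qed.

Lemma smooth_bigsum (V : normedModType R) (J : Type) (r : seq J) (P : pred J)
  (f : J -> U -> V) : (forall j, smooth_on O (f j)) ->
  smooth_on O (fun x => \sum_(j <- r | P j) f j x).
Proof.
by move=> sf; apply/smooth_onP => k; apply: Ck_bigsum => j; apply: (smooth_onP _).1; exact: sf.
Qed.

Lemma Ck_mul k (f g : U -> R) : Ck k f -> Ck k g -> Ck k (fun x => f x * g x).
Proof.
elim: k f g => [|k IH] f g.
  by move=> df dg x Ox; apply: differentiable_mul; [exact: df|exact: dg].
move=> sf sg; split=> [x Ox|v].
  by apply: differentiable_mul; [exact: Ck_differentiable sf _|exact: Ck_differentiable sg _].
apply: (Ck_eq _ (Ck_add (IH _ _ (sf.2 v) (CkW sg)) (IH _ _ (CkW sf) (sg.2 v)))) => y Oy.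
by rewrite derive_mul//; [exact: Ck_differentiable sf _|exact: Ck_differentiable sg _].
Qed.

Lemma smooth_mul (f g : U -> R) :
  smooth_on O f -> smooth_on O g -> smooth_on O (fun x => f x * g x).
Proof. by move=> /smooth_onP Cf /smooth_onP Cg; apply/smooth_onP => k; exact: Ck_mul. Qed.

Lemma smooth_prod (J : Type) (r : seq J) (P : pred J) (f : J -> U -> R) :
  (forall j, smooth_on O (f j)) -> smooth_on O (fun x => \prod_(j <- r | P j) f j x).
Proof.
move=> sf; elim: r => [|j r IH].
  by apply: (smooth_eq _ (smooth_cst (1 : R))) => x _; rewrite big_nil.
case Pj : (P j); last by apply: (smooth_eq _ IH) => x _; rewrite big_cons Pj.
by apply: (smooth_eq _ (smooth_mul (sf j) IH)) => x _; rewrite big_cons Pj.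
Qed.

Lemma Ck_mxP k m n (F : U -> 'M[R]_(m, n)) :
  Ck k F <-> forall i j, Ck k (fun x => F x i j).
Proof.
elim: k F => [|k IH] F /=.
  split=> [dF i j x Ox|dF x Ox]; first exact: (differentiable_mxP F x).1 (dF x Ox) i j.
  by apply/differentiable_mxP => i j; exact: dF.
split=> [[dF sF] i j|H].
  split=> [x Ox|v]; first exact: (differentiable_mxP F x).1 (dF x Ox) i j.
  apply: (Ck_eq _ ((IH (der v F)).1 (sF v) i j)) => y Oy.
  by rewrite derive_entry//; exact: dF.
have dF x : O x -> differentiable F x.
  by move=> Ox; apply/differentiable_mxP => i j; have [+ _] := H i j; exact.
split=> // v; apply/IH => i j; have [_ /(_ v)] := H i j.
by apply: Ck_eq => y Oy; rewrite derive_entry//; exact: dF.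
Qed.

Lemma smooth_mxP m n (F : U -> 'M[R]_(m, n)) :
  smooth_on O F <-> forall i j, smooth_on O (fun x => F x i j).
Proof.
split=> [/smooth_onP sF i j|sF]; apply/smooth_onP => k; first exact: (Ck_mxP k F).1 (sF k) i j.
by apply/Ck_mxP => i j; exact: (smooth_onP _).1 (sF i j) k.
Qed.

Lemma smooth_mulmx m n p (F : U -> 'M[R]_(m, n)) (G : U -> 'M[R]_(n, p)) :
  smooth_on O F -> smooth_on O G -> smooth_on O (fun x => F x *m G x).
Proof.
move=> /smooth_mxP sF /smooth_mxP sG; apply/smooth_mxP => i j.
apply: (smooth_eq (f := fun x => \sum_k F x i k * G x k j)) => [x _|]; first by rewrite mxE.
by apply: smooth_bigsum => k; exact: smooth_mul.
Qed.

Lemma smooth_trmx m n (F : U -> 'M[R]_(m, n)) :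
  smooth_on O F -> smooth_on O (fun x => (F x)^T).
Proof.
move=> /smooth_mxP sF; apply/smooth_mxP => i j.
by apply: (smooth_eq _ (sF j i)) => x _; rewrite mxE.
Qed.

Lemma smooth_scale m n (k : U -> R) (F : U -> 'M[R]_(m, n)) :
  smooth_on O k -> smooth_on O F -> smooth_on O (fun x => k x *: F x).
Proof.
move=> sk /smooth_mxP sF; apply/smooth_mxP => i j.
by apply: (smooth_eq _ (smooth_mul sk (sF i j))) => x _; rewrite mxE.
Qed.

Lemma smooth_row_mx m n1 n2 (F : U -> 'M[R]_(m, n1)) (G : U -> 'M[R]_(m, n2)) :
  smooth_on O F -> smooth_on O G -> smooth_on O (fun x => row_mx (F x) (G x)).
Proof.
move=> /smooth_mxP sF /smooth_mxP sG; apply/smooth_mxP => i j.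
case: (split_ordP j) => k ->.
  by apply: (smooth_eq _ (sF i k)) => x _; rewrite row_mxEl.
by apply: (smooth_eq _ (sG i k)) => x _; rewrite row_mxEr.
Qed.

Lemma smooth_col_mx m1 m2 n (F : U -> 'M[R]_(m1, n)) (G : U -> 'M[R]_(m2, n)) :
  smooth_on O F -> smooth_on O G -> smooth_on O (fun x => col_mx (F x) (G x)).
Proof.
move=> /smooth_trmx sF /smooth_trmx sG.
apply: (smooth_eq _ (smooth_trmx (smooth_row_mx sF sG))) => x _.
by rewrite tr_row_mx !trmxK.
Qed.

Lemma smooth_det n (F : U -> 'M[R]_n) :
  smooth_on O F -> smooth_on O (fun x => \det (F x)).
Proof.
move=> /smooth_mxP sF; apply: smooth_bigsum => s.
apply: smooth_mul; first exact: smooth_cst.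
by apply: smooth_prod => i; exact: sF.
Qed.

Lemma Ck_inv k (f : U -> R) : (forall x, O x -> f x != 0) -> Ck k f ->
  Ck k (fun x => (f x)^-1).
Proof.
move=> f0; elim: k => [|k IH] sf.
  move=> x Ox; apply: (differentiable_comp (f := f) (sf x Ox)).
  exact: differentiable_Rinv (f0 x Ox).
split=> [x Ox|v].
  apply: (differentiable_comp (f := f) (sf.1 x Ox)).
  exact: differentiable_Rinv (f0 x Ox).
have Cf' := IH (CkW sf).
apply: (Ck_eq _ (Ck_scale_cst (-1) (Ck_mul (sf.2 v) (Ck_mul Cf' Cf')))) => y Oy.
rewrite der.unlock deriveV; [|exact: f0|by apply: diff_derivable; exact: sf.1].
transitivity (-1 * ('D_v f y * ((f y)^-1 * (f y)^-1))) => //.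
transitivity (- (f y) ^- 2 * 'D_v f y) => //.
by rewrite expr2 invfM; ring.
Qed.

Lemma smooth_inv (f : U -> R) : (forall x, O x -> f x != 0) -> smooth_on O f ->
  smooth_on O (fun x => (f x)^-1).
Proof. by move=> f0 /smooth_onP Cf; apply/smooth_onP => k; exact: Ck_inv. Qed.

Lemma smooth_invmx n (F : U -> 'M[R]_n) : (forall x, O x -> F x \in unitmx) ->
  smooth_on O F -> smooth_on O (fun x => invmx (F x)).
Proof.
move=> uF sF; have sF' := (smooth_mxP F).1 sF.
apply: (smooth_eq (f := fun x => (\det (F x))^-1 *: \adj (F x))) => [x Ox|].
  by rewrite /invmx uF.
apply: smooth_scale.
  apply: smooth_inv; last exact: smooth_det.
  by move=> x Ox; have := uF x Ox; rewrite unitmxE unitfE.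
apply/smooth_mxP => i j.
apply: (smooth_eq (f := fun x => (-1) ^+ (j + i) * \det (row' j (col' i (F x))))).
  by move=> x _; rewrite mxE.
apply: smooth_mul; first exact: smooth_cst.
apply: smooth_det; apply/smooth_mxP => a b.
by apply: (smooth_eq _ (sF' (lift j a) (lift i b))) => x _; rewrite !mxE.
Qed.

End Smooth.
Arguments smooth_onP {R U O V f}.

Section SmoothComp.
Context {R : realType} {U : normedModType R}.
Variable (O : set U).
Hypothesis oO : open O.

(** By the chain rule in coordinates, a derivative of the composite is a sum of components of
    [der v f] times partial derivatives of [g] composed with [f]. The order of [g] has dropped by
    one, and [f] is kept at the lower order. *)
Lemma Ck_comp_real k n (O' : set 'rV[R]_n) (f : U -> 'rV[R]_n) (g : 'rV[R]_n -> R) :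
  open O' -> (forall x, O x -> O' (f x)) -> Ck O k f -> Ck O' k g ->
  Ck O k (fun x => g (f x)).
Proof.
move=> oO' fO; elim: k g => [|k IH] g sf sg.
  by move=> x Ox; exact: differentiable_comp (sf x Ox) (sg _ (fO x Ox)).
have df x : O x -> differentiable f x by exact: Ck_differentiable sf.
have dg x : O' x -> differentiable g x by exact: Ck_differentiable sg.
split=> [x Ox|v]; first exact: (@differentiable_comp _ _ _ _ f g x (df x Ox) (dg _ (fO x Ox))).
apply: (Ck_eq oO (f := fun x => \sum_i (der v f x) 0 i * der (delta_mx 0 i) g (f x))).
  move=> y Oy; have dfy := df y Oy; have dgy := dg _ (fO y Oy).
  by rewrite (derive_comp _ dfy dgy) -(derive_row _ dgy).
apply: (Ck_bigsum oO) => i; apply: (Ck_mul oO).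
  exact: (Ck_mxP oO k _).1 (sf.2 v) 0 i.
exact: IH (CkW sf) (sg.2 _).
Qed.

Lemma smooth_comp_real n (O' : set 'rV[R]_n) (f : U -> 'rV[R]_n) (g : 'rV[R]_n -> R) :
  open O' -> (forall x, O x -> O' (f x)) -> smooth_on O f -> smooth_on O' g ->
  smooth_on O (fun x => g (f x)).
Proof.
move=> oO' fO /smooth_onP sf /smooth_onP sg; apply/smooth_onP => k.
exact: Ck_comp_real fO (sf k) (sg k).
Qed.

Lemma smooth_comp n p q (O' : set 'rV[R]_n) (f : U -> 'rV[R]_n) (g : 'rV[R]_n -> 'M[R]_(p, q)) :
  open O' -> (forall x, O x -> O' (f x)) -> smooth_on O f -> smooth_on O' g ->
  smooth_on O (fun x => g (f x)).
Proof.
move=> oO' fO sf /(smooth_mxP oO') sg; apply/(smooth_mxP oO) => i j.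
exact: smooth_comp_real fO sf (sg i j).
Qed.

(** Since the derivative of [L] is constant, the chain rule has a single term and no coordinates on
    [U'] enter. This serves for the slices of [R^o * E], which is not a space of row vectors, and
    for its projection. *)
Lemma smooth_comp_affine (U' V : normedModType R) (O' : set U') (L : U -> U') (dL : U -> U')
    (g : U' -> V) : open O' ->
  (forall x, differentiable L x) -> (forall v x, der v L x = dL v) ->
  (forall x, O x -> O' (L x)) -> smooth_on O' g -> smooth_on O (fun x => g (L x)).
Proof.
move=> oO' diL DL LO /smooth_onP sg; apply/smooth_onP => k.
elim: k g sg => [|k IH] g sg.
  by move=> x Ox; apply: (differentiable_comp (diL x)); exact: sg 0%N _ (LO x Ox).
split=> [x Ox|v]; first by apply: (differentiable_comp (diL x)); exact: sg 0%N _ (LO x Ox).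
apply: (Ck_eq oO (f := fun x => der (dL v) g (L x))).
  move=> y Oy; have dgy : differentiable g (L y) by exact: sg 0%N _ (LO y Oy).
  by rewrite (derive_comp _ (diL y) dgy) DL.
apply: (IH (der (dL v) g)) => j; exact: (sg j.+1).2 (dL v).
Qed.

Lemma der_sqrt (f : U -> R) x v : 0 < f x -> differentiable f x ->
  der v (fun y => Num.sqrt (f y)) x = der v f x * (2 * Num.sqrt (f x))^-1.
Proof.
move=> f0 df; have H := is_derive1_sqrt f0.
have ds : differentiable (Num.sqrt : R -> R) (f x) by apply/derivable1_diffP; have [] := H.
rewrite (derive_comp v df ds).
have -> : der (der v f x) Num.sqrt (f x) = der v f x *: der (1 : R) Num.sqrt (f x).
  by rewrite -(deriveZv _ _ ds); congr (der _ _ _); exact/esym/mulr1.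
by rewrite (der_val H).
Qed.

Lemma Ck_sqrt k (f : U -> R) : (forall x, O x -> 0 < f x) -> Ck O k f ->
  Ck O k (fun x => Num.sqrt (f x)).
Proof.
move=> f0; elim: k => [|k IH] sf.
  move=> x Ox; apply: (differentiable_comp (f := f) (sf x Ox)).
  by apply/derivable1_diffP; have [] := is_derive1_sqrt (f0 x Ox).
have dS x : O x -> differentiable (fun x => Num.sqrt (f x)) x.
  move=> Ox; apply: (differentiable_comp (f := f) (sf.1 x Ox)).
  by apply/derivable1_diffP; have [] := is_derive1_sqrt (f0 x Ox).
split=> // v.
have Cf' := IH (CkW sf).
have Cs : Ck O k (fun x => (Num.sqrt (f x))^-1).
  apply: Ck_inv => // x Ox; rewrite gt_eqF// sqrtr_gt0; exact: f0.
apply: (Ck_eq oO _ (Ck_scale_cst oO (2^-1) (Ck_mul oO (sf.2 v) Cs))) => y Oy.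
rewrite der_sqrt ?f0//; last exact: sf.1.
transitivity (2^-1 * (der v f y * (Num.sqrt (f y))^-1)) => //.
by rewrite invfM; ring.
Qed.

Lemma smooth_sqrt (f : U -> R) : (forall x, O x -> 0 < f x) -> smooth_on O f ->
  smooth_on O (fun x => Num.sqrt (f x)).
Proof. by move=> f0 /smooth_onP Cf; apply/smooth_onP => k; exact: Ck_sqrt. Qed.

(** The direction varies with the point, so the derivative is first expanded in the fixed coordinate
    directions. *)
Lemma smooth_derive_along n m p (Ox : set 'rV[R]_n) (X : 'rV[R]_n -> 'rV[R]_n)
    (F : 'rV[R]_n -> 'M[R]_(m, p)) : open Ox ->
  smooth_on Ox X -> smooth_on Ox F -> smooth_on Ox (fun x => der (X x) F x).
Proof.
move=> oOx sX sF.
apply: (smooth_eq oOx (f := fun x => \sum_i X x 0 i *: der (delta_mx 0 i) F x)).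
  by move=> y Oy; rewrite -derive_row//; exact: smooth_diff sF Oy.
apply: (smooth_bigsum oOx) => i; apply: (smooth_scale oOx); last exact: smooth_derive.
exact: (smooth_mxP oOx _).1 sX 0 i.
Qed.

Lemma smooth_ip n (G : U -> 'M[R]_n) (u v : U -> 'rV[R]_n) :
  smooth_on O G -> smooth_on O u -> smooth_on O v ->
  smooth_on O (fun x => ip (G x) (u x) (v x)).
Proof.
move=> sG su sv.
have : smooth_on O (fun x => u x *m G x *m (v x)^T).
  by apply: (smooth_mulmx oO); [exact: smooth_mulmx|exact: smooth_trmx].
by move=> /(smooth_mxP oO); exact.
Qed.

Lemma smooth_id : smooth_on O (fun x => x).
Proof.
apply/smooth_onP => k; case: k => [|k]; first by move=> x _; have [] := is_diff_id x.
split=> [x _|v]; first by have [] := is_diff_id x.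
by apply: (Ck_eq oO _ (Ck_cst oO k v)) => y _; rewrite (der_val (is_derive_id _ _)).
Qed.

End SmoothComp.

Section SmoothLocal.
Context {R : realType} {U : normedModType R}.

Lemma smooth_subset (V : normedModType R) (O O' : set U) (f : U -> V) :
  O' `<=` O -> smooth_on O f -> smooth_on O' f.
Proof. by move=> OO' sf s x /OO'; exact: sf. Qed.

(** [O] and the complement of [K] are open and cover the space. On the first the extension is [f],
    on the second it is [0]. *)
Lemma smooth_extend0 (O K : set U) (f : U -> R) : open O -> closed K -> K `<=` O ->
  smooth_on O f -> (forall x, O x -> ~ K x -> f x = 0) -> smooth_on [set: U] (f \_ O).
Proof.
move=> oO cK KO sf f0 s x _.
have sO : smooth_on O (f \_ O).
  by apply: (smooth_eq oO _ sf) => y Oy; rewrite patchT// inE.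
have oK : open (~` K) by exact: closed_openC.
have sK : smooth_on (~` K) (f \_ O).
  apply: (smooth_eq oK _ (smooth_cst oK (0 : R))) => y Ky.
  by rewrite patchE; case: ifPn => // Oy; rewrite f0//; exact: set_mem.
have [Kx|Kx] := pselect (K x); first exact/sO/KO.
exact: sK.
Qed.

End SmoothLocal.

(** * Symmetry of second derivatives *)

Section Schwarz.
Context {R : realType} {U : normedModType R}.
Implicit Types (O : set U) (f : U -> R) (u v x : U).

Lemma is_derive_line f x u (s : R) : differentiable f (x + s *: u) ->
  is_derive s (1 : R) (fun r : R => f (x + r *: u)) (der u f (x + s *: u)).
Proof.
move=> df.
have dl : differentiable (fun r : R => x + r *: u) s.
  by apply: differentiable_add; [exact: differentiable_const|exact: differentiableZl].
have Dl : der (1 : R) (fun r : R => x + r *: u) s = u.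
  rewrite derive_add ?derive_const ?add0r; [|exact: differentiable_const|exact: differentiableZl].
  by rewrite derive_scalel ?(der_val (is_derive_id _ _)) ?scale1r//.
have := is_derive_der (1 : R) (differentiable_comp dl df).
by rewrite (derive_comp _ dl df) Dl.
Qed.

(** Two uses of the mean value theorem: in [s] for the difference of [f] between two opposite sides
    of the parallelogram, then in [t] for [der u f]. *)
Lemma second_difference O f x u v (h k : R) : open O -> Ck O 1 f -> 0 < h -> 0 < k ->
  (forall s t, 0 <= s <= h -> 0 <= t <= k -> O (x + s *: u + t *: v)) ->
  exists s t, [/\ 0 <= s <= h, 0 <= t <= k &
    f (x + h *: u + k *: v) - f (x + h *: u) - f (x + k *: v) + f x =
    h * k * der v (der u f) (x + s *: u + t *: v)].
Proof.
move=> oO [df sf] h0 k0 Oin.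
have Oin0 s : 0 <= s <= h -> O (x + s *: u).
  by move=> hs; have := Oin s 0 hs; rewrite scale0r addr0 lexx ltW//; exact.
have xC s r : x + s *: u + r *: v = (x + r *: v) + s *: u by rewrite addrAC.
pose phi (s : R) := f ((x + k *: v) + s *: u) - f (x + s *: u).
have kk : 0 <= k <= k by rewrite lexx ltW.
have [|s|s sh Es] := @MVT R phi (fun s => der u f (x + k *: v + s *: u) - der u f (x + s *: u)) 0 h h0.
- move=> s; rewrite in_itv /= => /andP[/ltW s0 /ltW sh].
  apply: is_deriveB; apply: is_derive_line; apply: df; last by apply: Oin0; rewrite s0.
  by rewrite -xC; apply: Oin => //; rewrite s0.
- apply: derivable_within_continuous => r; rewrite in_itv /= => s0h.
  suff H : is_derive r (1 : R) phi (der u f (x + k *: v + r *: u) - der u f (x + r *: u)) by [].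
  apply: is_deriveB; apply: is_derive_line; apply: df; last exact: Oin0.
  by rewrite -xC; exact: Oin.
have /andP[/ltW s0 /ltW sh'] : 0 < s < h by move: sh; rewrite in_itv.
have s0h : 0 <= s <= h by rewrite s0.
pose psi (t : R) := der u f (x + s *: u + t *: v).
have Ck0 := sf u.
have [|t|t tk Et] := @MVT R psi (fun t => der v (der u f) (x + s *: u + t *: v)) 0 k k0.
- move=> t; rewrite in_itv /= => /andP[/ltW t0 /ltW tk].
  by apply: is_derive_line; apply: Ck0; apply: Oin => //; rewrite t0.
- apply: derivable_within_continuous => r; rewrite in_itv /= => tk.
  suff H : is_derive r (1 : R) psi (der v (der u f) (x + s *: u + r *: v)) by [].
  by apply: is_derive_line; apply: Ck0; apply: Oin.
have /andP[/ltW t0 /ltW tk'] : 0 < t < k by move: tk; rewrite in_itv.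
exists s, t; split; [by []|by rewrite t0|].
move: Et Es; rewrite /psi /phi !scale0r !addr0 !subr0 -!xC => Et Es.
rewrite Et in Es.
transitivity (f (x + h *: u + k *: v) - f (x + h *: u) - (f (x + k *: v) - f x)); first by ring.
by rewrite Es; ring.
Qed.

(** The second difference does not change when the two sides are exchanged, so the two mixed
    derivatives take a common value at two points of a small parallelogram. Continuity at [x] does
    the rest. *)
Lemma schwarz O f x u v : open O -> Ck O 2 f -> O x ->
  der u (der v f) x = der v (der u f) x.
Proof.
move=> oO Cf Ox.
have Cf1 : Ck O 1 f by exact: CkW.
have cuv : {for x, continuous (der u (der v f))}.
  exact: differentiable_continuous (((Cf.2 v).2 u) x Ox).
have cvu : {for x, continuous (der v (der u f))}.
  exact: differentiable_continuous (((Cf.2 u).2 v) x Ox).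
apply/eqP; rewrite -subr_eq0 -normr_eq0; apply/eqP/le_anti; rewrite normr_ge0 andbT.
apply/ler_addgt0Pl => e e0; rewrite addr0.
have e20 : 0 < e / 2 by rewrite divr_gt0.
move/cvgrPdist_lt : cuv => /(_ _ e20) H1.
move/cvgrPdist_lt : cvu => /(_ _ e20) H2.
have H3 : nbhs x O by exact: open_nbhs_nbhs.
have [r /= r0 Hr] := (nbhs_ballP x _).1 (filterI H3 (filterI H1 H2)).
(* With this side length the whole parallelogram at [x] lies in the ball of radius [r], as [h] times
   the bracket is [r / 2]; the summand 1 covers [u = v = 0]. *)
pose h := r / (2 * (`|u| + `|v| + 1)).
have D0 : 0 < `|u| + `|v| + 1 by rewrite ltr_wpDl// addr_ge0.
have h0 : 0 < h by rewrite divr_gt0// mulr_gt0.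
have B s t : 0 <= s <= h -> 0 <= t <= h -> ball x r (x + s *: u + t *: v).
  move=> /andP[s0 sh] /andP[t0 th]; rewrite -ball_normE /ball_ /=.
  rewrite -addrA opprD addNKr normrN (le_lt_trans (ler_normD _ _))// !normrZ !ger0_norm//.
  apply: (@le_lt_trans _ _ (h * (`|u| + `|v| + 1))).
    rewrite !mulrDr mulr1 -addrA lerD ?ler_wpM2r//.
    by apply: ler_wpDr; [exact: ltW|rewrite ler_wpM2r].
  rewrite /h invfM mulrA divfK ?gt_eqF//.
  by rewrite ltr_pdivrMr// ltr_pMr// ltr1n.
have Bo s t : 0 <= s <= h -> 0 <= t <= h -> O (x + s *: u + t *: v).
  by move=> hs ht; have [] := Hr _ (B s t hs ht).
have {}Hr y : ball x r y -> [/\ O y, `|der u (der v f) x - der u (der v f) y| < e / 2 &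
    `|der v (der u f) x - der v (der u f) y| < e / 2].
  by move=> yr; have [a [b c]] := Hr y yr; split; [exact: a|exact: b|exact: c].
have [s [t [hs ht E1]]] := second_difference oO Cf1 h0 h0 Bo.
have [|s' [t' [hs' ht' E2]]] := @second_difference O f x v u h h oO Cf1 h0 h0.
  by move=> s' t' hs' ht'; rewrite addrAC; exact: Bo.
have E : der v (der u f) (x + s *: u + t *: v) = der u (der v f) (x + s' *: v + t' *: u).
  apply: (@mulfI _ (h * h)); first by rewrite mulf_neq0// gt_eqF.
  rewrite -E1 -E2 (addrAC x (h *: v)); ring.
have {}H1 : `|der v (der u f) x - der v (der u f) (x + s *: u + t *: v)| < e / 2.
  by have [_ _] := Hr _ (B s t hs ht).
have {}H2 : `|der u (der v f) x - der v (der u f) (x + s *: u + t *: v)| < e / 2.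
  by have [_ + _] := Hr _ (B t' s' ht' hs'); rewrite E addrAC.
rewrite (splitr e).
rewrite -(subrKA (der v (der u f) (x + s *: u + t *: v))) (le_trans (ler_normD _ _))// lerD//; first exact: ltW.
by rewrite distrC ltW.
Qed.

Lemma schwarz_mx O m n (F : U -> 'M[R]_(m, n)) x u v : open O -> smooth_on O F -> O x ->
  der u (der v F) x = der v (der u F) x.
Proof.
move=> oO sF Ox; apply/matrixP => i j.
have dF w y : O y -> differentiable (der w F) y by move=> Oy; exact: (smooth_diff (smooth_derive w sF) Oy).
rewrite (derive_entry u i j (dF v x Ox)) (derive_entry v i j (dF u x Ox)).
have E w y : O y -> (der w F y) i j = der w (fun z => F z i j) y.
  by move=> Oy; rewrite (derive_entry w i j (smooth_diff sF Oy)).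
rewrite (derive_eq_in _ oO Ox (E v)) (derive_eq_in _ oO Ox (E u)).
apply: (schwarz _ _ oO _ Ox); apply: (smooth_onP).1.
exact: (smooth_mxP oO F).1 sF i j.
Qed.

End Schwarz.

(** * Iterated integrals *)

Section ContinuityAt.
Context {R : realType}.

Definition cts_at (T : topologicalType) (V : normedModType R) (f : T -> V) (x : T) : Prop :=
  f @ x --> f x.

Definition cts (T : topologicalType) (V : normedModType R) (f : T -> V) : Prop :=
  forall x, cts_at f x.

Lemma cts_continuous (T : topologicalType) (V : normedModType R) (f : T -> V) :
  cts f -> continuous f.
Proof. exact. Qed.

Lemma cts_at_comp (T U : topologicalType) (V : normedModType R) (f : T -> U) (g : U -> V) x :
  f @ x --> f x -> cts_at g (f x) -> cts_at (fun y => g (f y)) x.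
Proof. exact: continuous_comp. Qed.

Lemma cts_atP (T : topologicalType) (V : normedModType R) (f : T -> V) (x : T) :
  cts_at f x <-> forall e : R, 0 < e -> \forall y \near x, `|f x - f y| < e.
Proof. exact: cvgrPdist_lt. Qed.

Lemma cts_at_cst (T : topologicalType) (V : normedModType R) (w : V) (x : T) :
  cts_at (fun=> w) x.
Proof. exact: cvg_cst. Qed.

Lemma cts_at_id (V : normedModType R) (x : V) : cts_at (fun y => y) x.
Proof. exact: cvg_id. Qed.

Lemma differentiable_cts_at (U V : normedModType R) (f : U -> V) x :
  differentiable f x -> cts_at f x.
Proof. exact: differentiable_continuous. Qed.

Lemma cts_at_opp (T : topologicalType) (V : normedModType R) (f : T -> V) x :
  cts_at f x -> cts_at (fun y => - f y) x.
Proof. exact: cvgN. Qed.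

Lemma cts_at_add (T : topologicalType) (V : normedModType R) (f g : T -> V) x :
  cts_at f x -> cts_at g x -> cts_at (fun y => f y + g y) x.
Proof. exact: cvgD. Qed.

Lemma cts_at_sub (T : topologicalType) (V : normedModType R) (f g : T -> V) x :
  cts_at f x -> cts_at g x -> cts_at (fun y => f y - g y) x.
Proof. exact: cvgB. Qed.

Lemma cts_at_scale (T : topologicalType) (V : normedModType R) (k : T -> R) (f : T -> V) x :
  cts_at k x -> cts_at f x -> cts_at (fun y => k y *: f y) x.
Proof. exact: cvgZ. Qed.

Lemma cts_at_norm (T : topologicalType) (V : normedModType R) (f : T -> V) x :
  cts_at f x -> cts_at (fun y => `|f y|) x.
Proof. exact: cvg_norm. Qed.

Lemma cts_at_inv (T : topologicalType) (f : T -> R) x : f x != 0 ->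
  cts_at f x -> cts_at (fun y => (f y)^-1) x.
Proof. by move=> f0 cf; exact: cvgV f0 cf. Qed.

End ContinuityAt.

Section ContinuousArith.
Context {R : realType} {T : topologicalType}.
Implicit Types (f g : T -> R).

Lemma continuous_add f g x : cts_at f x -> cts_at g x ->
  cts_at (fun y => f y + g y) x.
Proof. exact: cvgD. Qed.

Lemma continuous_mul f g x : cts_at f x -> cts_at g x ->
  cts_at (fun y => f y * g y) x.
Proof. exact: cvgM. Qed.

Lemma continuous_cmul (k : R) g x : cts_at g x -> cts_at (fun y => k * g y) x.
Proof. by move=> cg; apply: continuous_mul => //; exact: cts_at_cst. Qed.

Lemma continuous_bigsum (J : Type) (r : seq J) (h : J -> T -> R) x :
  (forall j, cts_at (h j) x) -> cts_at (fun y => \sum_(j <- r) h j y) x.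
Proof.
move=> ch; elim: r => [|j r IH].
  rewrite (_ : (fun y => _) = fun=> 0); first exact: cts_at_cst.
  by apply/funext => y; rewrite big_nil.
rewrite (_ : (fun y => _) = fun y => h j y + \sum_(k <- r) h k y).
  exact: continuous_add.
by apply/funext => y; rewrite big_cons.
Qed.

End ContinuousArith.

Section MatrixNorm.
Context {R : realType}.

Lemma mx_norm_entry m n (A : 'M[R]_(m, n)) i j : `|A i j| <= `|A|.
Proof.
rewrite [leRHS]/Num.Def.normr/= mx_normrE.
exact: (le_bigmax _ (fun k : 'I_m * 'I_n => `|A k.1 k.2|) (i, j)).
Qed.

Lemma mx_norm_le m n (A : 'M[R]_(m, n)) M : 0 <= M ->
  (forall i j, `|A i j| <= M) -> `|A| <= M.
Proof.
move=> M0 AM; rewrite [leLHS]/Num.Def.normr/= mx_normrE.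
by apply: bigmax_le => // -[i j] _; exact: AM.
Qed.

Lemma continuous_mxP (T : topologicalType) m n (F : T -> 'M[R]_(m, n)) x :
  cts_at F x <-> forall i j, cts_at (fun y => F y i j) x.
Proof.
split=> [cF i j|cF].
  exact: (cvg_comp _ _ cF (@coord_continuous _ _ _ i j (F x))).
apply/cvgrPdist_le => /= e e0; near=> y; apply: mx_norm_le; first exact: ltW.
move=> i j; rewrite !mxE; move: i j; near: y.
apply: filter_forall => i; apply: filter_forall => j.
exact: ((cvgrPdist_le _ _).1 (cF i j) _ e0).
Unshelve. all: by end_near. Qed.

Lemma norm_row_mxl n (t : R) (x : 'rV[R]_n) : `|t| <= `|row_mx (t%:M : 'rV_1) x|.
Proof.
by have := mx_norm_entry (row_mx (t%:M : 'rV_1) x) 0 (lshift n 0); rewrite row_mxEl mxE eqxx mulr1n.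
Qed.

Lemma norm_row_mxr n (t : R) (x : 'rV[R]_n) : `|x| <= `|row_mx (t%:M : 'rV_1) x|.
Proof.
apply: mx_norm_le => // i j; rewrite -(row_mxEr (t%:M : 'rV_1) x).
by rewrite [i]ord1; exact: mx_norm_entry.
Qed.

Lemma continuous_row_mx (T : topologicalType) n (a : T -> R) (b : T -> 'rV[R]_n) x :
  cts_at a x -> cts_at b x ->
  cts_at (fun y => row_mx ((a y)%:M : 'rV_1) (b y)) x.
Proof.
move=> ca /continuous_mxP cb; apply/continuous_mxP => i j.
case: (split_ordP j) => k ->.
  rewrite (_ : (fun y => _) = a)//; apply/funext => y.
  by rewrite row_mxEl !ord1 mxE eqxx mulr1n.
rewrite (_ : (fun y => _) = fun y => b y i k); first exact: cb.
by apply/funext => y; rewrite row_mxEr.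
Qed.

End MatrixNorm.

Section LineIntegral.
Context {R : realType}.
Local Notation mu := (@lebesgue_measure R).
Implicit Types (g G : R -> R) (B : R).

Definition line_integral g : R := \int[mu]_(t in [set: R]) g t.

Lemma line_integral_restrict g B : (forall t, B < `|t| -> g t = 0) ->
  forall a b, a <= - B -> B <= b -> line_integral g = \int[mu]_(t in `[a, b]) g t.
Proof.
move=> g0 a b aB Bb; rewrite [RHS]Rintegral_mkcond; congr (fine (integral _ _ _)).
apply/funext => t /=; congr EFin; rewrite patchE; case: ifPn => // /negP tab.
rewrite g0// ltNge; apply/negP; rewrite ler_norml => /andP[t1 t2]; apply: tab.
by rewrite inE /= in_itv /= (le_trans aB t1) (le_trans t2 Bb).
Qed.

Lemma compact_support_integrable g B : cts g ->
  (forall t, B < `|t| -> g t = 0) -> mu.-integrable [set: R] (EFin \o g).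
Proof.
move=> cg g0.
have -> : EFin \o g = (EFin \o g) \_ `[- B, B].
  apply/funext => t /=; rewrite patchE; case: ifPn => // /negP tab.
  rewrite g0// ltNge; apply/negP; rewrite ler_norml => ?; apply: tab.
  by rewrite inE /= in_itv.
apply: (integrable_mkcond _ _).1; first exact: measurable_itv.
by apply: continuous_compact_integrable; [exact: segment_compact|exact: continuous_subspaceT].
Qed.

(** The integral from minus infinity is an antiderivative at every point, [g] being integrable and
    continuous. It reduces estimates and substitutions for line integrals to the mean value theorem
    and the chain rule. *)
Lemma antiderivative g B : cts g -> (forall t, B < `|t| -> g t = 0) ->
  exists G, forall t, is_derive t (1 : R) G (g t).
Proof.
move=> cg g0; exists (fun x => \int[mu]_(t in `]-oo, x]) g t) => t.
have [] := @continuous_FTC1 R g (BInfty _ true) t (t + 1).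
- by rewrite ltrDl.
- by apply: integrableS (compact_support_integrable cg g0).
- by rewrite ltNyr.
- exact: cg.
move=> dG GE; apply: (DeriveDef dG); rewrite -derive1E; exact: GE.
Qed.

Lemma is_derive_continuous G g t : is_derive t (1 : R) G (g t) -> cts_at G t.
Proof. by move=> [dG _]; apply: differentiable_continuous; exact/derivable1_diffP. Qed.

Lemma line_integral_antiderivative g G B : cts g ->
  (forall t, B < `|t| -> g t = 0) -> (forall t, is_derive t (1 : R) G (g t)) ->
  forall a b, a < b -> a <= - B -> B <= b -> line_integral g = G b - G a.
Proof.
move=> cg g0 dG a b ab aB Bb; rewrite (line_integral_restrict g0 aB Bb).
have cG : cts G by move=> t; exact: is_derive_continuous (dG t).
rewrite /Rintegral (@continuous_FTC2 R g G)//.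
- exact: (continuous_subspaceT (cts_continuous cg)).
- split=> [t _| |]; [by have [] := dG t|apply: cvg_at_right_filter; exact: cG|apply: cvg_at_left_filter; exact: cG].
- by move=> t _; rewrite derive1E; have [_] := dG t.
Qed.

Lemma line_integralD g h B : cts g -> cts h ->
  (forall t, B < `|t| -> g t = 0) -> (forall t, B < `|t| -> h t = 0) ->
  line_integral (fun t => g t + h t) = line_integral g + line_integral h.
Proof.
move=> cg ch g0 h0; apply: RintegralD; first exact: measurableT.
  exact: compact_support_integrable cg g0.
exact: compact_support_integrable ch h0.
Qed.

Lemma line_integralZ g k B : cts g -> (forall t, B < `|t| -> g t = 0) ->
  line_integral (fun t => k * g t) = k * line_integral g.
Proof.
move=> cg g0; apply: RintegralZl; first exact: measurableT.
exact: compact_support_integrable cg g0.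
Qed.

Lemma line_integral_le g B (M : R) : cts g -> (forall t, B < `|t| -> g t = 0) ->
  0 <= B -> (forall t, `|g t| <= M) -> `|line_integral g| <= M * (2 * B + 2).
Proof.
move=> cg g0 B0 gM; have [G dG] := antiderivative cg g0.
(* The margin 1 keeps the interval nondegenerate when [B] is 0. Its length is the constant
   [2 * B + 2] of the statement. *)
have ab : - (B + 1) < B + 1 by rewrite gtrN// ltr_wpDl.
rewrite (line_integral_antiderivative cg g0 dG ab) ?lerN2 ?lerDl//.
have cG : cts G by move=> t; exact: is_derive_continuous (dG t).
have [|c _ ->] := MVT ab (fun x _ => dG x); first exact: (continuous_subspaceT (cts_continuous cG)).
rewrite normrM (_ : B + 1 - - (B + 1) = 2 * B + 2); last by ring.
by rewrite (ger0_norm (_ : 0 <= 2 * B + 2)) ?ler_wpM2r// addr_ge0// mulr_ge0.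
Qed.

Lemma line_integral_derive g G B : cts g ->
  (forall t, is_derive t (1 : R) G (g t)) ->
  (forall t, B < `|t| -> G t = 0) -> (forall t, B < `|t| -> g t = 0) ->
  line_integral g = 0.
Proof.
move=> cg dG G0 g0.
have [b Bb b0] : exists2 b, B < b & 0 < b by exists (`|B| + 1); [rewrite (le_lt_trans (ler_norm _))// ltrDl|rewrite ltr_wpDl].
have Bb' : B < `|b| by rewrite ger0_norm// ltW.
rewrite (line_integral_antiderivative cg g0 dG (_ : - b < b)) ?gtrN ?lerN2//; [|exact: ltW..].
by rewrite !G0 ?subrr// normrN.
Qed.

Lemma line_integral_affine g B a l : cts g -> (forall t, B < `|t| -> g t = 0) ->
  0 < l -> line_integral (fun t => g (a + l * t)) = l^-1 * line_integral g.
Proof.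
move=> cg g0 l0; have [G dG] := antiderivative cg g0.
(* Beyond [C] one has [|l * t| > |B| + |a|], hence [|a + l * t| > |B|], and the substituted function
   vanishes. *)
pose C := (`|B| + `|a|) / l.
have C0 : 0 <= C by rewrite divr_ge0 ?addr_ge0// ltW.
have cga : cts (fun t => g (a + l * t)).
  move=> t; apply: (@cts_at_comp _ _ _ _ (fun t => a + l * t) g); last exact: cg.
  by apply: continuous_add; [exact: cts_at_cst|apply: continuous_cmul; exact: cts_at_id].
have dGa t : is_derive t (1 : R) (fun t => l^-1 * G (a + l * t)) (g (a + l * t)).
  have da : is_derive t (1 : R) (fun t : R => a + l * t) l.
    have d1 : is_derive t (1 : R) (fun t : R => l * t) (l * 1).
      by have := is_deriveZ l (is_derive_id t (1 : R)).
    have d2 := is_deriveD (is_derive_cst a t (1 : R)) d1.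
    by apply: (is_derive_eq d2); rewrite add0r mulr1.
  have := @is_derive1_comp R G (fun t => a + l * t) t _ _ (dG (a + l * t)) da.
  move=> /(is_deriveZ l^-1) H; apply: (is_derive_eq H).
  transitivity (l^-1 * (g (a + l * t) * l)) => //.
  by rewrite mulrCA mulVf ?mulr1// gt_eqF.
have bnd t : C < `|t| -> `|B| < `|a + l * t|.
  rewrite /C ltr_pdivrMr// => Ct.
  rewrite -(ltrD2r `|a|) (lt_le_trans Ct)//.
  rewrite -[in leLHS](gtr0_norm l0) -normrM mulrC.
  by rewrite -{1}(addrK a (l * t)) (addrC _ a) (le_trans (ler_normD _ _))// normrN.
have ga0 t : C < `|t| -> g (a + l * t) = 0.
  by move=> /bnd Bt; rewrite g0// (le_lt_trans (ler_norm B)).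
have C10 : 0 < C + 1 by rewrite ltr_wpDl.
have CC : - (C + 1) < C + 1 by rewrite gtrN.
have lC : l * (C + 1) = `|B| + `|a| + l by rewrite mulrDr mulr1 /C mulrC divfK ?gt_eqF.
rewrite (line_integral_antiderivative cga ga0 dGa CC) ?lerN2 ?lerDl//.
rewrite (@line_integral_antiderivative g G B cg g0 dG (a + l * (- (C + 1))) (a + l * (C + 1))).
- by rewrite mulrBr.
- by rewrite ltrD2l ltr_pM2l.
- have := bnd (- (C + 1)); rewrite normrN (gtr0_norm C10) ltrDl => /(_ ltr01).
  rewrite ltr_normr mulrN lC => /orP[|]; have := normr_ge0 B; have := ler_norm a;
    have := ler_norm B; lra.
- have := bnd (C + 1); rewrite (gtr0_norm C10) ltrDl => /(_ ltr01).
  rewrite ltr_normr lC => /orP[|]; have := normr_ge0 B; have := ler_norm (- a);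
    have := ler_norm B; rewrite normrN; lra.
Qed.

End LineIntegral.

(** * Line integrals depending on a parameter *)

Section ParametricLineIntegral.
Context {R : realType}.

Lemma is_derive_cvg (V : normedModType R) (f : R -> V) x l :
  (h^-1 *: (f (h + x) - f x) @[h --> 0^'] --> l) -> is_derive x (1 : R) f l.
Proof.
move=> fl.
have fl' : h^-1 *: (f (h *: (1 : R) + x) - f x) @[h --> (0 : R)^'] --> l.
  rewrite (_ : (fun h => _) = fun h => h^-1 *: (f (h + x) - f x))//.
  by apply/funext => h; congr (_ *: (f (_ + _) - _)); exact: mulr1.
by apply: DeriveDef; [apply/cvg_ex; exists l|exact: cvg_lim fl'].
Qed.

Lemma cvg_param_slice (T U : topologicalType) (f : T -> U -> R) z x :
  cts_at (fun p : T * U => f p.1 p.2) (z, x) -> cts_at (f z) x.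
Proof.
move=> cf; apply: (@cts_at_comp _ _ _ _ (fun y => (z, y)) (fun p : T * U => f p.1 p.2)) => //.
by apply: cvg_pair; [exact: cvg_cst|exact: cvg_id].
Qed.

(* A form of the tube lemma. *)
Lemma uniform_near (T : topologicalType) (O : set T) (g : T -> R -> R) (B : R) z0 (e : R) :
  open O -> O z0 -> 0 <= B ->
  (forall z t, O z -> cts_at (fun p : T * R => g p.1 p.2) (z, t)) ->
  (forall z t, O z -> B < `|t| -> g z t = 0) -> 0 < e ->
  \forall z \near z0, forall t, `|g z t - g z0 t| < e.
Proof.
move=> oO Oz0 B0 cg g0 e0.
have cB : compact (`[- B, B]%classic : set R) by exact: segment_compact.
move/compact_near_coveringP : cB => /(_ T (nbhs z0) (fun z t => `|g z t - g z0 t| < e) _).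
have NO : \forall z \near z0, O z by exact: open_nbhs_nbhs.
move=> H; have {H} : \forall z \near z0, `[- B, B] `<=` (fun t => `|g z t - g z0 t| < e).
  apply: H => t _.
  have e20 : 0 < e / 2 by rewrite divr_gt0.
  have H1 : \forall p \near (t, z0), `|g z0 t - g p.2 p.1| < e / 2.
    have cgs : cts_at (fun p : R * T => g p.2 p.1) (t, z0).
      apply: (@cts_at_comp _ _ _ _ (@unstable.swap R T) (fun p : T * R => g p.1 p.2)).
        exact: swap_continuous.
      exact: cg.
    exact: (cts_atP _ _).1 cgs _ e20.
  have H2 : \forall p \near (t, z0), `|g z0 t - g z0 p.1| < e / 2.
    have cgs : cts_at (fun p : R * T => g z0 p.1) (t, z0).
      apply: (@cts_at_comp _ _ _ _ (fun p : R * T => p.1) (g z0)); first exact: cvg_fst.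
      exact: cvg_param_slice (cg _ _ Oz0).
    exact: (cts_atP _ _).1 cgs _ e20.
  near=> p; rewrite (splitr e) -(subrKA (g z0 t)) (le_lt_trans (ler_normD _ _))//.
  by rewrite ltrD//; [rewrite distrC|]; near: p.
move=> H; near=> z => t.
have [tB|tB] := leP `|t| B; last by rewrite !g0 ?subrr ?normr0//; near: z.
apply: (near H z) => //.
by rewrite /= in_itv /= -ler_norml.
Unshelve. all: by end_near. Qed.

Lemma continuous_line_integral (T : topologicalType) (O : set T) (g : T -> R -> R) (B : R) :
  open O -> 0 <= B ->
  (forall z t, O z -> cts_at (fun p : T * R => g p.1 p.2) (z, t)) ->
  (forall z t, O z -> B < `|t| -> g z t = 0) ->
  forall z, O z -> cts_at (fun z => line_integral (g z)) z.
Proof.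
move=> oO B0 cg g0 z0 Oz0; apply/cvgrPdist_lt => e e0.
have cgz z : O z -> continuous (g z) by move=> Oz t; exact: cvg_param_slice (cg _ _ Oz).
(* [line_integral_le] multiplies a uniform bound by [2 * B + 2]. Dividing [e] by the larger
   [2 * B + 3] leaves a result strictly below [e]. *)
have D0 : 0 < 2 * B + 3 by rewrite ltr_wpDl// mulr_ge0.
have := uniform_near oO Oz0 B0 cg g0 (divr_gt0 e0 D0).
apply: filterS2 (open_nbhs_nbhs (conj oO Oz0)) => z Oz Hz.
have E : line_integral (g z0) - line_integral (g z) = line_integral (fun t => g z0 t + -1 * g z t).
  rewrite (@line_integralD R _ _ B) ?(@line_integralZ R _ _ B) ?mulN1r//; try exact: cgz.
  - by move=> t; exact: g0.
  - by move=> t; apply: continuous_cmul; exact: cgz.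
  - by move=> t; exact: g0.
  - by move=> t ?; rewrite g0// mulr0.
rewrite E (le_lt_trans (@line_integral_le R _ B (e / (2 * B + 3)) _ _ _ _))//.
- by move=> t; apply: continuous_add; [exact: cgz|by apply: continuous_cmul; exact: cgz].
- by move=> t Bt; rewrite !g0// mulr0 addr0.
- by move=> t; rewrite mulN1r distrC ltW.
- by rewrite -mulrA gtr_pMr// mulrC ltr_pdivrMr// mul1r ltrD2l; lra.
Qed.

(** The error of the difference quotient is the integral of [q]. By the mean value theorem in the
    parameter, [q t] is a difference of two values of [g'] at [t], at parameters at most [|h|]
    apart, and [uniform_near] makes it small for all [t] at once. *)
Lemma is_derive_line_integral (O : set R) (g g' : R -> R -> R) (B : R) :
  open O -> 0 <= B ->
  (forall z t, O z -> cts_at (fun p : R * R => g p.1 p.2) (z, t)) ->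
  (forall z t, O z -> cts_at (fun p : R * R => g' p.1 p.2) (z, t)) ->
  (forall z t, O z -> is_derive z (1 : R) (g ^~ t) (g' z t)) ->
  (forall z t, O z -> B < `|t| -> g z t = 0) ->
  (forall z t, O z -> B < `|t| -> g' z t = 0) ->
  forall z, O z -> is_derive z (1 : R) (fun z => line_integral (g z)) (line_integral (g' z)).
Proof.
move=> oO B0 cg cg' dg g0 g'0 z0 Oz0; apply: is_derive_cvg; apply/cvgrPdist_lt => e e0.
have cgz z : O z -> continuous (g z) by move=> Oz t; exact: cvg_param_slice (cg _ _ Oz).
have cgz' z : O z -> continuous (g' z) by move=> Oz t; exact: cvg_param_slice (cg' _ _ Oz).
have D0 : 0 < 2 * B + 3 by rewrite ltr_wpDl// mulr_ge0.
have NO : \forall z \near z0, O z by exact: open_nbhs_nbhs.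
have [r /= r0 Hr] := (nbhs_ballP z0 _).1 (filterI NO (uniform_near oO Oz0 B0 cg' g'0 (divr_gt0 e0 D0))).
have Hb (h s : R) : `|h| < r -> `|s| <= `|h| -> ball z0 r (s + z0).
  move=> hr sh; rewrite -ball_normE /ball_ /= opprD addrCA subrr addr0 normrN.
  exact: le_lt_trans hr.
near=> h.
have hr : `|h| < r by near: h; exact: dnbhs0_lt.
have h0 : h != 0 by near: h; exact: nbhs_dnbhs_neq.
have Ozh : O (h + z0) by have [] := Hr _ (Hb h h hr (lexx _)).
pose q t := g' z0 t + - h^-1 * (g (h + z0) t + -1 * g z0 t).
have cq1 : cts (fun t => g (h + z0) t + -1 * g z0 t).
  by move=> t; apply: continuous_add; [exact: cgz|by apply: continuous_cmul; exact: cgz].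
have q10 t : B < `|t| -> g (h + z0) t + -1 * g z0 t = 0.
  by move=> Bt; rewrite !g0// mulr0 addr0.
have E : line_integral (g' z0) - h^-1 *: (line_integral (g (h + z0)) - line_integral (g z0)) =
    line_integral q.
  rewrite /q (@line_integralD R _ _ B).
  - rewrite (@line_integralZ R _ _ B)// (@line_integralD R _ _ B).
    + rewrite (@line_integralZ R _ _ B) ?mulN1r ?mulNr//; first exact: cgz.
      by move=> t; exact: g0.
    + exact: cgz.
    + by move=> t; apply: continuous_cmul; exact: cgz.
    + by move=> t; exact: g0.
    + by move=> t Bt; rewrite g0// mulr0.
  - exact: cgz'.
  - by move=> t; apply: continuous_cmul; exact: cq1.
  - by move=> t; exact: g'0.
  - by move=> t Bt; rewrite q10// mulr0.
rewrite E (le_lt_trans (@line_integral_le R _ B (e / (2 * B + 3)) _ _ _ _))//.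
- by move=> t; apply: continuous_add; [exact: cgz'|by apply: continuous_cmul; exact: cq1].
- by move=> t Bt; rewrite /q q10// g'0// mulr0 addr0.
- move=> t; rewrite /q mulN1r.
  have [s sh Es] : exists2 s, `|s| <= `|h| & g (h + z0) t - g z0 t = g' (s + z0) t * h.
    have dgs s : `|s| <= `|h| -> is_derive s (1 : R) (fun s => g (s + z0) t) (g' (s + z0) t).
      move=> sh; have Os : O (s + z0) by have [] := Hr _ (Hb h s hr sh).
      have H := @is_derive1_comp R (g ^~ t) (fun s => s + z0) s _ _ (dg _ t Os) (is_derive_shift s 1 z0).
      by apply: (is_derive_eq H); rewrite mulr1.
    have cgs s : `|s| <= `|h| -> cts_at (fun s => g (s + z0) t) s.
      by move=> /dgs[dd _]; apply: differentiable_continuous; exact/derivable1_diffP.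
    have [hp|hn|h00] := ltgtP h 0; last by move: h0; rewrite h00 eqxx.
    + have [||s] := @MVT_segment R (fun s => g (s + z0) t) (fun s => g' (s + z0) t) h 0 (ltW hp).
      * move=> s; rewrite in_itv /= => /andP[s1 s2]; apply: dgs.
        by rewrite !ltr0_norm// lerN2 ltW.
      * apply: continuous_in_subspaceT => s; rewrite inE /= in_itv /= => /andP[s1 s2].
        by apply: cgs; rewrite !ler0_norm ?lerN2// ltW.
      rewrite in_itv /= => /andP[s1 s2]; rewrite !add0r => Es.
      exists s; first by rewrite !ler0_norm ?lerN2// ltW.
      by rewrite -opprB Es mulrN opprK.
    + have [||s] := @MVT_segment R (fun s => g (s + z0) t) (fun s => g' (s + z0) t) 0 h (ltW hn).
      * move=> s; rewrite in_itv /= => /andP[s1 s2]; apply: dgs.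
        by rewrite !gtr0_norm// ltW.
      * apply: continuous_in_subspaceT => s; rewrite inE /= in_itv /= => /andP[s1 s2].
        by apply: cgs; rewrite !ger0_norm// ltW.
      rewrite in_itv /= => /andP[s1 s2]; rewrite !add0r subr0 => Es.
      by exists s => //; rewrite !ger0_norm// ltW.
  rewrite Es mulNr mulrCA mulVf// mulr1 distrC ltW//.
  by have [_] := Hr _ (Hb h s hr sh); exact.
- by rewrite -mulrA gtr_pMr// mulrC ltr_pdivrMr// mul1r ltrD2l; lra.
Unshelve. all: by end_near. Qed.

End ParametricLineIntegral.

Section RowMx.
Context {R : realType}.

Lemma differentiable_row_mx (U : normedModType R) m n1 n2 (F : U -> 'M[R]_(m, n1))
    (G : U -> 'M[R]_(m, n2)) x : differentiable F x -> differentiable G x ->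
  differentiable (fun y => row_mx (F y) (G y)) x.
Proof.
move=> /differentiable_mxP dF /differentiable_mxP dG; apply/differentiable_mxP => i j.
case: (split_ordP j) => k ->.
  by under eq_fun do rewrite row_mxEl.
by under eq_fun do rewrite row_mxEr.
Qed.

Lemma derive_row_mx (U : normedModType R) m n1 n2 (F : U -> 'M[R]_(m, n1))
    (G : U -> 'M[R]_(m, n2)) x v : differentiable F x -> differentiable G x ->
  der v (fun y => row_mx (F y) (G y)) x = row_mx (der v F x) (der v G x).
Proof.
move=> dF dG; apply/matrixP => i j.
rewrite derive_entry; last exact: differentiable_row_mx.
case: (split_ordP j) => k ->.
  by under eq_fun do rewrite row_mxEl; rewrite row_mxEl derive_entry.
by under eq_fun do rewrite row_mxEr; rewrite row_mxEr derive_entry.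
Qed.

Lemma differentiable_id (U : normedModType R) (x : U) : differentiable (fun y => y) x.
Proof. by have [] := is_diff_id x. Qed.

Lemma derive_id_val (U : normedModType R) (x v : U) : der v (fun y => y) x = v.
Proof. exact: der_val (is_derive_id _ _). Qed.

Lemma row_mx_line n (t : R) (x : 'rV[R]_n) :
  row_mx t%:M x = row_mx 0%:M x + t *: (delta_mx 0 0 : 'rV_(1 + n)).
Proof.
apply/rowP => j; rewrite [RHS]mxE [X in _ + X]mxE.
case: (split_ordP j) => k ->.
  by rewrite !row_mxEl !ord1 !mxE eqxx mulr1n mul0rn add0r mulr1.
by rewrite !row_mxEr mxE mulr0 addr0.
Qed.

Lemma affine_row_mx n (a : 'rV[R]_(1 + n)) l t (x : 'rV[R]_n) :
  a + l *: row_mx t%:M x = row_mx (a 0 0 + l * t)%:M (rsubmx a + l *: x).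
Proof.
rewrite -[in LHS](hsubmxK a) scale_row_mx add_row_mx; congr row_mx.
apply/rowP => k; rewrite !ord1 !mxE eqxx !mulr1n; congr (a _ _ + _); exact: val_inj.
Qed.

Lemma delta_mx_rshift n (i : 'I_n) :
  (delta_mx 0 (rshift 1 i) : 'rV[R]_(1 + n)) = row_mx 0 (delta_mx 0 i).
Proof.
apply/rowP => j; case: (split_ordP j) => k ->.
  by rewrite row_mxEl !mxE eqxx eq_lrshift.
by rewrite row_mxEr !mxE eqxx (inj_eq (@rshift_inj _ _)).
Qed.

Lemma row_mx_line_rshift n (t s : R) (x : 'rV[R]_n) j :
  row_mx (t%:M : 'rV_1) x + s *: delta_mx 0 (rshift 1 j) =
  row_mx (t%:M : 'rV_1) (x + s *: delta_mx 0 j).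
Proof. by rewrite delta_mx_rshift scale_row_mx scaler0 add_row_mx addr0. Qed.

End RowMx.

Section IntegralRn.
Context {R : realType}.

Lemma is_derive_eq_fun (V : normedModType R) (f g : R -> V) (x : R) df :
  is_derive x (1 : R) f df -> (forall s, f s = g s) -> is_derive x (1 : R) g df.
Proof. by move=> H fg; rewrite (_ : g = f)//; apply/funext. Qed.

Lemma integral_RnS n (f : 'rV[R]_n.+1 -> R) :
  integral_Rn f = line_integral (fun t => integral_Rn (fun x : 'rV[R]_n =>
    f (row_mx (t%:M : 'rV_1) x))).
Proof. by []. Qed.

Lemma integral_Rn0 n : integral_Rn (fun _ : 'rV[R]_n => 0) = 0 :> R.
Proof.
elim: n => [//|n IH]; rewrite integral_RnS.
rewrite (_ : (fun t => _) = fun=> 0); last by apply/funext.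
by rewrite /line_integral /Rintegral integral0.
Qed.

Lemma cts_row_mx (T : topologicalType) n (a : T -> R) (b : T -> 'rV[R]_n) x :
  cts_at a x -> cts_at b x -> cts_at (fun y => row_mx ((a y)%:M : 'rV_1) (b y)) x.
Proof. exact: continuous_row_mx. Qed.

Lemma cts_at_fst (T U : topologicalType) (V : normedModType R) (f : T -> V) (p : T * U) :
  cts_at f p.1 -> cts_at (fun q : T * U => f q.1) p.
Proof. by apply: cts_at_comp; exact: cvg_fst. Qed.

Lemma cts_at_snd (T U : topologicalType) (V : normedModType R) (f : U -> V) (p : T * U) :
  cts_at f p.2 -> cts_at (fun q : T * U => f q.2) p.
Proof. by apply: cts_at_comp; exact: cvg_snd. Qed.

Lemma cts_at_pair_comp (S T U : topologicalType) (V : normedModType R) (a : S -> T)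
    (b : S -> U) (f : T * U -> V) s :
  a @ s --> a s -> b @ s --> b s -> cts_at f (a s, b s) -> cts_at (fun r => f (a r, b r)) s.
Proof. by move=> ca cb; apply: (@cts_at_comp _ _ _ _ (fun r => (a r, b r))); exact: cvg_pair. Qed.

Lemma open_fst (T U : topologicalType) (O : set T) : open O -> open (O `*` [set: U]).
Proof.
move=> oO; rewrite (_ : _ `*` _ = fst @^-1` O).
  by apply: open_comp => // p _; exact: cvg_fst.
by apply/seteqP; split=> -[z u] //= [].
Qed.

Lemma uncons_cts (T : topologicalType) n (f : T -> 'rV[R]_n.+1 -> R) z t x :
  cts_at (fun p : T * 'rV[R]_n.+1 => f p.1 p.2) (z, row_mx (t%:M : 'rV_1) x) ->
  cts_at (fun p : (T * R) * 'rV[R]_n => f p.1.1 (row_mx (p.1.2%:M : 'rV_1) p.2)) ((z, t), x).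
Proof.
move=> cf.
apply: (@cts_at_pair_comp _ T 'rV[R]_n.+1 _ (fun p => p.1.1)
  (fun p : (T * R) * 'rV[R]_n => row_mx (p.1.2%:M : 'rV_1) p.2)
  (fun p : T * 'rV[R]_n.+1 => f p.1 p.2) ((z, t), x)) => //.
  by apply: (cvg_comp _ _ cvg_fst); exact: cvg_fst.
apply: (@cts_row_mx _ n (fun p : (T * R) * 'rV[R]_n => p.1.2) (fun p => p.2)).
  by apply: (cvg_comp _ _ cvg_fst); exact: cvg_snd.
exact: cvg_snd.
Qed.

(** The induction on the dimension generalises the parameter space: the inner integral depends on
    [z] and on the first coordinate, so the induction hypothesis is used for [T * R]. *)
Lemma cts_integral_Rn n (T : topologicalType) (O : set T) (f : T -> 'rV[R]_n -> R) (B : R) :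
  open O -> 0 <= B ->
  (forall z x, O z -> cts_at (fun p : T * 'rV[R]_n => f p.1 p.2) (z, x)) ->
  (forall z x, O z -> B < `|x| -> f z x = 0) ->
  forall z, O z -> cts_at (fun z => integral_Rn (f z)) z.
Proof.
elim: n T O f => [|n IH] T O f oO B0 cf f0 z Oz.
  apply: (@cts_at_pair_comp _ T 'rV[R]_0 _ (fun z => z) (fun=> 0)
    (fun p : T * 'rV[R]_0 => f p.1 p.2) z); [exact: cvg_id|exact: cvg_cst|exact: cf].
apply: (@continuous_line_integral R T O (fun z t => integral_Rn (fun x : 'rV[R]_n =>
   f z (row_mx (t%:M : 'rV_1) x))) B) => //.
  move=> z1 t Oz1.
  apply: (IH (T * R)%type (O `*` setT) (fun q x => f q.1 (row_mx (q.2%:M : 'rV_1) x))) => //.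
  - exact: open_fst.
  - by move=> [z2 t2] x [/= Oz2 _]; apply: uncons_cts; exact: cf.
  - by move=> [z2 t2] x [/= Oz2 _] Bx; apply: f0 => //; exact: lt_le_trans (norm_row_mxr _ _).
move=> z1 t Oz1 Bt; rewrite -[RHS](integral_Rn0 n); congr integral_Rn; apply/funext => x.
by apply: f0 => //; exact: lt_le_trans (norm_row_mxl _ _).
Qed.

Lemma cts_inner_integral n (f : 'rV[R]_n.+1 -> R) (B : R) : 0 <= B -> cts f ->
  (forall x, B < `|x| -> f x = 0) ->
  cts (fun t => integral_Rn (fun x : 'rV[R]_n => f (row_mx (t%:M : 'rV_1) x))).
Proof.
move=> B0 cf f0 t.
apply: (@cts_integral_Rn n R setT (fun t x => f (row_mx (t%:M : 'rV_1) x)) B) => //; first exact: openT.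
- move=> s x _.
  apply: (@cts_at_comp _ _ _ _ (fun p : R * 'rV[R]_n => row_mx (p.1%:M : 'rV_1) p.2) f); last exact: cf.
  by apply: cts_row_mx; [exact: cvg_fst|exact: cvg_snd].
- by move=> s x _ Bx; apply: f0 => //; exact: lt_le_trans (norm_row_mxr _ _).
Qed.

Lemma cts_slice n (f : 'rV[R]_n.+1 -> R) t : cts f ->
  cts (fun x : 'rV[R]_n => f (row_mx (t%:M : 'rV_1) x)).
Proof.
move=> cf x; apply: (@cts_at_comp _ _ _ _ (fun x : 'rV[R]_n => row_mx (t%:M : 'rV_1) x) f) => //.
by apply: cts_row_mx; [exact: cts_at_cst|exact: cts_at_id].
Qed.

Lemma inner_integral_out n (f : 'rV[R]_n.+1 -> R) (B : R) : (forall x, B < `|x| -> f x = 0) ->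
  forall t, B < `|t| -> integral_Rn (fun x : 'rV[R]_n => f (row_mx (t%:M : 'rV_1) x)) = 0.
Proof.
move=> f0 t Bt; rewrite -[RHS](integral_Rn0 n); congr integral_Rn; apply/funext => x.
by apply: f0 => //; exact: lt_le_trans (norm_row_mxl _ _).
Qed.

Lemma slice_out n (f : 'rV[R]_n.+1 -> R) (B : R) t : (forall x, B < `|x| -> f x = 0) ->
  forall x : 'rV[R]_n, B < `|x| -> f (row_mx (t%:M : 'rV_1) x) = 0.
Proof. by move=> f0 x Bx; apply: f0 => //; exact: lt_le_trans (norm_row_mxr _ _). Qed.

Lemma integral_RnD n (f g : 'rV[R]_n -> R) (B : R) : 0 <= B -> cts f -> cts g ->
  (forall x, B < `|x| -> f x = 0) -> (forall x, B < `|x| -> g x = 0) ->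
  integral_Rn (fun x => f x + g x) = integral_Rn f + integral_Rn g.
Proof.
elim: n f g => [//|n IH] f g B0 cf cg f0 g0; rewrite !integral_RnS.
rewrite -(@line_integralD R _ _ B).
- congr line_integral; apply/funext => t; apply: IH => //; try exact: cts_slice.
    exact: slice_out f0.
  exact: slice_out g0.
- exact: cts_inner_integral cf f0.
- exact: cts_inner_integral cg g0.
- exact: inner_integral_out f0.
- exact: inner_integral_out g0.
Qed.

Lemma integral_RnZ n (f : 'rV[R]_n -> R) (k B : R) : 0 <= B -> cts f ->
  (forall x, B < `|x| -> f x = 0) ->
  integral_Rn (fun x => k * f x) = k * integral_Rn f.
Proof.
elim: n f => [//|n IH] f B0 cf f0; rewrite !integral_RnS.
rewrite -(@line_integralZ R _ _ B).
- congr line_integral; apply/funext => t; apply: IH => //; first exact: cts_slice.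
  exact: slice_out f0.
- exact: cts_inner_integral cf f0.
- exact: inner_integral_out f0.
Qed.

Lemma integral_Rn_sum n (J : Type) (r : seq J) (f : J -> 'rV[R]_n -> R) (B : R) : 0 <= B ->
  (forall j, cts (f j)) -> (forall j x, B < `|x| -> f j x = 0) ->
  integral_Rn (fun x => \sum_(j <- r) f j x) = \sum_(j <- r) integral_Rn (f j).
Proof.
move=> B0 cf f0; elim: r => [|j r IH].
  rewrite big_nil -[RHS](integral_Rn0 n); congr integral_Rn; apply/funext => x.
  by rewrite big_nil.
rewrite big_cons -IH -(@integral_RnD n _ _ B)//.
- by congr integral_Rn; apply/funext => x; rewrite big_cons.
- by move=> x; apply: (@continuous_bigsum R _ J r f) => k; exact: cf.
- exact: f0.
- by move=> x Bx; rewrite big1// => k _; exact: f0.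
Qed.

Lemma is_derive_integral_Rn n (O : set R) (f f' : R -> 'rV[R]_n -> R) (B : R) :
  open O -> 0 <= B ->
  (forall z x, O z -> cts_at (fun p : R * 'rV[R]_n => f p.1 p.2) (z, x)) ->
  (forall z x, O z -> cts_at (fun p : R * 'rV[R]_n => f' p.1 p.2) (z, x)) ->
  (forall z x, O z -> is_derive z (1 : R) (f ^~ x) (f' z x)) ->
  (forall z x, O z -> B < `|x| -> f z x = 0) ->
  (forall z x, O z -> B < `|x| -> f' z x = 0) ->
  forall z, O z -> is_derive z (1 : R) (fun z => integral_Rn (f z)) (integral_Rn (f' z)).
Proof.
elim: n f f' => [|n IH] f f' oO B0 cf cf' df f0 f'0 z Oz; first exact: df.
have cin (h : R -> 'rV[R]_n.+1 -> R) :
    (forall z x, O z -> cts_at (fun p : R * 'rV[R]_n.+1 => h p.1 p.2) (z, x)) ->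
    (forall z x, O z -> B < `|x| -> h z x = 0) ->
    forall z t, O z -> cts_at (fun p : R * R => integral_Rn (fun x : 'rV[R]_n =>
      h p.1 (row_mx (p.2%:M : 'rV_1) x))) (z, t).
  move=> ch h0 z1 t Oz1.
  apply: (@cts_integral_Rn n (R * R)%type (O `*` setT)
    (fun q x => h q.1 (row_mx (q.2%:M : 'rV_1) x)) B) => //.
  - exact: open_fst.
  - by move=> [z2 t2] x [/= Oz2 _]; apply: uncons_cts; exact: ch.
  - by move=> [z2 t2] x [/= Oz2 _] Bx; apply: h0 => //; exact: lt_le_trans (norm_row_mxr _ _).
apply: (@is_derive_line_integral R O
  (fun z t => integral_Rn (fun x : 'rV[R]_n => f z (row_mx (t%:M : 'rV_1) x)))
  (fun z t => integral_Rn (fun x : 'rV[R]_n => f' z (row_mx (t%:M : 'rV_1) x))) B) => //.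
- exact: cin.
- exact: cin.
- move=> z1 t Oz1.
  have sl (h : R -> 'rV[R]_n.+1 -> R) z2 x :
      cts_at (fun p : R * 'rV[R]_n.+1 => h p.1 p.2) (z2, row_mx (t%:M : 'rV_1) x) ->
      cts_at (fun p : R * 'rV[R]_n => h p.1 (row_mx (t%:M : 'rV_1) p.2)) (z2, x).
    move=> ch; apply: (@cts_at_pair_comp _ R 'rV[R]_n.+1 _ (fun p => p.1)
      (fun p : R * 'rV[R]_n => row_mx (t%:M : 'rV_1) p.2)
      (fun p : R * 'rV[R]_n.+1 => h p.1 p.2) (z2, x)) => //; first exact: cvg_fst.
    by apply: cts_row_mx; [exact: cts_at_cst|exact: cvg_snd].
  apply: (IH (fun z x => f z (row_mx (t%:M : 'rV_1) x)) (fun z x => f' z (row_mx (t%:M : 'rV_1) x))) => //.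
  + by move=> z2 x Oz2; apply: sl; exact: cf.
  + by move=> z2 x Oz2; apply: sl; exact: cf'.
  + by move=> z2 x Oz2; apply: slice_out => y; exact: f0.
  + by move=> z2 x Oz2; apply: slice_out => y; exact: f'0.
- by move=> z1 t Oz1; apply: inner_integral_out => y; exact: f0.
- by move=> z1 t Oz1; apply: inner_integral_out => y; exact: f'0.
Qed.

Lemma der_out n (F : 'rV[R]_n -> R) (B : R) v : (forall x, B < `|x| -> F x = 0) ->
  forall x, B < `|x| -> der v F x = 0.
Proof.
move=> F0 x Bx.
have oB : open [set y : 'rV[R]_n | B < `|y|].
  apply: (@open_comp _ _ (fun y : 'rV[R]_n => `|y|) [set r | B < r]); last exact: open_gt.
  by move=> y _; exact: norm_continuous.
by rewrite (derive_eq_in v oB Bx F0) derive_const.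
Qed.

(** If the direction is a later coordinate, each inner integral vanishes by induction. The
    hypothesis is a derivative along a line, the form in which [integral_push] supplies it. *)
Lemma integral_Rn_derive_line n (F G : 'rV[R]_n -> R) i (B : R) : 0 <= B ->
  cts F -> cts G ->
  (forall x, is_derive (0 : R) (1 : R) (fun s : R => F (x + s *: delta_mx 0 i)) (G x)) ->
  (forall x, B < `|x| -> F x = 0) -> (forall x, B < `|x| -> G x = 0) -> integral_Rn G = 0.
Proof.
elim: n F G i => [F G []//|n IH] F G i B0 cF cG dF F0 G0; rewrite integral_RnS.
case: (@split_ordP 1 n i) => j ij; last first.
  rewrite (_ : (fun t => _) = fun=> 0); first by rewrite /line_integral /Rintegral integral0.
  apply/funext => t.
  apply: (IH (fun x => F (row_mx (t%:M : 'rV_1) x)) (fun x => G (row_mx (t%:M : 'rV_1) x)) j) => //.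
  - exact: cts_slice.
  - exact: cts_slice.
  - move=> x; apply: (is_derive_eq_fun (dF (row_mx (t%:M : 'rV_1) x))) => s.
    by rewrite ij; congr F; exact: row_mx_line_rshift.
  - exact: slice_out F0.
  - exact: slice_out G0.
(* The direction is the first coordinate: differentiation under the integral makes the inner
   integral of [G] the derivative of that of [F], which has bounded support. *)
apply: (@line_integral_derive R _ (fun t => integral_Rn (fun x : 'rV[R]_n =>
  F (row_mx (t%:M : 'rV_1) x))) B).
- exact: cts_inner_integral cG G0.
- move=> t.
  have sl (h : 'rV[R]_n.+1 -> R) z x : cts h ->
      cts_at (fun p : R * 'rV[R]_n => h (row_mx (p.1%:M : 'rV_1) p.2)) (z, x).
    move=> ch; apply: (@cts_at_comp _ _ _ _
      (fun p : R * 'rV[R]_n => row_mx (p.1%:M : 'rV_1) p.2) h); last exact: ch.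
    by apply: cts_row_mx; [exact: cvg_fst|exact: cvg_snd].
  apply: (@is_derive_integral_Rn n setT (fun t x => F (row_mx (t%:M : 'rV_1) x))
    (fun t x => G (row_mx (t%:M : 'rV_1) x)) B) => //; first exact: openT.
  + by move=> z x _; exact: sl.
  + by move=> z x _; exact: sl.
  + move=> z x _.
    have E s : row_mx (s%:M : 'rV_1) x = row_mx (0%:M : 'rV_1) x + s *: delta_mx 0 i.
      by rewrite ij ord1 row_mx_line (_ : lshift n 0 = 0)//; exact: val_inj.
    have dz := dF (row_mx (z%:M : 'rV_1) x).
    have ds : is_derive z (1 : R) (fun s : R => s - z) 1 by exact: is_derive_shift.
    rewrite -(subrr z) in dz.
    have H := @is_derive1_comp R _ (fun s => s - z) z _ _ dz ds.
    have {}H := is_derive_eq H (mulr1 _).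
    apply: (is_derive_eq_fun H) => s /=.
    by rewrite (E z) (E s) -addrA -scalerDl subrKC.
  + by move=> z x _; exact: slice_out F0 x.
  + by move=> z x _; exact: slice_out G0 x.
- exact: inner_integral_out F0.
- exact: inner_integral_out G0.
Qed.

Lemma integral_Rn_derive n (F : 'rV[R]_n -> R) i (B : R) : 0 <= B ->
  (forall x, differentiable F x) -> cts (der (delta_mx 0 i) F) ->
  (forall x, B < `|x| -> F x = 0) -> integral_Rn (der (delta_mx 0 i) F) = 0.
Proof.
move=> B0 dF cF F0; apply: (@integral_Rn_derive_line n F _ i B) => //.
- by move=> x; exact: differentiable_cts_at.
- move=> x; have dx : differentiable F (x + (0 : R) *: delta_mx 0 i) by exact: dF.
  by have := is_derive_line dx; rewrite scale0r addr0.
- exact: der_out.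
Qed.

Lemma integral_Rn_affine n (f : 'rV[R]_n -> R) (B : R) a l : 0 <= B -> cts f ->
  (forall x, B < `|x| -> f x = 0) -> 0 < l ->
  integral_Rn (fun x => f (a + l *: x)) = l^-1 ^+ n * integral_Rn f.
Proof.
elim: n f a => [|n IH] f a B0 cf f0 l0.
  by rewrite expr0 mul1r /=; congr f; apply/rowP => -[].
rewrite !integral_RnS.
pose q t := integral_Rn (fun x : 'rV[R]_n => f (row_mx (t%:M : 'rV_1) x)).
transitivity (line_integral (fun t => l^-1 ^+ n * q (a 0 0 + l * t))).
  congr line_integral; apply/funext => t.
  rewrite /q -(IH _ (rsubmx (a : 'rV_(1 + n))))//; [|exact: cts_slice|exact: slice_out f0].
  congr integral_Rn; apply/funext => x; congr f.
  refine (@affine_row_mx _ n a l t x).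
have cq : cts q by exact: cts_inner_integral cf f0.
have q0 : forall t, B < `|t| -> q t = 0 by exact: inner_integral_out f0.
have dl t : is_derive t (1 : R) (fun t => a 0 0 + l * t) l.
  have d1 : is_derive t (1 : R) (fun t : R => l * t) (l * 1).
    by have := is_deriveZ l (is_derive_id t (1 : R)).
  by apply: (is_derive_eq (is_deriveD (is_derive_cst (a 0 0) t (1 : R)) d1)); rewrite add0r mulr1.
rewrite (@line_integralZ R _ _ ((`|B| + `|a 0 0|) / l)).
- by rewrite (line_integral_affine _ cq q0 l0) exprSr mulrA.
- move=> t; apply: (@cts_at_comp _ _ _ _ (fun t => a 0 0 + l * t) q); last exact: cq.
  by apply: continuous_add; [exact: cts_at_cst|apply: continuous_cmul; exact: cts_at_id].
- move=> t; rewrite ltr_pdivrMr// => Ct; apply: q0.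
  rewrite (le_lt_trans (ler_norm B))// -(ltrD2r `|a 0 0|) (lt_le_trans Ct)//.
  rewrite -[in leLHS](gtr0_norm l0) -normrM mulrC.
  by rewrite -{1}(addrK (a 0 0) (l * t)) (addrC _ (a 0 0)) (le_trans (ler_normD _ _))// normrN.
Qed.

End IntegralRn.

(** * Derivative of a determinant *)

Section JacobiFormula.
Context {R : realType} {U : normedModType R}.

Lemma differentiable_prod (J : Type) (r : seq J) (f : J -> U -> R) x :
  (forall j, differentiable (f j) x) -> differentiable (fun y => \prod_(j <- r) f j y) x.
Proof.
move=> df; elim: r => [|j r IH].
  by under eq_fun do rewrite big_nil; exact: differentiable_const.
by under eq_fun do rewrite big_cons; exact: differentiable_mul.
Qed.

Lemma derive_prod (J : eqType) (r : seq J) (f : J -> U -> R) x v : uniq r ->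
  (forall j, differentiable (f j) x) ->
  der v (fun y => \prod_(j <- r) f j y) x =
  \sum_(j <- r) der v (f j) x * \prod_(k <- r | k != j) f k x.
Proof.
move=> + df; elim: r => [_|j r IH /= /andP[jr ur]].
  under eq_fun do rewrite big_nil.
  by rewrite big_nil derive_const.
under eq_fun do rewrite big_cons.
rewrite derive_mul; [|exact: df|exact: differentiable_prod].
rewrite (IH ur) [RHS]big_cons; congr (_ * _ + _).
  rewrite big_cons eqxx /= [LHS]big_seq [RHS]big_seq_cond; apply: eq_bigl => k.
  by case: (boolP (k \in r)) => //= kr; apply/esym; apply: contraNneq jr => <-.
rewrite mulr_sumr; apply: eq_big_seq => k kr.
have jk : j != k by apply: contraNneq jr => ->.
by rewrite big_cons jk mulrCA.
Qed.

Lemma differentiable_det n (F : U -> 'M[R]_n) x : differentiable F x ->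
  differentiable (fun y => \det (F y)) x.
Proof.
move=> /differentiable_mxP dF; apply: differentiable_bigsum => s.
by apply: differentiable_mul; [exact: differentiable_const|exact: differentiable_prod].
Qed.

(** The Leibniz formula gives a sum over [i] of the determinants of [D i], where row [i] is replaced
    by its derivative. Expanding each along that row produces the adjugate. *)
Lemma derive_det n (F : U -> 'M[R]_n) x v : differentiable F x ->
  der v (fun y => \det (F y)) x = \tr (der v F x *m \adj (F x)).
Proof.
move=> dF; have dF' := (differentiable_mxP F x).1 dF.
rewrite [LHS]derive_bigsum; last first.
  move=> s; apply: differentiable_mul; first exact: differentiable_const.
  by apply: differentiable_prod => i; exact: dF'.
pose D i : 'M[R]_n := \matrix_(k, j) if k == i then der v F x k j else F x k j.
transitivity (\sum_i \det (D i)).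
  rewrite exchange_big /=; apply: eq_bigr => s _.
  rewrite derive_mul; [|exact: differentiable_const|by apply: differentiable_prod => i; exact: dF'].
  rewrite derive_const mul0r add0r.
  rewrite (derive_prod (f := fun i y => F y i (s i)) v (index_enum_uniq _) (fun i => dF' i (s i))).
  rewrite mulr_sumr; apply: eq_bigr => i _; congr (_ * _).
  rewrite [RHS](bigD1 i)//= mxE eqxx derive_entry//; congr (_ * _).
  by apply: eq_bigr => k /negPf ki; rewrite mxE ki.
apply: eq_bigr => i _; rewrite (expand_det_row _ i) mxE; apply: eq_bigr => j _.
rewrite !mxE eqxx; congr (_ * _); rewrite /cofactor; congr (_ * \det _).
by apply/matrixP => k l; rewrite !mxE eq_sym (negPf (neq_lift _ _)).
Qed.

Lemma derive_det_unit n (F : U -> 'M[R]_n) x v : differentiable F x -> F x \in unitmx ->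
  der v (fun y => \det (F y)) x = \det (F x) * \tr (der v F x *m invmx (F x)).
Proof.
move=> dF uF; rewrite derive_det// /invmx uF -scalemxAr mxtraceZ mulrA divff ?mul1r//.
by move: uF; rewrite unitmxE unitfE.
Qed.

End JacobiFormula.

(** * Change of variables *)

Section PositiveIntegral.
Context {R : realType}.

Lemma line_integral_ge0 (g : R -> R) : (forall t, 0 <= g t) -> 0 <= line_integral g.
Proof. by move=> g0; apply: Rintegral_ge0 => t _; exact: g0. Qed.

(** If the integral were 0, the antiderivative would be nondecreasing with equal values at the two
    ends, hence constant between them, and its derivative [g 0] would vanish. *)
Lemma line_integral_gt0 (g : R -> R) (B : R) : cts g -> (forall t, B < `|t| -> g t = 0) ->
  (forall t, 0 <= g t) -> 0 < g 0 -> 0 < line_integral g.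
Proof.
move=> cg gB g0 g00; rewrite lt_neqAle line_integral_ge0// andbT eq_sym.
apply/eqP => J0.
have B0 : 0 <= B by rewrite leNgt; apply/negP => B0; move: g00; rewrite gB ?normr0// ltxx.
have [G dG] := antiderivative cg gB.
have cG : cts G by move=> t; exact: is_derive_continuous (dG t).
have ab : - (B + 1) < B + 1 by rewrite gtrN// ltr_wpDl.
move: J0; rewrite (line_integral_antiderivative cg gB dG ab) ?lerN2 ?lerDl// => /eqP.
rewrite subr_eq0 => /eqP Gab.
have dG1 x : x \in `]- (B + 1), B + 1[%R -> derivable G x 1 by move=> _; have [] := dG x.
have dGp x : x \in `]- (B + 1), B + 1[%R -> 0 <= G^`()%classic x.
  by move=> _; rewrite derive1E; have [_ ->] := dG x.
have mono := ger0_derive1_le_cc dG1 dGp (continuous_subspaceT (cts_continuous cG)).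
have Gc t : t \in `]- (B + 1), B + 1[%R -> G t = G (B + 1).
  rewrite in_itv /= => /andP[/ltW t1 /ltW t2]; apply/le_anti/andP; split.
    by apply: mono => //; rewrite in_itv /= ?t1 ?t2 ?(ltW ab) ?lexx.
  by rewrite Gab; apply: mono => //; rewrite in_itv /= ?t1 ?t2 ?(ltW ab) ?lexx.
have : is_derive (0 : R) (1 : R) G 0.
  apply: near_eq_is_derive (is_derive_cst (G (B + 1)) (0 : R) (1 : R)).
  have : 0 \in `]- (B + 1), B + 1[%R by rewrite in_itv /= oppr_lt0 !ltr_wpDl.
  by move=> /near_in_itvoo; apply: filterS => t /Gc.
move=> /der_val E; move: g00; rewrite -(der_val (dG 0)) E ltxx.
by [].
Qed.

Lemma integral_Rn_ge0 n (f : 'rV[R]_n -> R) : (forall x, 0 <= f x) -> 0 <= integral_Rn f.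
Proof.
elim: n f => [|n IH] f f0; first exact: f0.
by rewrite integral_RnS; apply: line_integral_ge0 => t; exact: IH.
Qed.

Lemma integral_Rn_gt0 n (f : 'rV[R]_n -> R) (B : R) : 0 <= B -> cts f ->
  (forall x, B < `|x| -> f x = 0) -> (forall x, 0 <= f x) -> 0 < f 0 -> 0 < integral_Rn f.
Proof.
elim: n f => [//|n IH] f B0 cf fB f0 f00.
rewrite integral_RnS; apply: (@line_integral_gt0 _ B).
- exact: cts_inner_integral cf fB.
- exact: inner_integral_out fB.
- by move=> t; exact: integral_Rn_ge0.
- apply: IH => //; [exact: cts_slice|exact: slice_out fB|].
  rewrite (_ : row_mx _ _ = 0)//; apply/rowP => j.
  case: (@split_ordP 1 n j) => k ->; first by rewrite row_mxEl !mxE mul0rn.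
  by rewrite row_mxEr !mxE.
Qed.

End PositiveIntegral.

Section Bump.
Context {R : realType}.

(** The square of the positive part, the simplest continuously differentiable function that vanishes
    on a half-line. *)
Definition pos_sqr (s : R) : R := if 0 <= s then s ^+ 2 else 0.
Definition dpos_sqr (s : R) : R := if 0 <= s then 2 * s else 0.

Lemma dpos_sqr_cts : cts dpos_sqr.
Proof.
move=> s; apply/cts_atP => e e0; have e20 : 0 < e / 2 by rewrite divr_gt0.
have Hs := (cts_atP _ _).1 (@cts_at_id R R s) _ e20.
near=> t.
have st : `|s - t| < e / 2 by near: t; exact: Hs.
apply: (@le_lt_trans _ _ (2 * `|s - t|)); last by rewrite mulrC -ltr_pdivlMr.
rewrite /dpos_sqr; case: ifPn => s0; case: ifPn => t0.
- by rewrite -mulrBr normrM ger0_norm.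
- rewrite subr0 normrM ger0_norm// ler_wpM2l//; move: t0; rewrite -ltNge => t0.
  by rewrite !ger0_norm ?subr_ge0; lra.
- rewrite sub0r normrN normrM ger0_norm// ler_wpM2l//; move: s0; rewrite -ltNge => s0.
  by rewrite distrC !ger0_norm ?subr_ge0; lra.
- by rewrite subrr normr0 mulr_ge0.
Unshelve. all: by end_near. Qed.

Lemma is_derive_pos_sqr s : is_derive s (1 : R) pos_sqr (dpos_sqr s).
Proof.
have dsq t : is_derive t (1 : R) (fun t : R => t ^+ 2) (2 * t).
  have := is_deriveX 2 (is_derive_id t (1 : R)) => H.
  by apply: (is_derive_eq H); rewrite expr1 [LHS]mulr1.
have [s0|s0|s0] := ltgtP s 0.
- rewrite /dpos_sqr leNgt s0 /=.
  apply: near_eq_is_derive (is_derive_cst (0 : R) s (1 : R)).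
  near=> t; rewrite /pos_sqr leNgt ifF//; apply/negbF; near: t.
  exact: lt_nbhsl.
- rewrite /dpos_sqr (ltW s0).
  apply: near_eq_is_derive (dsq s).
  near=> t; rewrite /pos_sqr ifT//; apply/ltW; near: t.
  exact: lt_nbhsr.
- rewrite s0 /dpos_sqr lexx mulr0; apply: is_derive_cvg; apply/cvgrPdist_lt => e e0.
  near=> h; rewrite addr0 sub0r normrN /pos_sqr lexx expr0n /= subr0.
  apply: (@le_lt_trans _ _ `|h|); last by near: h; exact: dnbhs0_lt.
  case: ifPn => h0; last by rewrite scaler0 normr0.
  have hn : h != 0 by near: h; exact: nbhs_dnbhs_neq.
  by rewrite [_ *: _](_ : _ = h^-1 * h ^+ 2)// expr2 mulKf.
Unshelve. all: by end_near. Qed.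

(** The norm of ['rV[R]_n] is the maximum norm, which is not smooth in general; the kernel is built
    on the Euclidean square, and [euclid_ge_norm] compares the two. *)
Definition euclid n (w : 'rV[R]_n) : R := (w *m w^T) 0 0.

Lemma euclidE n (w : 'rV[R]_n) : euclid w = \sum_i w 0 i ^+ 2.
Proof. by rewrite /euclid mxE; apply: eq_bigr => i _; rewrite mxE expr2. Qed.

Lemma euclid_ge0 n (w : 'rV[R]_n) : 0 <= euclid w.
Proof. by rewrite euclidE; apply: sumr_ge0 => i _; exact: sqr_ge0. Qed.

Lemma euclid_ge_norm n (w : 'rV[R]_n) : `|w| ^+ 2 <= euclid w.
Proof.
have : `|w| <= Num.sqrt (euclid w).
  apply: mx_norm_le; first exact: sqrtr_ge0.
  move=> i j; rewrite [i]ord1 -sqrtr_sqr ler_wsqrtr// euclidE (bigD1 j)//= lerDl.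
  by apply: sumr_ge0 => k _; exact: sqr_ge0.
move=> H; rewrite -(sqr_sqrtr (euclid_ge0 w)) ler_sqr ?nnegrE// sqrtr_ge0.
Qed.

Definition quad n (S : 'M[R]_n) (w : 'rV[R]_n) : R := (w *m S *m w^T) 0 0.

(** A continuously differentiable bump on the set where [quad S] is at most 1, an ellipsoid for
    positive definite [S]. The matrix is a parameter so that it can be deformed. *)
Definition rbump n (S : 'M[R]_n) (w : 'rV[R]_n) : R := pos_sqr (1 - quad S w).

Lemma rbump_out n (S : 'M[R]_n) w : 1 < quad S w -> rbump S w = 0.
Proof. by move=> w1; rewrite /rbump /pos_sqr leNgt subr_lt0 w1. Qed.

Lemma rbump_ge0 n (S : 'M[R]_n) w : 0 <= rbump S w.
Proof. by rewrite /rbump /pos_sqr; case: ifP => // _; exact: sqr_ge0. Qed.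

Lemma differentiable_quad (U : normedModType R) n (S : U -> 'M[R]_n) (w : U -> 'rV[R]_n) x :
  differentiable S x -> differentiable w x -> differentiable (fun y => quad (S y) (w y)) x.
Proof.
move=> dS dw.
have : differentiable (fun y => w y *m S y *m (w y)^T) x.
  by apply: differentiable_mulmx; [exact: differentiable_mulmx|exact: differentiable_trmx].
by move=> /differentiable_mxP; exact.
Qed.

Lemma derive_quad (U : normedModType R) n (S : U -> 'M[R]_n) (w : U -> 'rV[R]_n) x v :
  (S x)^T = S x -> differentiable S x -> differentiable w x ->
  der v (fun y => quad (S y) (w y)) x =
    quad (der v S x) (w x) + 2 * (der v w x *m S x *m (w x)^T) 0 0.
Proof.
move=> sS dS dw.
have d1 : differentiable (fun y => w y *m S y) x by exact: differentiable_mulmx.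
have d2 := differentiable_trmx dw.
have d3 : differentiable (fun y => w y *m S y *m (w y)^T) x by exact: differentiable_mulmx.
rewrite -(derive_entry v 0 0 d3) derive_mulmx// derive_mulmx// derive_trmx//.
have E : (w x *m S x *m (der v w x)^T) 0 0 = (der v w x *m S x *m (w x)^T) 0 0.
  have tr00 (A : 'M[R]_1) : A 0 0 = A^T 0 0 by rewrite mxE.
  by rewrite tr00 !trmx_mul trmxK sS mulmxA.
rewrite mulmxDl !mxE -/(quad _ _).
move: E; rewrite !mxE => ->; rewrite /quad mxE; ring.
Qed.

Lemma is_derive_comp_real (U : normedModType R) (q : U -> R) (b b' : R -> R) x v :
  differentiable q x -> (forall s, is_derive s (1 : R) b (b' s)) ->
  der v (fun y => b (q y)) x = b' (q x) * der v q x.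
Proof.
move=> dq db; have dbq : differentiable b (q x) by apply/derivable1_diffP; have [] := db (q x).
rewrite (derive_comp v dq dbq).
have -> : der (der v q x) b (q x) = der v q x *: der (1 : R) b (q x).
  by rewrite -deriveZv//; congr (der _ _ _); exact/esym/mulr1.
by rewrite (der_val (db _)) [LHS]mulrC.
Qed.

Lemma differentiable_rbump (U : normedModType R) n (S : U -> 'M[R]_n) (w : U -> 'rV[R]_n) x :
  differentiable S x -> differentiable w x -> differentiable (fun y => rbump (S y) (w y)) x.
Proof.
move=> dS dw.
have dq : differentiable (fun y => 1 - quad (S y) (w y)) x.
  by apply: differentiable_sub; [exact: differentiable_const|exact: differentiable_quad].
apply: (differentiable_comp (f := fun y => 1 - quad (S y) (w y)) dq).
by apply/derivable1_diffP; have [] := is_derive_pos_sqr (1 - quad (S x) (w x)).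
Qed.

Lemma derive_rbump (U : normedModType R) n (S : U -> 'M[R]_n) (w : U -> 'rV[R]_n) x v :
  (S x)^T = S x -> differentiable S x -> differentiable w x ->
  der v (fun y => rbump (S y) (w y)) x = - dpos_sqr (1 - quad (S x) (w x)) *
    (quad (der v S x) (w x) + 2 * (der v w x *m S x *m (w x)^T) 0 0).
Proof.
move=> sS dS dw; have dq := differentiable_quad dS dw.
rewrite (@is_derive_comp_real _ (fun y => 1 - quad (S y) (w y)) _ _ _ _ _ is_derive_pos_sqr).
  rewrite (derive_sub v (differentiable_const _ _) dq).
  by rewrite derive_const sub0r derive_quad// mulrN mulNr.
by apply: differentiable_sub => //; exact: differentiable_const.
Qed.

End Bump.

(** * Mass of the kernel under linear maps *)

Section LinearInvariance.
Context {R : realType} {n : nat}.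
Implicit Types (w u : 'rV[R]_n) (S J : 'M[R]_n).

Lemma norm_mulmx_le (J : 'M[R]_n) : exists2 C : R, 0 < C & forall w, `|w *m J| <= C * `|w|.
Proof.
exists (n%:R * `|J| + 1); first by rewrite ltr_wpDl// mulr_ge0.
move=> w; rewrite (@le_trans _ _ (n%:R * `|J| * `|w|))//; last first.
  by rewrite ler_wpM2r// lerDl.
apply: mx_norm_le => [|i j]; first by rewrite !mulr_ge0.
rewrite mxE (le_trans (ler_norm_sum _ _ _))// -mulrA -[X in X%:R](card_ord n) -sumr_const mulr_suml.
apply: ler_sum => k _; rewrite mul1r normrM mulrC.
by apply: ler_pM => //; exact: mx_norm_entry.
Qed.

Lemma quad_scale k (S : 'M[R]_n) w : quad S (k *: w) = k ^+ 2 * quad S w.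
Proof. by rewrite /quad linearZ /= -scalemxAl -scalemxAr -scalemxAl !mxE; ring. Qed.

Lemma quad_mulmx (J : 'M[R]_n) w : quad 1%:M (w *m J) = quad (J *m J^T) w.
Proof. by rewrite /quad mulmx1 trmx_mul !mulmxA. Qed.

(** A path from the identity to [J *m J^T]. With squares as weights it stays positive definite for
    every real [s], as [1 - s] and [s] never vanish together, so the derivatives in [s] exist on the
    whole line and the ends 0 and 1 are interior points. *)
Definition interp J (s : R) : 'M[R]_n := ((1 - s) ^+ 2)%:M + s ^+ 2 *: (J *m J^T).

Lemma interp_sym J s : (interp J s)^T = interp J s.
Proof. by rewrite /interp linearD /= tr_scalar_mx linearZ /= trmx_mul trmxK. Qed.

Lemma quad_interp J s w :
  quad (interp J s) w = (1 - s) ^+ 2 * euclid w + s ^+ 2 * euclid (w *m J).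
Proof.
rewrite /quad /interp mulmxDr mulmxDl mxE -scalemxAr -scalemxAl [X in _ + X]mxE.
rewrite mul_mx_scalar -scalemxAl [X in X + _]mxE /euclid; congr (_ + _ * _).
by rewrite trmx_mul !mulmxA.
Qed.

Lemma quad_interp_ge J : J \in unitmx ->
  exists2 c : R, 0 < c & forall s w, c * `|w| ^+ 2 <= quad (interp J s) w.
Proof.
move=> uJ; have [C C0 HC] := norm_mulmx_le (invmx J).
pose k := (C ^+ 2)^-1.
have k0 : 0 < k by rewrite invr_gt0 exprn_gt0.
have HJ w : k * `|w| ^+ 2 <= euclid (w *m J).
  apply: le_trans (euclid_ge_norm _); rewrite /k mulrC ler_pdivrMr ?exprn_gt0//.
  rewrite mulrC -exprMn ler_sqr ?nnegrE ?mulr_ge0 ?(ltW C0)//.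
  by have := HC (w *m J); rewrite mulmxK.
(* The factor one half is the least value of [(1 - s) ^+ 2 + s ^+ 2]. The numbers 1 and [k] bound
   the two forms from below, [k] through the bound [C] of the inverse of [J]. *)
exists (Num.min 1 k / 2); first by rewrite divr_gt0// lt_min ltr01.
move=> s w; rewrite quad_interp.
have m0 : 0 <= Num.min 1 k by rewrite le_min ler01 ltW.
have m1 : Num.min 1 k <= 1 by rewrite ge_min lexx.
have mk : Num.min 1 k <= k by rewrite ge_min lexx orbT.
have E1 := euclid_ge_norm w; have E2 := HJ w.
set q := `|w| ^+ 2 in E1 E2 *; have q0 : 0 <= q by exact: sqr_ge0.
apply: (@le_trans _ _ ((1 - s) ^+ 2 * (Num.min 1 k * q) + s ^+ 2 * (Num.min 1 k * q))).
  rewrite -mulrDl [leLHS](_ : _ = 2^-1 * (Num.min 1 k * q)); last by ring.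
  rewrite ler_wpM2r ?mulr_ge0//.
  have : 0 <= (2 * s - 1) ^+ 2 by exact: sqr_ge0.
  by rewrite -subr_ge0 => h; rewrite -subr_ge0; lra.
apply: lerD; rewrite ler_wpM2l ?sqr_ge0//.
  by apply: le_trans E1; rewrite ler_piMl.
by apply: le_trans E2; rewrite ler_wpM2r.
Qed.

Lemma interp_unit J s : J \in unitmx -> interp J s \in unitmx.
Proof.
move=> uJ; have [c c0 Hc] := quad_interp_ge uJ.
rewrite -row_free_unit; apply/row_freeP; apply/row_freeP.
rewrite -kermx_eq0; apply/eqP/row_matrixP => i; rewrite row0.
set w := row i _.
have wS : w *m interp J s = 0 by rewrite /w -row_mul mulmx_ker row0.
have := Hc s w; rewrite /quad wS mul0mx mxE.
rewrite pmulr_rle0// => h; apply/eqP; rewrite -normr_eq0.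
by rewrite -sqrf_eq0 eq_le h sqr_ge0.
Qed.

Definition dinterp J (s : R) : 'M[R]_n := (- (2 * (1 - s)))%:M + (2 * s) *: (J *m J^T).

Lemma is_derive_sqr (s : R) : is_derive s (1 : R) (fun t : R => t ^+ 2) (2 * s).
Proof.
have := is_deriveX 2 (is_derive_id s (1 : R)) => H.
by apply: (is_derive_eq H); rewrite expr1 [LHS]mulr1.
Qed.

Lemma is_derive_sqr1 (s : R) : is_derive s (1 : R) (fun t : R => (1 - t) ^+ 2) (- (2 * (1 - s))).
Proof.
have d1 : is_derive s (1 : R) (fun t : R => 1 - t) (-1).
  have H := is_deriveB (is_derive_cst (1 : R) s (1 : R)) (is_derive_id s (1 : R)).
  by apply: (is_derive_eq H); rewrite sub0r.
have H := @is_derive1_comp R (fun t => t ^+ 2) (fun t => 1 - t) s _ _ (is_derive_sqr (1 - s)) d1.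
by apply: (is_derive_eq H); rewrite mulrN1.
Qed.

Lemma diff_is_derive (f : R -> R) s d : is_derive s (1 : R) f d -> differentiable f s.
Proof. by move=> [+ _]; move/derivable1_diffP. Qed.

Lemma differentiable_interp J s : differentiable (interp J) s.
Proof.
apply: differentiable_add.
  rewrite (_ : (fun y : R => _) = fun y => ((1 - y) ^+ 2) *: 1%:M); last first.
    by apply/funext => y; rewrite scalemx1.
  exact: differentiableZl (diff_is_derive (is_derive_sqr1 s)).
exact: differentiableZl (diff_is_derive (is_derive_sqr s)).
Qed.

Lemma derive_interp J s : der (1 : R) (interp J) s = dinterp J s.
Proof.
have d1 := diff_is_derive (is_derive_sqr1 s).
have d2 := diff_is_derive (is_derive_sqr s).
rewrite (_ : interp J = fun y => ((1 - y) ^+ 2) *: 1%:M + y ^+ 2 *: (J *m J^T)); last first.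
  by apply/funext => y; rewrite /interp scalemx1.
rewrite derive_add; [|exact: differentiableZl..].
by rewrite !derive_scalel// (der_val (is_derive_sqr s)) (der_val (is_derive_sqr1 s)) scalemx1.
Qed.


Lemma bump_interp_out J : J \in unitmx ->
  exists2 B : R, 0 <= B & forall s w, B < `|w| -> rbump (interp J s) w = 0.
Proof.
move=> uJ; have [c c0 Hc] := quad_interp_ge uJ.
exists (Num.sqrt c^-1) => [|s w wB]; first exact: sqrtr_ge0.
apply: rbump_out; apply: lt_le_trans (Hc s w).
rewrite -ltr_pdivrMl// mulr1 -(sqr_sqrtr (ltW (_ : 0 < c^-1))) ?invr_gt0//.
by rewrite ltr_sqr ?nnegrE// sqrtr_ge0.
Qed.

Lemma cts_quad_comp (T : topologicalType) (a : T -> 'M[R]_n) (b : T -> 'rV[R]_n) x :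
  cts_at a x -> cts_at b x -> cts_at (fun y => quad (a y) (b y)) x.
Proof.
move=> /continuous_mxP ca /continuous_mxP cb.
rewrite (_ : (fun y => _) = fun y => \sum_j (\sum_i b y 0 i * a y i j) * b y 0 j).
  apply: continuous_bigsum => j; apply: continuous_mul; last exact: cb.
  by apply: continuous_bigsum => i; apply: continuous_mul; [exact: cb|exact: ca].
apply/funext => y; rewrite /quad mxE; apply: eq_bigr => j _.
by rewrite !mxE.
Qed.

Lemma cts_quad2_comp (T : topologicalType) (a : T -> 'M[R]_n) (b d : T -> 'rV[R]_n) x :
  cts_at a x -> cts_at b x -> cts_at d x -> cts_at (fun y => (b y *m a y *m (d y)^T) 0 0) x.
Proof.
move=> /continuous_mxP ca /continuous_mxP cb /continuous_mxP cd.
rewrite (_ : (fun y => _) = fun y => \sum_j (\sum_i b y 0 i * a y i j) * d y 0 j).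
  apply: continuous_bigsum => j; apply: continuous_mul; last exact: cd.
  by apply: continuous_bigsum => i; apply: continuous_mul; [exact: cb|exact: ca].
apply/funext => y; rewrite mxE; apply: eq_bigr => j _.
by rewrite !mxE.
Qed.

Lemma dinterp_cts J : cts (dinterp J).
Proof.
move=> s; apply/continuous_mxP => i j.
rewrite (_ : (fun y => _) = fun y => (- (2 * (1 - y))) * (i == j)%:R + (2 * y) * (J *m J^T) i j).
  apply: continuous_add; (apply: continuous_mul; last exact: cts_at_cst).
    have -> : (fun y => - (2 * (1 - y))) = (fun y : R => -2 + 2 * y) by apply/funext => y; ring.
    by apply: continuous_add; [exact: cts_at_cst|apply: continuous_cmul; exact: cts_at_id].
  by apply: continuous_cmul; exact: cts_at_id.
by apply/funext => y; rewrite /dinterp mxE [X in _ + X]mxE [X in X + _]mxE mulr_natr.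
Qed.

(* With [M = S' S^-1 / 2], the [s]-derivative of [rbump (S s)] is the divergence of
   [w M rbump (S s) w] minus [tr M rbump (S s) w]. *)
Lemma is_derive_bump_integral J s : J \in unitmx ->
  is_derive s (1 : R) (fun s => integral_Rn (rbump (interp J s)))
    (- (2^-1 * \tr (dinterp J s *m invmx (interp J s))) * integral_Rn (rbump (interp J s))).
Proof.
move=> uJ; have [B B0 HB] := bump_interp_out uJ.
pose b' (r : R) (w : 'rV[R]_n) := - dpos_sqr (1 - quad (interp J r) w) * quad (dinterp J r) w.
have cI : cts (interp J) by move=> r; exact: differentiable_cts_at (differentiable_interp J r).
have cdp (T : topologicalType) (q : T -> R) x : cts_at q x -> cts_at (fun y => - dpos_sqr (1 - q y)) x.
  move=> cq; rewrite (_ : (fun y => _) = fun y => -1 * dpos_sqr (1 + -1 * q y)); last first.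
    by apply/funext => y; rewrite !mulN1r.
  have c1 : cts_at (fun y => 1 + -1 * q y) x.
    by apply: (@continuous_add R T (fun=> 1)); [exact: cts_at_cst|exact: continuous_cmul].
  apply: continuous_cmul; apply: (@cts_at_comp _ _ _ _ (fun y => 1 + -1 * q y) dpos_sqr) => //.
  exact: dpos_sqr_cts.
have D r w : is_derive r (1 : R) (fun r => rbump (interp J r) w) (b' r w).
  have dI := differentiable_interp J r.
  have := is_derive_der (1 : R) (differentiable_rbump dI (differentiable_const w r)).
  rewrite (derive_rbump (1 : R) (interp_sym J r) dI (differentiable_const w r)).
  by rewrite derive_interp derive_const !mul0mx mxE mulr0 addr0.
have -> : - (2^-1 * \tr (dinterp J s *m invmx (interp J s))) * integral_Rn (rbump (interp J s)) =
   integral_Rn (b' s).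
  pose S := interp J s; pose M := 2^-1 *: (dinterp J s *m invmx S).
  pose F := rbump S.
  have uS : S \in unitmx by exact: interp_unit.
  have dF w : differentiable F w.
    by apply: differentiable_rbump; [exact: differentiable_const|exact: differentiable_id].
  have FD w v : der v F w = - dpos_sqr (1 - quad S w) * (2 * (v *m S *m w^T) 0 0).
    rewrite (derive_rbump v (S := fun=> S) (w := fun w => w) (x := w) (interp_sym J s)
      (differentiable_const S w) (differentiable_id w)).
    by rewrite derive_const derive_id_val (_ : quad 0 w = 0) ?add0r// /quad mulmx0 mul0mx mxE.
  have cF : cts F by move=> w; exact: differentiable_cts_at.
  have dL i w : differentiable (fun w : 'rV[R]_n => (w *m M) 0 i) w.
    have : differentiable (fun w : 'rV[R]_n => w *m M) w.
      by apply: differentiable_mulmx; [exact: differentiable_id|exact: differentiable_const].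
    by move=> /differentiable_mxP; exact.
  have LD i w v : der v (fun w : 'rV[R]_n => (w *m M) 0 i) w = (v *m M) 0 i.
    have d1 : differentiable (fun w : 'rV[R]_n => w *m M) w.
      by apply: differentiable_mulmx; [exact: differentiable_id|exact: differentiable_const].
    rewrite -(derive_entry v 0 i d1) (derive_mulmx v (differentiable_id w) (differentiable_const M w)).
    by rewrite derive_const derive_id_val mulmx0 addr0.
  pose H i w := (w *m M) 0 i * F w.
  have HD i w : der (delta_mx 0 i) (H i) w = M i i * F w + (w *m M) 0 i * der (delta_mx 0 i) F w.
    by rewrite derive_mul// LD -rowE mxE.
  have cFD v : cts (der v F).
    move=> w; rewrite (_ : der v F = fun w => - dpos_sqr (1 - quad S w) * (2 * (v *m S *m w^T) 0 0)).
      apply: continuous_mul; first by apply: cdp; apply: cts_quad_comp; [exact: cts_at_cst|exact: cts_at_id].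
      by apply: continuous_cmul; apply: cts_quad2_comp; [exact: cts_at_cst..|exact: cts_at_id].
    by apply/funext => y; exact: FD.
  have F0 w : B < `|w| -> F w = 0 by exact: HB.
  have F'0 v w : B < `|w| -> der v F w = 0 by exact: der_out.
  have cL i : cts (fun w : 'rV[R]_n => (w *m M) 0 i) by move=> w; exact: differentiable_cts_at.
  have c1 i : cts (fun w => M i i * F w) by move=> w; apply: continuous_cmul; exact: cF.
  have c2 i : cts (fun w => (w *m M) 0 i * der (delta_mx 0 i) F w).
    by move=> w; apply: continuous_mul; [exact: cL|exact: cFD].
  have I0 i : M i i * integral_Rn F + integral_Rn (fun w => (w *m M) 0 i * der (delta_mx 0 i) F w) = 0.
    rewrite -(@integral_RnZ _ _ _ _ B)// -(@integral_RnD _ _ _ _ B)//; last first.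
    - by move=> w Bw; rewrite F'0// mulr0.
    - by move=> w Bw; rewrite F0// mulr0.
    rewrite -[RHS](@integral_Rn_derive R n (H i) i B)//.
    - by congr integral_Rn; apply/funext => w; rewrite HD.
    - by move=> w; exact: differentiable_mul.
    - move=> w; rewrite (_ : der _ _ = fun w => M i i * F w + (w *m M) 0 i * der (delta_mx 0 i) F w).
        by apply: continuous_add; [exact: c1|exact: c2].
      by apply/funext => y; exact: HD.
    - by move=> w Bw; rewrite /H F0// mulr0.
  have E w : b' s w = \sum_i (w *m M) 0 i * der (delta_mx 0 i) F w.
    have -> : \sum_i (w *m M) 0 i * der (delta_mx 0 i) F w = der (w *m M) F w.
      by rewrite (derive_row (w *m M) (dF w)).
    rewrite FD /b'; congr (_ * _).
    rewrite /M -scalemxAr -!scalemxAl mxE mulrA divff ?mul1r// !mulmxA.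
    by rewrite (mulmxKV uS).
  rewrite (_ : b' s = fun w => \sum_i (w *m M) 0 i * der (delta_mx 0 i) F w); last by apply/funext.
  rewrite (@integral_Rn_sum R n _ _ _ B)//; last by move=> i w Bw; rewrite F'0// mulr0.
  have -> : 2^-1 * \tr (dinterp J s *m invmx (interp J s)) = \tr M by rewrite mxtraceZ.
  rewrite mulNr /mxtrace mulr_suml; apply/eqP; rewrite eq_sym -addr_eq0 addrC -big_split /=.
  by apply/eqP/big1 => i _; exact: I0.
apply: (@is_derive_integral_Rn R n setT (fun r => rbump (interp J r)) b' B) => //.
- exact: openT.
- move=> z x _.
  rewrite (_ : (fun p => _) = fun p : R * 'rV[R]_n => pos_sqr (1 + -1 * quad (interp J p.1) p.2)); last first.
    by apply/funext => p; rewrite mulN1r.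
  have c1 : cts_at (fun p : R * 'rV[R]_n => 1 + -1 * quad (interp J p.1) p.2) (z, x).
    apply: continuous_add; first exact: cts_at_cst.
    by apply: continuous_cmul; apply: cts_quad_comp; [apply: cts_at_fst; exact: cI|exact: cvg_snd].
  apply: (@cts_at_comp _ _ _ _ (fun p : R * 'rV[R]_n => 1 + -1 * quad (interp J p.1) p.2) pos_sqr) => //.
  by apply: is_derive_continuous; exact: is_derive_pos_sqr.
- move=> z x _; apply: (@continuous_mul _ _ (fun p : R * 'rV[R]_n => - dpos_sqr (1 - quad (interp J p.1) p.2))
    (fun p : R * 'rV[R]_n => quad (dinterp J p.1) p.2)).
    by apply: cdp; apply: cts_quad_comp; [apply: cts_at_fst; exact: cI|exact: cvg_snd].
  by apply: cts_quad_comp; [apply: cts_at_fst; exact: dinterp_cts|exact: cvg_snd].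
- by move=> z x _; exact: HB.
- move=> z x _ Bx.
  have [_] := D z x; rewrite -(der_val (D z x)).
  rewrite (_ : (fun r => rbump (interp J r) x) = fun=> 0) ?derive_const//.
  by apply/funext => r; exact: HB.
Qed.

(** Along [interp J] the mass has logarithmic derivative minus one half of the trace of [S' S^-1],
    while the determinant has that trace as logarithmic derivative. Hence the product [q] of the
    squared mass and the determinant is constant; squaring avoids the root of the determinant. *)
Lemma integral_bump_linear J : 0 < \det J ->
  integral_Rn (fun w => rbump 1%:M (w *m J)) * \det J = integral_Rn (rbump (1%:M : 'M[R]_n)).
Proof.
move=> J0; have uJ : J \in unitmx by rewrite unitmxE unitfE gt_eqF.
pose I s := integral_Rn (rbump (interp J s)).
pose q s := I s ^+ 2 * \det (interp J s).
have dq s : is_derive s (1 : R) q 0.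
  have dI := is_derive_bump_integral s uJ.
  have dD := differentiable_det (differentiable_interp J s).
  have diI : differentiable I s by exact: diff_is_derive dI.
  have di : differentiable q s.
    by apply: differentiable_mul => //; exact: differentiable_mul.
  apply: (is_derive_eq (is_derive_der (1 : R) di)).
  rewrite /q derive_mul//; last exact: differentiable_mul.
  rewrite [X in X * _](_ : _ = der (1 : R) I s * I s + I s * der (1 : R) I s); last first.
    by rewrite -derive_mul.
  rewrite (derive_det_unit (1 : R) (differentiable_interp J s) (interp_unit s uJ)).
  rewrite derive_interp /I (der_val dI).
  by field.
have [|c _] := @MVT R q (fun=> 0) 0 1 ltr01 (fun x _ => dq x).
  by apply: continuous_subspaceT => s; exact: is_derive_continuous (dq s).
rewrite mul0r /q /I => /eqP; rewrite subr_eq0 => /eqP.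
have -> : interp J 0 = 1%:M by rewrite /interp subr0 expr1n expr0n scale0r addr0.
have -> : interp J 1 = J *m J^T by rewrite /interp subrr expr0n expr1n scale1r -scalemx1 scale0r add0r.
rewrite det1 mulr1 det_mulmx det_tr -expr2 -exprMn => E.
have -> : (fun w => rbump 1%:M (w *m J)) = rbump (J *m J^T).
  by apply/funext => w; rewrite /rbump quad_mulmx.
(* The comparison of the ends of the path only gives equal squares. Both sides are nonnegative, the
   left one because [\det J] is positive. *)
have h1 : 0 <= integral_Rn (rbump (J *m J^T)) * \det J.
  by apply: mulr_ge0; [apply: integral_Rn_ge0 => w; exact: rbump_ge0|exact: ltW].
have h2 : 0 <= integral_Rn (rbump (1%:M : 'M[R]_n)).
  by apply: integral_Rn_ge0 => w; exact: rbump_ge0.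
by apply/eqP; rewrite -(eqrXn2 (isT : (0 < 2)%N) h1 h2) E.
Qed.

End LinearInvariance.

Section NearPair.

Lemma near_fst (T U : topologicalType) (P : set T) (z : T) (x : U) :
  nbhs z P -> \forall p \near (z, x), P p.1.
Proof.
move=> zP; exists (P, setT) => [|[a b] []//].
by split => //; exact: filterT.
Qed.

Lemma near_snd (T U : topologicalType) (P : set U) (z : T) (x : U) :
  nbhs x P -> \forall p \near (z, x), P p.2.
Proof.
move=> xP; exists (setT, P) => [|[a b] []//].
by split => //; exact: filterT.
Qed.

End NearPair.

(** * Cutoffs, Lipschitz bounds and difference quotients *)

Section LocalC1.
Context {R : realType} {n : nat}.

Lemma cts_at_near_eq (T : topologicalType) (V : normedModType R) (f g : T -> V) x :
  (\forall y \near x, f y = g y) -> cts_at f x -> cts_at g x.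
Proof.
move=> fg cf; rewrite /cts_at -(nbhs_singleton fg).
by apply: cvg_trans cf; apply: near_eq_cvg; apply: filterS fg => y ->.
Qed.

(** Off the closed set [K1] the cutoff [m] vanishes near [x], so nothing is asked of [G] there. Maps
    that are meaningful only on the image of a chart can thus stand in integrals over the whole
    space. *)
Lemma cts_cut (T : topologicalType) (m : 'rV[R]_n -> R) (K1 : set 'rV[R]_n)
    (G : T -> 'rV[R]_n -> R) z x : closed K1 -> cts m ->
  (forall x, ~ K1 x -> m x = 0) ->
  (K1 x -> cts_at (fun p : T * 'rV[R]_n => G p.1 p.2) (z, x)) ->
  cts_at (fun p : T * 'rV[R]_n => m p.2 * G p.1 p.2) (z, x).
Proof.
move=> cK cm m0 cG; have [Kx|Kx] := pselect (K1 x).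
  apply: (@continuous_mul _ _ (fun p : T * 'rV[R]_n => m p.2) (fun p : T * 'rV[R]_n => G p.1 p.2)).
    by apply: cts_at_snd; exact: cm.
  exact: cG.
apply: (@cts_at_near_eq _ _ (fun=> 0)); last exact: cts_at_cst.
have oK : nbhs x (~` K1) by apply: open_nbhs_nbhs; split => //; exact: closed_openC.
have H : \forall p \near (z, x), ~ K1 p.2 by exact: near_snd oK.
by apply: filterS H => p Kp; rewrite m0// mul0r.
Qed.

Lemma ball_segment (U : normedModType R) (y a b : U) (r s : R) : ball y r a -> ball y r b ->
  0 <= s <= 1 -> ball y r (b + s *: (a - b)).
Proof.
rewrite -ball_normE /ball_ /= => ya yb /andP[s0 s1].
have -> : y - (b + s *: (a - b)) = (1 - s) *: (y - b) + s *: (y - a).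
  rewrite scalerBl scale1r opprD addrA -[RHS]addrA; congr (_ + _).
  by rewrite -!scalerN -scalerDr !opprB subrKA.
rewrite (le_lt_trans (ler_normD _ _))// !normrZ (ger0_norm s0) ger0_norm ?subr_ge0//.
have [->|sn0] := eqVneq s 0; first by rewrite subr0 mul1r mul0r addr0.
have sp : 0 < s by rewrite lt_neqAle eq_sym sn0.
rewrite [ltRHS](_ : r = (1 - s) * r + s * r); last by ring.
rewrite ler_ltD//.
  by rewrite ler_wpM2l ?subr_ge0// ltW.
by rewrite ltr_pM2l.
Qed.

Lemma mvt_line (U : normedModType R) (F : U -> R) a b :
  (forall s : R, 0 <= s <= 1 -> differentiable F (b + s *: (a - b))) ->
  exists2 s : R, 0 <= s <= 1 & F a - F b = der (a - b) F (b + s *: (a - b)).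
Proof.
move=> dF.
have [||s] := @MVT R (fun s => F (b + s *: (a - b))) (fun s => der (a - b) F (b + s *: (a - b))) 0 1 ltr01.
- move=> s; rewrite in_itv /= => /andP[/ltW s0 /ltW s1]; apply: is_derive_line; apply: dF.
  by rewrite s0.
- apply: derivable_within_continuous => s; rewrite in_itv /= => s01.
  by have [] := is_derive_line (dF s s01).
rewrite in_itv /= => /andP[/ltW s0 /ltW s1] E; exists s; first by rewrite s0.
by move: E; rewrite scale1r scale0r addr0 subr0 mulr1 subrKC.
Qed.

(** Continuity bounds the partial derivatives on a ball around [y0], by their values at [y0] plus 1.
    The ball is convex, so the mean value theorem on segments applies to each component. *)
Lemma local_lipschitz p (O : set 'rV[R]_n) (eta : 'rV[R]_n -> 'rV[R]_p) y0 :
  open O -> smooth_on O eta -> O y0 ->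
  exists L r : R, [/\ 0 <= L, 0 < r, ball y0 r `<=` O,
    (forall a v, ball y0 r a -> `|der v eta a| <= L * `|v|) &
    (forall a b, ball y0 r a -> ball y0 r b -> `|eta a - eta b| <= L * `|a - b|)].
Proof.
move=> oO seta Oy0.
pose M i := `|der (delta_mx 0 i) eta y0| + 1.
have H : \forall a \near y0, O a /\ forall i, `|der (delta_mx 0 i) eta a| <= M i.
  suff H i : \forall a \near y0, `|der (delta_mx 0 i) eta a| <= M i.
    by apply: filterI; [exact: open_nbhs_nbhs|exact: filter_forall H].
  have c : cts_at (der (delta_mx 0 i) eta) y0.
    by apply: differentiable_cts_at; exact: (smooth_diff (smooth_derive _ seta) Oy0).
  apply: filterS ((cts_atP _ _).1 c 1 ltr01) => a h.
  rewrite -[in leLHS](subrK (der (delta_mx 0 i) eta y0) (der (delta_mx 0 i) eta a)).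
  by rewrite (le_trans (ler_normD _ _))// addrC lerD2l distrC ltW.
have [r /= r0 Hr] := (nbhs_ballP y0 _).1 H.
pose L := \sum_i M i.
have L0 : 0 <= L by apply: sumr_ge0 => i _; rewrite addr_ge0.
have B1 a v : ball y0 r a -> `|der v eta a| <= L * `|v|.
  move=> /Hr[Oa Ma]; rewrite (derive_row v (smooth_diff seta Oa)).
  rewrite (le_trans (ler_norm_sum _ _ _))// /L mulr_suml ler_sum// => i _.
  rewrite normrZ mulrC ler_pM//.
  exact: mx_norm_entry.
exists L, r; split => //; first by move=> a /Hr[].
move=> a b ya yb; apply: mx_norm_le; first by rewrite mulr_ge0.
move=> i j; rewrite [i]ord1.
have dj s : 0 <= s <= 1 -> differentiable eta (b + s *: (a - b)).
  by move=> s01; have [Os _] := Hr _ (ball_segment ya yb s01); exact: (smooth_diff seta Os).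
have [s s01 E] := @mvt_line _ (fun x => eta x 0 j) a b
   (fun s s01 => (differentiable_mxP _ _).1 (dj s s01) 0 j).
rewrite !mxE E -(derive_entry (a - b) 0 j (dj s s01)) (le_trans (mx_norm_entry _ _ _))//.
by apply: B1; exact: ball_segment.
Qed.

(** The value at [e = 0] is the limit, so that the quotient is continuous in all three arguments and
    a rescaled integrand may be evaluated at [e = 0]. *)
Definition diff_quot p (theta : 'rV[R]_n -> 'rV[R]_p) (e : R) (x w : 'rV[R]_n) : 'rV[R]_p :=
  if e == 0 then der w theta x else e^-1 *: (theta (x + e *: w) - theta x).

(** By the mean value theorem each component of the quotient is a value of the directional
    derivative [D] at a point of the segment from [x] to [x + e w], and [D] is jointly
    continuous. *)
Lemma cts_diff_quot0 p (O : set 'rV[R]_n) (theta : 'rV[R]_n -> 'rV[R]_p) x0 w0 :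
  open O -> smooth_on O theta -> O x0 ->
  cts_at (fun p : (R * 'rV[R]_n) * 'rV[R]_n => diff_quot theta p.1.1 p.1.2 p.2) ((0, x0), w0).
Proof.
move=> oO st Ox0; apply/continuous_mxP => i j; rewrite [i]ord1.
pose f x := theta x 0 j.
have sf : smooth_on O f by exact: (smooth_mxP oO _).1 st 0 j.
pose D (q : 'rV[R]_n * 'rV[R]_n) := \sum_k q.2 0 k * der (delta_mx 0 k) f q.1.
have DE x w : O x -> der w f x = D (x, w).
  by move=> Ox; rewrite (derive_row w (smooth_diff sf Ox)).
have cD : cts_at D (x0, w0).
  apply: continuous_bigsum => k; apply: (@continuous_mul R _ (fun q : 'rV[R]_n * 'rV[R]_n => q.2 0 k)
     (fun q => der (delta_mx 0 k) f q.1)).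
    apply: (@cts_at_snd R 'rV[R]_n 'rV[R]_n R (fun w => w 0 k) (x0, w0)).
    exact: (@coord_continuous _ _ _ 0 k w0).
  apply: (@cts_at_fst R 'rV[R]_n 'rV[R]_n R (der (delta_mx 0 k) f) (x0, w0)).
  by apply: differentiable_cts_at; exact: (smooth_diff (smooth_derive _ sf) Ox0).
apply/cts_atP => e e0.
have [r /= r0 Hr] := (nbhs_ballP (x0, w0) _).1 ((cts_atP _ _).1 cD e e0).
have [r' /= r'0 Hr'] := (nbhs_ballP x0 _).1 (open_nbhs_nbhs (conj oO Ox0)).
pose d := Num.min r r'; have d0 : 0 < d by rewrite lt_min r0.
have d20 : 0 < d / 2 by rewrite divr_gt0.
(* [N] bounds [|w|] near [w0]. For [|e| < d / 2 / N] and [x] within [d / 2] of [x0] the segment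
   stays in the ball of radius [d]. *)
pose N := `|w0| + d; have N0 : 0 < N by rewrite ltr_wpDl.
have dN0 : 0 < d / 2 / N by rewrite divr_gt0.
have Hx : \forall p \near ((0 : R, x0), w0), ball x0 (d / 2) p.1.2.
  apply: (near_fst (P := fun q : R * 'rV[R]_n => ball x0 (d / 2) q.2)).
  by apply: near_snd; exact: nbhsx_ballx.
have He : \forall p \near ((0 : R, x0), w0), `|p.1.1| < d / 2 / N.
  apply: (near_fst (P := fun q : R * 'rV[R]_n => `|q.1| < d / 2 / N)).
  apply: (near_fst (P := fun r : R => `|r| < d / 2 / N)).
  apply: filterS ((cts_atP _ _).1 (@cts_at_id R R 0) _ dN0) => r'' /=.
  by rewrite sub0r normrN.
have Hw : \forall p \near ((0 : R, x0), w0), ball w0 d p.2.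
  by apply: near_snd; exact: nbhsx_ballx.
near=> q.
have qx : ball x0 (d / 2) q.1.2 by near: q.
have qe : `|q.1.1| < d / 2 / N by near: q.
have qw : ball w0 d q.2 by near: q.
have wN : `|q.2| <= N.
  move: qw; rewrite -ball_normE /ball_ /= distrC => /ltW qw.
  by rewrite -(subrK w0 q.2) (le_trans (ler_normD _ _))// addrC lerD2l.
have seg s : 0 <= s <= 1 -> ball x0 d (q.1.2 + s *: (q.1.1 *: q.2)).
  move=> /andP[s0 s1]; move: qx; rewrite -!ball_normE /ball_ /= => qx.
  rewrite opprD addrA (le_lt_trans (ler_normB _ _))// [ltRHS](splitr d) ltr_leD//.
  rewrite !normrZ ger0_norm// -[leRHS]mul1r ler_pM// ?mulr_ge0//.
  rewrite -[leRHS](divfK (lt0r_neq0 N0)) ler_pM// ltW//.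
have rd : d <= r by rewrite ge_min lexx.
have rd' : d <= r' by rewrite ge_min lexx orbT.
have Oseg s : 0 <= s <= 1 -> O (q.1.2 + s *: (q.1.1 *: q.2)).
  by move=> s01; apply: Hr'; exact: le_ball rd' _ (seg s s01).
have fin x : ball x0 d x -> `|D (x0, w0) - D (x, q.2)| < e.
  by move=> xd; apply: Hr; split => /=; [exact: le_ball rd _ xd|exact: le_ball rd _ qw].
have dq x : O x -> (der q.2 theta x) 0 j = D (x, q.2).
  by move=> Ox; rewrite (derive_entry _ _ _ (smooth_diff st Ox)) -DE.
have -> : diff_quot theta 0 x0 w0 0 j = D (x0, w0).
  by rewrite /diff_quot eqxx (derive_entry _ _ _ (smooth_diff st Ox0)) -DE.
rewrite /diff_quot; case: eqVneq => [q0|q0].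
  have x00 : ball x0 d q.1.2 by have := seg 0; rewrite scale0r addr0 lexx ler01; exact.
  rewrite dq; first exact: fin.
  by apply: Hr'; exact: le_ball rd' _ x00.
have addK : q.1.2 + q.1.1 *: q.2 - q.1.2 = q.1.1 *: q.2 by rewrite addrC addKr.
have [s s01|s s01] := @mvt_line _ f (q.1.2 + q.1.1 *: q.2) q.1.2.
  by rewrite addK; exact: (smooth_diff sf (Oseg s s01)).
rewrite addK deriveZv; last exact: (smooth_diff sf (Oseg s s01)).
rewrite (DE _ _ (Oseg s s01)) => E.
rewrite mxE !mxE -[X in _^-1 * X]/(f (q.1.2 + q.1.1 *: q.2) - f q.1.2) E.
by rewrite [_ *: _]/(_ * _) mulKf//; apply: fin; exact: seg.
Unshelve. all: by end_near. Qed.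

End LocalC1.

(** * Mass of a density carried along a map and smeared *)

Section PushForward.
Context {R : realType} {n : nat}.
Implicit Types (x y : 'rV[R]_n) (m h : 'rV[R]_n -> R).

Lemma compact_norm_bound (K : set 'rV[R]_n) (f : 'rV[R]_n -> 'rV[R]_n) :
  compact K -> (forall x, K x -> cts_at f x) ->
  exists2 B : R, 0 <= B & forall x, K x -> `|f x| <= B.
Proof.
move=> cK cf; have [->|/set0P K0] := eqVneq K set0; first by exists 0.
have cn : {within K, continuous (fun x => `|f x|)}.
  apply: continuous_in_subspaceT => x /set_mem Kx.
  by apply: continuous_comp; [exact: cf|exact: norm_continuous].
have [a _ Ha] := compact_EVT_max K0 cK cn.
by exists `|f a| => // x Kx; apply: Ha; exact: mem_set.
Qed.

Variables (K1 : set 'rV[R]_n) (theta : 'rV[R]_n -> 'rV[R]_n).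
Hypothesis K1_compact : compact K1.
Hypothesis theta_cts : forall x, K1 x -> cts_at theta x.

Let K1_closed : closed K1.
Proof. exact: (compact_closed (@norm_hausdorff _ _) K1_compact). Qed.

(** The image of the density [m] under [s *: theta], smeared by [k]. At [s = 0] it is a multiple of
    [k], at [s = 1] the smeared image under [theta] itself. *)
Definition push m (k : 'rV[R]_n -> R) (s : R) y : R :=
  integral_Rn (fun x => m x * k (y - s *: theta x)).

Lemma cts_push_arg (T : topologicalType) (a : T -> R) (b : T -> 'rV[R]_n) z x :
  K1 x -> cts_at a z -> cts_at b z ->
  cts_at (fun p : T * 'rV[R]_n => b p.1 - a p.1 *: theta p.2) (z, x).
Proof.
move=> Kx ca cb.
have c1 : cts_at (fun p : T * 'rV[R]_n => b p.1) (z, x) by exact: cts_at_fst.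
have c2 : cts_at (fun p : T * 'rV[R]_n => a p.1) (z, x) by exact: cts_at_fst.
have c3 : cts_at (fun p : T * 'rV[R]_n => theta p.2) (z, x).
  by apply: cts_at_snd; exact: theta_cts.
by apply: cts_at_sub => //; exact: cts_at_scale.
Qed.

Variables (B : R).
Hypothesis B_ge0 : 0 <= B.
Hypothesis K1_bound : forall x, K1 x -> `|x| <= B.

Lemma supp_bound m : (forall x, ~ K1 x -> m x = 0) -> forall x, B < `|x| -> m x = 0.
Proof. by move=> m0 x Bx; apply: m0 => /K1_bound; rewrite leNgt Bx. Qed.

Lemma cts_push_comp (T : topologicalType) m k (a : T -> R) (b : T -> 'rV[R]_n) :
  cts m -> (forall x, ~ K1 x -> m x = 0) -> cts k -> cts a -> cts b ->
  cts (fun z => push m k (a z) (b z)).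
Proof.
move=> cm m0 ck ca cb z.
apply: (@cts_integral_Rn R n T setT (fun z x => m x * k (b z - a z *: theta x)) B) => //.
- exact: openT.
- move=> z1 x _; apply: (cts_cut (G := fun z x => k (b z - a z *: theta x)) K1_closed cm m0) => Kx.
  apply: (@cts_at_comp _ _ _ _ (fun p : T * 'rV[R]_n => b p.1 - a p.1 *: theta p.2) k).
    exact: cts_push_arg.
  exact: ck.
- by move=> z1 x _ Bx; rewrite (supp_bound m0)// mul0r.
Qed.

(** Both arguments of [push] move with [r], because the lemma serves twice: for the derivative in
    the scale [s] at a fixed point, and for the derivative along a coordinate line at a fixed
    scale. *)
Lemma is_derive_push m k (a a' : R -> R) (b b' : R -> 'rV[R]_n) r :
  cts m -> (forall x, ~ K1 x -> m x = 0) ->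
  (forall x, differentiable k x) -> (forall i, cts (der (delta_mx 0 i) k)) ->
  (forall r, is_derive r (1 : R) a (a' r)) -> (forall r, is_derive r (1 : R) b (b' r)) ->
  cts a' -> cts b' ->
  is_derive r (1 : R) (fun r => push m k (a r) (b r))
    (\sum_i integral_Rn (fun x => m x * ((b' r - a' r *: theta x) 0 i *
       der (delta_mx 0 i) k (b r - a r *: theta x)))).
Proof.
move=> cm m0 dk cdk da db ca' cb'.
have ck : cts k by move=> x; exact: differentiable_cts_at.
have ca : cts a by move=> s; exact: is_derive_continuous (da s).
have cb : cts b.
  move=> s; apply: differentiable_cts_at; apply/derivable1_diffP.
  by have [] := db s.
pose g i (r : R) x := m x * ((b' r - a' r *: theta x) 0 i *
       der (delta_mx 0 i) k (b r - a r *: theta x)).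
have cg i z x : cts_at (fun p : R * 'rV[R]_n => g i p.1 p.2) (z, x).
  apply: (cts_cut (G := fun r x => (b' r - a' r *: theta x) 0 i *
       der (delta_mx 0 i) k (b r - a r *: theta x)) K1_closed cm m0) => Kx.
  apply: (@continuous_mul _ _ (fun p : R * 'rV[R]_n => (b' p.1 - a' p.1 *: theta p.2) 0 i)
     (fun p : R * 'rV[R]_n => der (delta_mx 0 i) k (b p.1 - a p.1 *: theta p.2))).
    have c1 : cts_at (fun p : R * 'rV[R]_n => b' p.1 - a' p.1 *: theta p.2) (z, x).
      exact: cts_push_arg.
    exact: (continuous_mxP _ _).1 c1 0 i.
  apply: (@cts_at_comp _ _ _ _ (fun p : R * 'rV[R]_n => b p.1 - a p.1 *: theta p.2)
     (der (delta_mx 0 i) k)); last exact: cdk.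
  exact: cts_push_arg.
have cgs i z : cts (g i z).
  move=> x; exact: (cvg_param_slice (cg i z x)).
have g0 i z x : B < `|x| -> g i z x = 0 by move=> Bx; rewrite /g (supp_bound m0)// mul0r.
rewrite -(@integral_Rn_sum R n _ _ (fun i => g i r) B)//; last by move=> i x; exact: g0.
apply: (@is_derive_integral_Rn R n setT (fun r x => m x * k (b r - a r *: theta x))
  (fun r x => \sum_i g i r x) B) => //.
- exact: openT.
- move=> z x _; apply: (cts_cut (G := fun z x => k (b z - a z *: theta x)) K1_closed cm m0) => Kx.
  apply: (@cts_at_comp _ _ _ _ (fun p : R * 'rV[R]_n => b p.1 - a p.1 *: theta p.2) k).
    exact: cts_push_arg.
  exact: ck.
- move=> z x _; apply: (@continuous_bigsum R _ _ _ (fun i (p : R * 'rV[R]_n) => g i p.1 p.2)) => i.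
  exact: cg.
- move=> z x _.
  have dda : differentiable a z by apply/derivable1_diffP; have [] := da z.
  have ddb : differentiable b z by apply/derivable1_diffP; have [] := db z.
  have dc : differentiable (fun r => b r - a r *: theta x) z.
    by apply: differentiable_sub => //; exact: differentiableZl.
  have Dc : der (1 : R) (fun r => b r - a r *: theta x) z = b' z - a' z *: theta x.
    rewrite (derive_sub _ ddb (differentiableZl (theta x) dda)) derive_scalel//.
    by rewrite (der_val (da z)) (der_val (db z)).
  have dk' := dk (b z - a z *: theta x).
  have dkc : differentiable (fun r => k (b r - a r *: theta x)) z by exact: (differentiable_comp dc dk').
  have dmk : differentiable (fun r => m x * k (b r - a r *: theta x)) z.
    by apply: differentiable_mul => //; exact: differentiable_const.
  apply: (is_derive_eq (is_derive_der (1 : R) dmk)).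
  rewrite (derive_mul (1 : R) (differentiable_const (m x) z) dkc) derive_const mul0r add0r.
  by rewrite (derive_comp (1 : R) dc dk') Dc (derive_row _ dk') mulr_sumr.
- by move=> z x _ Bx; rewrite (supp_bound m0)// mul0r.
- by move=> z x _ Bx; rewrite big1// => i _; exact: g0.
Qed.

(* The derivative in [s] of the mass of [push h k s] is the integral of a divergence in [y],
   so the mass at [s = 1] equals that at [s = 0]; this replaces an appeal to Fubini. *)
Lemma integral_push h (k : 'rV[R]_n -> R) (Bk : R) : 0 <= Bk ->
  cts h -> (forall x, ~ K1 x -> h x = 0) ->
  (forall x, differentiable k x) -> (forall i, cts (der (delta_mx 0 i) k)) ->
  (forall x, Bk < `|x| -> k x = 0) ->
  integral_Rn (push h k 1) = integral_Rn h * integral_Rn k.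
Proof.
move=> Bk0 ch h0 dk cdk k0.
have ck : cts k by move=> x; exact: differentiable_cts_at.
have [C C0 HC] := compact_norm_bound K1_compact theta_cts.
(* A bound of the support in [y], uniform for [|s| < 2]. This open range contains both ends 0 and
   1. *)
pose Bt := Bk + 2 * C.
have Bt0 : 0 <= Bt by rewrite addr_ge0// mulr_ge0.
have far (s : R) x y : `|s| < 2 -> K1 x -> Bt < `|y| -> Bk < `|y - s *: theta x|.
  move=> s2 Kx By; have := lerB_dist y (s *: theta x); apply: lt_le_trans.
  rewrite ltrBrDr (le_lt_trans _ By)// /Bt lerD2l normrZ.
  by apply: ler_pM => //; [exact: ltW|exact: HC].
have push0 m kk (s : R) y : (forall x, ~ K1 x -> m x = 0) ->
    (forall x, Bk < `|x| -> kk x = 0) -> `|s| < 2 -> Bt < `|y| -> push m kk s y = 0.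
  move=> m0 kk0 s2 By; rewrite /push -[RHS](integral_Rn0 n); congr integral_Rn.
  apply/funext => x; have [Kx|Kx] := pselect (K1 x); last by rewrite m0// mul0r.
  by rewrite kk0 ?mulr0//; exact: far.
pose hi i x := h x * theta x 0 i.
have chi i : cts (hi i).
  move=> x.
  have c : cts_at (fun p : R * 'rV[R]_n => h p.2 * theta p.2 0 i) (0, x).
    apply: (cts_cut (G := fun (r : R) x => theta x 0 i) K1_closed ch h0) => Kx.
    apply: (@cts_at_snd R R 'rV[R]_n R (fun x => theta x 0 i) (0, x)).
    exact: (continuous_mxP _ _).1 (theta_cts Kx) 0 i.
  exact: (@cvg_param_slice R R _ (fun _ x => h x * theta x 0 i) 0 x c).
have hi0 i x : ~ K1 x -> hi i x = 0 by move=> Kx; rewrite /hi h0// mul0r.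
pose dki i := der (delta_mx 0 i) k.
have dki0 i x : Bk < `|x| -> dki i x = 0 by exact: der_out.
have cst_cts (T : topologicalType) (V : normedModType R) (w : V) : cts (fun _ : T => w).
  by move=> z; exact: cts_at_cst.
have cid : cts (fun r : R => r) by move=> r; exact: cts_at_id.
have cpush m kk s : cts m -> (forall x, ~ K1 x -> m x = 0) -> cts kk -> cts (push m kk s).
  move=> cm m0 ckk; apply: (@cts_push_comp 'rV[R]_n m kk (fun=> s) (fun y => y)) => //.
  by move=> y; exact: cts_at_id.
have cpush2 m kk : cts m -> (forall x, ~ K1 x -> m x = 0) -> cts kk ->
    cts (fun p : R * 'rV[R]_n => push m kk p.1 p.2).
  move=> cm m0 ckk; apply: (@cts_push_comp (R * 'rV[R]_n)%type m kk (fun p => p.1) (fun p => p.2)) => //.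
    by move=> p; exact: cvg_fst.
  by move=> p; exact: cvg_snd.
pose V' s y := \sum_i - push (hi i) (dki i) s y.
have dV s y : is_derive s (1 : R) (fun s => push h k s y) (V' s y).
  have H := @is_derive_push h k (fun s => s) (fun=> 1) (fun=> y) (fun=> 0) s ch h0 dk cdk
    (fun r => is_derive_id r 1) (fun r => is_derive_cst y r 1) (cst_cts _ _ _) (cst_cts _ _ _).
  apply: (is_derive_eq H); apply: eq_bigr => i _.
  rewrite /push -mulN1r -(@integral_RnZ R n _ _ B)//.
  - congr integral_Rn; apply/funext => x; rewrite sub0r scale1r [(- theta x) 0 i]mxE /hi /dki; ring.
  - move=> x.
    have c : cts_at (fun p : R * 'rV[R]_n => hi i p.2 * dki i (y - s *: theta p.2)) (0, x).
      apply: (cts_cut (G := fun (r : R) x => dki i (y - s *: theta x)) K1_closed (chi i) (hi0 i)) => Kx.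
      apply: (@cts_at_comp _ _ _ _ (fun p : R * 'rV[R]_n => y - s *: theta p.2) (dki i)); last exact: cdk.
      by apply: (@cts_push_arg R (fun=> s) (fun=> y)) => //; exact: cts_at_cst.
    exact: (@cvg_param_slice R R _ (fun _ x => hi i x * dki i (y - s *: theta x)) 0 x c).
  - by move=> x Bx; rewrite (supp_bound (hi0 i))// mul0r.
have intV' (s : R) : `|s| < 2 -> integral_Rn (V' s) = 0.
  move=> s2; rewrite /V'.
  rewrite (@integral_Rn_sum R n _ _ (fun i y => - push (hi i) (dki i) s y) Bt)//.
  - apply: big1 => i _.
    apply: (@integral_Rn_derive_line R n (fun y => - push (hi i) k s y) _ i Bt) => //.
    + by move=> y; apply: cts_at_opp; exact: (cpush (hi i) k s (chi i) (hi0 i) ck y).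
    + by move=> y; apply: cts_at_opp; exact: (cpush (hi i) (dki i) s (chi i) (hi0 i) (cdk i) y).
    + move=> y; have db r : is_derive r (1 : R) (fun r : R => y + r *: (delta_mx 0 i : 'rV[R]_n)) (delta_mx 0 i).
        have dd : differentiable (fun r : R => y + r *: (delta_mx 0 i : 'rV[R]_n)) r.
          by apply: differentiable_add; [exact: differentiable_const|exact: differentiableZl].
        apply: (is_derive_eq (is_derive_der (1 : R) dd)).
        rewrite derive_add ?derive_const ?add0r; [|exact: differentiable_const|exact: differentiableZl].
        by rewrite derive_scalel// derive_id_val scale1r.
      have H := @is_derive_push (hi i) k (fun=> s) (fun=> 0)
        (fun r : R => y + r *: (delta_mx 0 i : 'rV[R]_n)) (fun=> delta_mx 0 i) 0 (chi i) (hi0 i) dk cdk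
        (fun r => is_derive_cst s r 1) db (cst_cts _ _ _) (cst_cts _ _ _).
      apply: (is_derive_eq (is_deriveN H)); congr (- _).
      rewrite (bigD1 i)//= [X in _ + X]big1 ?addr0.
        rewrite /push; congr integral_Rn; apply/funext => x.
        by rewrite scale0r subr0 scale0r addr0 mxE !eqxx mul1r.
      move=> j ji; rewrite -[RHS](integral_Rn0 n); congr integral_Rn; apply/funext => x.
      by rewrite scale0r subr0 mxE eqxx (negPf ji) mul0r mulr0.
    + by move=> y By; rewrite push0 ?oppr0//; exact: hi0.
    + by move=> y By; rewrite push0 ?oppr0//; [exact: hi0|exact: dki0].
  - by move=> i y; apply: cts_at_opp; exact: (cpush (hi i) (dki i) s (chi i) (hi0 i) (cdk i) y).
  - by move=> i y By; rewrite push0 ?oppr0//; [exact: hi0|exact: dki0].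
have dD (s : R) : `|s| < 2 -> is_derive s (1 : R) (fun s => integral_Rn (push h k s)) 0.
  move=> s2; rewrite -(intV' s s2).
  apply: (@is_derive_integral_Rn R n [set r : R | `|r| < 2] (push h k) V' Bt) => //.
  - apply: (@open_comp _ _ (fun r : R => `|r|) [set r | r < 2]); last exact: open_lt.
    by move=> y _; exact: norm_continuous.
  - by move=> z x _; exact: cpush2.
  - move=> z x _; apply: (@continuous_bigsum R _ _ _ (fun i (p : R * 'rV[R]_n) => - push (hi i) (dki i) p.1 p.2)) => i.
    by apply: cts_at_opp; exact: (cpush2 (hi i) (dki i) (chi i) (hi0 i) (cdk i) (z, x)).
  - by move=> z x z2; exact: push0.
  - move=> z x z2 Bx; apply: big1 => i _; rewrite push0 ?oppr0//; [exact: hi0|exact: dki0].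
have [||c _] := @MVT R (fun s => integral_Rn (push h k s)) (fun=> 0) 0 1 ltr01.
- move=> s; rewrite in_itv /= => /andP[s0 s1]; apply: dD; rewrite gtr0_norm//.
  by apply: lt_trans s1 _; rewrite ltr1n.
- apply: derivable_within_continuous => s; rewrite in_itv /= => /andP[s0 s1].
  suff H : is_derive s (1 : R) (fun s => integral_Rn (push h k s)) 0 by [].
  by apply: dD; rewrite ger0_norm// (le_lt_trans s1)// ltr1n.
rewrite mul0r => /eqP; rewrite subr_eq0 => /eqP ->.
rewrite -(@integral_RnZ R n _ _ Bk)//; congr integral_Rn; apply/funext => y.
have hs := supp_bound h0.
transitivity (integral_Rn (fun x => k y * h x)).
  by congr integral_Rn; apply/funext => x; rewrite scale0r subr0 mulrC.
by rewrite (@integral_RnZ R n h (k y) B) // mulrC.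
Qed.

End PushForward.

(** * Substitution for integrands of compact support *)

Section ChangeOfVariables.
Context {R : realType} {n : nat}.
Local Notation E := 'rV[R]_n.
Implicit Types (x y w : E).

Let k0 : E -> R := rbump (1%:M : 'M[R]_n).
Let kint : R := integral_Rn k0.

Lemma quad1E w : quad (1%:M : 'M[R]_n) w = euclid w.
Proof. by rewrite /quad mulmx1. Qed.

Lemma rbump1_out w : 1 < `|w| -> k0 w = 0.
Proof.
move=> w1; apply: rbump_out; rewrite quad1E; apply: lt_le_trans (euclid_ge_norm w).
by rewrite -[ltLHS](expr1n _ 2) ltr_sqr ?nnegrE.
Qed.

Lemma rbump1N w : k0 (- w) = k0 w.
Proof.
rewrite /k0 /rbump (_ : quad 1%:M (- w) = quad 1%:M w)//.
by rewrite -[- w]scaleN1r quad_scale sqrrN expr1n mul1r.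
Qed.

Lemma rbump1_diff w : differentiable k0 w.
Proof. by apply: differentiable_rbump; [exact: differentiable_const|exact: differentiable_id]. Qed.

Lemma rbump1_cts : cts k0.
Proof. by move=> w; apply: differentiable_cts_at; exact: rbump1_diff. Qed.

Lemma rbump1_der w v : der v k0 w = - dpos_sqr (1 - euclid w) * (2 * (v *m w^T) 0 0).
Proof.
rewrite /k0 (derive_rbump v (S := fun=> 1%:M) (w := fun w => w) (x := w) (trmx1 _ _)
      (differentiable_const _ w) (differentiable_id w)).
rewrite derive_const derive_id_val quad1E mulmx1.
by rewrite (_ : quad 0 w = 0) ?add0r// /quad mulmx0 mul0mx mxE.
Qed.

Lemma rbump1_der_cts v : cts (der v k0).
Proof.
move=> w; rewrite (_ : der v k0 = fun w => - dpos_sqr (1 - euclid w) * (2 * (v *m 1%:M *m w^T) 0 0)); last first.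
  by apply/funext => y; rewrite rbump1_der mulmx1.
have c1 : cts_at (fun y : E => 1 + -1 * quad 1%:M y) w.
  apply: continuous_add; first exact: cts_at_cst.
  by apply: continuous_cmul; apply: cts_quad_comp; [exact: cts_at_cst|exact: cts_at_id].
apply: continuous_mul.
  rewrite (_ : (fun y => _) = fun y => -1 * dpos_sqr (1 + -1 * quad 1%:M y)); last first.
    by apply/funext => y; rewrite !mulN1r quad1E.
  apply: continuous_cmul; apply: (@cts_at_comp _ _ _ _ (fun y => 1 + -1 * quad 1%:M y) dpos_sqr) => //.
  exact: dpos_sqr_cts.
apply: continuous_cmul; apply: cts_quad2_comp; [exact: cts_at_cst..|exact: cts_at_id].
Qed.

Lemma kint_gt0 : 0 < kint.
Proof.
apply: (@integral_Rn_gt0 R n k0 1) => //.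
- exact: rbump1_cts.
- exact: rbump1_out.
- by move=> x; exact: rbump_ge0.
- by rewrite /k0 /rbump /quad mulmx1 mul0mx mxE subr0 /pos_sqr ler01 expr1n.
Qed.

Variables (O1 O2 K1 K2 : set E) (theta eta : E -> E) (f h : E -> R).
Hypotheses (oO1 : open O1) (oO2 : open O2).
Hypotheses (theta_smooth : smooth_on O1 theta) (eta_smooth : smooth_on O2 eta).
Hypotheses (thetaO : forall x, O1 x -> O2 (theta x)) (etaO : forall y, O2 y -> O1 (eta y)).
Hypotheses (thetaK : forall x, O1 x -> eta (theta x) = x).
Hypotheses (etaK : forall y, O2 y -> theta (eta y) = y).
Hypothesis jac_gt0 : forall x, O1 x -> 0 < \det ('J theta x).
Hypotheses (K1_compact : compact K1) (K2_compact : compact K2).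
Hypotheses (K1O : K1 `<=` O1) (K2O : K2 `<=` O2).
Hypotheses (f_cts : cts f) (h_cts : cts h).
Hypotheses (h_out : forall x, ~ K1 x -> h x = 0) (f_out : forall y, ~ K2 y -> f y = 0).
Hypothesis hE : forall x, O1 x -> h x = f (theta x) * \det ('J theta x).

Let K1_closed : closed K1.
Proof. exact: (compact_closed (@norm_hausdorff _ _) K1_compact). Qed.

Let K2_closed : closed K2.
Proof. exact: (compact_closed (@norm_hausdorff _ _) K2_compact). Qed.

Let theta_cts x : K1 x -> cts_at theta x.
Proof. by move=> /K1O Ox; apply: differentiable_cts_at; exact: (smooth_diff theta_smooth Ox). Qed.

Let eta_cts y : O2 y -> cts_at eta y.
Proof. by move=> Oy; apply: differentiable_cts_at; exact: (smooth_diff eta_smooth Oy). Qed.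

(** The smeared image of [h] at scale [|e|], with the limit to be proved as its value at [e = 0].
    The absolute value defines it on both sides of 0, so the limit is plain continuity at an
    interior point. *)
Definition mollified (p : R * E) : R :=
  if p.1 == 0 then f p.2 * kint
  else `|p.1|^-1 ^+ n * integral_Rn (fun x => h x * k0 (`|p.1|^-1 *: (p.2 - theta x))).

Variables (B : R).
Hypothesis B_ge0 : 0 <= B.
Hypothesis K1_bound : forall x, K1 x -> `|x| <= B.
Hypothesis K2_bound : forall x, K2 x -> `|x| <= B.

Lemma mollified_out e y : `|e| < 1 -> B + 1 < `|y| -> mollified (e, y) = 0.
Proof.
move=> e1 By; rewrite /mollified /=; case: eqVneq => [_|e0].
  rewrite (supp_bound K2_bound f_out) ?mul0r//.
  by apply: lt_trans By; rewrite ltrDl.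
rewrite [X in _ * X](_ : _ = 0) ?mulr0// -[RHS](integral_Rn0 n); congr integral_Rn.
apply/funext => x; have [Kx|Kx] := pselect (K1 x); last by rewrite h_out// mul0r.
have [K2x|K2x] := pselect (K2 (theta x)); last by rewrite hE ?f_out ?mul0r//; exact: K1O.
rewrite rbump1_out ?mulr0// normrZ normfV normr_id ltr_pdivlMl ?normr_gt0// mulr1.
have := lerB_dist y (theta x); apply: lt_le_trans.
by rewrite ltrBrDr (le_lt_trans _ By)// addrC lerD ?K2_bound// ltW.
Qed.

Lemma mollified_cts_neq0 e y : e != 0 -> cts_at mollified (e, y).
Proof.
move=> e0.
pose N : set (R * E) := [set p | p.1 != 0].
have oN : open N.
  rewrite (_ : N = [set r | r != 0] `*` setT); last by apply/seteqP; split=> p //= [].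
  by apply: open_fst; exact: open_neq.
have cinv p : N p -> cts_at (fun p : R * E => `|p.1|^-1) p.
  move=> Np; apply: cts_at_inv; first by rewrite normr_eq0.
  by apply: cts_at_norm; exact: cvg_fst.
pose g (p : R * E) : R := `|p.1|^-1 ^+ n * integral_Rn (fun x => h x * k0 (`|p.1|^-1 *: (p.2 - theta x))).
apply: (@cts_at_near_eq R _ R g).
  have : nbhs (e, y) N by apply: open_nbhs_nbhs; split.
  by apply: filterS => p Np; rewrite /mollified (negPf Np).
apply: (@continuous_mul _ _ (fun p : R * E => `|p.1|^-1 ^+ n)).
  apply: (@cts_at_comp R _ _ R (fun p : R * E => `|p.1|^-1) (fun r => r ^+ n)).
    exact: cinv.
  by apply: differentiable_cts_at; apply/derivable1_diffP; exact: exprn_derivable.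
apply: (@cts_integral_Rn R n _ N (fun p x => h x * k0 (`|p.1|^-1 *: (p.2 - theta x))) B) => //.
- move=> z x Nz.
  apply: (cts_cut (G := fun (p : R * E) (x : E) => k0 (`|p.1|^-1 *: (p.2 - theta x))) K1_closed h_cts h_out) => Kx.
  have c1 : cts_at (fun q : (R * E) * E => `|q.1.1|^-1) (z, x).
    exact: (@cts_at_fst R _ E R (fun p : R * E => `|p.1|^-1) (z, x) (cinv z Nz)).
  have c2 : cts_at (fun q : (R * E) * E => q.1.2) (z, x).
    by apply: (cvg_comp _ _ cvg_fst); exact: cvg_snd.
  have c3 : cts_at (fun q : (R * E) * E => theta q.2) (z, x).
    by apply: (@cts_at_snd R _ E E theta (z, x)); exact: theta_cts.
  have c4 : cts_at (fun q : (R * E) * E => `|q.1.1|^-1 *: (q.1.2 - theta q.2)) (z, x).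
    by apply: cts_at_scale => //; exact: cts_at_sub.
  apply: (@cts_at_comp _ _ _ _ (fun q : (R * E) * E => `|q.1.1|^-1 *: (q.1.2 - theta q.2)) k0).
    exact: c4.
  exact: rbump1_cts.
- by move=> z x _ Bx; rewrite (supp_bound K1_bound h_out)// mul0r.
Qed.

(** A point [x] contributes only if [theta x] lies in [K2], which stays at distance [r] from [y].
    For [|e| < r / 2] and arguments within [r / 2] of [y] the kernel does not reach that far. *)
Lemma mollified_cts_out y : ~ K2 y -> cts_at mollified (0, y).
Proof.
move=> K2y; apply: (@cts_at_near_eq _ _ _ (fun=> 0)); last exact: cts_at_cst.
have [r /= r0 Hr] := (nbhs_ballP y _).1 (open_nbhs_nbhs (conj (closed_openC K2_closed) K2y)).
have r20 : 0 < r / 2 by rewrite divr_gt0.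
have N1 : \forall p \near ((0 : R), y), ball y (r / 2) p.2.
  by apply: near_snd; exact: nbhsx_ballx.
have N2 : \forall p \near ((0 : R), y), `|p.1| < r / 2.
  apply: (near_fst (P := fun s : R => `|s| < r / 2)).
  apply: filterS ((cts_atP _ _).1 (@cts_at_id R R 0) _ r20) => s /=.
  by rewrite sub0r normrN.
near=> p.
have p2 : ball y (r / 2) p.2 by near: p.
have p1 : `|p.1| < r / 2 by near: p.
have ball2 : ball y r p.2 by apply: le_ball p2; rewrite ler_pdivrMr// ler_pMr// ler1n.
rewrite /mollified; case: eqVneq => [_|e0].
  by rewrite f_out ?mul0r//; exact: Hr.
rewrite [X in _ * X](_ : _ = 0) ?mulr0//.
rewrite -[RHS](integral_Rn0 n); congr integral_Rn; apply/funext => x.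
have [Kx|Kx] := pselect (K1 x); last by rewrite h_out// mul0r.
have [K2x|K2x] := pselect (K2 (theta x)); last by rewrite hE ?f_out ?mul0r//; exact: K1O.
rewrite rbump1_out ?mulr0// normrZ normfV normr_id ltr_pdivlMl ?normr_gt0// mulr1.
rewrite ltNge; apply/negP => h1.
apply: (Hr (theta x)) => //; move: p2; rewrite -!ball_normE /ball_ /= => p2.
rewrite -(subrKA p.2) (le_lt_trans (ler_normD _ _))// [ltRHS](splitr r) ltrD//.
exact: le_lt_trans h1 p1.
Unshelve. all: by end_near. Qed.

(* Substitute [x = eta y + e w] and let [e] tend to [0] under the integral. *)
Lemma mollified_cts_in y0 : O2 y0 -> cts_at mollified (0, y0).
Proof.
move=> Oy0.
have [L [r [L0 r0 Br Lder Llip]]] := local_lipschitz oO2 eta_smooth Oy0.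
pose x0 := eta y0.
have Ox0 : O1 x0 by exact: etaO.
pose F (p : R * E) w := h (eta p.2 + `|p.1| *: w) * k0 (diff_quot theta `|p.1| (eta p.2) w).
have [d /= d0 Hd] := (nbhs_ballP x0 _).1 (open_nbhs_nbhs (conj oO1 Ox0)).
have L10 : 0 < L + 2 by rewrite ltr_wpDl.
(* The radii [r / 2] leave both [p.2] and a point within [|p.1|] of it inside the ball of the
   Lipschitz bound; the other two conditions keep [eta p.2 + |p.1| w] in [O1] for [|w| < L + 2]. *)
pose N : set (R * E) := [set p | [/\ `|p.1| < r / 2, `|p.1| < d / 2 / (L + 2),
   ball y0 (r / 2) p.2 & ball x0 (d / 2) (eta p.2)]].
have N_nbhs : nbhs ((0 : R), y0) N.
  have near0 (c : R) : 0 < c -> \forall p \near ((0 : R), y0), `|p.1| < c.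
    move=> c0; apply: (near_fst (P := fun s : R => `|s| < c)).
    apply: filterS ((cts_atP _ _).1 (@cts_at_id R R 0) _ c0) => s /=.
    by rewrite sub0r normrN.
  have H1 := near0 _ (divr_gt0 r0 (ltr0n R 2)).
  have H2 := near0 _ (divr_gt0 (divr_gt0 d0 (ltr0n R 2)) L10).
  have H3 : \forall p \near ((0 : R), y0), ball y0 (r / 2) p.2.
    by apply: near_snd; apply: nbhsx_ballx; rewrite divr_gt0.
  have H4 : \forall p \near ((0 : R), y0), ball x0 (d / 2) (eta p.2).
    apply: (near_snd (P := fun y => ball x0 (d / 2) (eta y))).
    by apply: (eta_cts Oy0); apply: nbhsx_ballx; rewrite divr_gt0.
  apply: filterS (filterI H1 (filterI H2 (filterI H3 H4))) => p [a [b [c e]]].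
  by split.
pose N' := interior N.
have oN' : open N' by exact: open_interior.
have N'0 : N' (0, y0) by [].
have NN' p : N' p -> N p by exact: interior_subset.
have in_ball p w : N p -> `|w| < L + 2 -> O1 (eta p.2 + `|p.1| *: w).
  move=> [_ a _ b] wL; apply: Hd; move: b; rewrite -!ball_normE /ball_ /= => b.
  rewrite opprD addrA (le_lt_trans (ler_normB _ _))// [ltRHS](splitr d) ltr_leD//.
  rewrite normrZ normr_id -[leRHS](divfK (lt0r_neq0 L10)) ler_pM// ltW//.
have N_O2 p : N p -> O2 p.2.
  by move=> [_ _ a _]; apply: Br; apply: le_ball a; rewrite ler_pdivrMr// ler_pMr// ler1n.
have rr2 (y : E) : ball y0 (r / 2) y -> ball y0 r y.
  by move=> a; apply: le_ball a; rewrite ler_pdivrMr// ler_pMr// ler1n.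
(* The kernel keeps [theta x] within [|p.1|] of [p.2], so the Lipschitz bound of [eta] keeps [w]
   within [L]. For [p.1 = 0] the bound of the derivative of [eta] plays this part. The support in
   [w] is thus bounded uniformly in [p]. *)
have F_out p w : N p -> L < `|w| -> F p w = 0.
  move=> Np wL; have Op := N_O2 p Np; case: (Np) => a _ b _.
  rewrite /F; have [Kx|Kx] := pselect (K1 (eta p.2 + `|p.1| *: w)); last by rewrite h_out// mul0r.
  rewrite [X in _ * X](_ : _ = 0) ?mulr0//; apply: rbump1_out; rewrite ltNge; apply/negP.
  move=> q1; move: wL; rewrite ltNge => /negP; apply.
  move: q1; rewrite /diff_quot normr_eq0; case: eqVneq => [p10|p10] q1.
    have dt := smooth_diff theta_smooth (etaO Op).
    have de : differentiable eta (theta (eta p.2)).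
      by rewrite etaK//; exact: (smooth_diff eta_smooth Op).
    have E1 : der w (fun x => eta (theta x)) (eta p.2) = w.
      by rewrite (derive_eq_in w oO1 (etaO Op) thetaK) derive_id_val.
    rewrite -[in leLHS]E1 (derive_comp w dt de) etaK//.
    rewrite (le_trans (Lder _ _ (rr2 _ b)))//.
    by rewrite -[leRHS]mulr1 ler_wpM2l.
  have p1 : 0 < `|p.1| by rewrite normr_gt0.
  move: q1; rewrite normrZ normfV normr_id ler_pdivrMl// mulr1 etaK// => q1.
  have Ox := K1O Kx.
  have tb : ball y0 r (theta (eta p.2 + `|p.1| *: w)).
    move: b; rewrite -!ball_normE /ball_ /= => b.
    rewrite -(subrKA p.2) (le_lt_trans (ler_normD _ _))// [ltRHS](splitr r) ltrD//.
    by rewrite distrC (le_lt_trans q1).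
  have := Llip _ _ tb (rr2 _ b); rewrite thetaK// addrC addKr normrZ normr_id => H.
  by rewrite -(ler_pM2l p1) (le_trans H)// mulrC ler_wpM2r.
have F_cts p w : N' p -> cts_at (fun q : (R * E) * E => F q.1 q.2) (p, w).
  move=> N'p; have Np := NN' p N'p; have Op := N_O2 p Np.
  (* Either [F] vanishes near the point, or [|w| <= L], which is inside the radius [L + 2] where
     [theta] is only evaluated on [O1]. *)
  have [wL|wL] := ltP L `|w|.
    apply: (@cts_at_near_eq _ _ _ (fun=> 0)); last exact: cts_at_cst.
    have H1 : \forall q \near (p, w), N' q.1 by apply: near_fst; exact: open_nbhs_nbhs.
    have H2 : \forall q \near (p, w), L < `|q.2|.
      apply: (near_snd (P := fun w : E => L < `|w|)).
      exact: (@norm_continuous _ _ w _ (open_nbhs_nbhs (conj (@open_gt _ L) wL))).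
    by apply: filterS2 H1 H2 => q Nq Lq; rewrite F_out//; exact: NN'.
  have wL2 : `|w| < L + 2 by rewrite (le_lt_trans wL)// ltrDl.
  have cp1 : cts_at (fun q : (R * E) * E => `|q.1.1|) (p, w).
    apply: (@cts_at_fst R _ E R (fun p : R * E => `|p.1|) (p, w)).
    by apply: cts_at_norm; exact: cvg_fst.
  have cp2 : cts_at (fun q : (R * E) * E => eta q.1.2) (p, w).
    apply: (@cts_at_fst R _ E E (fun p : R * E => eta p.2) (p, w)).
    by apply: cts_at_snd; exact: eta_cts.
  have cp3 : cts_at (fun q : (R * E) * E => q.2) (p, w) by exact: cvg_snd.
  have cp4 : cts_at (fun q : (R * E) * E => eta q.1.2 + `|q.1.1| *: q.2) (p, w).
    by apply: cts_at_add => //; exact: cts_at_scale.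
  apply: (@continuous_mul _ _ (fun q : (R * E) * E => h (eta q.1.2 + `|q.1.1| *: q.2))).
    apply: (@cts_at_comp _ _ _ _ (fun q : (R * E) * E => eta q.1.2 + `|q.1.1| *: q.2) h).
      exact: cp4.
    exact: h_cts.
  have cQ : cts_at (fun q : (R * E) * E => diff_quot theta `|q.1.1| (eta q.1.2) q.2) (p, w).
    have [p10|p10] := eqVneq p.1 0.
      apply: (@cts_at_pair_comp R _ (R * E)%type E E
        (fun q : (R * E) * E => (`|q.1.1|, eta q.1.2)) (fun q => q.2)
        (fun s : (R * E) * E => diff_quot theta s.1.1 s.1.2 s.2) (p, w)) => //=.
        exact: (cvg_pair cp1 cp2).
      by rewrite p10 normr0; apply: cts_diff_quot0 oO1 theta_smooth _; exact: etaO.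
    apply: (@cts_at_near_eq _ _ _ (fun q : (R * E) * E =>
      `|q.1.1|^-1 *: (theta (eta q.1.2 + `|q.1.1| *: q.2) - theta (eta q.1.2)))).
      have H1 : \forall q \near (p, w), q.1.1 != 0.
        apply: (near_fst (P := fun q : R * E => q.1 != 0)).
        case: (p) p10 => a b /= a0.
        apply: (near_fst (P := fun s : R => s != 0)).
        have oS : open [set s : R | s != 0] by exact: open_neq.
        have : nbhs a [set s : R | s != 0] by apply: open_nbhs_nbhs; split.
        by apply: filterS.
      by apply: filterS H1 => q q0; rewrite /diff_quot normr_eq0 (negPf q0).
    apply: cts_at_scale; first by apply: cts_at_inv => //; rewrite normr_eq0.
    apply: cts_at_sub.
      apply: (@cts_at_comp _ _ _ _ (fun q : (R * E) * E => eta q.1.2 + `|q.1.1| *: q.2) theta) => //.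
      by apply: differentiable_cts_at; apply: (smooth_diff theta_smooth); exact: in_ball.
    apply: (@cts_at_comp _ _ _ _ (fun q : (R * E) * E => eta q.1.2) theta) => //.
    by apply: differentiable_cts_at; apply: (smooth_diff theta_smooth); exact: etaO.
  apply: (@cts_at_comp _ _ _ _ (fun q : (R * E) * E => diff_quot theta `|q.1.1| (eta q.1.2) q.2) k0) => //.
  exact: rbump1_cts.
apply: (@cts_at_near_eq R _ _ (fun p => integral_Rn (F p))); last first.
  by apply: (@cts_integral_Rn R n _ N' F L) => // z x /NN'; exact: F_out.
have : nbhs ((0 : R), y0) N' by exact: open_nbhs_nbhs.
apply: filterS => p N'p; have Np := NN' p N'p; have Op := N_O2 p Np.
rewrite /mollified; case: eqVneq => [p10|p10].
  rewrite /F p10 normr0 /diff_quot eqxx.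
  have dt := smooth_diff theta_smooth (etaO Op).
  have dE w : der w theta (eta p.2) = w *m 'J theta (eta p.2).
    by rewrite der.unlock deriveEjacobian.
  under eq_fun do rewrite scale0r addr0 dE.
  set J := 'J theta (eta p.2).
  have J0 : 0 < \det J by apply: jac_gt0; exact: etaO.
  have uJ : J \in unitmx by rewrite unitmxE unitfE gt_eqF.
  have [C C0 HC] := norm_mulmx_le (invmx J).
  rewrite (@integral_RnZ R n (fun w => k0 (w *m J)) _ C) ?(ltW C0)//.
  - rewrite hE; last exact: etaO.
    by rewrite etaK// -mulrA (mulrC (\det J)) integral_bump_linear.
  - move=> w.
    have dJ : differentiable (fun w : E => w *m J) w.
      by apply: differentiable_mulmx; [exact: differentiable_id|exact: differentiable_const].
    have cJ : cts_at (fun w : E => w *m J) w by exact: differentiable_cts_at.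
    apply: (@cts_at_comp R E E R (fun w : E => w *m J) k0); last exact: rbump1_cts.
    exact: cJ.
  - move=> w Cw; apply: rbump1_out; rewrite -(ltr_pM2l C0) mulr1 (lt_le_trans Cw)//.
    by have := HC (w *m J); rewrite mulmxK.
have l0 : 0 < `|p.1| by rewrite normr_gt0.
rewrite -(@integral_Rn_affine R n (fun x => h x * k0 (`|p.1|^-1 *: (p.2 - theta x))) B (eta p.2))//.
- congr integral_Rn; apply/funext => w; rewrite /F; congr (_ * _).
  rewrite /diff_quot gt_eqF// etaK// -rbump1N -scalerN opprB//.
- move=> x.
  have c : cts_at (fun q : R * E => h q.2 * k0 (`|p.1|^-1 *: (p.2 - theta q.2))) (0, x).
    apply: (cts_cut (G := fun (s : R) x => k0 (`|p.1|^-1 *: (p.2 - theta x))) K1_closed h_cts h_out) => Kx.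
    have c3 : cts_at (fun q : R * E => theta q.2) (0, x).
      by apply: (@cts_at_snd R R E E theta (0, x)); exact: theta_cts.
    have c4 : cts_at (fun q : R * E => `|p.1|^-1 *: (p.2 - theta q.2)) (0, x).
      by apply: cts_at_scale; [exact: cts_at_cst|apply: cts_at_sub => //; exact: cts_at_cst].
    apply: (@cts_at_comp _ _ E _ (fun q : R * E => `|p.1|^-1 *: (p.2 - theta q.2)) k0); first exact: c4.
    exact: rbump1_cts.
  exact: (@cvg_param_slice R R _ (fun _ x => h x * k0 (`|p.1|^-1 *: (p.2 - theta x))) 0 x c).
- by move=> x Bx; rewrite (supp_bound K1_bound h_out)// mul0r.
Qed.

(** For positive [e] the mollification is a [push] with the dilated kernel, whose mass
    [e ^+ n * kint] cancels the normalising factor. The integral therefore does not depend on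
    [e]. *)
Lemma integral_mollified e : 0 < e -> integral_Rn (fun y => mollified (e, y)) = integral_Rn h * kint.
Proof.
move=> e0.
pose k x := k0 (e^-1 *: x).
have ei0 : 0 < e^-1 by rewrite invr_gt0.
have dk x : differentiable k x.
  apply: (@differentiable_comp _ _ _ _ (fun x => e^-1 *: x) k0); last exact: rbump1_diff.
  by apply: differentiable_scale_cst; exact: differentiable_id.
have Dk v x : der v k x = e^-1 * der v k0 (e^-1 *: x).
  have d1 : differentiable (fun x : E => e^-1 *: x) x.
    by apply: differentiable_scale_cst; exact: differentiable_id.
  rewrite (derive_comp v d1 (rbump1_diff _)) derive_scale_cst; last exact: differentiable_id.
  by rewrite derive_id_val deriveZv//; exact: rbump1_diff.
have k_out x : e < `|x| -> k x = 0.
  by move=> ex; apply: rbump1_out; rewrite normrZ gtr0_norm// ltr_pdivlMl// mulr1.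
have ck : cts k by move=> x; exact: differentiable_cts_at.
have cdk i : cts (der (delta_mx 0 i) k).
  move=> x; rewrite (_ : der _ k = fun x => e^-1 * der (delta_mx 0 i) k0 (e^-1 *: x)); last first.
    by apply/funext => y; exact: Dk.
  have cs : cts_at (fun x : E => e^-1 *: x) x.
    apply: differentiable_cts_at; apply: differentiable_scale_cst; exact: differentiable_id.
  apply: continuous_cmul; apply: (@cts_at_comp _ _ _ _ (fun x : E => e^-1 *: x) (der (delta_mx 0 i) k0)) => //.
  exact: rbump1_der_cts.
have P := integral_push K1_compact theta_cts B_ge0 K1_bound (ltW e0) h_cts h_out dk cdk k_out.
have Ik : integral_Rn k = e ^+ n * kint.
  rewrite /kint -[X in X ^+ n](invrK e) -(@integral_Rn_affine R n k0 1 0 e^-1)//.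
  - by congr integral_Rn; apply/funext => x; rewrite add0r.
  - exact: rbump1_cts.
  - exact: rbump1_out.
have cpush1 : cts (push theta h k 1).
  apply: (@cts_push_comp R n K1 theta K1_compact theta_cts B B_ge0 K1_bound E h k (fun=> 1) (fun y => y)) => //.
    by move=> y; exact: cts_at_cst.
  by move=> y; exact: cts_at_id.
have [C C0 HC] := compact_norm_bound K1_compact theta_cts.
have push_out y : C + e < `|y| -> push theta h k 1 y = 0.
  move=> Cy; rewrite /push -[RHS](integral_Rn0 n); congr integral_Rn; apply/funext => x.
  have [Kx|Kx] := pselect (K1 x); last by rewrite h_out// mul0r.
  rewrite k_out ?mulr0// scale1r; have := lerB_dist y (theta x); apply: lt_le_trans.
  by rewrite ltrBrDr (le_lt_trans _ Cy)// addrC lerD2r; exact: HC.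
transitivity (integral_Rn (fun y => e^-1 ^+ n * push theta h k 1 y)).
  congr integral_Rn; apply/funext => y; rewrite /mollified gt_eqF//= gtr0_norm//.
  by congr (_ * integral_Rn _); apply/funext => x; rewrite scale1r.
rewrite (@integral_RnZ R n _ _ (C + e))//; last by rewrite addr_ge0// ltW.
have ee : e^-1 ^+ n * e ^+ n = 1 by rewrite -exprMn mulVf ?gt_eqF// expr1n.
by rewrite P Ik mulrCA (mulrA (e^-1 ^+ n)) ee mul1r.
Qed.

(** The integral of the mollification is constant for positive [e] and continuous at 0, where it is
    [kint] times the integral of [f]. The mass [kint] is positive and cancels. *)
Lemma change_of_variables : integral_Rn h = integral_Rn f.
Proof.
have B1 : 0 <= B + 1 by rewrite addr_ge0.
have cI : cts_at (fun e : R => integral_Rn (fun y => mollified (e, y))) 0.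
  apply: (@cts_integral_Rn R n R [set e : R | `|e| < 1] (fun e y => mollified (e, y)) (B + 1)) => //.
  - apply: (@open_comp _ _ (fun r : R => `|r|) [set r | r < 1]); last exact: open_lt.
    by move=> y _; exact: norm_continuous.
  - move=> e y _; rewrite (_ : (fun p => _) = mollified); last by apply/funext => -[].
    have [->|e0] := eqVneq e 0; last exact: mollified_cts_neq0.
    have [Ky|Ky] := pselect (K2 y); last exact: mollified_cts_out.
    by apply: mollified_cts_in; exact: K2O.
  - by move=> e y e1; exact: mollified_out.
  - by rewrite /= normr0.
have E0 : integral_Rn (fun y => mollified (0, y)) = kint * integral_Rn f.
  have fs := supp_bound K2_bound f_out.
  rewrite -(@integral_RnZ R n f kint B)//.
  by congr integral_Rn; apply/funext => y; rewrite /mollified eqxx mulrC.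
have key : integral_Rn h * kint = kint * integral_Rn f.
  rewrite -E0; apply/eqP; rewrite eq_sym -subr_eq0 -normr_eq0; apply/eqP/le_anti.
  rewrite normr_ge0 andbT; apply/ler_addgt0Pl => e e0; rewrite addr0.
  have [d /= d0 Hd] := (nbhs_ballP (0 : R) _).1 ((cts_atP _ _).1 cI e e0).
  have d20 : 0 < d / 2 by rewrite divr_gt0.
  rewrite -(integral_mollified d20); apply/ltW; apply: Hd.
  rewrite -ball_normE /ball_ /= sub0r normrN gtr0_norm//.
  by rewrite ltr_pdivrMr// ltr_pMr// ltr1n.
by apply: (mulfI (lt0r_neq0 kint_gt0)); rewrite -key mulrC.
Qed.

End ChangeOfVariables.

(** * Levi-Civita connection and curvature *)

Section InnerProduct.
Context {R : realType} {n : nat}.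
Implicit Types (G B : 'M[R]_n) (u v w : 'rV[R]_n).

Lemma ipDl G u v w : ip G (u + v) w = ip G u w + ip G v w.
Proof. by rewrite /ip !mulmxDl mxE. Qed.

Lemma ipZl G k u w : ip G (k *: u) w = k * ip G u w.
Proof. by rewrite /ip -!scalemxAl mxE. Qed.

Lemma ip0l G w : ip G 0 w = 0.
Proof. by rewrite -(scale0r (0 : 'rV[R]_n)) ipZl mul0r. Qed.

Lemma ipNl G u w : ip G (- u) w = - ip G u w.
Proof. by rewrite -scaleN1r ipZl mulN1r. Qed.

Lemma ipBl G u v w : ip G (u - v) w = ip G u w - ip G v w.
Proof. by rewrite ipDl ipNl. Qed.

Lemma ip_suml G (J : Type) (r : seq J) (P : pred J) (F : J -> 'rV[R]_n) w :
  ip G (\sum_(j <- r | P j) F j) w = \sum_(j <- r | P j) ip G (F j) w.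
Proof. by apply: (big_morph (fun u => ip G u w)) => [u v|]; rewrite ?ipDl ?ip0l. Qed.

Lemma ipDr G u v w : ip G u (v + w) = ip G u v + ip G u w.
Proof. by rewrite /ip linearD mulmxDr mxE. Qed.

Lemma ipZr G k u w : ip G u (k *: w) = k * ip G u w.
Proof. by rewrite /ip linearZ /= -scalemxAr mxE. Qed.

Lemma ip0r G w : ip G w 0 = 0.
Proof. by rewrite -(scale0r (0 : 'rV[R]_n)) ipZr mul0r. Qed.

Lemma ipNr G u w : ip G u (- w) = - ip G u w.
Proof. by rewrite -scaleN1r ipZr mulN1r. Qed.

Lemma ip_sumr G (J : Type) (r : seq J) (P : pred J) (F : J -> 'rV[R]_n) w :
  ip G w (\sum_(j <- r | P j) F j) = \sum_(j <- r | P j) ip G w (F j).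
Proof. by apply: (big_morph (fun u => ip G w u)) => [u v|]; rewrite ?ipDr ?ip0r. Qed.

Lemma ipDm G B u v : ip (G + B) u v = ip G u v + ip B u v.
Proof. by rewrite /ip mulmxDr mulmxDl mxE. Qed.

Lemma ip_mull G B u v : ip G (u *m B) v = ip (B *m G) u v.
Proof. by rewrite /ip !mulmxA. Qed.

Lemma ip_mulr G B u v : ip G u (v *m B) = ip (G *m B^T) u v.
Proof. by rewrite /ip trmx_mul !mulmxA. Qed.

Lemma ip_sym G u v : G^T = G -> ip G u v = ip G v u.
Proof.
move=> sG; rewrite /ip; have <- : (v *m G *m u^T)^T = u *m G *m v^T.
  by rewrite !trmx_mul trmxK sG mulmxA.
by rewrite mxE.
Qed.

Lemma ip_delta G i j : ip G (delta_mx 0 i) (delta_mx 0 j) = G i j.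
Proof. by rewrite /ip -rowE trmx_delta -colE !mxE. Qed.

Lemma ip_inj G B : (forall u v, ip G u v = ip B u v) -> G = B.
Proof. by move=> GB; apply/matrixP => i j; rewrite -!ip_delta GB. Qed.

Lemma ip_nondegenerate G u v : G \in unitmx -> (forall w, ip G u w = ip G v w) -> u = v.
Proof.
move=> uG uv; apply: (can_inj (mulmxK uG)); apply/rowP => j.
have := uv (delta_mx 0 j); rewrite /ip trmx_delta -!colE !mxE; exact.
Qed.

Lemma pos_unitmx G : (forall u, u != 0 -> 0 < ip G u u) -> G \in unitmx.
Proof.
move=> pG; rewrite -row_free_unit -kermx_eq0; apply/eqP/row_matrixP => i; rewrite row0.
apply: contraTeq (negbT (ltxx (0 : R))) => r0; rewrite negbK.
have := pG _ r0; rewrite /ip -row_mul mulmx_ker row0 mul0mx mxE; exact.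
Qed.

Let frame_mx (e : 'I_n -> 'rV[R]_n) : 'M[R]_n := \matrix_(a, j) e a 0 j.

Let frame_mxE G e : (forall a b, ip G (e a) (e b) = (a == b)%:R) ->
  frame_mx e *m (G *m (frame_mx e)^T) = 1%:M.
Proof.
have rM a : row a (frame_mx e) = e a by apply/rowP => j; rewrite !mxE.
move=> eG; apply: ip_inj => u v; rewrite mulmxA -ip_mulr -ip_mull mulmx_sum_row (mulmx_sum_row v).
rewrite ip_suml /ip mulmx1 mxE; apply: eq_bigr => a _; rewrite -/(ip _ _ _) rM ipZl ip_sumr.
rewrite (bigD1 a)//= big1 ?addr0 ?rM ?ipZr ?eG ?eqxx ?mulr1 ?mxE// => b ba.
by rewrite rM ipZr eG eq_sym (negPf ba) mulr0.
Qed.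

(** With [F] the matrix whose rows are the frame, [F G F^T = 1]; for square matrices the inverse is
    two-sided, so [F^T F] inverts [G]. Traces over a frame thereby become contractions with
    [invmx G]. *)
Lemma orthonormal_sum G (e : 'I_n -> 'rV[R]_n) : G \in unitmx ->
  (forall a b, ip G (e a) (e b) = (a == b)%:R) -> \sum_a (e a)^T *m e a = invmx G.
Proof.
move=> uG eG; have MG := mulmx1C (frame_mxE eG).
apply: (can_inj (mulKmx uG)); rewrite mulmxV// -MG -mulmxA; congr (G *m _).
apply/matrixP => i j; rewrite summxE mxE; apply: eq_bigr => a _.
by rewrite !mxE big_ord1 !mxE.
Qed.

Lemma orthonormal_det_gt0 G (e : 'I_n -> 'rV[R]_n) :
  (forall a b, ip G (e a) (e b) = (a == b)%:R) -> 0 < \det G.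
Proof.
move=> eG; have := congr1 determinant (frame_mxE eG).
rewrite !det_mulmx det_tr det1 mulrCA -expr2 => E.
have := @ltr01 R; rewrite -E pmulr_lgt0// lt_def sqr_ge0 andbT; apply/eqP => d0.
by move: E; rewrite d0 mulr0 => /esym/eqP; rewrite oner_eq0.
Qed.

End InnerProduct.

Section DerivativeIp.
Context {R : realType} {U : normedModType R} {n : nat}.

Lemma differentiable_ip (B : U -> 'M[R]_n) (Y Z : U -> 'rV[R]_n) x :
  differentiable B x -> differentiable Y x -> differentiable Z x ->
  differentiable (fun y => ip (B y) (Y y) (Z y)) x.
Proof.
move=> dB dY dZ; apply: (differentiable_mxP _ _).1.
by apply: differentiable_mulmx; [exact: differentiable_mulmx|exact: differentiable_trmx].
Qed.

Lemma derive_ip (B : U -> 'M[R]_n) (Y Z : U -> 'rV[R]_n) x v :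
  differentiable B x -> differentiable Y x -> differentiable Z x ->
  der v (fun y => ip (B y) (Y y) (Z y)) x =
  ip (der v B x) (Y x) (Z x) + ip (B x) (der v Y x) (Z x) + ip (B x) (Y x) (der v Z x).
Proof.
move=> dB dY dZ; have dYB := differentiable_mulmx dY dB; have dZT := differentiable_trmx dZ.
rewrite /ip -(derive_entry v 0 0 (differentiable_mulmx dYB dZT)).
rewrite (derive_mulmx v dYB dZT) (derive_mulmx v dY dB) (derive_trmx v dZ).
by rewrite mulmxDl mxE [in LHS]mxE; congr (_ + _); rewrite [LHS]addrC.
Qed.

End DerivativeIp.

Section Connection.
Context {R : realType} {n : nat}.
Local Notation E := 'rV[R]_n.
Implicit Types (G : E -> 'M[R]_n) (X Y Z : E -> E) (u v w x : E).

Lemma christ_mxD G x u v : christ_mx G x (u + v) = christ_mx G x u + christ_mx G x v.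
Proof.
apply/matrixP => i k; rewrite !mxE -big_split; apply: eq_bigr => j _ /=.
by rewrite mxE mulrDr.
Qed.

Lemma christ_mxZ G x c v : christ_mx G x (c *: v) = c *: christ_mx G x v.
Proof.
apply/matrixP => i k; rewrite !mxE mulr_sumr; apply: eq_bigr => j _ /=.
by rewrite mxE mulrCA.
Qed.

Lemma christ_mx0 G x : christ_mx G x 0 = 0.
Proof. by rewrite -(scale0r (0 : E)) christ_mxZ scale0r. Qed.

Lemma christ_mxN G x v : christ_mx G x (- v) = - christ_mx G x v.
Proof. by rewrite -scaleN1r christ_mxZ scaleN1r. Qed.

Lemma christ_mx_sum G x (J : Type) (r : seq J) (P : pred J) (F : J -> E) :
  christ_mx G x (\sum_(j <- r | P j) F j) = \sum_(j <- r | P j) christ_mx G x (F j).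
Proof. by apply: (big_morph (christ_mx G x)) => [u v|]; rewrite ?christ_mxD ?christ_mx0. Qed.

Lemma christ_mx_delta G x v : christ_mx G x v = \sum_k v 0 k *: christ_mx G x (delta_mx 0 k).
Proof.
rewrite {1}(row_sum_delta v) christ_mx_sum; apply: eq_bigr => k _; exact: christ_mxZ.
Qed.

(** The connection matrix of the direction [v] acts on [Y x] from the right, whereas [nabla] has the
    matrix of the argument acting on the direction. The two agree by the symmetry of the Christoffel
    symbols ([nablaE]); in this form the Leibniz rule for matrices applies. *)
Definition cov G v Y x : E := der v Y x + Y x *m christ_mx G x v.

Definition dchrist G u v x : 'M[R]_n := der u (fun y => christ_mx G y v) x.

(** The derivative of the connection matrices plus their commutator, for constant [u] and [v]. The
    products are in reverse order because the matrices act on row vectors from the right. *)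
Definition curv_mx G x u v : 'M[R]_n :=
  dchrist G u v x - dchrist G v u x
  + christ_mx G x v *m christ_mx G x u - christ_mx G x u *m christ_mx G x v.

End Connection.

Lemma derive_along {R : realType} {n m p : nat} (O : set 'rV[R]_n) (Y : 'rV[R]_n -> 'rV[R]_n)
    (F : 'rV[R]_n -> 'M[R]_(m, p)) x u : open O -> O x -> smooth_on O F -> differentiable Y x ->
  der u (fun y => der (Y y) F y) x = der u (der (Y x) F) x + der (der u Y x) F x.
Proof.
move=> oO Ox sF dY; have dYk := (differentiable_mxP _ _).1 dY.
have dF y : O y -> differentiable F y by exact: smooth_diff.
have dDF k : differentiable (der (delta_mx 0 k) F) x.
  exact: smooth_diff (smooth_derive _ sF) Ox.
rewrite (derive_eq_in u oO Ox (fun y Oy => derive_row (Y y) (dF y Oy))).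
rewrite (derive_eq_in u oO Ox (fun y Oy => derive_row (Y x) (dF y Oy))).
rewrite derive_bigsum; last by move=> k; exact: differentiable_scale.
rewrite derive_bigsum; last by move=> k; exact: differentiable_scale_cst.
rewrite (derive_row (der u Y x) (dF x Ox)) -big_split; apply: eq_bigr => k _ /=.
rewrite (derive_scale u (dYk 0 k) (dDF k)) (derive_scale_cst _ _ (dDF k)) addrC.
by rewrite (derive_entry u 0 k dY).
Qed.

Section LocalGeometry.
Context {R : realType} {n : nat}.
Local Notation E := 'rV[R]_n.
Variables (O : set E) (G : E -> 'M[R]_n).
Hypotheses (oO : open O) (G_smooth : smooth_on O G).
Hypotheses (G_sym : forall x, O x -> (G x)^T = G x) (G_unit : forall x, O x -> G x \in unitmx).
Implicit Types (X Y Z : E -> E) (u v w x : E).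

Lemma christ_mx_smooth v : smooth_on O (fun x => christ_mx G x v).
Proof.
have sI := smooth_invmx oO G_unit G_smooth.
have sd u i j : smooth_on O (fun x => ('D_u G x) i j).
  have := (smooth_mxP oO _).1 (smooth_derive u G_smooth) i j.
  by rewrite der.unlock.
apply/smooth_mxP => // i k; apply: (smooth_eq oO _ (f := fun x => \sum_j christoffel G x k i j * v 0 j)).
  by move=> y _; rewrite mxE.
apply: smooth_bigsum => // j; apply: smooth_mul => //; last exact: smooth_cst.
apply: smooth_mul => //; first exact: smooth_cst.
apply: smooth_bigsum => // l; apply: smooth_mul => //; first exact: (smooth_mxP oO _).1.
by apply: smooth_sub => //; exact: smooth_add.
Qed.

Lemma dG x : O x -> differentiable G x.
Proof. exact: smooth_diff. Qed.

Let G_sym_near x : O x -> \forall y \near x, (G y)^T = G y.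
Proof. by move=> Ox; apply: filterS (open_nbhs_nbhs (conj oO Ox)) => y; exact: G_sym. Qed.

(** Vanishing torsion on constant fields, whose bracket is 0. *)
Lemma christ_mx_sym x u v : O x -> u *m christ_mx G x v = v *m christ_mx G x u.
Proof.
move=> Ox; have := nabla_torsion_free (cst u) (cst v) (dG Ox) (G_sym_near Ox).
rewrite /nabla /bracket !derive_cst !add0r oppr0 => /eqP; rewrite subr_eq0 => /eqP; exact.
Qed.

Lemma derive_metric x v : O x ->
  der v G x = christ_mx G x v *m G x + G x *m (christ_mx G x v)^T.
Proof.
move=> Ox; apply: ip_inj => u w; rewrite ipDm -ip_mull -ip_mulr.
rewrite der.unlock (christ_metric _ _ _ (dG Ox) (G_sym_near Ox) (G_unit Ox)) /christ.
by rewrite (christ_mx_sym v u)// (christ_mx_sym v w).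
Qed.

Lemma nablaE X Y x : O x -> nabla G X Y x = cov G (X x) Y x.
Proof. by move=> Ox; rewrite /nabla /cov der.unlock /christ christ_mx_sym. Qed.

Lemma dchrist_sym x u v w : O x -> v *m dchrist G u w x = w *m dchrist G u v x.
Proof.
move=> Ox; have dA z : differentiable (fun y => christ_mx G y z) x.
  exact: smooth_diff (christ_mx_smooth z) Ox.
have dc z : differentiable (fun=> z : E) x by exact: differentiable_const.
have D (z z' : E) : der u (fun y => z *m christ_mx G y z') x = z *m dchrist G u z' x.
  by rewrite (derive_mulmx u (dc z) (dA z')) derive_const mul0mx add0r.
rewrite -!D; apply: (derive_eq_in u oO Ox) => y Oy; exact: christ_mx_sym.
Qed.

Lemma differentiable_christ_mx Y x : O x -> differentiable Y x ->
  differentiable (fun y => christ_mx G y (Y y)) x.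
Proof.
move=> Ox dY; have dYk := (differentiable_mxP _ _).1 dY.
rewrite (_ : (fun y => _) = fun y => \sum_k Y y 0 k *: christ_mx G y (delta_mx 0 k)).
  apply: differentiable_bigsum => k; apply: differentiable_scale => //.
  exact: smooth_diff (christ_mx_smooth _) Ox.
by apply/funext => y; exact: christ_mx_delta.
Qed.

Lemma smooth_christ_mx Y : smooth_on O Y -> smooth_on O (fun y => christ_mx G y (Y y)).
Proof.
move=> /(smooth_mxP oO) sY.
rewrite (_ : (fun y => _) = fun y => \sum_k Y y 0 k *: christ_mx G y (delta_mx 0 k)).
  apply: smooth_bigsum => // k; apply: smooth_scale => //.
  exact: christ_mx_smooth.
by apply/funext => y; exact: christ_mx_delta.
Qed.

Lemma derive_christ_mx Y x u : O x -> differentiable Y x ->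
  der u (fun y => christ_mx G y (Y y)) x = dchrist G u (Y x) x + christ_mx G x (der u Y x).
Proof.
move=> Ox dY; have dYk := (differentiable_mxP _ _).1 dY.
have dA z : differentiable (fun y => christ_mx G y z) x.
  exact: smooth_diff (christ_mx_smooth z) Ox.
have E1 : der u (fun y => christ_mx G y (Y y)) x =
    \sum_k (der u (fun y => Y y 0 k) x *: christ_mx G x (delta_mx 0 k)
            + Y x 0 k *: dchrist G u (delta_mx 0 k) x).
  rewrite (derive_eq_in u oO Ox (fun y _ => christ_mx_delta G y (Y y))).
  rewrite derive_bigsum; last by move=> k; exact: differentiable_scale.
  by apply: eq_bigr => k _; rewrite (derive_scale u (dYk 0 k) (dA _)).
have E2 : dchrist G u (Y x) x = \sum_k Y x 0 k *: dchrist G u (delta_mx 0 k) x.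
  rewrite /dchrist (derive_eq_in u oO Ox (fun y _ => christ_mx_delta G y (Y x))).
  rewrite derive_bigsum; last by move=> k; exact: differentiable_scale_cst.
  by apply: eq_bigr => k _; rewrite (derive_scale_cst _ _ (dA _)).
rewrite E1 E2 (christ_mx_delta G x (der u Y x)) -big_split /=; apply: eq_bigr => k _.
by rewrite addrC (derive_entry u 0 k dY).
Qed.

Lemma dchristDl x u v w : O x -> dchrist G (u + v) w x = dchrist G u w x + dchrist G v w x.
Proof. by move=> Ox; exact: (deriveDv _ _ (smooth_diff (christ_mx_smooth w) Ox)). Qed.

Lemma dchristZl x c v w : O x -> dchrist G (c *: v) w x = c *: dchrist G v w x.
Proof. by move=> Ox; exact: (deriveZv _ _ (smooth_diff (christ_mx_smooth w) Ox)). Qed.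

Lemma dchristDr x u v w : O x -> dchrist G u (v + w) x = dchrist G u v x + dchrist G u w x.
Proof.
move=> Ox; rewrite /dchrist (derive_eq_in u oO Ox (fun y _ => christ_mxD G y v w)).
by apply: derive_add; exact: smooth_diff (christ_mx_smooth _) Ox.
Qed.

Lemma dchristZr x c v w : O x -> dchrist G v (c *: w) x = c *: dchrist G v w x.
Proof.
move=> Ox; rewrite /dchrist (derive_eq_in v oO Ox (fun y _ => christ_mxZ G y c w)).
by apply: derive_scale_cst; exact: smooth_diff (christ_mx_smooth _) Ox.
Qed.

Lemma smooth_cov X Y : smooth_on O X -> smooth_on O Y -> smooth_on O (fun x => cov G (X x) Y x).
Proof.
move=> sX sY; apply: smooth_add => //; first exact: smooth_derive_along.
by apply: smooth_mulmx => //; exact: smooth_christ_mx.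
Qed.

Lemma covDl x u v Y : differentiable Y x -> cov G (u + v) Y x = cov G u Y x + cov G v Y x.
Proof. by move=> dY; rewrite /cov (deriveDv _ _ dY) christ_mxD mulmxDr addrACA. Qed.

Lemma covZl x c v Y : differentiable Y x -> cov G (c *: v) Y x = c *: cov G v Y x.
Proof. by move=> dY; rewrite /cov (deriveZv _ _ dY) christ_mxZ -scalemxAr scalerDr. Qed.

Lemma covZ x v (k : E -> R) Y : differentiable k x -> differentiable Y x ->
  cov G v (fun y => k y *: Y y) x = der v k x *: Y x + k x *: cov G v Y x.
Proof. by move=> dk dY; rewrite /cov (derive_scale v dk dY) -scalemxAl scalerDr addrA. Qed.

Lemma derive_ip_cov x v Y Z : O x -> differentiable Y x -> differentiable Z x ->
  der v (fun y => ip (G y) (Y y) (Z y)) x =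
  ip (G x) (cov G v Y x) (Z x) + ip (G x) (Y x) (cov G v Z x).
Proof.
move=> Ox dY dZ; rewrite (derive_ip v (dG Ox) dY dZ) (derive_metric v Ox) ipDm -ip_mull -ip_mulr.
by rewrite /cov ipDl ipDr; ring.
Qed.

Lemma cov_eq x v Y Z : O x -> (forall y, O y -> Y y = Z y) -> cov G v Y x = cov G v Z x.
Proof. by move=> Ox YZ; rewrite /cov (derive_eq_in v oO Ox YZ) YZ. Qed.

(** The second derivatives of [Z] cancel by Schwarz's theorem, and the terms with derivatives of [X]
    and [Y] cancel against the bracket. What remains depends on the values at [x] only. *)
Lemma curvE X Y Z x : O x -> smooth_on O X -> smooth_on O Y -> smooth_on O Z ->
  curv G X Y Z x = Z x *m curv_mx G x (X x) (Y x).
Proof.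
move=> Ox sX sY sZ.
have dX := smooth_diff sX Ox; have dY := smooth_diff sY Ox; have dZ := smooth_diff sZ Ox.
have E1 X' Y' : smooth_on O X' -> smooth_on O Y' -> nabla G X' (nabla G Y' Z) x =
   der (X' x) (der (Y' x) Z) x + der (der (X' x) Y' x) Z x + (der (X' x) Z x *m christ_mx G x (Y' x)
    + Z x *m (dchrist G (X' x) (Y' x) x + christ_mx G x (der (X' x) Y' x)))
    + (der (Y' x) Z x + Z x *m christ_mx G x (Y' x)) *m christ_mx G x (X' x).
  move=> sX' sY'; rewrite nablaE// (cov_eq _ Ox (fun y Oy => nablaE _ _ Oy)).
  have dD : differentiable (fun y => der (Y' y) Z y) x.
    by apply: smooth_diff Ox; exact: smooth_derive_along.
  have dY' := smooth_diff sY' Ox; have dC := differentiable_christ_mx Ox dY'.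
  rewrite {1}/cov (derive_add _ dD (differentiable_mulmx dZ dC)) (derive_mulmx _ dZ dC).
  by rewrite (derive_christ_mx _ Ox dY') (derive_along _ oO Ox sZ dY').
have E2 : nabla G (bracket X Y) Z x = der (der (X x) Y x) Z x - der (der (Y x) X x) Z x
    + Z x *m (christ_mx G x (der (X x) Y x) - christ_mx G x (der (Y x) X x)).
  have EB : bracket X Y x = der (X x) Y x - der (Y x) X x by rewrite /bracket der.unlock.
  by rewrite nablaE// EB /cov (deriveDv _ _ dZ) (deriveNv _ dZ) christ_mxD christ_mxN.
have N1 := E1 X Y sX sY; have N2 := E1 Y X sY sX.
have SW := schwarz_mx (X x) (Y x) oO sZ Ox.
rewrite /curv N1 N2 E2 SW /curv_mx.
set d1 := der (Y x) (der _ _) _; set d2 := der (der (X x) Y x) Z x.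
set d3 := der (der (Y x) X x) Z x; set d4 := der (X x) Z x; set d5 := der (Y x) Z x.
set c1 := christ_mx G x (der _ _ _); set c2 := christ_mx G x (der _ _ _).
set b1 := dchrist _ _ _ _; set b2 := dchrist _ _ _ _.
set a1 := christ_mx G x (X x); set a2 := christ_mx G x (Y x); move: (Z x) => z.
rewrite !mulmxDr !mulmxDl !mulmxN !mulmxA.
move: (d4 *m a2) (d5 *m a1) (z *m c1) (z *m c2) (z *m b1) (z *m b2) (z *m a2 *m a1) (z *m a1 *m a2).
move=> *; apply/rowP => j; rewrite !mxE; ring.
Qed.

End LocalGeometry.

(** * Symmetries of the curvature *)

Section CurvatureSymmetries.
Context {R : realType} {n : nat}.
Local Notation E := 'rV[R]_n.
Variables (O : set E) (G : E -> 'M[R]_n).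
Hypotheses (oO : open O) (G_smooth : smooth_on O G).
Hypotheses (G_sym : forall x, O x -> (G x)^T = G x) (G_unit : forall x, O x -> G x \in unitmx).
Implicit Types (X Y Z : E -> E) (u v w x z : E).

Let sA := christ_mx_smooth oO G_smooth G_unit.
Let dA v x (Ox : O x) : differentiable (fun y => christ_mx G y v) x.
Proof. exact: smooth_diff (sA v) Ox. Qed.

Lemma curv_mxC x u v : curv_mx G x v u = - curv_mx G x u v.
Proof.
rewrite /curv_mx; move: (dchrist G u v x) (dchrist G v u x) => a b.
move: (_ *m _) (_ *m _) => c d; apply/matrixP => i j; rewrite !mxE; ring.
Qed.

Lemma curv_mxDr x u v w : O x -> curv_mx G x u (v + w) = curv_mx G x u v + curv_mx G x u w.
Proof.
move=> Ox; rewrite /curv_mx christ_mxD (dchristDr oO G_smooth G_unit)//.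
rewrite (dchristDl oO G_smooth G_unit)// mulmxDl mulmxDr.
by apply/matrixP => i j; rewrite !mxE; ring.
Qed.

Lemma curv_mxZr x c u v : O x -> curv_mx G x u (c *: v) = c *: curv_mx G x u v.
Proof.
move=> Ox; rewrite /curv_mx christ_mxZ (dchristZr oO G_smooth G_unit)//.
rewrite (dchristZl oO G_smooth G_unit)// -scalemxAl -scalemxAr.
by apply/matrixP => i j; rewrite !mxE; ring.
Qed.

Lemma curv_mxDl x u v w : O x -> curv_mx G x (u + v) w = curv_mx G x u w + curv_mx G x v w.
Proof. by move=> Ox; rewrite !(curv_mxC x w) curv_mxDr// opprD. Qed.

Lemma curv_mxZl x c u v : O x -> curv_mx G x (c *: u) v = c *: curv_mx G x u v.
Proof. by move=> Ox; rewrite !(curv_mxC x v) curv_mxZr// scalerN. Qed.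

Lemma curv_mx_bianchi x u v w : O x ->
  w *m curv_mx G x u v + u *m curv_mx G x v w + v *m curv_mx G x w u = 0.
Proof.
move=> Ox; rewrite /curv_mx !mulmxDr !mulmxN !mulmxA.
have A1 a b := christ_mx_sym oO G_smooth G_sym a b Ox.
have D1 a b c := dchrist_sym oO G_smooth G_sym G_unit a b c Ox.
rewrite (A1 u v) (A1 w v) (A1 w u) (D1 u v w) (D1 v u w) (D1 w u v).
move: (_ *m dchrist _ u _ _) (_ *m dchrist _ v _ _) (_ *m dchrist _ w _ _) => a b c.
move: (_ *m _ *m _) (_ *m _ *m _) (_ *m _ *m _) => p q r.
apply/rowP => j; rewrite !mxE; ring.
Qed.

Let trE (p q c d : 'M[R]_n) : (p - q + c - d)^T = p^T - q^T + c^T - d^T.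
Proof. by apply/matrixP => i j; rewrite !mxE. Qed.

(** Second derivatives of the metric commute. Expanding both by metric compatibility leaves exactly
    this combination of curvature terms. *)
Lemma curv_mx_skew x u v : O x ->
  curv_mx G x u v *m G x + G x *m (curv_mx G x u v)^T = 0.
Proof.
move=> Ox; have dGx := smooth_diff G_smooth Ox.
have DD a b : der a (der b G) x =
    dchrist G a b x *m G x + christ_mx G x b *m (christ_mx G x a *m G x + G x *m (christ_mx G x a)^T)
    + ((christ_mx G x a *m G x + G x *m (christ_mx G x a)^T) *m (christ_mx G x b)^T
    + G x *m (dchrist G a b x)^T).
  have dAb := dA b Ox; have dAbT := differentiable_trmx dAb.
  rewrite (derive_eq_in a oO Ox (fun y Oy => derive_metric oO G_smooth G_sym G_unit b Oy)).
  rewrite (derive_add _ (differentiable_mulmx dAb dGx) (differentiable_mulmx dGx dAbT)).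
  rewrite (derive_mulmx _ dAb dGx) (derive_mulmx _ dGx dAbT) (derive_trmx _ dAb).
  by rewrite !(derive_metric oO G_smooth G_sym G_unit a Ox).
have := schwarz_mx u v oO G_smooth Ox; rewrite !DD /curv_mx => /eqP; rewrite -subr_eq0 => /eqP <-.
rewrite trE !trmx_mul; move: (christ_mx G x u) (christ_mx G x v) (G x) => a b g.
move: (dchrist G u v x) (dchrist G v u x) => p q.
rewrite !(mulmxDr, mulmxDl, mulmxN, mulNmx) !mulmxA.
by apply/matrixP => i j; do !rewrite [in LHS]mxE; do !rewrite [in RHS]mxE; ring.
Qed.

Lemma curv_mx_ip x u v z w : O x ->
  ip (G x) (z *m curv_mx G x u v) w = - ip (G x) z (w *m curv_mx G x u v).
Proof.
move=> Ox; rewrite ip_mull ip_mulr; apply/eqP; rewrite -addr_eq0 -ipDm curv_mx_skew//.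
by rewrite /ip mulmx0 mul0mx mxE.
Qed.

(** A linear consequence of the two skew symmetries and of four instances of the Bianchi
    identity. *)
Lemma curv_mx_pair x u v z w : O x ->
  ip (G x) (z *m curv_mx G x u v) w = ip (G x) (u *m curv_mx G x z w) v.
Proof.
move=> Ox; pose K a b c d := ip (G x) (c *m curv_mx G x a b) d.
have s1 a b c d : K b a c d = - K a b c d by rewrite /K curv_mxC mulmxN ipNl.
have s2 a b c d : K a b d c = - K a b c d.
  by rewrite /K curv_mx_ip// ip_sym// G_sym.
have B a b c d : K a b c d + K b c a d + K c a b d = 0.
  by rewrite /K -!ipDl curv_mx_bianchi// ip0l.
rewrite -/(K u v z w) -/(K z w u v).
have := B u v z w; have := B v z w u; have := B z w u v; have := B w u v z.
have := s2 u v z w; have := s2 v z u w; have := s1 z u v w; have := s2 u z v w.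
have := s2 z w v u; have := s1 w v z u; have := s2 v w z u; have := s2 w u z v.
lra.
Qed.

End CurvatureSymmetries.

Section ParallelEndomorphism.
Context {R : realType} {n : nat}.
Local Notation E := 'rV[R]_n.
Variables (O : set E) (G phi : E -> 'M[R]_n).
Hypotheses (oO : open O) (G_smooth : smooth_on O G).
Hypotheses (G_sym : forall x, O x -> (G x)^T = G x) (G_unit : forall x, O x -> G x \in unitmx).
Hypothesis phi_smooth : smooth_on O phi.
Hypothesis phi_parallel : forall X Y, smooth_on O X -> smooth_on O Y ->
  forall x, O x -> nabla G X (act phi Y) x = nabla G X Y x *m phi x.
Implicit Types (X Y Z : E -> E) (u v w x z : E).

Let sA := christ_mx_smooth oO G_smooth G_unit.
Let dA v x (Ox : O x) : differentiable (fun y => christ_mx G y v) x.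
Proof. exact: smooth_diff (sA v) Ox. Qed.

(** Parallelism evaluated on constant fields, one row of [phi] at a time. *)
Lemma derive_parallel x v : O x ->
  der v phi x = christ_mx G x v *m phi x - phi x *m christ_mx G x v.
Proof.
move=> Ox; apply/row_matrixP => i; rewrite !rowE.
have dc : differentiable (fun=> delta_mx 0 i : E) x by exact: differentiable_const.
have := phi_parallel (smooth_cst oO v) (smooth_cst oO (delta_mx 0 i)) Ox.
rewrite !(nablaE oO G_smooth G_sym)// /cov /act derive_const add0r.
rewrite (derive_mulmx _ dc (smooth_diff phi_smooth Ox)) derive_const mul0mx add0r => H.
by rewrite mulmxBr !mulmxA -H addrK.
Qed.

Lemma cov_act x v Y : O x -> differentiable Y x ->
  cov G v (act phi Y) x = cov G v Y x *m phi x.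
Proof.
move=> Ox dY; rewrite /cov /act (derive_mulmx _ dY (smooth_diff phi_smooth Ox)).
by rewrite derive_parallel// mulmxDl mulmxBr !mulmxA addrA subrK.
Qed.

(** Second derivatives of [phi] commute. Expanded by [derive_parallel], their difference is the
    commutator of the curvature with [phi]. *)
Lemma curv_mx_commute x u v : O x ->
  curv_mx G x u v *m phi x = phi x *m curv_mx G x u v.
Proof.
move=> Ox; have dpx := smooth_diff phi_smooth Ox.
have DD a b : der a (der b phi) x =
    dchrist G a b x *m phi x + christ_mx G x b *m (christ_mx G x a *m phi x - phi x *m christ_mx G x a)
    - ((christ_mx G x a *m phi x - phi x *m christ_mx G x a) *m christ_mx G x b
    + phi x *m dchrist G a b x).
  have dAb := dA b Ox.
  rewrite (derive_eq_in a oO Ox (fun y Oy => derive_parallel b Oy)).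
  rewrite (derive_sub _ (differentiable_mulmx dAb dpx) (differentiable_mulmx dpx dAb)).
  rewrite (derive_mulmx _ dAb dpx) (derive_mulmx _ dpx dAb).
  by rewrite !(derive_parallel a Ox).
have := schwarz_mx u v oO phi_smooth Ox; rewrite !DD /curv_mx => /eqP; rewrite -subr_eq0 => /eqP H.
apply/eqP; rewrite -subr_eq0 -H; apply/eqP.
rewrite !mulmxDr !mulmxDl !mulNmx !mulmxN !mulmxA.
by apply/matrixP => i j; do !rewrite [in LHS]mxE; do !rewrite [in RHS]mxE; ring.
Qed.

End ParallelEndomorphism.

(** * Divergence in a frame and in coordinates *)

Section Divergence.
Context {R : realType} {n : nat}.
Local Notation E := 'rV[R]_n.
Variables (O : set E) (G : E -> 'M[R]_n) (e : 'I_n -> E -> E).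
Hypotheses (oO : open O) (G_smooth : smooth_on O G).
Hypotheses (G_sym : forall x, O x -> (G x)^T = G x) (G_unit : forall x, O x -> G x \in unitmx).
Hypothesis e_frame : orthonormal_frame O G e.
Implicit Types (u v w x : E).

Let e_ip x : O x -> forall a b, ip (G x) (e a x) (e b x) = (a == b)%:R.
Proof. by move=> Ox a b; exact: e_frame.2. Qed.

Lemma frame_expand x u : O x -> u = \sum_b ip (G x) u (e b x) *: e b x.
Proof.
move=> Ox; rewrite -[LHS](mulmxK (G_unit Ox)) -(orthonormal_sum (G_unit Ox) (e_ip Ox)).
rewrite mulmx_sumr; apply: eq_bigr => b _; rewrite mulmxA.
by apply/rowP => j; rewrite mxE big_ord1 [in RHS]mxE.
Qed.

Lemma frame_trace x (T : 'M[R]_n) : O x ->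
  \sum_a ip (G x) (e a x *m T) (e a x) = \tr T.
Proof.
move=> Ox; rewrite -[RHS](congr1 mxtrace (mulmxK (G_unit Ox) T)).
rewrite -(orthonormal_sum (G_unit Ox) (e_ip Ox)) mulmx_sumr raddf_sum.
apply: eq_bigr => a _ /=; rewrite /ip [T *m G x *m _]mulmxA mxtrace_mulC !mulmxA.
by rewrite /mxtrace big_ord1.
Qed.

Lemma det_metric_gt0 x : O x -> 0 < \det (G x).
Proof. by move=> Ox; exact: orthonormal_det_gt0 (e_ip Ox). Qed.

(** By Jacobi's formula and metric compatibility the derivative of the volume density along [v] is
    the trace of [christ_mx G x v] times the density. Symmetry of the Christoffel symbols makes the
    zeroth-order part of the covariant divergence the trace of [christ_mx G x (V x)], which matches
    it. *)
Lemma divergence (V : E -> E) x : O x -> differentiable V x ->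
  \sum_k der (delta_mx 0 k) (fun y => V y 0 k * Num.sqrt (\det (G y))) x =
  (\sum_a ip (G x) (cov G (e a x) V x) (e a x)) * Num.sqrt (\det (G x)).
Proof.
move=> Ox dV; have d0 := det_metric_gt0 Ox; have dGx := smooth_diff G_smooth Ox.
have dd := differentiable_det dGx; have sd0 : 0 < Num.sqrt (\det (G x)) by rewrite sqrtr_gt0.
have dVk := (differentiable_mxP _ _).1 dV.
have dsd : differentiable (fun y => Num.sqrt (\det (G y))) x.
  apply: (smooth_diff _ Ox); apply: (smooth_sqrt oO det_metric_gt0).
  exact: smooth_det.
have Dsd v : der v (fun y => Num.sqrt (\det (G y))) x =
    \tr (christ_mx G x v) * Num.sqrt (\det (G x)).
  rewrite (@der_sqrt _ _ (fun y => \det (G y)) x v d0 dd) (derive_det_unit v dGx (G_unit Ox)).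
  rewrite (derive_metric oO G_smooth G_sym G_unit v Ox) mulmxDl mxtraceD mulmxK ?G_unit//.
  rewrite (mxtrace_mulC (G x *m _)) mulmxA mulVmx ?G_unit// mul1mx mxtrace_tr.
  rewrite -{1}(sqr_sqrtr (ltW d0)).
  by field; rewrite gt_eqF.
pose T : 'M[R]_n := \matrix_k cov G (delta_mx 0 k) V x.
have ET u : cov G u V x = u *m T.
  rewrite mulmx_sum_row /cov (derive_row u dV) (christ_mx_delta G x u) mulmx_sumr -big_split.
  by apply: eq_bigr => k _; rewrite rowK /cov scalerDr scalemxAr.
rewrite (eq_bigr _ (fun a _ => congr1 (fun z => ip (G x) z _) (ET (e a x)))) frame_trace//.
rewrite mulr_suml; have -> : \sum_i T i i * Num.sqrt (\det (G x)) =
    \sum_i (der (delta_mx 0 i) V x) 0 i * Num.sqrt (\det (G x))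
     + \tr (christ_mx G x (V x)) * Num.sqrt (\det (G x)).
  rewrite /mxtrace mulr_suml -big_split; apply: eq_bigr => k _ /=; rewrite mxE -mulrDl; congr (_ * _).
  rewrite /cov mxE; congr (_ + _); rewrite (christ_mx_sym oO G_smooth G_sym _ _ Ox).
  by rewrite -rowE mxE.
rewrite (christ_mx_delta G x (V x)) raddf_sum mulr_suml -big_split /=; apply: eq_bigr => k _.
rewrite (derive_mul _ (dVk 0 k) dsd) Dsd (derive_entry _ 0 k dV) mxtraceZ; ring.
Qed.

End Divergence.

(** * The pointwise identity behind the first variation *)

Section FirstVariation.
Context {R : realType} {n : nat}.
Local Notation E := 'rV[R]_n.
Variables (O : set E) (G phi : E -> 'M[R]_n) (e : 'I_n -> E -> E).
Hypotheses (oO : open O) (G_smooth : smooth_on O G).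
Hypotheses (G_sym : forall x, O x -> (G x)^T = G x) (G_unit : forall x, O x -> G x \in unitmx).
Hypothesis e_frame : orthonormal_frame O G e.
Hypothesis phi_smooth : smooth_on O phi.
Hypothesis phi_sym : forall x u v, O x -> ip (G x) (u *m phi x) v = ip (G x) u (v *m phi x).
Hypothesis phi_parallel : forall X Y, smooth_on O X -> smooth_on O Y ->
  forall x, O x -> nabla G X (act phi Y) x = nabla G X Y x *m phi x.
Implicit Types (X Y Z xi W : E -> E) (u v w x z : E).

Let e_smooth a : smooth_on O (e a). Proof. exact: e_frame.1. Qed.
Let NE X Y x := @nablaE R n O G oO G_smooth G_sym X Y x.
Let sm_cov X Y : smooth_on O X -> smooth_on O Y -> smooth_on O (fun x => cov G (X x) Y x).
Proof. exact: smooth_cov. Qed.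

Lemma smooth_nabla X Y : smooth_on O X -> smooth_on O Y -> smooth_on O (nabla G X Y).
Proof.
by move=> sX sY; apply: (smooth_eq oO _ (sm_cov sX sY)) => y Oy; rewrite NE.
Qed.

Lemma smooth_act X : smooth_on O X -> smooth_on O (act phi X).
Proof. by move=> sX; exact: smooth_mulmx. Qed.

Lemma smooth_rough_laplacian X : smooth_on O X -> smooth_on O (rough_laplacian G e X).
Proof.
move=> sX; apply: smooth_opp => //; apply: smooth_bigsum => // a.
by apply: smooth_sub => //; do !apply: smooth_nabla => //.
Qed.

Lemma smooth_curv X Y Z : smooth_on O X -> smooth_on O Y -> smooth_on O Z ->
  smooth_on O (curv G X Y Z).
Proof.
move=> sX sY sZ; apply: smooth_sub => //; first by apply: smooth_sub => //; do !apply: smooth_nabla => //.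
apply: smooth_nabla => //; rewrite /bracket -[X in smooth_on _ X]/(_ : E -> E).
have := smooth_sub oO (smooth_derive_along oO sX sY) (smooth_derive_along oO sY sX).
by rewrite der.unlock.
Qed.

Lemma smooth_S_field X : smooth_on O X -> smooth_on O (S_field G phi e X).
Proof.
move=> sX; apply: smooth_bigsum => // a.
by apply: smooth_curv => //; [exact: smooth_act|exact: smooth_nabla].
Qed.

Lemma rough_laplacianE X x : O x -> smooth_on O X -> rough_laplacian G e X x =
  - \sum_a (cov G (e a x) (fun y => cov G (e a y) X y) x - cov G (cov G (e a x) (e a) x) X x).
Proof.
move=> Ox sX; congr (- _); apply: eq_bigr => a _; rewrite !NE//; congr (_ - _).
by apply: (cov_eq _ oO _ Ox) => y; exact: NE.
Qed.

Lemma S_fieldE X x : O x -> smooth_on O X -> S_field G phi e X x =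
  \sum_a e a x *m curv_mx G x (X x *m phi x) (cov G (e a x) X x).
Proof.
move=> Ox sX; apply: eq_bigr => a _.
rewrite (curvE oO G_smooth G_sym G_unit Ox)//; [|exact: smooth_act|exact: smooth_nabla].
by rewrite NE.
Qed.

Lemma rough_laplacian_act X x : O x -> smooth_on O X ->
  rough_laplacian G e (act phi X) x = rough_laplacian G e X x *m phi x.
Proof.
move=> Ox sX; have dX y : O y -> differentiable X y by exact: smooth_diff.
have CA v y Y := @cov_act R n O G phi oO G_smooth G_sym phi_smooth phi_parallel y v Y.
rewrite !rough_laplacianE//; last exact: smooth_act.
rewrite mulNmx mulmx_suml; congr (- _); apply: eq_bigr => a _; rewrite mulmxBl; congr (_ - _); last first.
  by rewrite CA//; exact: dX.
rewrite -CA//; last exact: smooth_diff (sm_cov (e_smooth a) sX) Ox.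
by apply: (cov_eq _ oO _ Ox) => y Oy; rewrite CA//; exact: dX.
Qed.

Definition flux_form xi W x u : R :=
  ip (G x) (xi x *m curv_mx G x u (S_field G phi e xi x)) (W x *m phi x)
  - ip (G x) (cov G u W x) (act phi (rough_laplacian G e xi) x)
  + ip (G x) (W x) (cov G u (act phi (rough_laplacian G e xi)) x).

(** The vector dual to [flux_form], by [flux_ip]; the frame is only a means of writing it. *)
Definition flux xi W x : E := \sum_b flux_form xi W x (e b x) *: e b x.

(** The linearisation of [S_field] at [xi] in the direction [W], one term for each of the two places
    where [xi] occurs; [derive_joint_S] identifies it with a time derivative. *)
Definition S_variation xi W x : E :=
  \sum_a (e a x *m curv_mx G x (W x *m phi x) (cov G (e a x) xi x)
          + e a x *m curv_mx G x (xi x *m phi x) (cov G (e a x) W x)).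

Definition euler_lagrange xi x : E :=
  let S := S_field G phi e xi in
  rough_laplacian G e (rough_laplacian G e xi) x
  - \sum_a (nabla_curv G (e a) (e a) S xi x + curv G (e a) (nabla G (e a) S) xi x
            + 2 *: curv G (e a) S (nabla G (e a) xi) x).

Lemma smooth_flux xi W : smooth_on O xi -> smooth_on O W -> smooth_on O (flux xi W).
Proof.
move=> sxi sW; apply: smooth_bigsum => // b; apply: smooth_scale => //.
have sL := smooth_act (smooth_rough_laplacian sxi).
apply: smooth_add => //; first apply: smooth_sub => //.
- apply: (smooth_eq oO (f := fun y => ip (G y) (curv G (e b) (S_field G phi e xi) xi y) (act phi W y))).
    by move=> y Oy; rewrite (curvE oO G_smooth G_sym G_unit Oy)//; exact: smooth_S_field.
  apply: smooth_ip => //; last exact: smooth_act.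
  by apply: smooth_curv => //; exact: smooth_S_field.
- by apply: smooth_ip => //; exact: sm_cov.
- by apply: smooth_ip => //; exact: sm_cov.
Qed.

Lemma flux_ip xi W x u : O x -> smooth_on O xi -> smooth_on O W ->
  ip (G x) (flux xi W x) u = flux_form xi W x u.
Proof.
move=> Ox sxi sW.
have dW := smooth_diff sW Ox.
have dL := smooth_diff (smooth_act (smooth_rough_laplacian sxi)) Ox.
have fD p q : flux_form xi W x (p + q) = flux_form xi W x p + flux_form xi W x q.
  rewrite /flux_form (covDl _ _ _ dW) (covDl _ _ _ dL) (curv_mxDl oO G_smooth G_unit _ _ _ Ox).
  by rewrite mulmxDr !ipDl ipDr; ring.
have fZ c p : flux_form xi W x (c *: p) = c * flux_form xi W x p.
  rewrite /flux_form (covZl _ _ _ dW) (covZl _ _ _ dL) (curv_mxZl oO G_smooth G_unit _ _ _ Ox).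
  by rewrite -scalemxAr !ipZl ipZr; ring.
have f0 : flux_form xi W x 0 = 0 by rewrite -(scale0r (0 : E)) fZ mul0r.
rewrite [in RHS](frame_expand G_unit e_frame u Ox) (big_morph _ fD f0) ip_suml.
by apply: eq_bigr => b _; rewrite fZ ipZl mulrC (ip_sym _ _ (G_sym Ox)).
Qed.

(** The Laplacian terms are Green's identity for [W] and [P]. In the curvature terms, pair symmetry
    brings [e a] and [S] into the arguments of [R]: [H1] yields a term without derivatives of [W],
    while [H2] yields one with [cov G (e a x) W x], which the divergence removes. *)
Lemma variation_identity xi W x : O x -> smooth_on O xi -> smooth_on O W ->
  ip (G x) (S_variation xi W x) (S_field G phi e xi x)
  + ip (G x) (rough_laplacian G e W x) (act phi (rough_laplacian G e xi) x)
  = ip (G x) (euler_lagrange xi x) (act phi W x)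
    + \sum_a ip (G x) (cov G (e a x) (flux xi W) x) (e a x).
Proof.
move=> Ox sxi sW.
set S := S_field G phi e xi; set L := rough_laplacian G e xi; set P := act phi L.
have sS : smooth_on O S by exact: smooth_S_field.
have sL : smooth_on O L by exact: smooth_rough_laplacian.
have sP : smooth_on O P by exact: smooth_act.
have CE X Y Z y := @curvE R n O G oO G_smooth G_sym G_unit X Y Z y.
have DI v Y Z : smooth_on O Y -> smooth_on O Z ->
    der v (fun y => ip (G y) (Y y) (Z y)) x =
    ip (G x) (cov G v Y x) (Z x) + ip (G x) (Y x) (cov G v Z x).
  by move=> sY sZ; apply: (derive_ip_cov oO) => //; exact: smooth_diff Ox.
(* The Leibniz rule for the function [flux_form] evaluated on [e a]. Its last term subtracts the
   flux through the derivative of [e a], which supplies the corrections in the rough Laplacians and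
   in the derivative of [R]. *)
have E1 a : ip (G x) (cov G (e a x) (flux xi W) x) (e a x) =
    ip (G x) (nabla G (e a) (curv G (e a) S xi) x) (act phi W x)
    + ip (G x) (xi x *m curv_mx G x (e a x) (S x)) (cov G (e a x) W x *m phi x)
    - ip (G x) (cov G (e a x) (fun y => cov G (e a y) W y) x) (P x)
    + ip (G x) (W x) (cov G (e a x) (fun y => cov G (e a y) P y) x)
    - flux_form xi W x (cov G (e a x) (e a) x).
  have sfl := smooth_flux sxi sW.
  apply/eqP; rewrite -(flux_ip _ Ox sxi sW) eq_sym subr_eq eq_sym -DI//; apply/eqP.
  have sη : smooth_on O (curv G (e a) S xi) by exact: smooth_curv.
  have sCW := sm_cov (e_smooth a) sW; have sCP := sm_cov (e_smooth a) sP.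
  rewrite (derive_eq_in (g := fun y => ip (G y) (curv G (e a) S xi y) (act phi W y)
     - ip (G y) (cov G (e a y) W y) (P y) + ip (G y) (W y) (cov G (e a y) P y)) _ oO Ox); last first.
    by move=> y Oy; rewrite (flux_ip _ Oy sxi sW) /flux_form -/S -/L -/P CE.
  have dip Y Z : smooth_on O Y -> smooth_on O Z -> differentiable (fun y => ip (G y) (Y y) (Z y)) x.
    by move=> sY sZ; apply: differentiable_ip; exact: smooth_diff Ox.
  have sphW := smooth_act sW.
  rewrite (derive_add _ (differentiable_sub (dip _ _ sη sphW) (dip _ _ sCW sP)) (dip _ _ sW sCP)).
  rewrite (derive_sub _ (dip _ _ sη sphW) (dip _ _ sCW sP)) !DI// CE// NE//.
  rewrite (cov_act oO G_smooth G_sym phi_smooth phi_parallel)//; last exact: smooth_diff Ox.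
  ring.
rewrite (eq_bigr _ (fun a _ => E1 a)) /S_variation /euler_lagrange -/S -/L.
(* [phi] commutes with the rough Laplacian and is self-adjoint, so it moves from [W] to the
   Laplacian of [xi]. *)
have EL : ip (G x) (rough_laplacian G e L x) (act phi W x) = ip (G x) (W x) (rough_laplacian G e P x).
  by rewrite /P rough_laplacian_act// -phi_sym// (ip_sym _ _ (G_sym Ox)).
rewrite ipBl EL (rough_laplacianE Ox sW) (rough_laplacianE Ox sP) ipNl ipNr !ip_suml ip_sumr.
(* The derivative of [R], that of [S] and one of the two copies of the last term assemble to the
   derivative of the field [curv G (e a) S xi]. The other copy remains. *)
have E2 a : nabla_curv G (e a) (e a) S xi x + curv G (e a) (nabla G (e a) S) xi x
            + 2 *: curv G (e a) S (nabla G (e a) xi) x =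
    nabla G (e a) (curv G (e a) S xi) x - xi x *m curv_mx G x (cov G (e a x) (e a) x) (S x)
    + cov G (e a x) xi x *m curv_mx G x (e a x) (S x).
  rewrite /nabla_curv (CE (nabla G (e a) (e a)) S xi)//; last exact: smooth_nabla.
  rewrite (CE _ _ (nabla G (e a) xi))//; last exact: smooth_nabla.
  rewrite (NE (e a) (e a) Ox) (NE (e a) xi Ox); move: (nabla G _ _ x) (curv G _ _ _ x) => p q.
  set r := xi x *m _; set s := cov _ _ _ _ *m _; move: r s => r s.
  by apply/rowP => j; rewrite !mxE; ring.
have pr u v z w := @curv_mx_pair R n O G oO G_smooth G_sym G_unit x u v z w Ox.
rewrite -!sumrN -!big_split /=; apply: eq_bigr => a _.
have H1 : ip (G x) (e a x *m curv_mx G x (W x *m phi x) (cov G (e a x) xi x)) (S x) =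
    - ip (G x) (cov G (e a x) xi x *m curv_mx G x (e a x) (S x)) (W x *m phi x).
  by rewrite pr (curv_mx_ip oO G_smooth G_sym G_unit _ _ _ _ Ox) (ip_sym _ _ (G_sym Ox)).
have H2 : ip (G x) (e a x *m curv_mx G x (xi x *m phi x) (cov G (e a x) W x)) (S x) =
    ip (G x) (xi x *m curv_mx G x (e a x) (S x)) (cov G (e a x) W x *m phi x).
  rewrite pr -mulmxA -(curv_mx_commute oO G_smooth G_sym G_unit phi_smooth phi_parallel _ _ Ox).
  by rewrite mulmxA phi_sym.
by rewrite E2 /flux_form -/S -/L -/P !(ipDl, ipDr, ipNl, ipNr) H1 H2 /act; ring.
Qed.

End FirstVariation.

(** * Tension field of a section *)

Section Submatrices.
Context {R : realType} {n : nat}.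
Local Notation E2 := 'rV[R]_(n + n).
Implicit Types (y w : E2).

Lemma differentiable_lsubmx y : differentiable (lsubmx : E2 -> 'rV[R]_n) y.
Proof.
apply/differentiable_mxP => i j; rewrite (_ : (fun z => _) = fun z : E2 => z i (lshift n j)).
  by apply: (differentiable_mxP _ _).1; exact: differentiable_id.
by apply/funext => z; rewrite mxE.
Qed.

Lemma differentiable_rsubmx y : differentiable (rsubmx : E2 -> 'rV[R]_n) y.
Proof.
apply/differentiable_mxP => i j; rewrite (_ : (fun z => _) = fun z : E2 => z i (rshift n j)).
  by apply: (differentiable_mxP _ _).1; exact: differentiable_id.
by apply/funext => z; rewrite mxE.
Qed.

Lemma derive_lsubmx y w : der w (lsubmx : E2 -> 'rV[R]_n) y = lsubmx w.
Proof.
apply/matrixP => i j; rewrite (derive_entry _ _ _ (differentiable_lsubmx y)) mxE.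
rewrite (_ : (fun z => _) = fun z : E2 => z i (lshift n j)); last by apply/funext => z; rewrite mxE.
by rewrite -(derive_entry w i (lshift n j) (differentiable_id y)) derive_id_val.
Qed.

Lemma derive_rsubmx y w : der w (rsubmx : E2 -> 'rV[R]_n) y = rsubmx w.
Proof.
apply/matrixP => i j; rewrite (derive_entry _ _ _ (differentiable_rsubmx y)) mxE.
rewrite (_ : (fun z => _) = fun z : E2 => z i (rshift n j)); last by apply/funext => z; rewrite mxE.
by rewrite -(derive_entry w i (rshift n j) (differentiable_id y)) derive_id_val.
Qed.

Lemma smooth_lsubmx (O : set E2) : open O -> smooth_on O (lsubmx : E2 -> 'rV[R]_n).
Proof.
move=> oO; apply/(smooth_mxP oO) => i j; apply: (smooth_eq oO (f := fun z : E2 => z i (lshift n j))).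
  by move=> z _; rewrite mxE.
exact: (smooth_mxP oO _).1 (smooth_id oO) i _.
Qed.

Lemma smooth_rsubmx (O : set E2) : open O -> smooth_on O (rsubmx : E2 -> 'rV[R]_n).
Proof.
move=> oO; apply/(smooth_mxP oO) => i j; apply: (smooth_eq oO (f := fun z : E2 => z i (rshift n j))).
  by move=> z _; rewrite mxE.
exact: (smooth_mxP oO _).1 (smooth_id oO) i _.
Qed.

Lemma open_lsubmx (O : set 'rV[R]_n) : open O -> open [set y : E2 | O (lsubmx y)].
Proof.
move=> oO; apply: (@open_comp _ _ (lsubmx : E2 -> 'rV[R]_n)) => // y _.
exact: differentiable_cts_at (differentiable_lsubmx y).
Qed.

End Submatrices.

Section KoszulFormula.
Context {R : realType} {n : nat}.
Local Notation E := 'rV[R]_n.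
Variables (O : set E) (G : E -> 'M[R]_n).
Hypotheses (oO : open O) (G_smooth : smooth_on O G).
Hypotheses (G_sym : forall x, O x -> (G x)^T = G x) (G_unit : forall x, O x -> G x \in unitmx).

(** Koszul's formula for constant fields with the first two arguments equal. It evaluates the
    connection against [w] without an inverse metric. *)
Lemma christ_koszul x u w : O x ->
  ip (G x) (u *m christ_mx G x u) w = ip (der u G x) u w - 2^-1 * ip (der w G x) u u.
Proof.
move=> Ox; rewrite !(derive_metric oO G_smooth G_sym G_unit)// !ipDm -!ip_mulr -!ip_mull.
rewrite (christ_mx_sym oO G_smooth G_sym w u Ox) (ip_sym u (u *m _) (G_sym Ox)).
by field.
Qed.

End KoszulFormula.

(** * Horizontal and vertical parts of the tension field *)

Section Tension.
Context {R : realType} {n : nat}.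
Local Notation E := 'rV[R]_n.
Local Notation E2 := 'rV[R]_(n + n).
Variables (O : set E) (G phi : E -> 'M[R]_n) (e : 'I_n -> E -> E).
Hypotheses (oO : open O) (G_smooth : smooth_on O G).
Hypotheses (G_sym : forall x, O x -> (G x)^T = G x) (G_unit : forall x, O x -> G x \in unitmx).
Hypothesis e_frame : orthonormal_frame O G e.
Hypothesis phi_smooth : smooth_on O phi.
Hypothesis phi_involution : forall x, O x -> phi x *m phi x = 1%:M.
Hypothesis phi_sym : forall x u v, O x -> ip (G x) (u *m phi x) v = ip (G x) u (v *m phi x).
Hypothesis phi_parallel : forall X Y, smooth_on O X -> smooth_on O Y ->
  forall x, O x -> nabla G X (act phi Y) x = nabla G X Y x *m phi x.
Implicit Types (X Y Z : E -> E) (u v x z : E).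

Let B x := G x *m (phi x)^T.
Let H := phi_sasaki G phi.
Let OH := [set y : E2 | O (lsubmx y)].
Let oOH : open OH. Proof. exact: open_lsubmx. Qed.
Let sA := christ_mx_smooth oO G_smooth G_unit.

(* [kappa y a] is the connection map, written [a K] in [phi_sasaki]. *)
Definition kappa (y a : E2) : E := rsubmx a + lsubmx a *m christ_mx G (lsubmx y) (rsubmx y).

Let ipB x u v : ip (B x) u v = ip (G x) u (v *m phi x).
Proof. by rewrite ip_mulr. Qed.

Let B_sym x : O x -> (B x)^T = B x.
Proof.
move=> Ox; apply: ip_inj => u v; rewrite [RHS]ipB -phi_sym// ip_mull /B trmx_mul trmxK.
by rewrite G_sym.
Qed.

Let B_unit x : O x -> B x \in unitmx.
Proof.
move=> Ox; rewrite unitmx_mul G_unit//= unitmx_tr.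
by have /mulmx1_unit[] := phi_involution Ox.
Qed.

Let B_smooth : smooth_on O B.
Proof. by apply: smooth_mulmx => //; exact: smooth_trmx. Qed.

(** [B] is parallel because [G] and [phi] are, and so obeys the rule of a metric. *)
Let derB x v : O x -> der v B x = christ_mx G x v *m B x + B x *m (christ_mx G x v)^T.
Proof.
move=> Ox; have dp := smooth_diff phi_smooth Ox; have dG' := smooth_diff G_smooth Ox.
rewrite (derive_mulmx v dG' (differentiable_trmx dp)) (derive_trmx v dp).
rewrite (derive_metric oO G_smooth G_sym G_unit v Ox).
rewrite (derive_parallel oO G_smooth G_sym phi_smooth phi_parallel v Ox) /B.
rewrite linearB /= !trmx_mul mulmxDl mulmxBr !mulmxA -!addrA; congr (_ + _).
by rewrite addrC subrK.
Qed.

Let derB_ip2 x v u : O x -> ip (der v B x) u u = 2 * ip (B x) u (u *m christ_mx G x v).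
Proof.
move=> Ox; rewrite (derB v Ox); have := B_sym Ox; move: (B x) => b sb.
by rewrite ipDm -ip_mulr -ip_mull (ip_sym _ u sb); ring.
Qed.

Let derB_ip x v Y Z : O x -> differentiable Y x -> differentiable Z x ->
  der v (fun p => ip (B p) (Y p) (Z p)) x =
  ip (B x) (cov G v Y x) (Z x) + ip (B x) (Y x) (cov G v Z x).
Proof.
move=> Ox dY dZ; rewrite (derive_ip v (smooth_diff B_smooth Ox) dY dZ) (derB v Ox) ipDm -ip_mull -ip_mulr.
by rewrite /cov ipDl ipDr; ring.
Qed.

Lemma sasakiE (y a b : E2) : ip (H y) a b =
  ip (G (lsubmx y)) (lsubmx a) (lsubmx b) + ip (B (lsubmx y)) (kappa y a) (kappa y b).
Proof.
rewrite /H /phi_sasaki; set P := col_mx 1%:M 0; set K := col_mx _ 1%:M.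
have aP c : c *m P = lsubmx c.
  by rewrite -{1}(hsubmxK c) mul_row_col mulmx1 mulmx0 addr0.
have aK c : c *m K = kappa y c.
  by rewrite -{1}(hsubmxK c) mul_row_col mulmx1 addrC.
by rewrite -!aP -!aK /ip mulmxDr mulmxDl mxE; congr (_ + _); rewrite !trmx_mul !mulmxA.
Qed.

Let H_smooth : smooth_on OH H.
Proof.
have sl : smooth_on OH (lsubmx : E2 -> E) by exact: smooth_lsubmx.
have sc p q (F : E -> 'M[R]_(p, q)) : smooth_on O F -> smooth_on OH (fun y : E2 => F (lsubmx y)).
  by apply: (smooth_comp oOH oO).
have sK : smooth_on OH (fun y : E2 => col_mx (christ_mx G (lsubmx y) (rsubmx y)) 1%:M : 'M[R]_(n + n, n)).
  apply: smooth_col_mx => //; last exact: smooth_cst.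
  apply: (smooth_eq oOH (f := fun y : E2 => \sum_k (rsubmx y : E) 0 k *: christ_mx G (lsubmx y) (delta_mx 0 k))).
    by move=> y _; rewrite -christ_mx_delta.
  apply: smooth_bigsum => // k; apply: smooth_scale => //; last exact: sc (sA _).
  by apply: (smooth_mxP oOH _).1; exact: smooth_rsubmx.
apply: smooth_add => //.
  apply: smooth_mulmx => //; last exact: smooth_cst.
  by apply: smooth_mulmx => //; [exact: smooth_cst|exact: sc].
by apply: smooth_mulmx => //; [apply: smooth_mulmx => //; exact: sc B_smooth|exact: smooth_trmx].
Qed.

Let H_sym y : OH y -> (H y)^T = H y.
Proof.
move=> Oy; apply: ip_inj => a b.
have -> : ip (H y)^T a b = ip (H y) b a.
  rewrite /ip; have <- : (b *m H y *m a^T)^T = a *m (H y)^T *m b^T.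
    by rewrite !trmx_mul trmxK mulmxA.
  by rewrite mxE.
by rewrite !sasakiE (ip_sym _ (lsubmx a) (G_sym Oy)) (ip_sym _ (kappa y a) (B_sym Oy)).
Qed.

(** [H] need not be definite, so positivity cannot give invertibility. Vectors with zero horizontal
    part detect [kappa y a] through [B]; once this is 0, the horizontal part of [a] is detected
    through [G]. *)
Let H_nondegenerate (y a : E2) : OH y -> (forall b : E2, ip (H y) a b = 0) -> a = 0.
Proof.
move=> Oy a0; have k0 : kappa y a = 0.
  apply: (ip_nondegenerate (B_unit Oy)) => z; rewrite ip0l -(a0 (row_mx 0 z)) sasakiE /kappa.
  by rewrite row_mxKl row_mxKr ip0r add0r mul0mx addr0.
have l0 : lsubmx a = 0.
  by apply: (ip_nondegenerate (G_unit Oy)) => z; rewrite ip0l -(a0 (row_mx z 0)) sasakiE k0 ip0l addr0 row_mxKl.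
by rewrite -(hsubmxK a) l0; move: k0; rewrite /kappa l0 mul0mx addr0 => ->; rewrite row_mx0.
Qed.

Let H_unit y : OH y -> H y \in unitmx.
Proof.
move=> Oy; rewrite -row_free_unit -kermx_eq0; apply/eqP/row_matrixP => i; rewrite row0.
apply: (H_nondegenerate Oy) => b; by rewrite /ip -row_mul mulmx_ker row0 mul0mx mxE.
Qed.

Let derH x v (a w : E2) : O x -> der w (fun p => ip (H p) a a) (row_mx x v) =
  ip (der (lsubmx w) G x) (lsubmx a) (lsubmx a)
  + ip (der (lsubmx w) B x) (kappa (row_mx x v) a) (kappa (row_mx x v) a)
  + 2 * ip (B x) (kappa (row_mx x v) a)
      (lsubmx a *m (dchrist G (lsubmx w) v x + christ_mx G x (rsubmx w))).
Proof.
move=> Ox; pose q : E2 := row_mx x v.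
have lq : lsubmx q = x by exact: row_mxKl.
have rq : rsubmx q = v by exact: row_mxKr.
have dl := differentiable_lsubmx q; have dr := differentiable_rsubmx q.
have dGl : differentiable G (lsubmx q) by rewrite lq; exact: smooth_diff G_smooth Ox.
have dBl : differentiable B (lsubmx q) by rewrite lq; exact: smooth_diff B_smooth Ox.
have dAl k : differentiable (fun y => christ_mx G y (delta_mx 0 k)) (lsubmx q).
  by rewrite lq; exact: smooth_diff (sA _) Ox.
have dcG : differentiable (fun y : E2 => G (lsubmx y)) q by exact: (differentiable_comp dl).
have dcB : differentiable (fun y : E2 => B (lsubmx y)) q by exact: (differentiable_comp dl).
have dcA k : differentiable (fun y : E2 => christ_mx G (lsubmx y) (delta_mx 0 k)) q.
  exact: (differentiable_comp dl (dAl k)).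
have drk := (differentiable_mxP _ _).1 dr.
have Efun : (fun y : E2 => christ_mx G (lsubmx y) (rsubmx y)) =
    fun y => \sum_k (rsubmx y : E) 0 k *: christ_mx G (lsubmx y) (delta_mx 0 k).
  by apply/funext => y; exact: christ_mx_delta.
have dA : differentiable (fun y : E2 => christ_mx G (lsubmx y) (rsubmx y)) q.
  by rewrite Efun; apply: differentiable_bigsum => k; exact: differentiable_scale.
have DA : der w (fun y : E2 => christ_mx G (lsubmx y) (rsubmx y)) q =
    dchrist G (lsubmx w) v x + christ_mx G x (rsubmx w).
  rewrite Efun derive_bigsum; last by move=> k; exact: differentiable_scale.
  have -> : dchrist G (lsubmx w) v x =
      \sum_k v 0 k *: der (lsubmx w) (fun y => christ_mx G y (delta_mx 0 k)) x.
    rewrite /dchrist (derive_eq_in _ oO Ox (fun y _ => christ_mx_delta G y v)).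
    rewrite derive_bigsum; last by move=> k; apply: differentiable_scale_cst; exact: smooth_diff (sA _) Ox.
    by apply: eq_bigr => k _; apply: derive_scale_cst; exact: smooth_diff (sA _) Ox.
  rewrite (christ_mx_delta G x (rsubmx w)) -big_split; apply: eq_bigr => k _ /=.
  rewrite (derive_scale _ (drk 0 k) (dcA k)) -(derive_entry _ _ _ dr) derive_rsubmx lq rq addrC.
  congr (_ + _); congr (_ *: _).
  by rewrite (derive_comp w dl (dAl k)) derive_lsubmx lq.
have dca : differentiable (fun=> lsubmx a : E) q by exact: differentiable_const.
have dra : differentiable (fun=> rsubmx a : E) q by exact: differentiable_const.
have dk : differentiable (fun y : E2 => kappa y a) q.
  exact: (differentiable_add dra (differentiable_mulmx dca dA)).
have Dk : der w (fun y : E2 => kappa y a) q = lsubmx a *m (dchrist G (lsubmx w) v x + christ_mx G x (rsubmx w)).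
  rewrite /kappa (derive_add w dra (differentiable_mulmx dca dA)) (derive_mulmx w dca dA).
  by rewrite !derive_const mul0mx !add0r DA.
rewrite (_ : (fun y : E2 => ip (H y) a a) = fun y : E2 => ip (G (lsubmx y)) (lsubmx a) (lsubmx a)
   + ip (B (lsubmx y)) (kappa y a) (kappa y a)); last by apply/funext => y; exact: sasakiE.
rewrite (derive_add w (differentiable_ip dcG dca dca) (differentiable_ip dcB dk dk)).
rewrite (derive_ip w dcG dca dca) (derive_ip w dcB dk dk) derive_const ip0l ip0r !addr0.
rewrite (derive_comp w dl dGl) (derive_comp w dl dBl) derive_lsubmx lq Dk -/q.
by rewrite (ip_sym _ (kappa q a) (B_sym Ox)); ring.
Qed.

Let df X (a : 'I_n) := fun y => der (e a y) (section_map X) y.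

Let dfE X (a : 'I_n) x : differentiable X x -> df X a x = row_mx (e a x) (der (e a x) X x).
Proof.
move=> dX; rewrite /df /section_map (derive_row_mx _ (differentiable_id x) dX).
by rewrite derive_id_val.
Qed.

Let df_kappa X x u : O x -> kappa (section_map X x) (row_mx u (der u X x)) = cov G u X x.
Proof.
move=> Ox; rewrite /kappa /section_map !row_mxKl !row_mxKr /cov.
by rewrite (christ_mx_sym oO G_smooth G_sym u _ Ox).
Qed.

(* [xw] extends [w]; the derivative of [H] along the section is traded for
   that of the scalar function [H(df, xw)]. *)
Let second_form_ip X (a : 'I_n) x (w : E2) (xw : E -> E2) : O x -> smooth_on O X ->
  smooth_on O xw -> xw x = w ->
  ip (H (section_map X x)) (second_form G H (section_map X) (e a) (e a) x) w =
  der (e a x) (fun p => ip (H (section_map X p)) (df X a p) (xw p)) x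
  - ip (H (section_map X x)) (df X a x) (der (e a x) xw x)
  - 2^-1 * der w (fun p => ip (H p) (df X a x) (df X a x)) (section_map X x)
  - ip (H (section_map X x)) (row_mx (cov G (e a x) (e a) x) (der (cov G (e a x) (e a) x) X x)) w.
Proof.
move=> Ox sX sw xwx.
have sf : smooth_on O (section_map X).
  by apply: smooth_row_mx => //; exact: smooth_id.
have ea : smooth_on O (e a) by exact: e_frame.1.
have sdf : smooth_on O (df X a) by exact: smooth_derive_along.
have Of : OH (section_map X x) by rewrite /OH /= row_mxKl.
have dH := smooth_diff H_smooth Of; have dsf := smooth_diff sf Ox.
have dHf : differentiable (fun z => H (section_map X z)) x by exact: (differentiable_comp dsf).
have Ddf : der (e a x) (section_map X) x = df X a x by [].
rewrite (derive_ip _ dHf (smooth_diff sdf Ox) (smooth_diff sw Ox)) xwx.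
rewrite (derive_comp _ dsf dH) Ddf.
have dca : differentiable (fun=> df X a x) (section_map X x) by exact: differentiable_const.
rewrite (derive_ip w dH dca dca) derive_const ip0l ip0r !addr0.
have -> : second_form G H (section_map X) (e a) (e a) x =
    der (e a x) (df X a) x + df X a x *m christ_mx H (section_map X x) (df X a x)
    - row_mx (cov G (e a x) (e a) x) (der (cov G (e a x) (e a) x) X x).
  have DN u : row_mx u (der u X x) = der u (section_map X) x.
    by rewrite /section_map (derive_row_mx _ (differentiable_id x) (smooth_diff sX Ox)) derive_id_val.
  by rewrite DN /second_form (nablaE oO G_smooth G_sym _ _ Ox) /df der.unlock.
rewrite !(ipDl, ipNl) (christ_koszul oOH H_smooth H_sym H_unit _ _ Of); ring.
Qed.

Let ip_row_kappa X x u (w : E2) : O x ->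
  ip (H (section_map X x)) (row_mx u (der u X x)) w =
  ip (G x) u (lsubmx w) + ip (B x) (cov G u X x) (kappa (section_map X x) w).
Proof. by move=> Ox; rewrite sasakiE df_kappa// /section_map !row_mxKl. Qed.

Let der_cst x v z : cov G v (fun=> z) x = z *m christ_mx G x v.
Proof. by rewrite /cov derive_const add0r. Qed.

(** A constant vertical field extends [vlift z] and has no horizontal part, so only [B] and [kappa]
    enter. The Christoffel term in [F1] cancels half of [F2], and the second covariant derivative of
    [X] is left. *)
Lemma tension_vlift X x z : O x -> smooth_on O X ->
  ip (H (section_map X x)) (tension G H e (section_map X) x) (vlift z) =
  - ip (B x) (rough_laplacian G e X x) z.
Proof.
move=> Ox sX; have dX y : O y -> differentiable X y by exact: smooth_diff.
rewrite (rough_laplacianE e oO G_smooth G_sym Ox sX) ipNl opprK !ip_suml.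
apply: eq_bigr => a _; have ea : smooth_on O (e a) by exact: e_frame.1.
have lv : lsubmx (vlift z) = 0 :> E by rewrite row_mxKl.
have rv : rsubmx (vlift z) = z :> E by rewrite row_mxKr.
have kv y : kappa y (vlift z) = z by rewrite /kappa rv lv mul0mx addr0.
have sc : smooth_on O (fun y => cov G (e a y) X y) by exact: smooth_cov.
have F1 : der (e a x) (fun p => ip (H (section_map X p)) (df X a p) (vlift z)) x =
    ip (B x) (cov G (e a x) (fun y => cov G (e a y) X y) x) z
    + ip (B x) (cov G (e a x) X x) (z *m christ_mx G x (e a x)).
  rewrite (derive_eq_in (g := fun p => ip (B p) (cov G (e a p) X p) z) _ oO Ox); last first.
    by move=> y Oy; rewrite (dfE a (dX y Oy)) ip_row_kappa// lv ip0r add0r kv.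
  rewrite (derB_ip _ Ox (smooth_diff sc Ox)); last exact: differentiable_const.
  by rewrite der_cst.
have z0 (V : normedModType R) (f : E -> V) : differentiable f x -> der 0 f x = 0.
  by move=> df'; rewrite -(scale0r (0 : E)) (deriveZv _ _ df') scale0r.
have F2 : der (vlift z) (fun p => ip (H p) (df X a x) (df X a x)) (section_map X x) =
    2 * ip (B x) (cov G (e a x) X x) (e a x *m christ_mx G x z).
  rewrite (derH _ _ _ Ox) lv rv z0; last exact: smooth_diff G_smooth Ox.
  rewrite z0; last exact: smooth_diff B_smooth Ox.
  rewrite /dchrist z0; last exact: smooth_diff (sA _) Ox.
  rewrite (dfE a (dX x Ox)) row_mxKl -/(section_map X x) df_kappa// add0r.
  by rewrite {1 2}/ip !mulmx0 !mul0mx !mxE !add0r.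
rewrite (second_form_ip (xw := fun=> vlift z) a Ox sX (smooth_cst oO _) erefl).
rewrite F1 F2 derive_const ip0r ip_row_kappa// lv ip0r kv ipDl ipNl.
by rewrite (christ_mx_sym oO G_smooth G_sym z _ Ox); field.
Qed.

(** The horizontal lift of the constant [z] along the whole section is chosen as extension: [kappa]
    vanishes on it, so its pairing with the differential of the section involves [G] alone. The
    derivatives of the Christoffel symbols that remain form a curvature. *)
Lemma tension_hlift X x z : O x -> smooth_on O X ->
  ip (H (section_map X x)) (tension G H e (section_map X) x) (hlift G x (X x) z) =
  ip (G x) (S_field G phi e X x) z.
Proof.
move=> Ox sX; have dX y : O y -> differentiable X y by exact: smooth_diff.
rewrite (S_fieldE oO G_smooth G_sym G_unit e_frame phi_smooth Ox sX) !ip_suml.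
apply: eq_bigr => a _; have ea : smooth_on O (e a) by exact: e_frame.1.
pose xw p : E2 := hlift G p (X p) z.
have lw p : lsubmx (xw p) = z by rewrite row_mxKl.
have kw p : kappa (section_map X p) (xw p) = 0.
  by rewrite /kappa lw /section_map row_mxKr row_mxKl row_mxKr addrC subrr.
have sAX := smooth_christ_mx oO G_smooth G_unit sX.
have szA : smooth_on O (fun p => - (z *m christ_mx G p (X p))).
  by apply: smooth_opp => //; apply: smooth_mulmx => //; exact: smooth_cst.
have sxw : smooth_on O xw.
  by apply: smooth_row_mx => //; exact: smooth_cst.
have F1 : der (e a x) (fun p => ip (H (section_map X p)) (df X a p) (xw p)) x =
    ip (G x) (cov G (e a x) (e a) x) z + ip (G x) (e a x) (z *m christ_mx G x (e a x)).
  rewrite (derive_eq_in (g := fun p => ip (G p) (e a p) z) _ oO Ox); last first.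
    by move=> y Oy; rewrite (dfE a (dX y Oy)) ip_row_kappa// lw kw ip0r addr0.
  rewrite (derive_ip_cov oO G_smooth G_sym G_unit _ Ox (smooth_diff ea Ox)); last exact: differentiable_const.
  by rewrite der_cst.
have dc0 : differentiable (fun=> z) x by exact: differentiable_const.
have Dxw : der (e a x) xw x =
    row_mx 0 (- (z *m (dchrist G (e a x) (X x) x + christ_mx G x (der (e a x) X x)))).
  rewrite /xw /hlift (derive_row_mx _ dc0 (smooth_diff szA Ox)) derive_const; congr row_mx.
  have dAX := smooth_diff sAX Ox.
  rewrite (derive_opp _ (differentiable_mulmx dc0 dAX)) (derive_mulmx _ dc0 dAX) derive_const mul0mx add0r.
  by rewrite (derive_christ_mx oO G_smooth G_unit _ Ox (dX x Ox)).
have F2 : der (xw x) (fun p => ip (H p) (df X a x) (df X a x)) (section_map X x) =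
    2 * ip (G x) (e a x) (e a x *m christ_mx G x z)
    + 2 * ip (B x) (cov G (e a x) X x) (cov G (e a x) X x *m christ_mx G x z)
    + 2 * ip (B x) (cov G (e a x) X x)
      (e a x *m (dchrist G z (X x) x - christ_mx G x (z *m christ_mx G x (X x)))).
  rewrite (derH _ _ _ Ox) lw row_mxKr (dfE a (dX x Ox)) row_mxKl -/(section_map X x) df_kappa//.
  have -> : ip (der z G x) (e a x) (e a x) = 2 * ip (G x) (e a x) (e a x *m christ_mx G x z).
    rewrite (derive_metric oO G_smooth G_sym G_unit _ Ox) ipDm -ip_mulr -ip_mull.
    by rewrite (ip_sym _ (e a x) (G_sym Ox)); ring.
  by rewrite derB_ip2// christ_mxN.
rewrite (second_form_ip a Ox sX sxw erefl) F1 F2 Dxw (dfE a (dX x Ox)) !ip_row_kappa// lw kw ip0r addr0.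
rewrite row_mxKl ip0r add0r {1}/kappa row_mxKl row_mxKr mul0mx addr0.
have cs u v := christ_mx_sym oO G_smooth G_sym u v Ox.
have ds u v w := dchrist_sym oO G_smooth G_sym G_unit u v w Ox.
(* Pair symmetry and commutation with [phi] turn the right-hand side into a pairing by [B] of the
   covariant derivative of [X] with the curvature of [e a], [z] applied to [X], the shape of the
   left-hand side. *)
rewrite (curv_mx_pair oO G_smooth G_sym G_unit _ _ _ _ Ox) -mulmxA.
rewrite -(curv_mx_commute oO G_smooth G_sym G_unit phi_smooth phi_parallel _ _ Ox) mulmxA.
rewrite (ip_sym _ (cov G (e a x) X x) (G_sym Ox)) -ipB.
set c := cov G (e a x) X x.
have E1 : c *m christ_mx G x z =
    z *m christ_mx G x (der (e a x) X x) + X x *m christ_mx G x (e a x) *m christ_mx G x z.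
  by rewrite /c /cov mulmxDl (cs z).
have E2' := ds (e a x) z (X x); have E3 := ds z (e a x) (X x).
have E4 : e a x *m christ_mx G x (z *m christ_mx G x (X x)) =
    X x *m christ_mx G x z *m christ_mx G x (e a x).
  by rewrite cs (cs z).
rewrite /curv_mx !mulmxDr !mulmxN !mulmxA E1 E2' E3 E4 (cs z (e a x)) !(ipDr, ipNr).
by field.
Qed.

(** The two tests determine [kappa] and the horizontal part of the tension field, by nondegeneracy
    of [B] and [G]; [sasakiE] then evaluates its square. *)
Lemma bienergy_densityE X x : O x -> smooth_on O X ->
  bienergy_density G phi e X x =
  ip (G x) (S_field G phi e X x) (S_field G phi e X x)
  + ip (G x) (rough_laplacian G e X x) (rough_laplacian G e X x *m phi x).
Proof.
move=> Ox sX; rewrite /bienergy_density -/H; set tau := tension _ _ _ _ _.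
have lS : lsubmx (section_map X x) = x :> E by rewrite row_mxKl.
have rS : rsubmx (section_map X x) = X x :> E by rewrite row_mxKr.
have k0 : kappa (section_map X x) tau = - rough_laplacian G e X x.
  apply: (ip_nondegenerate (B_unit Ox)) => z; rewrite ipNl -tension_vlift// sasakiE lS.
  have -> : kappa (section_map X x) (vlift z) = z by rewrite /kappa [X in X + _]row_mxKr [X in X *m _]row_mxKl mul0mx addr0.
  by rewrite [lsubmx (vlift z)]row_mxKl ip0r add0r.
have l0 : lsubmx tau = S_field G phi e X x.
  apply: (ip_nondegenerate (G_unit Ox)) => z; rewrite -tension_hlift// sasakiE lS.
  have -> : kappa (section_map X x) (hlift G x (X x) z) = 0.
    by rewrite /kappa lS rS [X in X + _]row_mxKr [X in X *m _]row_mxKl addNr.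
  by rewrite ip0r addr0 [lsubmx (hlift _ _ _ _)]row_mxKl.
by rewrite sasakiE lS k0 l0 ipNl ipNr opprK ipB.
Qed.

End Tension.

(** * Changes of frames and of charts *)

Section FrameIndependence.
Context {R : realType} {n : nat}.
Local Notation E := 'rV[R]_n.
Variables (O : set E) (G phi : E -> 'M[R]_n).
Hypotheses (oO : open O) (G_smooth : smooth_on O G).
Hypotheses (G_sym : forall x, O x -> (G x)^T = G x) (G_unit : forall x, O x -> G x \in unitmx).
Hypothesis phi_smooth : smooth_on O phi.
Implicit Types (e : 'I_n -> E -> E) (X : E -> E) (u v w x : E).

Lemma bilinear_expand (V : lmodType R) (h : E -> E -> V) :
  (forall u v w, h (u + v) w = h u w + h v w) -> (forall c u w, h (c *: u) w = c *: h u w) ->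
  (forall u v w, h w (u + v) = h w u + h w v) -> (forall c u w, h w (c *: u) = c *: h w u) ->
  forall u v, h u v = \sum_k \sum_l (u 0 k * v 0 l) *: h (delta_mx 0 k) (delta_mx 0 l).
Proof.
move=> hDl hZl hDr hZr u v.
have h0l w : h 0 w = 0 by rewrite -(scale0r (0 : E)) hZl scale0r.
have h0r w : h w 0 = 0 by rewrite -(scale0r (0 : E)) hZr scale0r.
rewrite {1}(row_sum_delta u) (big_morph (fun u => h u v) (fun a b => hDl a b v) (h0l v)).
apply: eq_bigr => k _; rewrite hZl {1}(row_sum_delta v).
rewrite (big_morph (h _) (fun a b => hDr a b _) (h0r _)) scaler_sumr.
by apply: eq_bigr => l _; rewrite hZr scalerA.
Qed.

(** The right-hand side, a contraction with the inverse metric, does not mention the frame. *)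
Lemma frame_bilinear e (V : lmodType R) (h : E -> E -> V) x : orthonormal_frame O G e -> O x ->
  (forall u v, h u v = \sum_k \sum_l (u 0 k * v 0 l) *: h (delta_mx 0 k) (delta_mx 0 l)) ->
  \sum_a h (e a x) (e a x) = \sum_k \sum_l invmx (G x) k l *: h (delta_mx 0 k) (delta_mx 0 l).
Proof.
move=> fe Ox hE; rewrite (eq_bigr _ (fun a _ => hE (e a x) (e a x))) exchange_big /=.
apply: eq_bigr => k _; rewrite exchange_big /=; apply: eq_bigr => l _.
rewrite -scaler_suml; congr (_ *: _).
rewrite -(orthonormal_sum (G_unit Ox) (fun a b => fe.2 a b x Ox)) summxE.
by apply: eq_bigr => a _; rewrite mxE big_ord1 mxE.
Qed.

(** The second covariant derivative, with [u] extended to a constant field, whose covariant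
    derivative along [v] is [u *m christ_mx G x v]. It is bilinear in the two vectors, unlike either
    of the two terms of the rough Laplacian, which see the derivatives of the frame. *)
Let hess X x u v : E :=
  \sum_k u 0 k *: cov G v (cov G (delta_mx 0 k) X) x - cov G (u *m christ_mx G x v) X x.

(** The derivatives of the coefficients of [e a] occur in both terms of the rough Laplacian and
    cancel. *)
Let rough_laplacian_hess e X x : orthonormal_frame O G e -> O x -> smooth_on O X ->
  rough_laplacian G e X x = - \sum_a hess X x (e a x) (e a x).
Proof.
move=> fe Ox sX; rewrite (rough_laplacianE e oO G_smooth G_sym Ox sX); congr (- _).
apply: eq_bigr => a _; have sea := fe.1 a; have dea := smooth_diff sea Ox.
have dX y : O y -> differentiable X y by exact: smooth_diff.
have dek := (differentiable_mxP _ _).1 dea.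
have sT k : smooth_on O (cov G (delta_mx 0 k) X).
  by have := smooth_cov oO G_smooth G_unit (smooth_cst oO (delta_mx 0 k)) sX.
have covE y v : O y -> cov G v X y = \sum_k v 0 k *: cov G (delta_mx 0 k) X y.
  move=> Oy; rewrite {1}/cov (derive_row v (dX y Oy)) (christ_mx_delta G y v) mulmx_sumr -big_split.
  by apply: eq_bigr => k _; rewrite /cov scalerDr scalemxAr.
rewrite (cov_eq _ oO _ Ox (fun y Oy => covE y (e a y) Oy)).
have dS k : differentiable (fun y => e a y 0 k *: cov G (delta_mx 0 k) X y) x.
  by apply: differentiable_scale => //; exact: smooth_diff (sT k) Ox.
have -> : cov G (e a x) (fun y => \sum_k e a y 0 k *: cov G (delta_mx 0 k) X y) x =
   \sum_k (der (e a x) (fun y => e a y 0 k) x *: cov G (delta_mx 0 k) X x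
     + e a x 0 k *: cov G (e a x) (cov G (delta_mx 0 k) X) x).
  rewrite {1}/cov (derive_bigsum _ _ _ dS) mulmx_suml -big_split; apply: eq_bigr => k _ /=.
  by rewrite -(covZ _ _ (dek 0 k) (smooth_diff (sT k) Ox)).
rewrite big_split /= /hess (_ : cov G (e a x) (e a) x = der (e a x) (e a) x + e a x *m christ_mx G x (e a x))//.
rewrite (covDl _ _ _ (dX x Ox)) opprD addrACA -[RHS]add0r; congr (_ + _).
apply/eqP; rewrite subr_eq0 (covE x (der _ _ _) Ox); apply/eqP/eq_bigr => k _.
by rewrite (derive_entry _ 0 k dea).
Qed.

Lemma rough_laplacian_frame e e' X x : orthonormal_frame O G e -> orthonormal_frame O G e' ->
  O x -> smooth_on O X -> rough_laplacian G e X x = rough_laplacian G e' X x.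
Proof.
move=> fe fe' Ox sX; have dX := smooth_diff sX Ox.
have dT k : differentiable (cov G (delta_mx 0 k) X) x.
  by apply: smooth_diff Ox; have := smooth_cov oO G_smooth G_unit (smooth_cst oO (delta_mx 0 k)) sX.
have hE : forall u v, hess X x u v =
    \sum_k \sum_l (u 0 k * v 0 l) *: hess X x (delta_mx 0 k) (delta_mx 0 l).
  apply: bilinear_expand => [u v w|c u w|u v w|c u w]; rewrite /hess.
  - rewrite mulmxDl (covDl _ _ _ dX) opprD addrACA -big_split; congr (_ + _).
    by apply: eq_bigr => k _; rewrite mxE scalerDl.
  - rewrite -scalemxAl (covZl _ _ _ dX) scalerBr scaler_sumr; congr (_ - _).
    by apply: eq_bigr => k _; rewrite mxE scalerA.
  - rewrite christ_mxD mulmxDr (covDl _ _ _ dX) opprD addrACA -big_split; congr (_ + _).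
    by apply: eq_bigr => k _; rewrite (covDl _ _ _ (dT k)) scalerDr.
  - rewrite christ_mxZ -scalemxAr (covZl _ _ _ dX) scalerBr scaler_sumr; congr (_ - _).
    by apply: eq_bigr => k _; rewrite (covZl _ _ _ (dT k)) !scalerA mulrC.
by rewrite !rough_laplacian_hess// (frame_bilinear fe Ox hE) (frame_bilinear fe' Ox hE).
Qed.

Lemma S_field_frame e e' X x : orthonormal_frame O G e -> orthonormal_frame O G e' ->
  O x -> smooth_on O X -> S_field G phi e X x = S_field G phi e' X x.
Proof.
move=> fe fe' Ox sX; have dX := smooth_diff sX Ox.
pose h u v := u *m curv_mx G x (X x *m phi x) (cov G v X x).
have hE : forall u v, h u v = \sum_k \sum_l (u 0 k * v 0 l) *: h (delta_mx 0 k) (delta_mx 0 l).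
  apply: bilinear_expand => [u v w|c u w|u v w|c u w]; rewrite /h.
  - by rewrite mulmxDl.
  - by rewrite -scalemxAl.
  - by rewrite (covDl _ _ _ dX) (curv_mxDr oO G_smooth G_unit _ _ _ Ox) mulmxDr.
  - by rewrite (covZl _ _ _ dX) (curv_mxZr oO G_smooth G_unit _ _ _ Ox) -scalemxAr.
rewrite (S_fieldE oO G_smooth G_sym G_unit fe phi_smooth Ox sX).
rewrite (S_fieldE oO G_smooth G_sym G_unit fe' phi_smooth Ox sX).
by rewrite (frame_bilinear fe Ox hE) (frame_bilinear fe' Ox hE).
Qed.

End FrameIndependence.

(** * Naturality under isometric changes of chart *)

Section Naturality.
Context {R : realType} {n : nat}.
Local Notation E := 'rV[R]_n.
Variables (O1 O2 : set E) (theta eta : E -> E).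
Hypotheses (oO1 : open O1) (oO2 : open O2).
Hypotheses (theta_smooth : smooth_on O1 theta) (eta_smooth : smooth_on O2 eta).
Hypotheses (thetaO : forall x, O1 x -> O2 (theta x)) (etaO : forall y, O2 y -> O1 (eta y)).
Hypotheses (thetaK : forall x, O1 x -> eta (theta x) = x).
Hypotheses (etaK : forall y, O2 y -> theta (eta y) = y).
Variables (G1 G2 : E -> 'M[R]_n).
Hypotheses (G1_smooth : smooth_on O1 G1) (G2_smooth : smooth_on O2 G2).
Hypotheses (G1_sym : forall x, O1 x -> (G1 x)^T = G1 x) (G2_sym : forall x, O2 x -> (G2 x)^T = G2 x).
Hypotheses (G1_unit : forall x, O1 x -> G1 x \in unitmx) (G2_unit : forall x, O2 x -> G2 x \in unitmx).
Hypothesis isometry : forall x u v, O1 x ->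
  ip (G2 (theta x)) (der u theta x) (der v theta x) = ip (G1 x) u v.
Implicit Types (X Y Z : E -> E) (u v w x y : E).

(** The fields are [theta]-related; for the expressions of one field in two charts this is the
    transformation law. *)
Definition related X Y := forall x, O1 x -> Y (theta x) = der (X x) theta x.

Let dt x : O1 x -> differentiable theta x. Proof. exact: smooth_diff. Qed.

Let der_surj x v : O1 x -> exists u, der u theta x = v.
Proof.
move=> Ox; exists (der v eta (theta x)); have Oy := thetaO Ox.
have de := smooth_diff eta_smooth Oy.
have dte : differentiable theta (eta (theta x)) by rewrite thetaK//; exact: dt.
rewrite -{2}(thetaK Ox) -(derive_comp v de dte).
by rewrite (derive_eq_in v oO2 Oy (fun y Oy => etaK Oy)) derive_id_val.
Qed.

Let derive_isometry x u v w : O1 x ->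
  ip (der (der w theta x) G2 (theta x)) (der u theta x) (der v theta x)
  + ip (G2 (theta x)) (der w (der u theta) x) (der v theta x)
  + ip (G2 (theta x)) (der u theta x) (der w (der v theta) x) = ip (der w G1 x) u v.
Proof.
move=> Ox; have Oy := thetaO Ox; have dG2 := smooth_diff G2_smooth Oy.
have dGt : differentiable (fun z => G2 (theta z)) x by exact: (differentiable_comp (dt Ox)).
have du z : differentiable (der z theta) x by exact: smooth_diff (smooth_derive z theta_smooth) Ox.
have := derive_eq_in w oO1 Ox (fun z Oz => isometry u v Oz).
rewrite (derive_ip w dGt (du u) (du v)) (derive_comp w (dt Ox) dG2) => ->.
have dc z : differentiable (fun=> z : E) x by exact: differentiable_const.
by rewrite (derive_ip w (smooth_diff G1_smooth Ox) (dc u) (dc v)) !derive_const ip0l ip0r !addr0.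
Qed.

(* The difference of the two sides is symmetric in [u, v], and pairing it with
   [der w theta x] gives a form that is skew in the last two arguments. *)
Lemma christ_transform x u v : O1 x ->
  der u theta x *m christ_mx G2 (theta x) (der v theta x) =
  der (u *m christ_mx G1 x v) theta x - der u (der v theta) x.
Proof.
move=> Ox; have Oy := thetaO Ox.
pose B a b := der a theta x *m christ_mx G2 (theta x) (der b theta x)
  - (der (a *m christ_mx G1 x b) theta x - der a (der b theta) x).
suff B0 : B u v = 0 by apply/eqP; rewrite -subr_eq0 -/(B u v) B0.
have Bsym a b : B a b = B b a.
  rewrite /B (christ_mx_sym oO2 G2_smooth G2_sym _ _ Oy).
  by rewrite (christ_mx_sym oO1 G1_smooth G1_sym a _ Ox) (schwarz_mx a b oO1 theta_smooth Ox).
pose c a b d := ip (G2 (theta x)) (B a b) (der d theta x).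
have c_skew a b d : c a b d = - c a d b.
  apply/eqP; rewrite -addr_eq0 /c (ip_sym (B a d) _ (G2_sym Oy)) /B.
  have := derive_isometry b d a Ox.
  rewrite (derive_metric oO2 G2_smooth G2_sym G2_unit _ Oy) ipDm -ip_mull -ip_mulr.
  rewrite (derive_metric oO1 G1_smooth G1_sym G1_unit _ Ox) ipDm -ip_mull -ip_mulr -!isometry//.
  rewrite !(ipDl, ipDr, ipNl, ipNr).
  rewrite !(christ_mx_sym oO2 G2_smooth G2_sym _ (der a theta x) Oy).
  rewrite !(christ_mx_sym oO1 G1_smooth G1_sym _ a Ox) => H.
  apply/eqP; move: H; lra.
have c_sym a b d : c a b d = c b a d by rewrite /c Bsym.
apply: (ip_nondegenerate (G2_unit Oy)) => z; have [d <-] := der_surj z Ox; rewrite ip0l -/(c u v d).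
have : c u v d = - c u v d.
  by rewrite {1}c_sym c_skew c_sym c_skew opprK c_sym c_skew.
lra.
Qed.

Lemma derive_related X Y x u : O1 x -> smooth_on O1 X -> smooth_on O2 Y -> related X Y ->
  der (der u theta x) Y (theta x) = der u (der (X x) theta) x + der (der u X x) theta x.
Proof.
move=> Ox sX sY XY; have dX := smooth_diff sX Ox; have dY := smooth_diff sY (thetaO Ox).
rewrite -(derive_comp u (dt Ox) dY) (derive_eq_in u oO1 Ox XY).
by rewrite (derive_along u oO1 Ox theta_smooth dX).
Qed.

(** Differentiating the relation produces second derivatives of [theta], which those in the
    transformation law of the Christoffel symbols cancel. *)
Lemma cov_related X Y x u : O1 x -> smooth_on O1 X -> smooth_on O2 Y -> related X Y ->
  cov G2 (der u theta x) Y (theta x) = der (cov G1 u X x) theta x.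
Proof.
move=> Ox sX sY XY; rewrite /cov (derive_related u Ox sX sY XY) XY// christ_transform//.
rewrite (schwarz_mx u _ oO1 theta_smooth Ox) (deriveDv _ _ (dt Ox)).
by rewrite addrC [in LHS]addrA subrK addrC.
Qed.

Lemma related_nabla X1 X2 Y1 Y2 : smooth_on O1 Y1 -> smooth_on O2 Y2 ->
  related X1 X2 -> related Y1 Y2 -> related (nabla G1 X1 Y1) (nabla G2 X2 Y2).
Proof.
move=> sY1 sY2 XX YY x Ox.
rewrite (nablaE oO2 G2_smooth G2_sym _ _ (thetaO Ox)) (nablaE oO1 G1_smooth G1_sym _ _ Ox).
by rewrite XX//; exact: cov_related.
Qed.

Lemma related_add X1 X2 Y1 Y2 : related X1 X2 -> related Y1 Y2 ->
  related (fun x => X1 x + Y1 x) (fun x => X2 x + Y2 x).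
Proof. by move=> XX YY x Ox; rewrite XX// YY// (deriveDv _ _ (dt Ox)). Qed.

Lemma related_opp X1 X2 : related X1 X2 -> related (fun x => - X1 x) (fun x => - X2 x).
Proof. by move=> XX x Ox; rewrite XX// (deriveNv _ (dt Ox)). Qed.

Lemma related_sum (J : Type) (r : seq J) (X1 X2 : J -> E -> E) :
  (forall j, related (X1 j) (X2 j)) ->
  related (fun x => \sum_(j <- r) X1 j x) (fun x => \sum_(j <- r) X2 j x).
Proof.
move=> XX x Ox.
have d0 : der 0 theta x = 0 by have := deriveZv 0 (0 : E) (dt Ox); rewrite !scale0r.
rewrite (big_morph (fun v => der v theta x) (fun a b => deriveDv a b (dt Ox)) d0).
by apply: eq_bigr => j _; exact: XX.
Qed.

Lemma related_bracket X1 X2 Y1 Y2 : smooth_on O1 X1 -> smooth_on O1 Y1 ->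
  smooth_on O2 X2 -> smooth_on O2 Y2 ->
  related X1 X2 -> related Y1 Y2 -> related (bracket X1 Y1) (bracket X2 Y2).
Proof.
move=> sX1 sY1 sX2 sY2 XX YY x Ox.
have bE X Y z : bracket X Y z = der (X z) Y z - der (Y z) X z by rewrite /bracket der.unlock.
rewrite !bE XX// YY// (derive_related _ Ox sY1 sY2 YY) (derive_related _ Ox sX1 sX2 XX).
rewrite (schwarz_mx (X1 x) _ oO1 theta_smooth Ox) (deriveDv _ _ (dt Ox)) (deriveNv _ (dt Ox)).
by rewrite opprD addrACA subrr add0r.
Qed.

Lemma related_curv X1 X2 Y1 Y2 Z1 Z2 :
  smooth_on O1 X1 -> smooth_on O1 Y1 -> smooth_on O1 Z1 ->
  smooth_on O2 X2 -> smooth_on O2 Y2 -> smooth_on O2 Z2 ->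
  related X1 X2 -> related Y1 Y2 -> related Z1 Z2 ->
  related (curv G1 X1 Y1 Z1) (curv G2 X2 Y2 Z2).
Proof.
move=> sX1 sY1 sZ1 sX2 sY2 sZ2 XX YY ZZ.
have sn1 X Y := @smooth_nabla R n O1 G1 oO1 G1_smooth G1_sym G1_unit X Y.
have sn2 X Y := @smooth_nabla R n O2 G2 oO2 G2_smooth G2_sym G2_unit X Y.
have BB := related_bracket sX1 sY1 sX2 sY2 XX YY.
apply: related_add; last by apply: related_opp; exact: related_nabla.
apply: related_add; last apply: related_opp.
  by apply: related_nabla => //; [exact: sn1|exact: sn2|exact: related_nabla].
by apply: related_nabla => //; [exact: sn1|exact: sn2|exact: related_nabla].
Qed.

Lemma smooth_push X : smooth_on O1 X -> smooth_on O2 (fun y => der (X (eta y)) theta (eta y)).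
Proof.
move=> sX; have := smooth_derive_along oO1 sX theta_smooth.
exact: (smooth_comp oO2 oO1 etaO eta_smooth).
Qed.

Lemma related_push X : related X (fun y => der (X (eta y)) theta (eta y)).
Proof. by move=> x Ox; rewrite thetaK. Qed.

Lemma curv_mx_related x u v w : O1 x ->
  der w theta x *m curv_mx G2 (theta x) (der u theta x) (der v theta x) =
  der (w *m curv_mx G1 x u v) theta x.
Proof.
move=> Ox; have sc z := @smooth_cst R _ O1 oO1 E z.
have := related_curv (sc u) (sc v) (sc w) (smooth_push (sc u)) (smooth_push (sc v))
  (smooth_push (sc w)) (related_push _) (related_push _) (related_push _) Ox.
rewrite (curvE oO1 G1_smooth G1_sym G1_unit Ox)//.
rewrite (curvE oO2 G2_smooth G2_sym G2_unit (thetaO Ox)) ?thetaK//; exact: smooth_push.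
Qed.

Lemma push_frame e1 : orthonormal_frame O1 G1 e1 ->
  orthonormal_frame O2 G2 (fun a y => der (e1 a (eta y)) theta (eta y)).
Proof.
move=> fe; split=> [a|a b y Oy]; first exact: smooth_push (fe.1 a).
by have := isometry (e1 a (eta y)) (e1 b (eta y)) (etaO Oy); rewrite etaK// => ->; exact: fe.2 (etaO Oy).
Qed.

Variables (e1 e2 : 'I_n -> E -> E).
Hypotheses (e1_frame : orthonormal_frame O1 G1 e1) (e2_frame : orthonormal_frame O2 G2 e2).

(** The given frames of the two charts are not related to each other. Independence of the frame
    replaces [e2] by the image of [e1], after which the connection is natural term by term. *)
Lemma related_rough_laplacian X1 X2 : smooth_on O1 X1 -> smooth_on O2 X2 ->
  related X1 X2 -> related (rough_laplacian G1 e1 X1) (rough_laplacian G2 e2 X2).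
Proof.
move=> sX1 sX2 XX x Ox.
have sn1 X Y := @smooth_nabla R n O1 G1 oO1 G1_smooth G1_sym G1_unit X Y.
have sn2 X Y := @smooth_nabla R n O2 G2 oO2 G2_smooth G2_sym G2_unit X Y.
pose e' a y := der (e1 a (eta y)) theta (eta y).
have fe : orthonormal_frame O2 G2 e' by exact: push_frame.
have Oy := thetaO Ox.
rewrite (rough_laplacian_frame oO2 G2_smooth G2_sym G2_unit e2_frame fe Oy sX2).
suff RR a : related
    (fun y => nabla G1 (e1 a) (nabla G1 (e1 a) X1) y - nabla G1 (nabla G1 (e1 a) (e1 a)) X1 y)
    (fun y => nabla G2 (e' a) (nabla G2 (e' a) X2) y - nabla G2 (nabla G2 (e' a) (e' a)) X2 y).
  exact: (related_opp (@related_sum _ (index_enum _) _ _ RR) Ox).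
have ee : related (e1 a) (e' a) by exact: related_push.
have s1 := e1_frame.1 a; have s2 := fe.1 a.
apply: related_add; last apply: related_opp.
  by apply: related_nabla => //; [exact: sn1|exact: sn2|exact: related_nabla].
by apply: related_nabla => //; exact: related_nabla.
Qed.

Variables (phi1 phi2 : E -> 'M[R]_n).
Hypotheses (phi1_smooth : smooth_on O1 phi1) (phi2_smooth : smooth_on O2 phi2).
Hypothesis phi_related : forall x u, O1 x ->
  der u theta x *m phi2 (theta x) = der (u *m phi1 x) theta x.

Lemma related_act X1 X2 : related X1 X2 -> related (act phi1 X1) (act phi2 X2).
Proof. by move=> XX x Ox; rewrite /act XX// phi_related. Qed.

Lemma related_S_field X1 X2 : smooth_on O1 X1 -> smooth_on O2 X2 ->
  related X1 X2 -> related (S_field G1 phi1 e1 X1) (S_field G2 phi2 e2 X2).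
Proof.
move=> sX1 sX2 XX x Ox.
pose e' a y := der (e1 a (eta y)) theta (eta y).
have fe : orthonormal_frame O2 G2 e' by exact: push_frame.
have Oy := thetaO Ox.
rewrite (S_field_frame oO2 G2_smooth G2_sym G2_unit phi2_smooth e2_frame fe Oy sX2).
suff RR a : related (curv G1 (act phi1 X1) (nabla G1 (e1 a) X1) (e1 a))
    (curv G2 (act phi2 X2) (nabla G2 (e' a) X2) (e' a)).
  exact: (@related_sum _ (index_enum _) _ _ RR x Ox).
have ee : related (e1 a) (e' a) by exact: related_push.
have s1 := e1_frame.1 a; have s2 := fe.1 a.
apply: related_curv => //.
- exact: smooth_mulmx.
- exact: (@smooth_nabla R n O1 G1 oO1 G1_smooth G1_sym G1_unit).
- exact: smooth_mulmx.
- exact: (@smooth_nabla R n O2 G2 oO2 G2_smooth G2_sym G2_unit).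
- exact: related_act.
- exact: related_nabla.
Qed.

(** The two vectors are compared through their pairings with images of vectors, that is through
    [flux_form], whose ingredients are all natural. *)
Lemma related_flux xi1 xi2 W1 W2 : smooth_on O1 xi1 -> smooth_on O2 xi2 ->
  smooth_on O1 W1 -> smooth_on O2 W2 -> related xi1 xi2 -> related W1 W2 ->
  related (flux G1 phi1 e1 xi1 W1) (flux G2 phi2 e2 xi2 W2).
Proof.
move=> sx1 sx2 sW1 sW2 xx WW x Ox; have Oy := thetaO Ox.
apply: (ip_nondegenerate (G2_unit Oy)) => w; have [u <-] := der_surj w Ox.
rewrite isometry// (flux_ip oO1 G1_smooth G1_sym G1_unit e1_frame phi1_smooth _ Ox sx1 sW1).
rewrite (flux_ip oO2 G2_smooth G2_sym G2_unit e2_frame phi2_smooth _ Oy sx2 sW2) /flux_form.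
have sL1 : smooth_on O1 (act phi1 (rough_laplacian G1 e1 xi1)).
  by apply: (smooth_act oO1 phi1_smooth); exact: (smooth_rough_laplacian oO1 G1_smooth G1_sym G1_unit e1_frame).
have sL2 : smooth_on O2 (act phi2 (rough_laplacian G2 e2 xi2)).
  by apply: (smooth_act oO2 phi2_smooth); exact: (smooth_rough_laplacian oO2 G2_smooth G2_sym G2_unit e2_frame).
have LL := related_act (related_rough_laplacian sx1 sx2 xx).
rewrite (cov_related u Ox sL1 sL2 LL) (cov_related u Ox sW1 sW2 WW).
rewrite (related_S_field sx1 sx2 xx Ox) (xx x Ox) (WW x Ox) (LL x Ox).
by rewrite curv_mx_related// phi_related// !isometry.
Qed.

End Naturality.

(** * One-parameter families of vector fields *)

Section Slices.
Context {R : realType} {n : nat}.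
Local Notation E := 'rV[R]_n.
Local Notation T := (R^o * E)%type.

Lemma differentiable_snd_pair (p : T) : differentiable (snd : T -> E) p.
Proof. by apply: (@linear_differentiable R T E snd) => q; exact: cvg_snd. Qed.

Lemma derive_snd_pair (p v : T) : der v (snd : T -> E) p = v.2.
Proof.
rewrite der.unlock (deriveE _ (differentiable_snd_pair p)).
by rewrite (@diff_lin R T E snd)// => q; exact: cvg_snd.
Qed.

Lemma is_diff_slice (t : R^o) (x : E) :
  is_diff x (fun y : E => ((t, y) : T)) (fun y : E => ((0, y) : T)).
Proof. exact: (@is_diff_pair R E R^o E (cst t) (cst 0) id id x). Qed.

Lemma differentiable_slice (t : R^o) (x : E) : differentiable (fun y : E => ((t, y) : T)) x.
Proof. by have [] := is_diff_slice t x. Qed.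

Lemma derive_slice (t : R^o) (x v : E) : der v (fun y : E => ((t, y) : T)) x = (0, v).
Proof.
have [d E1] := is_diff_slice t x.
by rewrite der.unlock (deriveE _ d) E1.
Qed.

Lemma derive_fixed_time (V : normedModType R) (f : T -> V) (t : R^o) (x v : E) :
  differentiable f (t, x) -> der v (fun y => f (t, y)) x = der ((0, v) : T) f (t, x).
Proof.
by move=> df; rewrite (derive_comp v (differentiable_slice t x) df) derive_slice.
Qed.

Lemma derive_along_space (V : normedModType R) (f : T -> V) (p : T) (v : E) : differentiable f p ->
  der ((0, v) : T) f p = \sum_k v 0 k *: der ((0, delta_mx 0 k) : T) f p.
Proof.
case: p => t x df.
rewrite -(derive_fixed_time _ df) derive_row; last first.
  exact: (differentiable_comp (differentiable_slice t x) df).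
by apply: eq_bigr => k _; rewrite (derive_fixed_time _ df).
Qed.

Lemma is_derive_time (V : normedModType R) (f : T -> V) (t : R) (x : E) :
  differentiable f (t, x) ->
  is_derive t (1 : R) (fun s : R => f (s, x)) (der ((1, 0) : T) f (t, x)).
Proof.
move=> df.
have [d E1] : is_diff (t : R^o) (fun s : R^o => ((s, x) : T)) (fun s : R^o => ((s, 0) : T)).
  exact: (@is_diff_pair R R^o R^o E id id (cst x) (cst 0) t).
have dc : differentiable (fun s : R^o => f (s, x)) t by exact: (differentiable_comp d df).
apply: DeriveDef; first exact: diff_derivable.
have := derive_comp (1 : R^o) d df.
have -> : der (1 : R^o) (fun s : R^o => ((s, x) : T)) t = (1, 0).
  by rewrite der.unlock (deriveE _ d) E1.
by rewrite der.unlock.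
Qed.

End Slices.

(** * Differential operators on families depending on time *)

Section JointFamily.
Context {R : realType} {n : nat}.
Local Notation E := 'rV[R]_n.
Local Notation T := (R^o * E)%type.
Variables (O : set E) (U : set T) (G phi : E -> 'M[R]_n) (e : 'I_n -> E -> E).
Hypotheses (oO : open O) (oU : open U) (UO : forall p, U p -> O p.2).
Hypothesis (G_smooth : smooth_on O G).
Hypotheses (G_sym : forall x, O x -> (G x)^T = G x) (G_unit : forall x, O x -> G x \in unitmx).
Hypothesis e_frame : orthonormal_frame O G e.
Hypothesis phi_smooth : smooth_on O phi.
Hypothesis phi_involution : forall x, O x -> phi x *m phi x = 1%:M.
Hypothesis phi_sym : forall x u v, O x -> ip (G x) (u *m phi x) v = ip (G x) u (v *m phi x).
Hypothesis phi_parallel : forall X Y, smooth_on O X -> smooth_on O Y ->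
  forall x, O x -> nabla G X (act phi Y) x = nabla G X Y x *m phi x.
Implicit Types (Z u v : T -> E) (X : E -> E) (p : T).

Let e_smooth a : smooth_on O (e a). Proof. exact: e_frame.1. Qed.

Definition dt : T := (1, 0).

Lemma smooth_space (V : normedModType R) (f : E -> V) :
  smooth_on O f -> smooth_on U (fun p => f p.2).
Proof.
move=> sf; apply: (smooth_comp_affine oU (L := snd) (dL := snd) oO) => //.
- exact: differentiable_snd_pair.
- by move=> v p; exact: derive_snd_pair.
Qed.

Lemma derive_time_space (V : normedModType R) (f : E -> V) p :
  smooth_on O f -> U p -> der dt (fun p => f p.2) p = 0.
Proof.
move=> sf Up; have df := smooth_diff sf (UO Up).
rewrite (derive_comp dt (differentiable_snd_pair p) df) derive_snd_pair /=.
by have := deriveZv 0 (0 : E) df; rewrite !scale0r.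
Qed.

Let sA := christ_mx_smooth oO G_smooth G_unit.

(* [cov G (X x) (Z (t, -)) x], jointly in [(t, x)] *)
Definition joint_cov X Z p : E := der ((0, X p.2) : T) Z p + Z p *m christ_mx G p.2 (X p.2).

Lemma cov_slice X Z p : differentiable Z p ->
  cov G (X p.2) (fun y => Z (p.1, y)) p.2 = joint_cov X Z p.
Proof. by case: p => t x dZ; rewrite /cov (derive_fixed_time _ dZ). Qed.

Lemma smooth_joint_cov X Z : smooth_on O X -> smooth_on U Z -> smooth_on U (joint_cov X Z).
Proof.
move=> sX sZ; have sXk := (smooth_mxP oO _).1 sX.
apply: smooth_add => //; last first.
  apply: smooth_mulmx => //; have := smooth_christ_mx oO G_smooth G_unit sX.
  exact: (@smooth_space _ (fun x => christ_mx G x (X x))).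
apply: (smooth_eq oU (f := fun p => \sum_k X p.2 0 k *: der ((0, delta_mx 0 k) : T) Z p)).
  by move=> p Up; rewrite (derive_along_space _ (smooth_diff sZ Up)).
apply: smooth_bigsum => // k; apply: smooth_scale => //; last exact: smooth_derive.
exact: (smooth_space (sXk 0 k)).
Qed.

(** The direction and the connection do not depend on time, and Schwarz's theorem on the product
    exchanges the time derivative with the space derivative. *)
Lemma derive_joint_cov X Z p : smooth_on O X -> smooth_on U Z -> U p ->
  der dt (joint_cov X Z) p = joint_cov X (der dt Z) p.
Proof.
move=> sX sZ Up; have sXk := (smooth_mxP oO _).1 sX.
have sAX : smooth_on O (fun x => christ_mx G x (X x)) by exact: smooth_christ_mx.
have dZ := smooth_diff sZ Up; have dA := smooth_diff (smooth_space sAX) Up.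
have dD k : differentiable (der ((0, delta_mx 0 k) : T) Z) p by exact: smooth_diff (smooth_derive _ sZ) Up.
have dX k : differentiable (fun p : T => X p.2 0 k) p.
  exact: (smooth_diff (smooth_space (sXk 0 k)) Up).
have E1 : der dt (fun p : T => der ((0, X p.2) : T) Z p) p = der ((0, X p.2) : T) (der dt Z) p.
  rewrite (derive_eq_in _ oU Up (fun q Uq => derive_along_space (X q.2) (smooth_diff sZ Uq))).
  rewrite derive_bigsum; last by move=> k; exact: differentiable_scale.
  rewrite (derive_along_space _ (smooth_diff (smooth_derive dt sZ) Up)); apply: eq_bigr => k _.
  rewrite (derive_scale _ (dX k) (dD k)) (derive_time_space (sXk 0 k) Up) scale0r add0r.
  by rewrite (schwarz_mx dt _ oU sZ Up).
have sD : smooth_on U (fun p : T => der ((0, X p.2) : T) Z p).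
  apply: (smooth_eq oU (f := fun p => \sum_k X p.2 0 k *: der ((0, delta_mx 0 k) : T) Z p)).
    by move=> q Uq; rewrite (derive_along_space _ (smooth_diff sZ Uq)).
  apply: smooth_bigsum => // k; apply: smooth_scale => //; last exact: smooth_derive.
  exact: (smooth_space (sXk 0 k)).
rewrite /joint_cov (derive_add _ (smooth_diff sD Up) (differentiable_mulmx dZ dA)) E1.
by rewrite (derive_mulmx _ dZ dA) (derive_time_space sAX Up) mulmx0 addr0.
Qed.

(** Separates coefficients that depend on time from matrices that depend on the point alone, so that
    smoothness and the time derivative can be read off. *)
Let curv_mx_expand p u v : U p -> curv_mx G p.2 (u p) (v p) =
  \sum_k \sum_l (u p 0 k * v p 0 l) *: curv_mx G p.2 (delta_mx 0 k) (delta_mx 0 l).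
Proof.
move=> Up; have Op := UO Up; apply: (bilinear_expand (h := curv_mx G p.2)) => [a b c|c a b|a b c|c a b].
- exact: (curv_mxDl oO G_smooth G_unit).
- exact: (curv_mxZl oO G_smooth G_unit).
- exact: (curv_mxDr oO G_smooth G_unit).
- exact: (curv_mxZr oO G_smooth G_unit).
Qed.

Let smooth_curv_mx_delta k l : smooth_on O (fun x => curv_mx G x (delta_mx 0 k) (delta_mx 0 l)).
Proof.
have sD a b : smooth_on O (dchrist G a b) by exact: smooth_derive.
apply: smooth_sub => //; last by apply: smooth_mulmx.
apply: smooth_add => //; last by apply: smooth_mulmx.
by apply: smooth_sub.
Qed.

Lemma smooth_joint_curv u v : smooth_on U u -> smooth_on U v ->
  smooth_on U (fun p => curv_mx G p.2 (u p) (v p)).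
Proof.
move=> /(smooth_mxP oU) su /(smooth_mxP oU) sv.
apply: (smooth_eq oU (fun q Uq => esym (curv_mx_expand u v Uq))).
apply: smooth_bigsum => // k; apply: smooth_bigsum => // l; apply: smooth_scale => //.
  exact: smooth_mul.
exact: (smooth_space (smooth_curv_mx_delta k l)).
Qed.

Lemma derive_joint_curv u v p : smooth_on U u -> smooth_on U v -> U p ->
  der dt (fun p => curv_mx G p.2 (u p) (v p)) p =
  curv_mx G p.2 (der dt u p) (v p) + curv_mx G p.2 (u p) (der dt v p).
Proof.
move=> su sv Up; have dku k := (differentiable_mxP _ _).1 (smooth_diff su Up) 0 k.
have dkv k := (differentiable_mxP _ _).1 (smooth_diff sv Up) 0 k.
have dC k l := smooth_diff (smooth_space (smooth_curv_mx_delta k l)) Up.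
rewrite (derive_eq_in _ oU Up (fun q Uq => curv_mx_expand u v Uq)).
rewrite (curv_mx_expand (der dt u) v Up) (curv_mx_expand u (der dt v) Up) -big_split.
rewrite derive_bigsum; last first.
  move=> k; apply: differentiable_bigsum => l; apply: differentiable_scale => //.
  exact: differentiable_mul.
apply: eq_bigr => k _; rewrite -big_split derive_bigsum; last first.
  by move=> l; apply: differentiable_scale => //; exact: differentiable_mul.
apply: eq_bigr => l _ /=.
rewrite (derive_scale _ (differentiable_mul (dku k) (dkv l)) (dC k l)).
rewrite (derive_time_space (smooth_curv_mx_delta k l) Up) scaler0 addr0.
rewrite (derive_mul _ (dku k) (dkv l)) scalerDl.
by rewrite (derive_entry _ 0 k (smooth_diff su Up)) (derive_entry _ 0 l (smooth_diff sv Up)).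
Qed.

Hypothesis U_slice : forall p x, U p -> O x -> U (p.1, x).

Lemma smooth_slice Z p : U p -> smooth_on U Z -> smooth_on O (fun y => Z (p.1, y)).
Proof.
move=> Up sZ; have L1 x : differentiable (fun y : E => ((p.1, y) : T)) x by exact: differentiable_slice.
have L2 (v x : E) : der v (fun y : E => ((p.1, y) : T)) x = (0, v) by exact: derive_slice.
have L3 x : O x -> U (p.1, x) by exact: U_slice.
exact: (smooth_comp_affine oO oU L1 L2 L3 sZ).
Qed.

Let smooth_frame_acc a : smooth_on O (fun x => cov G (e a x) (e a) x).
Proof. exact: smooth_cov. Qed.

Definition joint_laplacian Z p : E :=
  - \sum_a (joint_cov (e a) (joint_cov (e a) Z) p
            - joint_cov (fun x => cov G (e a x) (e a) x) Z p).

Definition joint_S Z p : E :=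
  \sum_a e a p.2 *m curv_mx G p.2 (Z p *m phi p.2) (joint_cov (e a) Z p).

Definition joint_density Z p : R :=
  ip (G p.2) (joint_S Z p) (joint_S Z p)
  + ip (G p.2) (joint_laplacian Z p) (joint_laplacian Z p *m phi p.2).

Lemma laplacian_slice Z p : U p -> smooth_on U Z ->
  rough_laplacian G e (fun y => Z (p.1, y)) p.2 = joint_laplacian Z p.
Proof.
move=> Up sZ; have Op := UO Up.
have dZ q : U q -> differentiable Z q by exact: smooth_diff.
rewrite (rough_laplacianE e oO G_smooth G_sym Op (smooth_slice Up sZ)); congr (- _).
apply: eq_bigr => a _; congr (_ - _).
  have sC := smooth_joint_cov (e_smooth a) sZ.
  rewrite -(cov_slice _ (smooth_diff sC Up)); apply: (cov_eq _ oO _ Op) => y Oy.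
  exact: (cov_slice (p := (p.1, y)) (e a) (dZ _ (U_slice Up Oy))).
exact: (cov_slice (fun x => cov G (e a x) (e a) x) (dZ _ Up)).
Qed.

Lemma smooth_joint_laplacian Z : smooth_on U Z -> smooth_on U (joint_laplacian Z).
Proof.
move=> sZ; apply: smooth_opp => //; apply: smooth_bigsum => // a.
by apply: smooth_sub => //; do !apply: smooth_joint_cov => //.
Qed.

Lemma derive_joint_laplacian Z p : smooth_on U Z -> U p ->
  der dt (joint_laplacian Z) p = joint_laplacian (der dt Z) p.
Proof.
move=> sZ Up; have sC a := smooth_joint_cov (e_smooth a) sZ.
have dC a := smooth_diff (smooth_joint_cov (e_smooth a) (sC a)) Up.
have dA a := smooth_diff (smooth_joint_cov (smooth_frame_acc a) sZ) Up.
rewrite /joint_laplacian derive_opp; last by apply: differentiable_bigsum => a; exact: differentiable_sub.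
congr (- _); rewrite derive_bigsum; last by move=> a; exact: differentiable_sub.
apply: eq_bigr => a _; rewrite (derive_sub _ (dC a) (dA a)); congr (_ - _); last first.
  exact: derive_joint_cov.
rewrite (derive_joint_cov (e_smooth a) (sC a) Up) /joint_cov.
rewrite (derive_eq_in _ oU Up (fun q Uq => derive_joint_cov (e_smooth a) sZ Uq)).
by rewrite (derive_joint_cov (e_smooth a) sZ Up).
Qed.

Lemma S_slice Z p : U p -> smooth_on U Z ->
  S_field G phi e (fun y => Z (p.1, y)) p.2 = joint_S Z p.
Proof.
move=> Up sZ; have Op := UO Up.
rewrite (S_fieldE oO G_smooth G_sym G_unit e_frame phi_smooth Op (smooth_slice Up sZ)).
apply: eq_bigr => a _; rewrite -surjective_pairing.
by rewrite (cov_slice (e a) (smooth_diff sZ Up)).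
Qed.

Let smooth_act_joint Z : smooth_on U Z -> smooth_on U (fun p => Z p *m phi p.2).
Proof. by move=> sZ; apply: smooth_mulmx => //; exact: smooth_space. Qed.

Lemma smooth_joint_S Z : smooth_on U Z -> smooth_on U (joint_S Z).
Proof.
move=> sZ; apply: smooth_bigsum => // a; apply: smooth_mulmx => //; first exact: smooth_space.
by apply: smooth_joint_curv; [exact: smooth_act_joint|exact: smooth_joint_cov].
Qed.

Let derive_act_joint Z p : smooth_on U Z -> U p ->
  der dt (fun p => Z p *m phi p.2) p = der dt Z p *m phi p.2.
Proof.
move=> sZ Up; have dp := smooth_diff (smooth_space phi_smooth) Up.
by rewrite (derive_mulmx _ (smooth_diff sZ Up) dp) (derive_time_space phi_smooth Up) mulmx0 addr0.
Qed.

(** [S] is quadratic in the field, with coefficients constant in time, so the derivative falls on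
    each of its two occurrences. *)
Lemma derive_joint_S Z p : smooth_on U Z -> U p ->
  der dt (joint_S Z) p =
  S_variation G phi e (fun y => Z (p.1, y)) (fun y => der dt Z (p.1, y)) p.2.
Proof.
move=> sZ Up; have sZ' := smooth_derive dt sZ.
have sC a : smooth_on U (fun p => curv_mx G p.2 (Z p *m phi p.2) (joint_cov (e a) Z p)).
  by apply: smooth_joint_curv; [exact: smooth_act_joint|exact: smooth_joint_cov].
have dC a := smooth_diff (sC a) Up; have de a := smooth_diff (smooth_space (e_smooth a)) Up.
rewrite /joint_S derive_bigsum; last by move=> a; exact: differentiable_mulmx.
rewrite /S_variation; apply: eq_bigr => a _; rewrite -mulmxDr.
rewrite (derive_mulmx _ (de a) (dC a)) (derive_time_space (e_smooth a) Up) mul0mx add0r.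
rewrite (derive_joint_curv (smooth_act_joint sZ) (smooth_joint_cov (e_smooth a) sZ) Up).
rewrite (derive_act_joint sZ Up) (derive_joint_cov (e_smooth a) sZ Up) -!surjective_pairing.
rewrite (cov_slice (e a) (smooth_diff sZ Up)).
by rewrite (cov_slice (e a) (smooth_diff sZ' Up)).
Qed.

Lemma density_slice Z p : U p -> smooth_on U Z ->
  bienergy_density G phi e (fun y => Z (p.1, y)) p.2 = joint_density Z p.
Proof.
move=> Up sZ; have Op := UO Up.
rewrite (bienergy_densityE oO G_smooth G_sym G_unit e_frame phi_smooth phi_involution phi_sym phi_parallel Op (smooth_slice Up sZ)).
by rewrite (S_slice Up sZ) (laplacian_slice Up sZ).
Qed.

Lemma smooth_joint_density Z : smooth_on U Z -> smooth_on U (joint_density Z).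
Proof.
move=> sZ; have sL := smooth_joint_laplacian sZ; have sS := smooth_joint_S sZ.
have sG := smooth_space G_smooth.
by apply: smooth_add => //; apply: smooth_ip => //; exact: smooth_act_joint.
Qed.

(** The density is a sum of two quadratic expressions, for [G] and for the symmetric form given by
    [phi]. The resulting factor 2 meets the one half in [bienergy]. *)
Lemma derive_joint_density Z p : smooth_on U Z -> U p ->
  let X := fun y => Z (p.1, y) in let W := fun y => der dt Z (p.1, y) in
  der dt (joint_density Z) p =
  2 * (ip (G p.2) (S_variation G phi e X W p.2) (S_field G phi e X p.2)
       + ip (G p.2) (rough_laplacian G e W p.2) (act phi (rough_laplacian G e X) p.2)).
Proof.
move=> sZ Up X W; have Op := UO Up; have sZ' := smooth_derive dt sZ.
have dS := smooth_diff (smooth_joint_S sZ) Up.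
have dL := smooth_diff (smooth_joint_laplacian sZ) Up.
have dLp := smooth_diff (smooth_act_joint (smooth_joint_laplacian sZ)) Up.
have dG' := smooth_diff (smooth_space G_smooth) Up.
rewrite /joint_density (derive_add _ (differentiable_ip dG' dS dS) (differentiable_ip dG' dL dLp)).
rewrite (derive_ip _ dG' dS dS) (derive_ip _ dG' dL dLp) (derive_time_space G_smooth Up).
rewrite (derive_act_joint (smooth_joint_laplacian sZ) Up) (derive_joint_laplacian sZ Up).
rewrite (derive_joint_S sZ Up) -/X -/W /act -(laplacian_slice Up sZ') -(laplacian_slice Up sZ) -(S_slice Up sZ).
rewrite -/X -/W.
have El A B : ip (G p.2) A (B *m phi p.2) = ip (G p.2) B (A *m phi p.2).
  by rewrite -phi_sym// ip_sym// G_sym.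
rewrite (El _ (rough_laplacian G e W p.2)) (ip_sym _ (S_variation G phi e X W p.2) (G_sym Op)).
have -> A B : ip (0 : 'M[R]_n) A B = 0 by rewrite /ip mulmx0 mul0mx mxE.
have -> A B : ip (0 : 'M[R]_n) A B = 0 by rewrite /ip mulmx0 mul0mx mxE.
by rewrite !add0r; ring.
Qed.

End JointFamily.

(** * Divergence theorem *)

Section Charts.
Context {R : realType} {n : nat} {M : topologicalType} {I : Type}.
Local Notation E := 'rV[R]_n.
Variable A : I -> chart R n M.
Hypothesis A_atlas : oriented_atlas A.
Implicit Types (i j : I) (x : E).

Let Ai i : is_chart (A i). Proof. by case: A_atlas. Qed.

Lemma img_open i : open (img (A i)). Proof. by case: (Ai i). Qed.

Lemma param_dom i x : img (A i) x -> dom (A i) (param (A i) x).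
Proof. by case: (Ai i) => _ _ K _ _ [p dp <-]; rewrite K. Qed.

Lemma paramK i x : img (A i) x -> Defs.coord (A i) (param (A i) x) = x.
Proof. by case: (Ai i) => _ _ K _ _ [p dp <-]; rewrite K. Qed.

Lemma coordK i p : dom (A i) p -> param (A i) (Defs.coord (A i) p) = p.
Proof. by case: (Ai i) => _ _ K _ _; exact: K. Qed.

Lemma coord_img i p : dom (A i) p -> img (A i) (Defs.coord (A i) p).
Proof. by exists p. Qed.

(** [param] is continuous within the image of the chart; the image being open, this is continuity at
    each of its points. *)
Lemma open_param_preimage i (D : set M) : open D ->
  open [set x | img (A i) x /\ D (param (A i) x)].
Proof.
move=> oD; rewrite openE => x [Ix Dx].
have cp : param (A i) @ x --> param (A i) x.
  have oI : open (img (A i)) by exact: img_open.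
  case: (Ai i) => _ _ _ _ /subspace_continuousP/(_ x Ix).
  by rewrite within_interior//; exact: open_nbhs_nbhs.
have H1 : nbhs x (img (A i)) by apply: open_nbhs_nbhs; split=> //; exact: img_open.
have H2 : nbhs x (param (A i) @^-1` D) by apply: cp; exact: open_nbhs_nbhs.
exact: filterI.
Qed.

Lemma overlap_open i j : open (overlap (A i) (A j)).
Proof. by apply: open_param_preimage; case: (Ai j). Qed.

Lemma compact_coord i (K : set M) : compact K -> K `<=` dom (A i) -> compact (Defs.coord (A i) @` K).
Proof.
move=> cK KD; apply: continuous_compact => //; apply: continuous_subspaceW KD _.
by case: (Ai i).
Qed.

Lemma transition_param i j x : overlap (A i) (A j) x ->
  param (A j) (transition (A i) (A j) x) = param (A i) x.
Proof. by move=> [Ix Dx]; rewrite /transition coordK. Qed.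

Lemma transition_overlap i j x : overlap (A i) (A j) x ->
  overlap (A j) (A i) (transition (A i) (A j) x).
Proof.
move=> Ox; split; last by rewrite transition_param//; exact: param_dom Ox.1.
exact: coord_img Ox.2.
Qed.

Lemma transitionK i j x : overlap (A i) (A j) x ->
  transition (A j) (A i) (transition (A i) (A j) x) = x.
Proof. by move=> Ox; rewrite {1}/transition transition_param// paramK//; exact: Ox.1. Qed.

Lemma transition_smooth i j : smooth_on (overlap (A i) (A j)) (transition (A i) (A j)).
Proof. by case: A_atlas. Qed.

End Charts.

Section DivergenceTheorem.
Context {R : realType} {n : nat} {M : topologicalType} {I : Type}.
Local Notation E := 'rV[R]_n.
Variable A : I -> chart R n M.
Hypothesis M_compact : compact [set: M].
Hypothesis A_atlas : oriented_atlas A.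
Variable g : I -> E -> 'M[R]_n.
Hypothesis g_metric : riemannian_metric A g.
Variable e : I -> 'I_n -> E -> E.
Hypothesis e_frame : forall i, orthonormal_frame (img (A i)) (g i) (e i).
Variables (N : nat) (c : 'I_N -> I) (rho : 'I_N -> M -> R).
Hypothesis rho_partition : partition_of_unity A c rho.
Implicit Types (i j : I) (x : E) (a b : 'I_N).

Let oI i : open (img (A i)). Proof. exact: img_open. Qed.

Lemma metric_smooth i : smooth_on (img (A i)) (g i).
Proof. by case: g_metric. Qed.

Lemma metric_mx_sym i x : img (A i) x -> (g i x)^T = g i x.
Proof. by case: g_metric => _ gs _ _; exact: gs. Qed.

Lemma metric_unit i x : img (A i) x -> g i x \in unitmx.
Proof. by case: g_metric => _ _ gp _ Ix; apply: pos_unitmx => u; exact: gp. Qed.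

Let det_gt0 i x : img (A i) x -> 0 < \det (g i x).
Proof. exact: det_metric_gt0. Qed.

Lemma sqrt_det_smooth i : smooth_on (img (A i)) (fun x => Num.sqrt (\det (g i x))).
Proof.
by apply: smooth_sqrt => //; [move=> x; exact: det_gt0|apply: smooth_det => //; exact: metric_smooth].
Qed.

Let rho_smooth a i : smooth_on (img (A i)) (fun x => rho a (param (A i) x)).
Proof. by case: rho_partition => + _ _ _; exact. Qed.

Definition rho_support a : set M := closure [set p | rho a p != 0].

Lemma rho_support_compact a : compact (rho_support a).
Proof. by apply: (subclosed_compact _ M_compact) => //; exact: closed_closure. Qed.

Let support_closed a : closed (rho_support a). Proof. exact: closed_closure. Qed.

Let rho_out a p : ~ rho_support a p -> rho a p = 0.
Proof.
by move=> np; apply: contra_notP np => /eqP r0; apply: subset_closure.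
Qed.

Let rho_dom a : rho_support a `<=` dom (A (c a)).
Proof. by case: rho_partition => _ _ + _; exact. Qed.

Lemma derive_rho_out a i x v : img (A i) x -> ~ rho_support a (param (A i) x) ->
  der v (fun x => rho a (param (A i) x)) x = 0.
Proof.
move=> Ix np; have oO := open_param_preimage A_atlas (i := i) (closed_openC (@support_closed a)).
rewrite (derive_eq_in (g := fun=> 0) v oO (conj Ix np)) ?derive_const//.
by move=> y [_ ny]; exact: rho_out.
Qed.

Definition chart_support a : set E := Defs.coord (A (c a)) @` rho_support a.

Lemma chart_support_compact a : compact (chart_support a).
Proof. exact: (compact_coord A_atlas (@rho_support_compact a) (@rho_dom a)). Qed.

Lemma chart_support_closed a : closed (chart_support a).
Proof. exact: (compact_closed (@norm_hausdorff _ _) (@chart_support_compact a)). Qed.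

Lemma chart_support_img a : chart_support a `<=` img (A (c a)).
Proof. by move=> _ [p Sp <-]; apply: coord_img; exact: rho_dom. Qed.

Lemma param_support a x : img (A (c a)) x -> rho_support a (param (A (c a)) x) -> chart_support a x.
Proof. by move=> Ix Sx; exists (param (A (c a)) x) => //; exact: paramK. Qed.

(* The support condition is vacuous outside the image of the chart, where the
   patched function is [0]. *)
Lemma patch_smooth a (f : E -> R) : smooth_on (img (A (c a))) f ->
  (forall x, img (A (c a)) x -> ~ chart_support a x -> f x = 0) ->
  smooth_on [set: E] (f \_ (img (A (c a)))).
Proof. by apply: smooth_extend0 => //; [exact: chart_support_closed|exact: chart_support_img]. Qed.

Lemma patch_out a (f : E -> R) : (forall x, img (A (c a)) x -> ~ chart_support a x -> f x = 0) ->
  forall x, ~ chart_support a x -> (f \_ (img (A (c a)))) x = 0.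
Proof.
move=> f0 x nx; rewrite patchE; case: ifPn => // Ix.
by apply: f0 => //; exact: set_mem.
Qed.

Lemma smooth_cts (f : E -> R) : smooth_on [set: E] f -> cts f.
Proof. by move=> sf x; apply: differentiable_cts_at; exact: (smooth_diff sf). Qed.

Lemma rho_chart_out a x : img (A (c a)) x -> ~ chart_support a x -> rho a (param (A (c a)) x) = 0.
Proof. by move=> Ix nx; apply: rho_out => /(param_support Ix). Qed.

Lemma chart_support_bound : exists2 B : R, 0 <= B & forall a x, chart_support a x -> `|x| <= B.
Proof.
have H a : exists B : R, 0 <= B /\ forall x, chart_support a x -> `|x| <= B.
  have [B B0 HB] := compact_norm_bound (f := id) (@chart_support_compact a) (fun x _ => @cts_at_id R E x).
  by exists B.
have [B HB] := choice H; exists (\sum_a B a); first by apply: sumr_ge0 => a _; have [] := HB a.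
move=> a x Kx; rewrite (bigD1 a)//= (le_trans ((HB a).2 x Kx))// lerDl sumr_ge0// => b _.
by have [] := HB b.
Qed.

Variable V : I -> E -> E.
Hypothesis V_field : vector_field A V.

Let V_smooth i : smooth_on (img (A i)) (V i). Proof. by case: V_field. Qed.

Let V_related i j x : overlap (A i) (A j) x ->
  V j (transition (A i) (A j) x) = der (V i x) (transition (A i) (A j)) x.
Proof. by move=> Ox; rewrite der.unlock; case: V_field => _; exact. Qed.

Let sdet i x := Num.sqrt (\det (g i x)).
Let rhoc a i x := rho a (param (A i) x).
Let drho a i x := der (V i x) (rhoc a i) x.
Let div i x := \sum_k ip (g i x) (cov (g i) (e i k x) (V i) x) (e i k x).

Let drho_smooth a i : smooth_on (img (A i)) (drho a i).
Proof.
have Vk k := (smooth_mxP (@oI i) (V i)).1 (@V_smooth i) 0 k.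
apply: (smooth_eq (@oI i) (f := fun x => \sum_k V i x 0 k * der (delta_mx 0 k) (rhoc a i) x)).
  by move=> x Ix; rewrite /drho derive_row//; exact: smooth_diff (@rho_smooth a i) Ix.
apply: smooth_bigsum => // k; apply: smooth_mul => //.
by apply: smooth_derive; exact: rho_smooth.
Qed.

Let drho_out a i x : img (A i) x -> ~ rho_support a (param (A i) x) -> drho a i x = 0.
Proof. exact: derive_rho_out. Qed.

Let div_smooth i : smooth_on (img (A i)) (div i).
Proof.
apply: smooth_bigsum => // k; apply: smooth_ip => //.
- exact: metric_smooth.
- exact: (smooth_cov (@oI i) (@metric_smooth i) (@metric_unit i) ((e_frame i).1 k) (@V_smooth i)).
- exact: (e_frame i).1.
Qed.

Lemma divergence_integrand_smooth a :
  smooth_on [set: E] ((fun x => rhoc a (c a) x * div (c a) x * sdet (c a) x) \_ (img (A (c a)))).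
Proof.
apply: patch_smooth.
  by apply: smooth_mul => //; [apply: smooth_mul => //; exact: rho_smooth|exact: sqrt_det_smooth].
by move=> x Ix nx; rewrite /rhoc rho_chart_out// !mul0r.
Qed.

(* Stokes in one chart: [rho_a V sqrt(det g)] has compact support. *)
Let integral_by_parts a :
  integral_Rn ((fun x => rhoc a (c a) x * div (c a) x * sdet (c a) x) \_ (img (A (c a)))) =
  - integral_Rn ((fun x => drho a (c a) x * sdet (c a) x) \_ (img (A (c a)))).
Proof.
set i := c a; set O := img (A i); have [B B0 HB] := chart_support_bound.
have oO : open O by exact: oI.
pose F k := (fun x => rhoc a i x * (V i x 0 k * sdet i x)) \_ O.
have sVk k := (smooth_mxP oO (V i)).1 (@V_smooth i) 0 k.
have sfk k : smooth_on O (fun x => V i x 0 k * sdet i x).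
  by apply: smooth_mul => //; exact: sqrt_det_smooth.
have sF k : smooth_on [set: E] (F k).
  apply: patch_smooth; first by apply: smooth_mul => //; exact: rho_smooth.
  by move=> x Ix nx; rewrite /rhoc rho_chart_out// mul0r.
have F0 k x : B < `|x| -> F k x = 0.
  move=> Bx; apply: patch_out; last by move=> /HB; rewrite leNgt Bx.
  by move=> y Iy ny; rewrite /rhoc rho_chart_out// mul0r.
have cF k v : cts (der v (F k)) by apply: smooth_cts; exact: smooth_derive.
have I0 k : integral_Rn (der (delta_mx 0 k) (F k)) = 0.
  have dF x : differentiable (F k) x by exact: (smooth_diff (sF k)).
  exact: (integral_Rn_derive B0 dF (cF k _) (F0 k)).
pose T1 := (fun x => drho a i x * sdet i x) \_ O.
pose T2 := (fun x => rhoc a i x * div i x * sdet i x) \_ O.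
have s1 : smooth_on [set: E] T1.
  apply: patch_smooth; first by apply: smooth_mul => //; exact: sqrt_det_smooth.
  by move=> x Ix nx; rewrite drho_out ?mul0r// => /(param_support Ix).
have s2 : smooth_on [set: E] T2 by exact: divergence_integrand_smooth.
have out1 x : B < `|x| -> T1 x = 0.
  move=> Bx; apply: patch_out; last by move=> /HB; rewrite leNgt Bx.
  by move=> y Iy ny; rewrite drho_out ?mul0r// => /(param_support Iy).
have out2 x : B < `|x| -> T2 x = 0.
  move=> Bx; apply: patch_out; last by move=> /HB; rewrite leNgt Bx.
  by move=> y Iy ny; rewrite /rhoc rho_chart_out// !mul0r.
apply/eqP; rewrite -addr_eq0 -(integral_RnD B0 (smooth_cts s2) (smooth_cts s1) out2 out1).
apply/eqP; transitivity (integral_Rn (fun x => \sum_k der (delta_mx 0 k) (F k) x)); last first.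
  rewrite (@integral_Rn_sum R n _ _ (fun k => der (delta_mx 0 k) (F k)) B)//.
    by rewrite big1.
  by move=> k x; apply: der_out; exact: F0.
congr integral_Rn; apply/funext => x.
have [Ox|Ox] := pselect (O x); last first.
  rewrite /T1 /T2 !patchE !memNset// addr0 big1// => k _.
  (* Off the image of the chart, [x] has a neighbourhood avoiding the closed support, on which [F k]
     is 0. *)
  have oK : open (~` chart_support a) by apply: closed_openC; exact: chart_support_closed.
  have nK : ~ chart_support a x by move=> /chart_support_img.
  rewrite (derive_eq_in (g := fun=> 0) _ oK nK) ?derive_const// => y ny.
  by apply: patch_out => // z Iz nz; rewrite /rhoc rho_chart_out// mul0r.
rewrite /T1 /T2 !patchE mem_set//.
have drk := smooth_diff (@rho_smooth a i) Ox.
have dV := smooth_diff (@V_smooth i) Ox.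
have DF k : der (delta_mx 0 k) (F k) x = der (delta_mx 0 k) (rhoc a i) x * (V i x 0 k * sdet i x)
    + rhoc a i x * der (delta_mx 0 k) (fun x => V i x 0 k * sdet i x) x.
  rewrite -(derive_mul _ drk (smooth_diff (sfk k) Ox)); apply: (derive_eq_in _ oO Ox) => y Oy.
  by rewrite /F patchE mem_set.
rewrite (eq_bigr _ (fun k _ => DF k)) big_split /= -mulr_sumr.
have -> := divergence oO (@metric_smooth i) (@metric_mx_sym i) (@metric_unit i) (e_frame i) Ox dV.
rewrite [LHS]addrC -[X in _ + X = _]mulrA; congr (_ + _).
rewrite /drho (derive_row (V i x) drk) mulr_suml; apply: eq_bigr => k _.
by rewrite -[_ *: _]/(_ * _) -mulrA mulrCA.
Qed.

Let jac i j x u : overlap (A i) (A j) x ->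
  der u (transition (A i) (A j)) x = u *m 'J (transition (A i) (A j)) x.
Proof.
move=> Ox; rewrite der.unlock deriveEjacobian//.
exact: smooth_diff (@transition_smooth _ _ _ _ _ A_atlas i j) Ox.
Qed.

(** The metric matrix of the first chart is [J *m g j *m J^T], so the roots differ by the absolute
    value of [\det J]. The orientation removes the absolute value. *)
Lemma sqrt_det_transition i j x : overlap (A i) (A j) x ->
  sdet i x = sdet j (transition (A i) (A j) x) * \det ('J (transition (A i) (A j)) x).
Proof.
move=> Ox; set th := transition _ _; set J := 'J th x.
have J0 : 0 < \det J by case: A_atlas => _ _ _; apply.
rewrite /sdet; have -> : g i x = J *m (g j (th x) *m J^T).
  apply: ip_inj => u v; rewrite mulmxA -ip_mulr -ip_mull -!jac//.
  by case: g_metric => _ _ _ H; rewrite -(H i j x u v Ox) der.unlock.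
have dj := @det_gt0 j (th x) (transition_overlap A_atlas Ox).1.
rewrite !det_mulmx det_tr mulrCA -expr2 sqrtrM ?ltW// sqrtr_sqr gtr0_norm//.
Qed.

(** The integrand lives on the intersection of the two supports, a compact set inside both chart
    domains. Its coordinate images are the compact sets of [change_of_variables], and the Jacobian
    is absorbed by the volume density. *)
Let integral_overlap a b :
  integral_Rn ((fun x => rhoc b (c a) x * (drho a (c a) x * sdet (c a) x)) \_ (img (A (c a)))) =
  integral_Rn ((fun x => rhoc b (c b) x * (drho a (c b) x * sdet (c b) x)) \_ (img (A (c b)))).
Proof.
set i := c a; set j := c b.
pose S := rho_support a `&` rho_support b.
have cS : compact S by apply: compact_closedI; [exact: rho_support_compact|exact: support_closed].
pose K1 := Defs.coord (A i) @` S; pose K2 := Defs.coord (A j) @` S.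
have SI : S `<=` dom (A i) by move=> p [pa _]; exact: rho_dom pa.
have SJ : S `<=` dom (A j) by move=> p [_ pb]; exact: rho_dom pb.
have cK1 : compact K1 by exact: (compact_coord A_atlas cS SI).
have cK2 : compact K2 by exact: (compact_coord A_atlas cS SJ).
have K1O : K1 `<=` overlap (A i) (A j).
  by move=> _ [p Sp <-]; split; [exact: coord_img (SI _ Sp)|rewrite coordK//; [exact: SJ|exact: SI]].
have K2O : K2 `<=` overlap (A j) (A i).
  by move=> _ [p Sp <-]; split; [exact: coord_img (SJ _ Sp)|rewrite coordK//; [exact: SI|exact: SJ]].
have [B1 B10 HB1] := compact_norm_bound (f := id) cK1 (fun x _ => @cts_at_id R E x).
have [B2 B20 HB2] := compact_norm_bound (f := id) cK2 (fun x _ => @cts_at_id R E x).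
set h := (X in integral_Rn X = _); set f := (X in _ = integral_Rn X).
have sfi k : smooth_on (img (A k)) (fun x => rhoc b k x * (drho a k x * sdet k x)).
  apply: smooth_mul => //; first exact: rho_smooth.
  by apply: (smooth_mul (@oI k) (@drho_smooth a k)); exact: sqrt_det_smooth.
have h_cts : cts h.
  apply: smooth_cts; apply: patch_smooth => // x Ix nx.
  by rewrite drho_out ?mul0r ?mulr0// => /(param_support Ix).
have f_cts : cts f.
  apply: smooth_cts; apply: patch_smooth => // x Ix nx.
  by rewrite /rhoc rho_chart_out ?mul0r.
have out k x : img (A k) x -> ~ (Defs.coord (A k) @` S) x -> rhoc b k x * (drho a k x * sdet k x) = 0.
  move=> Ix nx; have [Sa|Sa] := pselect (rho_support a (param (A k) x)); last first.
    by rewrite drho_out ?mul0r ?mulr0.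
  have [Sb|Sb] := pselect (rho_support b (param (A k) x)); last by rewrite /rhoc rho_out ?mul0r.
  by case: nx; exists (param (A k) x) => //; exact: paramK Ix.
have h_out x : ~ K1 x -> h x = 0.
  by move=> nx; rewrite /h patchE; case: ifPn => // /set_mem Ix; exact: out.
have f_out x : ~ K2 x -> f x = 0.
  by move=> nx; rewrite /f patchE; case: ifPn => // /set_mem Ix; exact: out.
have hE x : overlap (A i) (A j) x ->
    h x = f (transition (A i) (A j) x) * \det ('J (transition (A i) (A j)) x).
  move=> Ox; have Oy := transition_overlap A_atlas Ox.
  rewrite /h /f !patchE !mem_set//; [|exact: Oy.1|exact: Ox.1].
  rewrite (sqrt_det_transition Ox) /rhoc transition_param// -!mulrA; congr (_ * _).
  rewrite !mulrA; congr (_ * _ * _).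
  have dth := smooth_diff (@transition_smooth _ _ _ _ _ A_atlas i j) Ox.
  have drj := smooth_diff (@rho_smooth a j) Oy.1.
  rewrite /drho V_related// -(derive_comp _ dth drj).
  apply: (derive_eq_in _ (@overlap_open _ _ _ _ _ A_atlas i j) Ox) => y Oy'.
  by rewrite /rhoc transition_param.
have jac_gt0 x : overlap (A i) (A j) x -> 0 < \det ('J (transition (A i) (A j)) x).
  by case: A_atlas => _ _ _; apply.
have H1 x : K1 x -> `|x| <= B1 + B2 by move=> /HB1 /le_trans; apply; rewrite lerDl.
have H2 x : K2 x -> `|x| <= B1 + B2 by move=> /HB2 /le_trans; apply; rewrite lerDr.
exact: (change_of_variables (@overlap_open _ _ _ _ _ A_atlas i j) (@overlap_open _ _ _ _ _ A_atlas j i)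
  (@transition_smooth _ _ _ _ _ A_atlas i j) (@transition_smooth _ _ _ _ _ A_atlas j i)
  (@transition_overlap _ _ _ _ _ A_atlas j i)
  (@transitionK _ _ _ _ _ A_atlas i j) (@transitionK _ _ _ _ _ A_atlas j i) jac_gt0
  cK1 cK2 K1O K2O f_cts h_cts h_out f_out hE (addr_ge0 B10 B20) H1 H2).
Qed.

Theorem integral_divergence : integral_vol A g c rho div = 0.
Proof.
rewrite /integral_vol (eq_bigr _ (fun a _ => integral_by_parts a)) sumrN; apply/eqP.
rewrite oppr_eq0; apply/eqP.
have [B B0 HB] := chart_support_bound.
have s1 i a b : smooth_on (img (A i)) (fun x => rhoc b i x * (drho a i x * sdet i x)).
  apply: smooth_mul => //; first exact: rho_smooth.
  by apply: (smooth_mul (@oI i) (@drho_smooth a i)); exact: sqrt_det_smooth.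
have E1 a : integral_Rn ((fun x => drho a (c a) x * sdet (c a) x) \_ (img (A (c a)))) =
   \sum_b integral_Rn ((fun x => rhoc b (c a) x * (drho a (c a) x * sdet (c a) x)) \_ (img (A (c a)))).
  rewrite -(@integral_Rn_sum R n _ _ _ B)//.
  - congr integral_Rn; apply/funext => x; have [Ox|Ox] := pselect (img (A (c a)) x); last first.
      by rewrite patchE memNset// big1// => b _; rewrite patchE memNset.
    rewrite patchE mem_set//; under eq_bigr do rewrite patchE mem_set//.
    rewrite -mulr_suml; have -> : \sum_b rhoc b (c a) x = 1.
      by case: rho_partition => _ _ _; exact.
    by rewrite mul1r.
  - move=> b; apply: smooth_cts; apply: patch_smooth => // x Ix nx.
    by rewrite drho_out ?mul0r ?mulr0// => /(param_support Ix).
  - move=> b x Bx; apply: patch_out; last by move=> /HB; rewrite leNgt Bx.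
    by move=> y Iy ny; rewrite drho_out ?mul0r ?mulr0// => /(param_support Iy).
rewrite (eq_bigr _ (fun a _ => E1 a)) exchange_big big1//= => b _.
rewrite (eq_bigr _ (fun a _ => integral_overlap a b)).
rewrite -(@integral_Rn_sum R n _ _ _ B)//; last 2 first.
- move=> a; apply: smooth_cts; apply: patch_smooth => // x Ix nx.
  by rewrite /rhoc rho_chart_out ?mul0r.
- move=> a x Bx; apply: patch_out; last by move=> /HB; rewrite leNgt Bx.
  by move=> y Iy ny; rewrite /rhoc rho_chart_out ?mul0r.
rewrite -[RHS](integral_Rn0 n); congr integral_Rn; apply/funext => x.
have [Ox|Ox] := pselect (img (A (c b)) x); last first.
  by rewrite big1// => a _; rewrite patchE memNset.
under eq_bigr do rewrite patchE mem_set//.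
(* All terms now stand in the chart of [rho b], where the sum of the derivatives of the [rho a] is
   the derivative of the constant 1. *)
rewrite -mulr_sumr -mulr_suml (_ : \sum_a drho a (c b) x = 0) ?mul0r ?mulr0//.
have dr a : differentiable (rhoc a (c b)) x by exact: smooth_diff (@rho_smooth a (c b)) Ox.
rewrite -(derive_bigsum _ _ _ dr) (derive_eq_in (V := R) (g := fun=> (1 : R)) _ (@oI _) Ox) ?derive_const// => y _.
by case: rho_partition => _ _ _; exact.
Qed.

End DivergenceTheorem.

(** * First variation *)

Section FieldCongruence.
Context {R : realType} {n : nat}.
Local Notation E := 'rV[R]_n.
Variables (O : set E) (G phi : E -> 'M[R]_n) (e : 'I_n -> E -> E).
Hypothesis oO : open O.
Implicit Types (X Y Z W : E -> E) (x : E).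

(** Component functions such as [xi i] and [xi_ 0 i] agree on the image of the chart only. It is
    open, so the agreement passes to derivatives of every order. *)
Definition eq_on X Y := forall x, O x -> X x = Y x.

Let nabla_der X Y x : nabla G X Y x = der (X x) Y x + X x *m christ_mx G x (Y x).
Proof. by rewrite /nabla der.unlock. Qed.

Let bracket_der X Y x : bracket X Y x = der (X x) Y x - der (Y x) X x.
Proof. by rewrite /bracket der.unlock. Qed.

Let sub_eq (a a' b b' : E) : a = a' -> b = b' -> a - b = a' - b'.
Proof. by move=> -> ->. Qed.

Let add_eq (a a' b b' d d' : E) : a = a' -> b = b' -> d = d' -> a + b + 2 *: d = a' + b' + 2 *: d'.
Proof. by move=> -> -> ->. Qed.

Lemma nabla_eq X X' Y Y' : eq_on X X' -> eq_on Y Y' -> eq_on (nabla G X Y) (nabla G X' Y').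
Proof.
by move=> XX YY x Ox; rewrite !nabla_der (XX x Ox) (YY x Ox) (derive_eq_in (X' x) oO Ox YY).
Qed.

Lemma bracket_eq X X' Y Y' : eq_on X X' -> eq_on Y Y' -> eq_on (bracket X Y) (bracket X' Y').
Proof.
move=> XX YY x Ox; rewrite !bracket_der (XX x Ox) (YY x Ox).
by rewrite (derive_eq_in (X' x) oO Ox YY) (derive_eq_in (Y' x) oO Ox XX).
Qed.

Lemma curv_eq X X' Y Y' Z Z' : eq_on X X' -> eq_on Y Y' -> eq_on Z Z' ->
  eq_on (curv G X Y Z) (curv G X' Y' Z').
Proof.
move=> XX YY ZZ x Ox.
exact: (sub_eq (sub_eq (nabla_eq XX (nabla_eq YY ZZ) Ox) (nabla_eq YY (nabla_eq XX ZZ) Ox))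
  (nabla_eq (bracket_eq XX YY) ZZ Ox)).
Qed.

Lemma nabla_curv_eq X X' Y Y' Z Z' W W' : eq_on X X' -> eq_on Y Y' -> eq_on Z Z' -> eq_on W W' ->
  eq_on (nabla_curv G X Y Z W) (nabla_curv G X' Y' Z' W').
Proof.
move=> XX YY ZZ WW x Ox.
exact: (sub_eq (sub_eq (sub_eq (nabla_eq XX (curv_eq YY ZZ WW) Ox)
  (curv_eq (nabla_eq XX YY) ZZ WW Ox)) (curv_eq YY (nabla_eq XX ZZ) WW Ox))
  (curv_eq YY ZZ (nabla_eq XX WW) Ox)).
Qed.

Lemma act_eq X X' : eq_on X X' -> eq_on (act phi X) (act phi X').
Proof. by move=> XX x Ox; rewrite /act (XX x Ox). Qed.

Let refl_on X : eq_on X X. Proof. by []. Qed.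

Lemma rough_laplacian_eq X X' : eq_on X X' ->
  eq_on (rough_laplacian G e X) (rough_laplacian G e X').
Proof.
move=> XX x Ox; rewrite /rough_laplacian; congr (- _); apply: eq_bigr => a _.
have ee := refl_on (e a).
exact: (sub_eq (nabla_eq ee (nabla_eq ee XX) Ox) (nabla_eq (nabla_eq ee ee) XX Ox)).
Qed.

Lemma S_field_eq X X' : eq_on X X' -> eq_on (S_field G phi e X) (S_field G phi e X').
Proof.
move=> XX x Ox; rewrite /S_field; apply: eq_bigr => a _; have ee := refl_on (e a).
exact: (curv_eq (act_eq XX) (nabla_eq ee XX) ee Ox).
Qed.

Lemma euler_lagrange_eq X X' : eq_on X X' ->
  eq_on (euler_lagrange G phi e X) (euler_lagrange G phi e X').
Proof.
move=> XX x Ox; have SS := S_field_eq XX.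
apply: (sub_eq (rough_laplacian_eq (rough_laplacian_eq XX) Ox)).
apply: eq_bigr => a _; have ee := refl_on (e a).
exact: (add_eq (nabla_curv_eq ee ee SS XX Ox) (curv_eq ee (nabla_eq ee SS) XX Ox)
  (curv_eq ee SS (nabla_eq ee XX) Ox)).
Qed.

End FieldCongruence.

Section FirstVariationFormula.
Context {R : realType} {n : nat} {M : topologicalType} {I : Type}.
Local Notation E := 'rV[R]_n.
Local Notation T := (R^o * E)%type.
Variable A : I -> chart R n M.
Hypothesis M_compact : compact [set: M].
Hypothesis A_atlas : oriented_atlas A.
Variables phi g : I -> E -> 'M[R]_n.
Hypothesis M_pkn : para_kahler_norden A phi g.
Variable e : I -> 'I_n -> E -> E.
Hypothesis e_frame : forall i, orthonormal_frame (img (A i)) (g i) (e i).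
Variables (N : nat) (c : 'I_N -> I) (rho : 'I_N -> M -> R).
Hypothesis rho_partition : partition_of_unity A c rho.
Variables (xi : I -> E -> E) (eps : R) (eps_gt0 : 0 < eps) (xi_ : R -> I -> E -> E).
Hypothesis xi_variation : smooth_variation A xi eps xi_.
Implicit Types (i j : I) (x : E) (a b : 'I_N).

Let oI i : open (img (A i)). Proof. exact: img_open. Qed.
Let g_metric := pkn_metric M_pkn.
Let g_smooth i : smooth_on (img (A i)) (g i).
Proof. exact: metric_smooth. Qed.
Let g_sym i : forall x, img (A i) x -> (g i x)^T = g i x.
Proof. by move=> x Ix; exact: (metric_mx_sym g_metric Ix). Qed.
Let g_unit i : forall x, img (A i) x -> g i x \in unitmx.
Proof. by move=> x Ix; exact: (metric_unit g_metric Ix). Qed.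
Let phi_smooth i : smooth_on (img (A i)) (phi i).
Proof. exact: (pkn_endomorphism M_pkn).1. Qed.
Let phi_inv i : forall x, img (A i) x -> phi i x *m phi i x = 1%:M.
Proof. exact: pkn_involution M_pkn i. Qed.
Let phi_sym i : forall x u v, img (A i) x ->
  ip (g i x) (u *m phi i x) v = ip (g i x) u (v *m phi i x).
Proof. by move=> x u v; exact: (pkn_sym M_pkn). Qed.
Let phi_par i : forall X Y, smooth_on (img (A i)) X -> smooth_on (img (A i)) Y ->
  forall x, img (A i) x -> nabla (g i) X (act (phi i) Y) x = nabla (g i) X Y x *m phi i x.
Proof. exact: pkn_parallel M_pkn i. Qed.

Let U i : set T := [set z : T | `|z.1| < eps /\ img (A i) z.2].
Let Z i (z : T) : E := xi_ z.1 i z.2.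
Let X0 i := xi_ 0 i.
Let W0 i x := der dt (Z i) (0, x).

Let oU i : open (U i).
Proof.
rewrite (_ : U i = (fst @^-1` [set t : R^o | `|t| < eps]) `&` (snd @^-1` (img (A i)))); last by [].
apply: openI; apply: open_comp.
- by move=> p _; exact: cvg_fst.
- apply: (@open_comp _ _ (fun t : R^o => `|t|) [set r | r < eps]); last exact: open_lt.
  by move=> t _; exact: norm_continuous.
- by move=> p _; exact: cvg_snd.
- exact: oI.
Qed.

Let UI i p : U i p -> img (A i) p.2. Proof. by case. Qed.
Let U_slice i p x : U i p -> img (A i) x -> U i (p.1, x). Proof. by case. Qed.
Let U0 i x : img (A i) x -> U i (0, x). Proof. by split=> //=; rewrite normr0. Qed.
Let Z_smooth i : smooth_on (U i) (Z i).
Proof. by case: xi_variation => _ _ H; exact: H i. Qed.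

Let in_slice (F : T -> E) i : (forall x, img (A i) x -> smooth_on (img (A i)) (fun y => F (0, y))) ->
  smooth_on (img (A i)) (fun y => F (0, y)).
Proof. by move=> H s x Ix; exact: (H x Ix). Qed.

Let X0_smooth i : smooth_on (img (A i)) (X0 i).
Proof.
apply: (in_slice (F := Z i)) => x Ix.
exact: (smooth_slice (@oI i) (@oU i) (@U_slice i) (U0 Ix) (@Z_smooth i)).
Qed.

Let W0_smooth i : smooth_on (img (A i)) (W0 i).
Proof.
apply: (in_slice (F := der dt (Z i))) => x Ix.
exact: (smooth_slice (@oI i) (@oU i) (@U_slice i) (U0 Ix) (smooth_derive dt (@Z_smooth i))).
Qed.

Let X0_field : vector_field A X0.
Proof. by case: xi_variation => + _ _; apply; rewrite normr0. Qed.

Let oJ : open [set t : R | `|t| < eps].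
Proof.
apply: (@open_comp _ _ (fun t : R => `|t|) [set r | r < eps]); last exact: open_lt.
by move=> t _; exact: norm_continuous.
Qed.

Let J0 : `|0 : R| < eps. Proof. by rewrite normr0. Qed.

Let W0_time i x : img (A i) x -> is_derive (0 : R) (1 : R) (fun t : R => xi_ t i x) (W0 i x).
Proof. by move=> Ix; apply: (is_derive_time (f := Z i)); exact: smooth_diff (@Z_smooth i) (U0 Ix). Qed.

(** At a fixed point the transformation law is linear, with a Jacobian independent of [t], and may
    be differentiated in [t]. *)
Let W0_field : vector_field A W0.
Proof.
split=> [i|i j x Ox]; first exact: W0_smooth.
set th := transition _ _; have Oy := transition_overlap A_atlas Ox.
have Hi := W0_time Ox.1; have Hj := W0_time Oy.1.
have dth := smooth_diff (@transition_smooth _ _ _ _ _ A_atlas i j) Ox.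
rewrite -(der_val Hj).
have JE u : 'D_u th x = u *m 'J th x by rewrite deriveEjacobian.
rewrite (derive_eq_in (g := fun t : R => xi_ t i x *m 'J th x) _ oJ J0); last first.
  move=> t te; case: xi_variation => vf _ _; have [_ H] := vf t te.
  by rewrite (H i j x Ox) JE.
have di : differentiable (fun t : R => xi_ t i x) 0 by apply/derivable1_diffP; have [] := Hi.
rewrite (derive_mulmx _ di (differentiable_const _ _)) derive_const mulmx0 addr0 (der_val Hi).
by rewrite JE.
Qed.

Let V i := flux (g i) (phi i) (e i) (X0 i) (W0 i).

(** On each overlap the transition map is an isometry compatible with [phi], so [related_flux]
    applies to the restricted data. The local fluxes thus form a field on [M], as
    [integral_divergence] requires. *)
Let V_field : vector_field A V.
Proof.
have sub1 i j : overlap (A i) (A j) `<=` img (A i) by move=> x [].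
split=> [i|i j x Ox].
  exact: (smooth_flux (@oI i) (@g_smooth i) (@g_sym i) (@g_unit i) (e_frame i) (@phi_smooth i)
    (@X0_smooth i) (@W0_smooth i)).
have fr k l : orthonormal_frame (overlap (A k) (A l)) (g k) (e k).
  split=> [a|a b y Oy]; first exact: smooth_subset (@sub1 k l) ((e_frame k).1 a).
  by apply: (e_frame k).2; exact: Oy.1.
have rel (F : I -> E -> E) : vector_field A F ->
    related (overlap (A i) (A j)) (transition (A i) (A j)) (F i) (F j).
  by move=> [_ H] y Oy; rewrite der.unlock; exact: H.
have iso y u v : overlap (A i) (A j) y ->
    ip (g j (transition (A i) (A j) y)) (der u (transition (A i) (A j)) y)
      (der v (transition (A i) (A j)) y) = ip (g i y) u v.
  by move=> Oy; rewrite der.unlock; case: g_metric => _ _ _; exact.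
have phr y u : overlap (A i) (A j) y ->
    der u (transition (A i) (A j)) y *m phi j (transition (A i) (A j) y) =
    der (u *m phi i y) (transition (A i) (A j)) y.
  by move=> Oy; rewrite der.unlock; exact: (pkn_endomorphism M_pkn).2.
have := @related_flux R n _ _ _ _ (@overlap_open _ _ _ _ _ A_atlas i j) (@overlap_open _ _ _ _ _ A_atlas j i)
  (@transition_smooth _ _ _ _ _ A_atlas i j) (@transition_smooth _ _ _ _ _ A_atlas j i)
  (@transition_overlap _ _ _ _ _ A_atlas i j) (@transition_overlap _ _ _ _ _ A_atlas j i)
  (@transitionK _ _ _ _ _ A_atlas i j) (@transitionK _ _ _ _ _ A_atlas j i)
  (g i) (g j) (smooth_subset (@sub1 i j) (@g_smooth i)) (smooth_subset (@sub1 j i) (@g_smooth j))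
  (fun y Oy => g_sym (@sub1 i j y Oy)) (fun y Oy => g_sym (@sub1 j i y Oy))
  (fun y Oy => g_unit (@sub1 i j y Oy)) (fun y Oy => g_unit (@sub1 j i y Oy)) iso
  (e i) (e j) (fr i j) (fr j i) (phi i) (phi j)
  (smooth_subset (@sub1 i j) (@phi_smooth i)) (smooth_subset (@sub1 j i) (@phi_smooth j)) phr
  (X0 i) (X0 j) (W0 i) (W0 j)
  (smooth_subset (@sub1 i j) (@X0_smooth i)) (smooth_subset (@sub1 j i) (@X0_smooth j))
  (smooth_subset (@sub1 i j) (@W0_smooth i)) (smooth_subset (@sub1 j i) (@W0_smooth j))
  (rel _ X0_field) (rel _ W0_field) x Ox.
by rewrite der.unlock.
Qed.

Let sdet i x := Num.sqrt (\det (g i x)).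
(** The factor of the integrand that is independent of [t]. Being continuous on the whole space with
    compact support in the chart, it cuts off densities that are meaningful on the image of the
    chart only. *)
Let weight a := (fun x => rho a (param (A (c a)) x) * sdet (c a) x) \_ (img (A (c a))).

Let weight_cts a : cts (weight a).
Proof.
apply: smooth_cts; apply: (patch_smooth M_compact A_atlas rho_partition).
  apply: (smooth_mul (@oI _)); first by case: rho_partition => + _ _ _; exact.
  exact: (sqrt_det_smooth A_atlas g_metric e_frame).
by move=> x Ix nx; rewrite (rho_chart_out A_atlas Ix nx) mul0r.
Qed.

Let weight_out a x : ~ chart_support A c rho a x -> weight a x = 0.
Proof.
apply: patch_out => y Iy ny; by rewrite (rho_chart_out A_atlas Iy ny) mul0r.
Qed.

Let D i := joint_density (g i) (phi i) (e i) (Z i).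

Let D_smooth i : smooth_on (U i) (D i).
Proof.
exact: (smooth_joint_density (@oI i) (@oU i) (@UI i) (@g_smooth i) (@g_unit i) (e_frame i) (@phi_smooth i) (@Z_smooth i)).
Qed.

Let weighted_cts a (F : T -> R) t x : smooth_on (U (c a)) F -> `|t| < eps ->
  cts_at (fun p : R * E => weight a p.2 * F p) (t, x).
Proof.
move=> sF te.
rewrite (_ : (fun p : R * E => _) = fun p : R * E => weight a p.2 * F (p.1, p.2)); last first.
  by apply/funext => -[].
have cK := @chart_support_closed _ _ _ _ _ M_compact A_atlas _ _ _ rho_partition a.
apply: (cts_cut (G := fun (s : R) (y : E) => F (s, y)) cK (@weight_cts a) (@weight_out a)).
move=> /(chart_support_img rho_partition) Ix.
rewrite (_ : (fun p : R * E => _) = F); last by apply/funext => -[].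
have Up : U (c a) (t, x) by [].
have dF : differentiable F ((t, x) : T) by exact: smooth_diff sF Up.
exact: (@differentiable_cts_at R T R F (t, x) dF).
Qed.

Let density_derivative a : is_derive (0 : R) (1 : R)
  (fun t : R => integral_Rn (fun x => weight a x * D (c a) (t, x)))
  (integral_Rn (fun x => weight a x * der dt (D (c a)) (0, x))).
Proof.
have [B B0 HB] := chart_support_bound M_compact A_atlas rho_partition.
have w0 x : B < `|x| -> weight a x = 0.
  by move=> Bx; apply: weight_out => /HB; rewrite leNgt Bx.
apply: (@is_derive_integral_Rn R n [set t : R | `|t| < eps] (fun t x => weight a x * D (c a) (t, x))
  (fun t x => weight a x * der dt (D (c a)) (t, x)) B) => //.
- move=> t x te; have := @weighted_cts a (D (c a)) t x (@D_smooth (c a)) te.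
  by rewrite (_ : (fun p : R * E => _) = fun p : R * E => weight a p.2 * D (c a) (p.1, p.2))//; apply/funext => -[].
- move=> t x te; have := @weighted_cts a (der dt (D (c a))) t x (smooth_derive dt (@D_smooth (c a))) te.
  by rewrite (_ : (fun p : R * E => _) = fun p : R * E => weight a p.2 * der dt (D (c a)) (p.1, p.2))//; apply/funext => -[].
- move=> t x te; have [Ix|nx] := pselect (img (A (c a)) x); last first.
    rewrite {2}/weight patchE memNset// mul0r.
    apply: (is_derive_eq_fun (is_derive_cst (0 : R) t 1)) => s.
    by rewrite /weight patchE memNset// mul0r.
  have dD := smooth_diff (@D_smooth (c a)) (conj te Ix : U (c a) (t, x)).
  exact: (is_deriveZ _ (is_derive_time dD)).
- by move=> t x _ Bx; rewrite w0// mul0r.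
- by move=> t x _ Bx; rewrite w0// mul0r.
Qed.

Theorem first_variation (W : I -> E -> E) :
  (forall i x, img (A i) x -> t^-1 *: (xi_ t i x - xi i x) @[t --> 0^'] --> W i x) ->
  is_derive (0 : R) (1 : R) (fun t : R => bienergy A phi g e c rho (xi_ t))
    (integral_vol A g c rho (fun i x =>
      ip (g i x) (euler_lagrange (g i) (phi i) (e i) (xi i) x) (act (phi i) (W i) x))).
Proof.
move=> W_def.
have xi0 i : eq_on (img (A i)) (xi i) (X0 i).
  by case: xi_variation => _ H _ x Ix; rewrite /X0 H.
(* [W] is given as a limit of difference quotients and [W0] as a partial derivative of the joint
   family; limits are unique. *)
have WE i x : img (A i) x -> W i x = W0 i x.
  move=> Ix; have [dW E0] := W0_time Ix.
  have H1 := W_def i x Ix.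
  have H2 : t^-1 *: (xi_ t i x - xi i x) @[t --> 0^'] --> W0 i x.
    rewrite -E0; move: dW; rewrite /derivable /derive => /cvg_ex[l Hl].
    have -> : (fun t : R => t^-1 *: (xi_ t i x - xi i x)) =
        fun t : R => t^-1 *: (((fun t : R => xi_ t i x) \o shift 0) (t *: 1) - xi_ 0 i x).
      by apply/funext => t /=; rewrite addr0 [t *: 1]mulr1 (xi0 i x Ix).
    by rewrite (cvg_lim _ Hl).
  exact: (cvg_unique _ H1 H2).
have [B B0 HB] := chart_support_bound M_compact A_atlas rho_partition.
pose div i x := \sum_k ip (g i x) (cov (g i) (e i k x) (V i) x) (e i k x).
pose target i x := ip (g i x) (euler_lagrange (g i) (phi i) (e i) (xi i) x) (act (phi i) (W i) x).
have DE i x : img (A i) x -> der dt (D i) (0, x) = 2 * (target i x + div i x).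
  move=> Ix; rewrite /D (derive_joint_density (@oI i) (@oU i) (@UI i) (@g_smooth i) (@g_sym i) (@g_unit i)
    (e_frame i) (@phi_smooth i) (@phi_sym i) (@U_slice i) (@Z_smooth i) (U0 Ix)) /=.
  rewrite (variation_identity (@oI i) (@g_smooth i) (@g_sym i) (@g_unit i) (e_frame i) (@phi_smooth i)
    (@phi_sym i) (@phi_par i) Ix (@X0_smooth i) (@W0_smooth i)).
  by rewrite /target (euler_lagrange_eq _ _ _ (@oI i) (xi0 i) Ix) /act WE.
pose T2 a := (fun x => rho a (param (A (c a)) x) * div (c a) x * sdet (c a) x) \_ (img (A (c a))).
pose T1 a := (fun x => rho a (param (A (c a)) x) * target (c a) x * sdet (c a) x) \_ (img (A (c a))).
have sT2 a : smooth_on [set: E] (T2 a).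
  exact: (divergence_integrand_smooth M_compact A_atlas g_metric e_frame rho_partition V_field a).
have T2_out a x : B < `|x| -> -1 * T2 a x = 0.
  move=> Bx; have nx : ~ chart_support A c rho a x by move=> /HB; rewrite leNgt Bx.
  rewrite (_ : T2 a x = 0) ?mulr0//; apply: (patch_out _ nx) => y Iy ny.
  by rewrite (rho_chart_out A_atlas Iy ny) !mul0r.
have cD a : cts (fun x => weight a x * der dt (D (c a)) (0, x)).
  move=> x; have := @weighted_cts a (der dt (D (c a))) 0 x (smooth_derive dt (@D_smooth (c a))) J0.
  rewrite (_ : (fun p : R * E => _) = fun p : R * E => weight a p.2 * der dt (D (c a)) (p.1, p.2)); last by apply/funext => -[].
  exact: (@cvg_param_slice R R E (fun t x => weight a x * der dt (D (c a)) (t, x)) 0 x).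
have D_out a x : B < `|x| -> weight a x * der dt (D (c a)) (0, x) = 0.
  by move=> Bx; rewrite weight_out ?mul0r// => /HB; rewrite leNgt Bx.
(* The factor one half of the bienergy turns the derivative of the density into the claimed
   integrand plus a divergence, which is split off chart by chart. *)
have E1 a : integral_Rn (T1 a) =
    2^-1 * integral_Rn (fun x => weight a x * der dt (D (c a)) (0, x)) - integral_Rn (T2 a).
  rewrite -(integral_RnZ 2^-1 B0 (cD a) (D_out a)) -mulN1r -(@integral_RnZ R n (T2 a) (-1) B B0); first last.
  - by move=> x /(T2_out a); rewrite mulN1r => /eqP; rewrite oppr_eq0 => /eqP.
  - by apply: smooth_cts.
  rewrite -(@integral_RnD R n _ _ B B0); first last.
  - exact: T2_out.
  - by move=> x /D_out ->; rewrite mulr0.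
  - by move=> x; apply: continuous_cmul; exact: (smooth_cts (sT2 a)).
  - by move=> x; apply: continuous_cmul; exact: cD.
  congr integral_Rn; apply/funext => x; rewrite /T1 /T2 /weight !patchE.
  case: ifPn => [/set_mem Ix|_]; last by rewrite mul0r !mulr0 addr0.
  by rewrite DE//; field.
(* The divergence terms cancel only after summation over the charts, by [integral_divergence]. *)
have E2 : integral_vol A g c rho target =
    2^-1 * \sum_a integral_Rn (fun x => weight a x * der dt (D (c a)) (0, x)).
  have I0 := integral_divergence M_compact A_atlas g_metric e_frame rho_partition V_field.
  rewrite /integral_vol (eq_bigr _ (fun a _ => E1 a)) sumrB -mulr_sumr.
  by rewrite [X in _ - X](_ : _ = 0) ?subr0.
rewrite E2; apply: (is_deriveZ 2^-1).
pose F t := \sum_a integral_Rn (fun x => weight a x * D (c a) (t, x)).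
have dF : is_derive (0 : R) (1 : R) F (\sum_a integral_Rn (fun x => weight a x * der dt (D (c a)) (0, x))).
  have dFa a := density_derivative a.
  have dfa a : differentiable (fun t : R => integral_Rn (fun x => weight a x * D (c a) (t, x))) (0 : R).
    by apply/derivable1_diffP; have [] := dFa a.
  rewrite (_ : \sum_a _ = der (1 : R) F 0).
    by apply: is_derive_der; exact: differentiable_bigsum.
  rewrite /F (derive_bigsum _ _ _ dfa); apply: eq_bigr => a _; exact/esym/der_val.
(* [F] is the integral of the density only for [|t| < eps], where the family is smooth; this open
   range around 0 suffices for the derivative. *)
have FE t : `|t| < eps -> F t = integral_vol A g c rho (fun i => bienergy_density (g i) (phi i) (e i) (xi_ t i)).
  move=> te; apply: eq_bigr => a _; congr integral_Rn; apply/funext => x; rewrite /weight !patchE.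
  case: ifPn => [/set_mem Ix|_]; last by rewrite mul0r.
  have Up : U (c a) (t, x) by [].
  rewrite /D -(density_slice (@oI _) (@oU _) (@UI _) (@g_smooth _) (@g_sym _) (@g_unit _) (e_frame _) (@phi_smooth _)
    (@phi_inv _) (@phi_sym _) (@phi_par _) (@U_slice _) Up (@Z_smooth _)) /=.
  by rewrite mulrAC.
have dF' : differentiable F 0 by apply/derivable1_diffP; have [] := dF.
rewrite -(der_val dF) (derive_eq_in _ oJ J0 FE); apply: is_derive_der.
exact: differentiable_eq_in oJ J0 FE dF'.
Qed.

End FirstVariationFormula.

Theorem theorem4p7 (R : realType) (m : nat)
    (M : topologicalType) (M_hausdorff : hausdorff_space M)
    (M_compact : compact [set: M])
    (I : Type) (A : I -> chart R (2 * m)%N M) (A_atlas : oriented_atlas A)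
    (phi g : I -> 'rV[R]_(2 * m) -> 'M[R]_(2 * m))
    (M_pkn : para_kahler_norden A phi g)
    (* local orthonormal frames and a partition of unity *)
    (e : I -> 'I_(2 * m) -> 'rV[R]_(2 * m) -> 'rV[R]_(2 * m))
    (e_frame : forall i, orthonormal_frame (img (A i)) (g i) (e i))
    (N : nat) (c : 'I_N -> I) (rho : 'I_N -> M -> R)
    (rho_partition : partition_of_unity A c rho)
    (xi : I -> 'rV[R]_(2 * m) -> 'rV[R]_(2 * m)) (xi_field : vector_field A xi)
    (eps : R) (eps_gt0 : 0 < eps)
    (xi_ : R -> I -> 'rV[R]_(2 * m) -> 'rV[R]_(2 * m))
    (xi_variation : smooth_variation A xi eps xi_)
    (W : I -> 'rV[R]_(2 * m) -> 'rV[R]_(2 * m))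
    (W_def : forall i x, img (A i) x ->
       t^-1 *: (xi_ t i x - xi i x) @[t --> 0^'] --> W i x) :
  is_derive (0 : R) (1 : R) (fun t : R => bienergy A phi g e c rho (xi_ t))
    (integral_vol A g c rho (fun i x =>
       let S := S_field (g i) (phi i) (e i) (xi i) in
       ip (g i x)
         (rough_laplacian (g i) (e i) (rough_laplacian (g i) (e i) (xi i)) x
          - \sum_a (nabla_curv (g i) (e i a) (e i a) S (xi i) x
                    + curv (g i) (e i a) (nabla (g i) (e i a) S) (xi i) x
                    + 2 *: curv (g i) (e i a) S (nabla (g i) (e i a) (xi i)) x))
         (act (phi i) (W i) x))).
Proof.
exact: (first_variation M_compact A_atlas M_pkn e_frame rho_partition eps_gt0 xi_variation W_def).
Qed.
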